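(* Let $K$ be a field. The ring $\mathcal{R}_\infty\cong\mathbb{Z}[U^{\pm1},R^{\pm1},L^{\pm1}]$ is a Laurent polynomial ring in three variables. The ring $\mathcal{R}_1$ is a (still infinitely generated) quotient of $\mathcal{R}_\infty[\{X_l\}_{l\ge1},\{Y_l\}_{l\ge1}]$, where the two sets of generators satisfy $X_l\cdot Y_{l'}=0$ for all $l,l'\ge1$ (and all further relations can be given explicitly).
   Context: A double complex over a field $K$ is a bigraded $K$-vector space $A=\bigoplus_{p,q\in\mathbb{Z}}A^{p,q}$ with endomorphisms $\partial_1,\partial_2$ of bidegree $(1,0)$ and $(0,1)$ satisfying $\partial_1^2=\partial_2^2=0$ and $\partial_1\partial_2+\partial_2\partial_1=0$. It is bounded if $A^{p,q}=0$ for all but finitely many $(p,q)$. The tensor product has the usual bigrading and differentials $\partial_i(a\otimes b)=\partial_ia\otimes b+(-1)^{|a|}a\otimes\partial_ib$, $|a|$ the total degree. The Frölicher spectral sequences of $A$ are those of the filtrations of the total complex $(\bigoplus_{p+q=\cdot}A^{p,q},\partial_1+\partial_2)$ by $\bigoplus_{p\ge m}A^{p,q}$ and by $\bigoplus_{q\ge m}A^{p,q}$. A morphism is an $E_r$-isomorphism ($r\in\mathbb{Z}_{>0}\cup\{\infty\}$) if it induces an isomorphism on the $r$-th page of both. The existence of an $E_r$-isomorphism is an equivalence relation on bounded double complexes over $K$. For $r\in\{1,\infty\}$, $\mathcal{R}_r$ is the ring of formal $\mathbb{Z}$-linear combinations of $E_r$-isomorphism classes of bounded double complexes over $K$ for which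 the $r$-th pages of both Frölicher spectral sequences are finite dimensional, modulo $[A]+[B]=[A\oplus B]$, with product induced by $\otimes$. The variables correspond to classes as follows. For a finite set $S\subset\mathbb{Z}^2$ as below, $[S]$ denotes the class of the (unique up to isomorphism) double complex that is one-dimensional in the bidegrees of $S$, zero elsewhere, with every component of $\partial_1,\partial_2$ between two bidegrees of $S$ an isomorphism. Then $R$ corresponds to $[\{(0,1)\}]$, $U$ to $[\{(1,0)\}]$, $L$ to $[\{(0,0),(1,0),(0,1)\}]$, $X_l$ to $[\{(j,-j),(j+1,-j)\mid 0\le j\le l-1\}]$ and $Y_l$ to $[\{(-j,j),(-j,j+1)\mid 0\le j\le l-1\}]$. *)

(* Defs.v *)
From HB Require Import structures.
From mathcomp Require Import all_boot all_order all_algebra.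
From mathcomp Require Import boolp.
From mathcomp Require Import zify ring.
From mathcomp Require Import finmap mpoly monalg.

Set Implicit Arguments.
Unset Strict Implicit.
Unset Printing Implicit Defensive.

Import Order.TTheory GRing.Theory Num.Theory.
Local Open Scope ring_scope.

(* The direct sum decomposition is given by its projections: [dc_proj p q] is
   the projection onto A^{p,q}, seen as an endomorphism of the whole space. *)
Record dcomplex (K : fieldType) := DComplex {
  dc_sort :> lmodType K;
  dc_proj : int -> int -> {linear dc_sort -> dc_sort};
  dc_d1 : {linear dc_sort -> dc_sort};
  dc_d2 : {linear dc_sort -> dc_sort};
  dc_projM : forall p q p' q' x, dc_proj p q (dc_proj p' q' x) =
    if (p == p') && (q == q') then dc_proj p q x else 0;
  dc_proj_sum : forall x, exists s : seq (int * int),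
    x = \sum_(t <- s) dc_proj t.1 t.2 x;
  dc_d1_deg : forall p q x, dc_d1 (dc_proj p q x) = dc_proj (p + 1) q (dc_d1 x);
  dc_d2_deg : forall p q x, dc_d2 (dc_proj p q x) = dc_proj p (q + 1) (dc_d2 x);
  dc_d1d1 : forall x, dc_d1 (dc_d1 x) = 0;
  dc_d2d2 : forall x, dc_d2 (dc_d2 x) = 0;
  dc_d1d2 : forall x, dc_d1 (dc_d2 x) + dc_d2 (dc_d1 x) = 0 }.

Section DoubleComplexes.
Variable K : fieldType.
Implicit Types A B C : dcomplex K.

Definition bounded A : Prop :=
  exists s : seq (int * int), forall p q, (p, q) \notin s ->
    forall x : A, dc_proj A p q x = 0.

Definition in_bidegree A (p q : int) (x : A) : Prop := dc_proj A p q x = x.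

Definition dc_morphism A B (f : {linear A -> B}) : Prop :=
  [/\ forall p q x, f (dc_proj A p q x) = dc_proj B p q (f x),
      forall x, f (dc_d1 A x) = dc_d1 B (f x) &
      forall x, f (dc_d2 A x) = dc_d2 B (f x)].

Definition has_shape (S : seq (int * int)) A : Prop :=
  [/\ forall p q, (p, q) \in S -> exists e : A,
        [/\ e != 0, in_bidegree p q e &
            forall x, in_bidegree p q x -> exists c : K, x = c *: e],
      forall p q, (p, q) \notin S -> forall x : A, dc_proj A p q x = 0,
      forall p q, (p, q) \in S -> (p + 1, q) \in S ->
        forall y : A, in_bidegree (p + 1) q y ->
          exists! x : A, in_bidegree p q x /\ dc_d1 A x = y &
      forall p q, (p, q) \in S -> (p, q + 1) \in S ->
        forall y : A, in_bidegree p (q + 1) y ->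
          exists! x : A, in_bidegree p q x /\ dc_d2 A x = y].

Definition bilinear_map (U V W : lmodType K) (t : U -> V -> W) : Prop :=
  (forall u, linear (t u)) /\ (forall v, linear (t^~ v)).

Definition tensor_product (U V W : lmodType K) (t : U -> V -> W) : Prop :=
  bilinear_map t /\
  forall (X : lmodType K) (b : U -> V -> X), bilinear_map b ->
    exists g : {linear W -> X}, (forall u v, g (t u v) = b u v) /\
      forall g' : {linear W -> X}, (forall u v, g' (t u v) = b u v) -> g' =1 g.

(* C is the tensor product of A and B.  Since pure tensors of homogeneous
   elements span C, the last conditions determine its grading and its
   differentials; so C is unique up to isomorphism. *)
Definition is_tensor A B C : Prop := exists t : A -> B -> C,
  [/\ tensor_product t,
      forall p q p' q' a b, in_bidegree p q a -> in_bidegree p' q' b ->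
        in_bidegree (p + p') (q + q') (t a b),
      forall p q a b, in_bidegree p q a ->
        dc_d1 C (t a b) = t (dc_d1 A a) b + (-1) ^ (p + q) *: t a (dc_d1 B b) &
      forall p q a b, in_bidegree p q a ->
        dc_d2 C (t a b) = t (dc_d2 A a) b + (-1) ^ (p + q) *: t a (dc_d2 B b)].

Definition dc_total A (x : A) : A := dc_d1 A x + dc_d2 A x.

(* The m-th step of the filtration in total degree n: by p if [i] is false,
   by q if [i] is true. *)
Definition filtration A (i : bool) (m n : int) (x : A) : Prop :=
  forall p q, ~~ ((p + q == n) && (m <= if i then q else p)) ->
    dc_proj A p q x = 0.

Definition homogeneous A (n : int) (x : A) : Prop :=
  forall p q, p + q != n -> dc_proj A p q x = 0.

(* Pages are indexed by r > 0 as [Some r], and by [None] for r = oo.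
   The term E_r^{m,n-m} is the quotient of [page_cycles r m n] by
   [page_boundaries r m n], i.e. of
     Z_r^m = {x in F^m | d x in F^{m+r}}   by   Z_{r-1}^{m+1} + d Z_{r-1}^{m-r+1}
   when r is finite, and of
     F^m /\ ker d   by   (F^{m+1} /\ ker d) + (F^m /\ im d)
   when r = oo. *)
Definition page_cycles A i (r : option nat) (m n : int) (x : A) : Prop :=
  filtration i m n x /\
  if r is Some k then filtration i (m + k%:Z) (n + 1) (dc_total x)
  else dc_total x = 0.

Definition page_boundaries A i (r : option nat) (m n : int) (x : A) : Prop :=
  exists y z : A, x = y + dc_total z /\
  if r is Some k then
    page_cycles i (Some k.-1) (m + 1) n y /\
    page_cycles i (Some k.-1) (m - k.-1%:Z) (n - 1) z
  else
    page_cycles i None (m + 1) n y /\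
    (homogeneous (n - 1) z /\ filtration i m n (dc_total z)).

(* Z / N is finite dimensional. *)
Definition subquotient_findim (V : lmodType K) (Z N : V -> Prop) : Prop :=
  exists (k : nat) (e : 'I_k -> V), (forall j, Z (e j)) /\
    forall x, Z x -> exists c : 'I_k -> K, N (x - \sum_j c j *: e j).

(* f induces an isomorphism from Z / N to Z' / N'. *)
Definition subquotient_iso (V W : lmodType K) (Z N : V -> Prop)
    (Z' N' : W -> Prop) (f : V -> W) : Prop :=
  [/\ forall x, Z x -> Z' (f x),
      forall x, N x -> N' (f x),
      forall x, Z x -> N' (f x) -> N x &
      forall y, Z' y -> exists2 x, Z x & N' (y - f x)].

(* For bounded A only finitely many terms of a page are nonzero, so the page is
   finite dimensional as soon as each of its terms is. *)
Definition findim_pages (r : option nat) A : Prop := forall i m n,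
  subquotient_findim (@page_cycles A i r m n) (@page_boundaries A i r m n).

Definition Er_isomorphism (r : option nat) A B (f : {linear A -> B}) : Prop :=
  dc_morphism f /\ forall i m n,
    subquotient_iso (@page_cycles A i r m n) (@page_boundaries A i r m n)
                    (@page_cycles B i r m n) (@page_boundaries B i r m n) f.

Definition Er_equiv (r : option nat) A B : Prop :=
  exists f : {linear A -> B}, Er_isomorphism r f.

End DoubleComplexes.

Section DirectSum.
Variable K : fieldType.

Section PairMap.
Variables (U V U' V' : lmodType K).
Variables (f : {linear U -> U'}) (g : {linear V -> V'}).

Definition pair_map (x : U * V) : U' * V' := (f x.1, g x.2).

Fact pair_map_is_linear : linear pair_map.
Proof. by move=> a [x x'] [y y']; rewrite /pair_map /= !linearP. Qed.

HB.instance Definition _ :=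
  GRing.isLinear.Build K (U * V)%type (U' * V')%type _ pair_map
    pair_map_is_linear.
End PairMap.

Variables A B : dcomplex K.
Let AB : lmodType K := (A * B)%type.
Let pr p q : {linear AB -> AB} := pair_map (dc_proj A p q) (dc_proj B p q).
Let d1 : {linear AB -> AB} := pair_map (dc_d1 A) (dc_d1 B).
Let d2 : {linear AB -> AB} := pair_map (dc_d2 A) (dc_d2 B).

Fact dsum_projM p q p' q' x : pr p q (pr p' q' x) =
  if (p == p') && (q == q') then pr p q x else 0.
Proof.
case: x => x y; transitivity ((dc_proj A p q (dc_proj A p' q' x),
  dc_proj B p q (dc_proj B p' q' y)) : AB) => //.
by rewrite !dc_projM; case: ifP.
Qed.

Lemma proj_seq_sum (C : dcomplex K) (x : C) (s t : seq (int * int)) :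
  x = \sum_(u <- s) dc_proj C u.1 u.2 x -> {subset s <= t} -> uniq t ->
  x = \sum_(u <- t) dc_proj C u.1 u.2 x.
Proof.
move=> xE st ut.
have zero p q : (p, q) \notin s -> dc_proj C p q x = 0.
  move=> pqs; rewrite xE linear_sum big_seq big1 // => -[p' q'] us.
  rewrite dc_projM /=; case: ifP => // /andP[/eqP pE /eqP qE].
  by rewrite pE qE us in pqs.
rewrite {1}xE.
have hs u : u \in s -> dc_proj C u.1 u.2 x =
    \sum_(v <- t) dc_proj C v.1 v.2 (dc_proj C u.1 u.2 x).
  move=> us; rewrite (bigD1_seq u) ?st //= dc_projM !eqxx /= big1 ?addr0 //.
  move=> v vu; rewrite dc_projM -[_ && _]/(v == u).
  by case: ifP => // vu'; rewrite vu' in vu.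
rewrite big_seq (eq_bigr _ hs) -big_seq exchange_big /=.
by apply: eq_bigr => v _; rewrite -linear_sum -xE.
Qed.

Fact dsum_proj_sum x : exists s : seq (int * int),
  x = \sum_(t <- s) pr t.1 t.2 x.
Proof.
case: x => x y; have [s xE] := dc_proj_sum x; have [t yE] := dc_proj_sum y.
exists (undup (s ++ t)); set w := undup _.
have pairE : forall l : seq (int * int), \sum_(u <- l) pr u.1 u.2 (x, y) =
    (\sum_(u <- l) dc_proj A u.1 u.2 x, \sum_(u <- l) dc_proj B u.1 u.2 y).
  by elim=> [|u l IHl]; rewrite ?big_nil // !big_cons IHl.
rewrite pairE.
rewrite -(proj_seq_sum xE) ?undup_uniq //; last first.
  by move=> u us; rewrite mem_undup mem_cat us.
rewrite -(proj_seq_sum yE) ?undup_uniq //.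
by move=> u us; rewrite mem_undup mem_cat us orbT.
Qed.

Fact dsum_d1_deg p q x : d1 (pr p q x) = pr (p + 1) q (d1 x).
Proof. by congr pair; apply: dc_d1_deg. Qed.

Fact dsum_d2_deg p q x : d2 (pr p q x) = pr p (q + 1) (d2 x).
Proof. by congr pair; apply: dc_d2_deg. Qed.

Fact dsum_d1d1 x : d1 (d1 x) = 0.
Proof. by congr pair; apply: dc_d1d1. Qed.

Fact dsum_d2d2 x : d2 (d2 x) = 0.
Proof. by congr pair; apply: dc_d2d2. Qed.

Fact dsum_d1d2 x : d1 (d2 x) + d2 (d1 x) = 0.
Proof. by congr pair; apply: dc_d1d2. Qed.

Definition dsum : dcomplex K := DComplex dsum_projM dsum_proj_sum
  dsum_d1_deg dsum_d2_deg dsum_d1d1 dsum_d2d2 dsum_d1d2.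

Lemma dsum_bounded : bounded A -> bounded B -> bounded dsum.
Proof.
move=> [s sA] [t tB]; exists (s ++ t) => p q; rewrite mem_cat negb_or.
by case/andP=> /sA zA /tB zB [x y]; congr pair; [apply: zA | apply: zB].
Qed.

Lemma dsum_filtration i m n (x : dsum) :
  filtration i m n x <-> filtration i m n x.1 /\ filtration i m n x.2.
Proof.
split=> [h|[h1 h2] p q pq]; last by congr pair; [apply: h1 | apply: h2].
by split=> p q /h; case.
Qed.

Lemma dsum_page_cycles i r m n (x : dsum) : page_cycles i r m n x <->
  page_cycles i r m n x.1 /\ page_cycles i r m n x.2.
Proof.
rewrite /page_cycles dsum_filtration; case: r => [k|].
  by rewrite (dsum_filtration _ _ _ (dc_total x)); tauto.
split=> [[[h1 h2] [e1 e2]]|[[h1 e1] [h2 e2]]]; first by split; split.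
by split; [split | congr pair].
Qed.

Lemma dsum_page_boundaries i r m n (x : A) (y : B) :
  page_boundaries i r m n x -> page_boundaries i r m n y ->
  page_boundaries i r m n ((x, y) : dsum).
Proof.
move=> [x1 [x2 [-> hx]]] [y1 [y2 [-> hy]]].
exists ((x1, y1) : dsum), ((x2, y2) : dsum); split=> //.
case: r hx hy => [k|] [hx1 hx2] [hy1 hy2].
  by split; apply/dsum_page_cycles; split.
case: hx2 hy2 => [hx2 hx3] [hy2 hy3].
split; first by apply/dsum_page_cycles; split.
split; last by apply/dsum_filtration; split.
by move=> p q pq; congr pair; [apply: hx2 | apply: hy2].
Qed.

Lemma page_cycles0 (C : dcomplex K) i r m n : page_cycles i r m n (0 : C).
Proof.
have d0 : dc_total (0 : C) = 0 by rewrite /dc_total !linear0 addr0.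
split; first by move=> p q _; rewrite linear0.
by case: r => [k|] //; rewrite d0 => p q _; rewrite linear0.
Qed.

Lemma dsum_findim_pages r :
  findim_pages r A -> findim_pages r B -> findim_pages r dsum.
Proof.
move=> fA fB i m n; have [k [e [eZ eS]]] := fA i m n.
have [l [e' [e'Z e'S]]] := fB i m n.
exists (k + l)%N, (fun j => match split j with
  | inl a => (e a, 0) | inr b => (0, e' b) end); split=> [j|[x y]].
  by case: (split j) => a; apply/dsum_page_cycles; split=> //=;
    apply: page_cycles0.
case/dsum_page_cycles=> /eS[c xc] /e'S[c' yc'].
exists (fun j => match split j with inl a => c a | inr b => c' b end).
rewrite big_split_ord /=.
under eq_bigr => a _ do rewrite (unsplitK (inl a)).
rewrite [X in _ - (_ + X)](eq_bigr (fun b => c' b *: ((0, e' b) : dsum))); last first.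
  by move=> b _; rewrite (unsplitK (inr b)).
set s1 := \sum_(a < k) _; set s2 := \sum_(b < l) _.
have s1E : s1 = (\sum_(j < k) c j *: e j, 0).
  apply: (big_ind2 (fun (u : dsum) v => u = (v, 0))) => //.
    by move=> _ u _ v -> ->; congr pair; rewrite addr0.
  by move=> a _; congr pair; rewrite scaler0.
have s2E : s2 = (0, \sum_(j < l) c' j *: e' j).
  apply: (big_ind2 (fun (u : dsum) v => u = (0, v))) => //.
    by move=> _ u _ v -> ->; congr pair; rewrite addr0.
  by move=> a _; congr pair; rewrite scaler0.
have -> : (x, y) - (s1 + s2) =
    (x - \sum_(j < k) c j *: e j, y - \sum_(j < l) c' j *: e' j) :> dsum.
  by rewrite s1E s2E; congr pair; rewrite /= ?addr0 ?add0r.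
exact: dsum_page_boundaries.
Qed.

End DirectSum.

Section GrothendieckRing.
Variables (K : fieldType) (r : option nat).

Definition fdcomplex := {A : dcomplex K | bounded A /\ findim_pages r A}.

Definition fdsum (A B : fdcomplex) : fdcomplex :=
  exist _ (dsum (sval A) (sval B))
    (conj (dsum_bounded (proj1 (svalP A)) (proj1 (svalP B)))
          (dsum_findim_pages (proj2 (svalP A)) (proj2 (svalP B)))).

(* A list [:: (n_1, A_1); ...] stands for n_1 [A_1] + ... *)
Definition formal := seq (int * fdcomplex).

(* The coefficient of the E_r-isomorphism class of A. *)
Definition class_coef (x : formal) (A : fdcomplex) : int :=
  \sum_(t <- x | `[< Er_equiv r (sval t.2) (sval A) >]) t.1.

Definition sum_relations (s : seq (int * (fdcomplex * fdcomplex))) : formal :=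
  flatten [seq [:: (t.1, t.2.1); (t.1, t.2.2); (- t.1, fdsum t.2.1 t.2.2)]
          | t <- s].

Definition formal_equiv (x y : formal) : Prop :=
  exists s, forall A, class_coef x A = class_coef (y ++ sum_relations s) A.

(* This type lives in a universe too large to be a [zmodType], so its
   operations are given unbundled. *)
Definition groth :=
  {C : formal -> Prop | exists x, C = formal_equiv x}.

Definition groth_of (x : formal) : groth :=
  exist _ (formal_equiv x) (ex_intro _ x erefl).

Definition groth_repr (X : groth) : formal := sval (cid (svalP X)).

Lemma groth_reprK X : groth_of (groth_repr X) = X.
Proof. by case: X => C hC; apply: eq_exist; rewrite /groth_repr; case: cid. Qed.

Lemma class_coef_cat x y A :
  class_coef (x ++ y) A = class_coef x A + class_coef y A.
Proof. by rewrite /class_coef big_cat. Qed.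

Lemma groth_ofP x y : groth_of x = groth_of y <-> formal_equiv x y.
Proof.
have refl u : formal_equiv u u by exists [::] => A; rewrite cats0.
have sym u v : formal_equiv u v -> formal_equiv v u.
  move=> [s h]; exists [seq (- t.1, t.2) | t <- s] => A.
  rewrite class_coef_cat h class_coef_cat -addrA -[LHS]addr0; congr (_ + _).
  elim: s {h} => [|t s IHs]; first by rewrite /class_coef !big_nil addr0.
  move: IHs; rewrite /class_coef /sum_relations /= !big_cons /=.
  by do 3!case: ifP => _; lia.
have trans u v w : formal_equiv u v -> formal_equiv v w -> formal_equiv u w.
  move=> [s hs] [t ht]; exists (t ++ s) => A.
  by rewrite hs /sum_relations map_cat flatten_cat catA !class_coef_cat ht
    class_coef_cat.
split=> [[e]|h]; first by rewrite -[formal_equiv x y]/(id _) e; apply: refl.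
apply: eq_exist; apply/funext => z; apply/propext; split; first exact/trans/sym.
exact: trans.
Qed.

Definition groth_class (A : fdcomplex) : groth := groth_of [:: (1, A)].

Definition groth_zero : groth := groth_of [::].

Definition groth_add (X Y : groth) : groth :=
  groth_of (groth_repr X ++ groth_repr Y).

Definition groth_opp (X : groth) : groth :=
  groth_of [seq (- t.1, t.2) | t <- groth_repr X].

Definition shape_class (S : seq (int * int)) (X : groth) : Prop :=
  exists2 A : fdcomplex, has_shape S (sval A) & X = groth_class A.

(* [mul] is the product induced by the tensor product; as the classes of
   complexes generate the additive group, there is at most one. *)
Definition tensor_mul (mul : groth -> groth -> groth) : Prop :=
  [/\ forall X Y Z, mul (groth_add X Y) Z = groth_add (mul X Z) (mul Y Z),
      forall X Y Z, mul Z (groth_add X Y) = groth_add (mul Z X) (mul Z Y) &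
      forall A B : fdcomplex,
        exists2 C : fdcomplex, is_tensor (sval A) (sval B) (sval C) &
          mul (groth_class A) (groth_class B) = groth_class C].

Definition ring_hom_to_groth (P : comNzRingType)
    (mul : groth -> groth -> groth) (f : P -> groth) : Prop :=
  [/\ forall x y, f (x + y) = groth_add (f x) (f y),
      forall x y, f (x * y) = mul (f x) (f y) &
      shape_class [:: (0, 0)] (f 1)].

Inductive subring_generated (mul : groth -> groth -> groth) (one : groth)
    (S : groth -> Prop) : groth -> Prop :=
| sg_base X : S X -> subring_generated mul one S X
| sg_one : subring_generated mul one S one
| sg_add X Y : subring_generated mul one S X -> subring_generated mul one S Y ->
    subring_generated mul one S (groth_add X Y)
| sg_opp X : subring_generated mul one S X ->
    subring_generated mul one S (groth_opp X)
| sg_mul X Y : subring_generated mul one S X -> subring_generated mul one S Y ->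
    subring_generated mul one S (mul X Y).

End GrothendieckRing.

Section Laurent.

(* multinomials' [mpoly] and [monalg] both define the notation {mpoly _[_]}. *)
Local Notation poly3 := (mpoly.mpoly 3 int).
Local Notation frac3 := {fraction poly3}.
Local Notation "x %:F" := (tofrac x).

Definition poly3_var (k : 'I_3) : poly3 := mpolyX int (mnm1 k).

Definition fracU : frac3 := (poly3_var 0)%:F.
Definition fracR : frac3 := (poly3_var 1)%:F.
Definition fracL : frac3 := (poly3_var 2)%:F.

(* Z[U^{+-1}, R^{+-1}, L^{+-1}] as a subring of Q(U, R, L). *)
Definition laurent_pred : {pred frac3} := fun x =>
  `[< exists (k : nat) (p : poly3), x * (fracU * fracR * fracL) ^+ k = p%:F >].

Fact laurent_subring_closed : subring_closed laurent_pred.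
Proof.
split=> [|x y /asboolP[k [p xE]] /asboolP[l [q yE]]|
         x y /asboolP[k [p xE]] /asboolP[l [q yE]]]; apply/asboolP.
- by exists 0%N, 1; rewrite expr0 mulr1 tofrac1.
- set w := poly3_var 0 * poly3_var 1 * poly3_var 2.
  have wE : fracU * fracR * fracL = w%:F by rewrite !tofracM.
  exists (k + l)%N, (p * w ^+ l - q * w ^+ k).
  by rewrite tofracB !tofracM !tofracXn -xE -yE wE exprD; ring.
- by exists (k + l)%N, (p * q); rewrite tofracM -xE -yE exprD mulrACA.
Qed.

HB.instance Definition _ :=
  GRing.isSubringClosed.Build frac3 laurent_pred laurent_subring_closed.

Record laurent := Laurent {
  laurent_val :> frac3;
  _ : laurent_val \in laurent_pred }.

HB.instance Definition _ := [isSub for laurent_val].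
HB.instance Definition _ := [Choice of laurent by <:].
HB.instance Definition _ := [SubChoice_isSubComNzRing of laurent by <:].

Fact laurent_monomial_subproof (a b c : int) :
  fracU ^ a * fracR ^ b * fracL ^ c \in laurent_pred.
Proof.
have nz k : (poly3_var k)%:F != 0 :> frac3.
  by rewrite tofrac_eq0 -msize_poly_eq0 /poly3_var msizeX.
have pow k (e : int) (n : nat) : (absz e <= n)%N ->
    exists p, (poly3_var k)%:F ^ e * (poly3_var k)%:F ^+ n = p%:F :> frac3.
  move=> en; have [m mE] : exists m : nat, (e + n%:Z = m)%R.
    by exists (absz (e + n%:Z)); lia.
  by exists (poly3_var k ^+ m); rewrite tofracXn !exprnP -expfzDr // mE.
set n := (absz a + absz b + absz c)%N.
have [|p pE] := pow 0 a n; first by rewrite /n; lia.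
have [|q qE] := pow 1 b n; first by rewrite /n; lia.
have [|s sE] := pow 2 c n; first by rewrite /n; lia.
apply/asboolP; exists n, (p * q * s).
rewrite !tofracM -pE -qE -sE !exprMn -/fracU -/fracR -/fracL.
by rewrite !mulrA; ring.
Qed.

(* U^a R^b L^c *)
Definition laurent_monomial (a b c : int) : laurent :=
  Laurent (laurent_monomial_subproof a b c).

Definition laurentU := laurent_monomial 1 0 0.
Definition laurentR := laurent_monomial 0 1 0.
Definition laurentL := laurent_monomial 0 0 1.

(* Polynomials over the Laurent ring in the variables X_l and Y_l with l >= 1:
   the variable X_{l+1} has index (true, l), and Y_{l+1} has index (false, l).
   So [varX l] and [varY l] are meaningful only for l >= 1. *)
Definition laurentXY := {malg laurent[{cmonom (bool * nat)%type}]}.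
HB.instance Definition _ := GRing.ComNzRing.on laurentXY.

Definition varX (l : nat) : laurentXY := << 1 *g ucm (true, l.-1) >>.
Definition varY (l : nat) : laurentXY := << 1 *g ucm (false, l.-1) >>.

Definition constXY (c : laurent) : laurentXY := c%:MP.

(* Besides X_l Y_l' = 0, the relations are L X_l = U X_l, L Y_l = R Y_l, and
   for l <= m
     X_l X_m = (1 + U^m R^{1-m}) X_l,   Y_l Y_m = (1 + U^{1-m} R^m) Y_l.
   They come from the tensor products of the shapes: on the first page of the
   spectral sequence that sees X_l, it is a differential d_l from bidegree
   (0,0) to (l,1-l) between one-dimensional spaces, and the other spectral
   sequence vanishes from the first page on. *)
Inductive XY_relation : laurentXY -> Prop :=
| XY_relation_XY l m of (0 < l)%N & (0 < m)%N :
    XY_relation (varX l * varY m)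
| XY_relation_LX l of (0 < l)%N :
    XY_relation (constXY laurentL * varX l - constXY laurentU * varX l)
| XY_relation_LY l of (0 < l)%N :
    XY_relation (constXY laurentL * varY l - constXY laurentR * varY l)
| XY_relation_XX l m of (0 < l)%N & (l <= m)%N :
    XY_relation (varX l * varX m -
      constXY (1 + laurent_monomial m%:Z (1 - m%:Z) 0) * varX l)
| XY_relation_YY l m of (0 < l)%N & (l <= m)%N :
    XY_relation (varY l * varY m -
      constXY (1 + laurent_monomial (1 - m%:Z) m%:Z 0) * varY l).

End Laurent.

Definition ideal_generated (P : comNzRingType) (S : P -> Prop) (x : P) : Prop :=
  exists s : seq (P * P), (forall t, t \in s -> S t.2) /\
    x = \sum_(t <- s) t.1 * t.2.

Definition shapeL : seq (int * int) := [:: (0, 0); (1, 0); (0, 1)].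

Definition shapeX (l : nat) : seq (int * int) :=
  flatten [seq [:: (j%:Z, - j%:Z); (j%:Z + 1, - j%:Z)] | j <- iota 0 l].

Definition shapeY (l : nat) : seq (int * int) :=
  flatten [seq [:: (- j%:Z, j%:Z); (- j%:Z, j%:Z + 1)] | j <- iota 0 l].

(* Main.v *)
(* Splitting off zigzags one at a time, every complex in question is homotopy
   equivalent to a finite direct sum of zigzags: a maximal class of total
   cohomology splits off an odd zigzag, a non-extendable chain an even one, and
   when neither exists the complex is contractible.  The classes of zigzags are
   told apart by invariants with values in the field Q(U, R, L): the bigraded
   dimensions of the total cohomology for both filtrations at once, and the
   dimensions of the pages of each spectral sequence.  These are additive and
   multiplicative because each is read off a homotopy onto a small model, and
   models can be added and tensored.  Hence the ring is the image of the
   polynomial ring under specializations of U, R, L, X_l, Y_l, and modulo the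
   relations every polynomial is a combination of the zigzags. *)
Require Import Defs.
From mathcomp Require Import all_boot all_order all_algebra.
From HB Require Import structures.
From mathcomp Require Import boolp classical_sets.
From mathcomp Require Import zify ring.

Set Implicit Arguments.
Unset Strict Implicit.
Unset Printing Implicit Defensive.

Import Order.TTheory GRing.Theory Num.Theory.
Local Open Scope ring_scope.

(** [Er_equiv] asks for a map in one direction, while a homotopy retraction yields maps both ways;
    so comparisons run through retractions, and cancellation in the group works with a preorder. A
    valid odd zigzag has one total class, with a column, a row and a total degree; the degrees of
    [U], [R], [L] form a basis of Z^3, so these zigzags are exactly the Laurent monomials. An even
    zigzag has no total cohomology and shows up only as one differential d_l in one of the two
    spectral sequences. The page E_(k+1) of that sequence still sees both ends of [X_l] iff l > k,
    and it cannot tell [L] from [U]. Hence the invariant of this page puts L = U, sends [X_l] to 1 +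
    U^l R^(1-l) for l > k and to 0 otherwise. Each such invariant is a ring homomorphism to a field,
    and the jump from k - 1 to k isolates the zigzags of half-length k. Classes with equal
    invariants are therefore equal, and every identity in the ring, including the relations, is
    checked after specialization. *)

Definition mklin (K : fieldType) (U V : lmodType K) (f : U -> V)
    (fL : linear f) : {linear U -> V} :=
  HB.pack f (GRing.isLinear.Build K U V _ f fL).

(** * Linear algebra over a field in arbitrary dimension *)

Section LinearAlgebra.
Variable K : fieldType.
Implicit Types U V W : lmodType K.

Definition subspace V (S : V -> Prop) : Prop :=
  S 0 /\ forall a x y, S x -> S y -> S (a *: x + y).

Section Subspace.
Variables (V : lmodType K) (S : V -> Prop) (sS : subspace S).

Lemma subspace0 : S 0. Proof. by case: sS. Qed.

Lemma subspaceZ a x : S x -> S (a *: x).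
Proof. by case: sS => S0 SL Sx; rewrite -[_ *: _]addr0; apply: SL. Qed.

Lemma subspaceD x y : S x -> S y -> S (x + y).
Proof. by case: sS => S0 SL Sx Sy; rewrite -[x]scale1r; apply: SL. Qed.

Lemma subspaceN x : S x -> S (- x).
Proof. by rewrite -scaleN1r; apply: subspaceZ. Qed.

Lemma subspaceB x y : S x -> S y -> S (x - y).
Proof. by move=> Sx /subspaceN; apply: subspaceD. Qed.

Lemma subspace_sum (I : Type) (r : seq I) (P : pred I) F :
  (forall i, P i -> S (F i)) -> S (\sum_(i <- r | P i) F i).
Proof. by move=> h; apply: big_ind => //; [apply: subspace0 | apply: subspaceD]. Qed.

End Subspace.

Lemma subspace_complement V (S : V -> Prop) : subspace S ->
  exists W : V -> Prop, [/\ subspace W, forall x, S x -> W x -> x = 0 &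
    forall x, exists2 s, S s & W (x - s)].
Proof.
move=> sS.
(* [P] does not ask for [0]: the union of the empty chain is empty and must satisfy [P] as well.
   Maximality puts [0] back. *)
pose P (W : set V) := (forall a x y, W x -> W y -> W (a *: x + y)) /\
  forall x, S x -> W x -> x = 0.
have [F FP Ftot|W [[WL WS] Wmax]] := @Zorn_bigcup V P.
  split=> [a x y [X FX Xx] [Y FY Yy]|x Sx [X FX Xx]]; last first.
    by case: (FP _ FX) => _; apply.
  case: (Ftot _ _ FX FY) => XY.
    by exists Y => //; case: (FP _ FY) => YL _; apply: YL => //; apply: XY.
  by exists X => //; case: (FP _ FX) => XL _; apply: XL => //; apply: XY.
have W0 : W 0.
  apply: contrapT => nW0; apply: (Wmax (fun x => x = 0)).
    rewrite /proper; split=> [x Wx|/(_ 0 erefl)//].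
    by case: nW0; rewrite -(subrr x) -scaleN1r addrC; apply: WL.
  by split=> // a x y -> ->; rewrite scaler0 addr0.
have sW : subspace W by [].
exists W; split=> // v; apply: contrapT => nv.
pose W' : set V := fun x => exists c w, W w /\ x = c *: v + w.
apply: (Wmax W').
  split=> [x Wx|sub]; first by exists 0, x; rewrite scale0r add0r.
  apply: nv; exists 0; first by case: sS.
  by rewrite subr0; apply: sub; exists 1, 0; rewrite scale1r addr0.
split=> [a _ _ [c [w [Ww ->]]] [c' [w' [Ww' ->]]]|x Sx [c [w [Ww xE]]]].
  exists (a * c + c'), (a *: w + w'); split; first exact: WL.
  by rewrite scalerDr scalerA scalerDl addrACA.
have [c0|c0] := eqVneq c 0.
  by apply: WS => //; rewrite xE c0 scale0r add0r.
case: nv; exists (c^-1 *: x); first exact: subspaceZ.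
have -> : v - c^-1 *: x = - c^-1 *: w.
  by rewrite xE scalerDr scalerA mulVf // scale1r opprD addrA subrr sub0r scaleNr.
exact: subspaceZ.
Qed.

Lemma subspace_projection V (S : V -> Prop) : subspace S ->
  exists p : {linear V -> V}, (forall x, S (p x)) /\ forall x, S x -> p x = x.
Proof.
move=> sS; have [W [sW SW dec]] := subspace_complement sS.
have [p pP] : exists p : V -> V, forall x, S (p x) /\ W (x - p x).
  by exists (fun x => projT1 (cid2 (dec x))) => x; case: cid2.
have pU x s : S s -> W (x - s) -> p x = s.
  have [Sp Wp] := pP x; move=> Ss Wxs; apply/eqP; rewrite -subr_eq0; apply/eqP.
  apply: SW; first exact: subspaceB.
  have -> : p x - s = (x - s) - (x - p x) by rewrite opprB [RHS]addrC addrA subrK.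
  exact: subspaceB.
have pL : linear p.
  move=> a x y; have [Sx Wx] := pP x; have [Sy Wy] := pP y; apply: pU.
    by apply: subspaceD => //; apply: subspaceZ.
  rewrite opprD addrACA -scalerBr; apply: subspaceD => //; exact: subspaceZ.
exists (mklin pL); split=> x /=; first by case: (pP x).
by move=> Sx; apply: pU => //; rewrite subrr; apply: subspace0.
Qed.

(** Project to the image, choose a preimage and remove its component in the kernel: the preimage so
    normalised is unique, and this makes [s] linear. Functionals with prescribed values and
    contractions of exact complexes both come from such an [s]. *)
Lemma quasi_inverse V W (f : {linear V -> W}) :
  exists s : {linear W -> V}, forall x, f (s (f x)) = f x.
Proof.
have sk : subspace (fun x => f x = 0).
  by split=> [|a x y fx fy]; rewrite ?linear0 // linearP fx fy scaler0 addr0.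
have si : subspace (fun y => exists x, f x = y).
  split=> [|a _ _ [x <-] [y <-]]; first by exists 0; rewrite linear0.
  by exists (a *: x + y); rewrite linearP.
have [p [pk pE]] := subspace_projection sk.
have [q [qi qE]] := subspace_projection si.
have [g gP] : exists g : W -> V, forall y, f (g y) = q y.
  by exists (fun x => projT1 (cid (qi x))) => x; case: cid.
pose s y := g y - p (g y).
have fs y : f (s y) = q y by rewrite linearB /= pk subr0.
have ps y : p (s y) = 0 by rewrite linearB /= (pE (p _)) ?subrr.
have sU y z : p z = 0 -> f z = q y -> s y = z.
  move=> pz fz; apply/eqP; rewrite -subr_eq0; apply/eqP.
  rewrite -(pE (s y - z)); last by rewrite linearB fs fz subrr.
  by rewrite linearB ps pz subrr.
have sL : linear s.
  by move=> a x y; apply: sU; rewrite !linearP ?ps ?fs ?scaler0 ?addr0.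
exists (mklin sL) => x /=; rewrite fs qE //; by exists x.
Qed.

Lemma functional_factor V W (f : {linear V -> W}) (l : {linear V -> K^o}) :
  (forall x, f x = 0 -> l x = 0) -> exists m : {linear W -> K^o},
  forall x, m (f x) = l x.
Proof.
move=> fl; have [s sP] := quasi_inverse f.
have mL : linear (fun y => l (s y)) by move=> a x y; rewrite !linearP.
exists (mklin mL) => x /=; apply/eqP; rewrite -subr_eq0 -linearB; apply/eqP.
by apply: fl; rewrite linearB sP subrr.
Qed.

Lemma functional_separate V (S : V -> Prop) v : subspace S -> ~ S v ->
  exists l : {linear V -> K^o}, (forall x, S x -> l x = 0) /\ l v = 1.
Proof.
move=> sS nv; have [p [pS pE]] := subspace_projection sS.
have wn : v - p v <> 0.
  by move/eqP; rewrite subr_eq0 => /eqP vE; apply: nv; rewrite vE.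
(* A quasi-inverse of the map from [c] to [c *: (v - p v)] is a functional with value 1 at
   [v - p v], because that vector is nonzero. *)
have sL : linear (fun c : K^o => c *: (v - p v)).
  by move=> a x y; rewrite scalerDl scalerA.
have [t tP] := quasi_inverse (mklin sL).
have lL : linear (fun x => t (x - p x)).
  by move=> a x y; rewrite -[RHS](linearP t) (linearP p) scalerBr opprD addrACA.
exists (mklin lL); split=> [x Sx|] /=; first by rewrite pE // subrr linear0.
have /eqP : t (1 *: (v - p v)) *: (v - p v) = 1 *: (v - p v) := tP 1.
rewrite -subr_eq0 -scalerBl scaler_eq0 scale1r => /orP[|/eqP//].
by rewrite subr_eq0 => /eqP.
Qed.

(** The map [x - q x] kills exactly [T], so on [S] its kernel is the intersection with [T], where
    [l] vanishes. Hence [l] on [S] factors through this map, and composing the factor with it gives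
    a functional that kills [T]. *)
Lemma functional_glue V (S T : V -> Prop) (l : {linear V -> K^o}) :
  subspace S -> subspace T -> (forall x, S x -> T x -> l x = 0) ->
  exists m : {linear V -> K^o}, (forall x, S x -> m x = l x) /\
    forall x, T x -> m x = 0.
Proof.
move=> sS sT lST; have [p [pS pE]] := subspace_projection sS.
have [q [qT qE]] := subspace_projection sT.
have fL : linear (fun x => p x - q (p x)).
  by move=> a x y; rewrite (linearP p) (linearP q) scalerBr opprD addrACA.
have lL : linear (fun x => l (p x)) by move=> a x y; rewrite !linearP.
have [|m /= mE] := functional_factor (f := mklin fL) (l := mklin lL).
  move=> x /= /eqP; rewrite subr_eq0 => /eqP pq; apply: lST => //.
  by rewrite pq.
have kL : linear (fun x => m (x - q x)).
  by move=> a x y; rewrite -[RHS](linearP m) (linearP q) scalerBr opprD addrACA.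
exists (mklin kL); split=> x xS /=; last by rewrite qE // subrr linear0.
by rewrite -{1 2}(pE x) // mE pE.
Qed.

End LinearAlgebra.

(** * Graded maps and filtrations *)

Section Graded.
Variable K : fieldType.
Implicit Types (A B C : dcomplex K) (V : lmodType K).

Lemma dc_support A (x : A) : exists s : seq (int * int),
  uniq s /\ forall p q, (p, q) \notin s -> dc_proj A p q x = 0.
Proof.
have [s xE] := dc_proj_sum x; exists (undup s); split; first exact: undup_uniq.
move=> p q; rewrite mem_undup => pqs; rewrite xE linear_sum big_seq big1 //.
move=> -[p' q'] us; rewrite dc_projM /=; case: ifP => // /andP[/eqP pE /eqP qE].
by rewrite pE qE us in pqs.
Qed.

Lemma big_support (V : nmodType) (T : eqType) (s t : seq T) (F : T -> V) :
  uniq s -> uniq t -> (forall u, u \notin s -> F u = 0) ->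
  (forall u, u \notin t -> F u = 0) -> \sum_(u <- s) F u = \sum_(u <- t) F u.
Proof.
move=> us ut sF tF.
have half (a b : seq T) : (forall u, u \notin b -> F u = 0) ->
    \sum_(u <- a) F u = \sum_(u <- [seq u <- a | u \in b]) F u.
  by move=> bF; rewrite big_filter [LHS](bigID (mem b)) /= [X in _ + X]big1 ?addr0.
rewrite (half s t) // (half t s) //; apply: perm_big.
apply: uniq_perm; rewrite ?filter_uniq // => u.
by rewrite !mem_filter andbC.
Qed.

Lemma dc_sum_support A (x : A) s : uniq s ->
  (forall p q, (p, q) \notin s -> dc_proj A p q x = 0) ->
  x = \sum_(t <- s) dc_proj A t.1 t.2 x.
Proof.
move=> us xs; have [t xE] := dc_proj_sum x.
have st : {subset t <= undup (s ++ t)} by move=> u; rewrite mem_undup mem_cat => ->; rewrite orbT.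
have := proj_seq_sum xE st (undup_uniq _) => {1}->.
have zero (p q : int) : (p, q) \notin undup (s ++ t) -> dc_proj A p q x = 0.
  by rewrite mem_undup mem_cat negb_or => /andP[/xs].
by apply: big_support; rewrite ?undup_uniq // => -[p q]; [apply: zero | apply: xs].
Qed.

Lemma dc_proj_in A p q (x : A) : in_bidegree p q (dc_proj A p q x).
Proof. by rewrite /in_bidegree dc_projM !eqxx. Qed.

Lemma dc_proj_bideg A p q p' q' (x : A) : in_bidegree p q x ->
  dc_proj A p' q' x = if (p' == p) && (q' == q) then x else 0.
Proof.
move=> xE; rewrite -[in LHS]xE dc_projM; case: ifP => // /andP[/eqP-> /eqP->].
exact: xE.
Qed.

Lemma dc_proj_eq A (x y : A) :
  (forall p q, dc_proj A p q x = dc_proj A p q y) -> x = y.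
Proof.
move=> xy; apply/eqP; rewrite -subr_eq0; apply/eqP.
have -> : x - y = \sum_(t <- [::]) dc_proj A t.1 t.2 (x - y).
  by apply: dc_sum_support => // p q _; rewrite linearB xy subrr.
by rewrite big_nil.
Qed.

Lemma graded_ext A V (f g : {linear A -> V}) :
  (forall p q x, in_bidegree p q x -> f x = g x) -> forall x, f x = g x.
Proof.
move=> fg x; have [s xE] := dc_proj_sum x.
rewrite xE !linear_sum; apply: eq_bigr => t _.
by apply: fg; apply: dc_proj_in.
Qed.

(** Every element has finite support, and the sum is the same over any finite set containing the
    support; comparing two elements over a common set gives linearity. *)
Lemma graded_map_exists A V (f : int -> int -> {linear A -> V}) :
  exists F : {linear A -> V}, forall p q x, in_bidegree p q x -> F x = f p q x.
Proof.
pose s x := projT1 (cid (@dc_support A x)).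
have sP x : uniq (s x) /\ forall p q, (p, q) \notin s x -> dc_proj A p q x = 0.
  by rewrite /s; case: cid.
pose F x := \sum_(t <- s x) f t.1 t.2 (dc_proj A t.1 t.2 x).
have FE x t : uniq t -> (forall p q, (p, q) \notin t -> dc_proj A p q x = 0) ->
    F x = \sum_(u <- t) f u.1 u.2 (dc_proj A u.1 u.2 x).
  have [us ss] := sP x; move=> ut st.
  by apply: big_support => // -[p q]; [move/ss | move/st] => ->; rewrite linear0.
have FL : linear F.
  move=> a x y; have [_ xs] := sP x; have [_ ys] := sP y.
  have hx p q : (p, q) \notin undup (s x ++ s y) -> dc_proj A p q x = 0.
    by rewrite mem_undup mem_cat negb_or => /andP[/xs].
  have hy p q : (p, q) \notin undup (s x ++ s y) -> dc_proj A p q y = 0.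
    by rewrite mem_undup mem_cat negb_or => /andP[_ /ys].
  rewrite (FE x _ (undup_uniq _) hx) (FE y _ (undup_uniq _) hy).
  rewrite (FE _ _ (undup_uniq (s x ++ s y))); last first.
    by move=> p q pq; rewrite linearP hx // hy // scaler0 addr0.
  rewrite scaler_sumr -big_split; apply: eq_bigr => t _ /=.
  by rewrite (linearP (dc_proj A _ _)) linearP.
exists (mklin FL) => p q x xpq /=; rewrite (FE x [:: (p, q)]) //.
  by rewrite big_seq1 xpq.
move=> p' q'; rewrite inE => /negbTE pq.
by rewrite (dc_proj_bideg _ _ xpq) -[_ && _]/((p', q') == (p, q)) pq.
Qed.

Definition graded_map A V (f : int -> int -> {linear A -> V}) :=
  projT1 (cid (graded_map_exists f)).

Lemma graded_mapE A V (f : int -> int -> {linear A -> V}) p q x :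
  in_bidegree p q x -> graded_map f x = f p q x.
Proof. by rewrite /graded_map; case: cid => F /= FP; apply: FP. Qed.

Lemma scale_linear V a : linear (fun x : V => a *: x).
Proof. by move=> c x y; rewrite scalerDr !scalerA mulrC. Qed.

(** Serves for truncations, with weights 0 and 1, and for the sign operator of the tensor
    product. *)
Definition weight A (w : int -> int -> K) : {linear A -> A} :=
  graded_map (fun p q => mklin (scale_linear (w p q))).

Lemma weight_bideg A w p q (x : A) : in_bidegree p q x -> weight A w x = w p q *: x.
Proof. by move=> xpq; rewrite /weight (graded_mapE _ xpq). Qed.

Lemma weight_proj A w p q (x : A) :
  dc_proj A p q (weight A w x) = w p q *: dc_proj A p q x.
Proof.
have fL : linear (fun x => w p q *: dc_proj A p q x).
  by move=> a u v; rewrite linearP scalerDr !scalerA mulrC.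
have gL : linear (fun x => dc_proj A p q (weight A w x)).
  by move=> a u v; rewrite !linearP.
apply: (@graded_ext A A (mklin gL) (mklin fL)) => p' q' u upq /=.
rewrite (weight_bideg _ upq) linearZ (dc_proj_bideg _ _ upq) /=.
by case: ifP => [/andP[/eqP-> /eqP->]|]; rewrite ?scaler0.
Qed.

Definition cut A (c : int -> int -> bool) : {linear A -> A} :=
  weight A (fun p q => (c p q)%:R).

Lemma cut_proj A c p q (x : A) :
  dc_proj A p q (cut A c x) = if c p q then dc_proj A p q x else 0.
Proof. by rewrite weight_proj; case: ifP; rewrite ?scale1r ?scale0r. Qed.

Lemma cut_id A (c : int -> int -> bool) (x : A) :
  (forall p q, ~~ c p q -> dc_proj A p q x = 0) -> cut A c x = x.
Proof.
move=> cx; apply: dc_proj_eq => p q; rewrite cut_proj; case: ifPn => // /cx //.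
Qed.

Lemma cutC A (c : int -> int -> bool) (x : A) :
  x = cut A c x + cut A (fun p q => ~~ c p q) x.
Proof.
by apply: dc_proj_eq => p q; rewrite linearD !cut_proj; case: (c p q);
  rewrite ?addr0 ?add0r.
Qed.

Lemma bideg_d1 A p q (x : A) : in_bidegree p q x -> in_bidegree (p + 1) q (dc_d1 A x).
Proof. by rewrite /in_bidegree -dc_d1_deg => ->. Qed.

Lemma bideg_d2 A p q (x : A) : in_bidegree p q x -> in_bidegree p (q + 1) (dc_d2 A x).
Proof. by rewrite /in_bidegree -dc_d2_deg => ->. Qed.

Lemma proj_d1 A p q (x : A) : dc_proj A p q (dc_d1 A x) = dc_d1 A (dc_proj A (p - 1) q x).
Proof. by rewrite dc_d1_deg subrK. Qed.

Lemma proj_d2 A p q (x : A) : dc_proj A p q (dc_d2 A x) = dc_d2 A (dc_proj A p (q - 1) x).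
Proof. by rewrite dc_d2_deg subrK. Qed.

Lemma dc_d2d1 A (x : A) : dc_d2 A (dc_d1 A x) = - dc_d1 A (dc_d2 A x).
Proof. by apply/eqP; rewrite -addr_eq0 addrC dc_d1d2. Qed.

Fact dc_total_linear A : linear (@dc_total K A).
Proof.
by move=> a x y; rewrite /dc_total (linearP (dc_d1 A)) (linearP (dc_d2 A)) scalerDr addrACA.
Qed.

HB.instance Definition _ A :=
  GRing.isLinear.Build K A A _ (@dc_total K A) (@dc_total_linear A).

Lemma dc_totalD A (x y : A) : dc_total (x + y) = dc_total x + dc_total y.
Proof. exact: linearD. Qed.

Lemma dc_totalB A (x y : A) : dc_total (x - y) = dc_total x - dc_total y.
Proof. exact: linearB. Qed.

Lemma dc_totalK A (x : A) : dc_total (dc_total x) = 0.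
Proof.
by rewrite /dc_total !linearD dc_d1d1 dc_d2d2 add0r addr0 dc_d1d2.
Qed.

Lemma proj_total A p q (x : A) : dc_proj A p q (dc_total x) =
  dc_d1 A (dc_proj A (p - 1) q x) + dc_d2 A (dc_proj A p (q - 1) x).
Proof. by rewrite linearD /= proj_d1 proj_d2. Qed.

Lemma homogeneous_subspace A n : subspace (@homogeneous K A n).
Proof.
split=> [p q _|a x y hx hy p q pq]; first by rewrite linear0.
by rewrite linearP hx // hy // scaler0 addr0.
Qed.

Lemma filtration_subspace A i m n : subspace (@filtration K A i m n).
Proof.
split=> [p q _|a x y hx hy p q pq]; first by rewrite linear0.
by rewrite linearP hx // hy // scaler0 addr0.
Qed.

Lemma filtration_homogeneous A i m n (x : A) : filtration i m n x -> homogeneous n x.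
Proof. by move=> h p q pq; apply: h; rewrite (negbTE pq). Qed.

Lemma filtration_le A i m m' n (x : A) : filtration i m n x -> m' <= m ->
  filtration i m' n x.
Proof.
move=> h mm p q pq; apply: h; apply: contra pq => /andP[-> /=].
exact: le_trans.
Qed.

Lemma bideg_homogeneous A p q n (x : A) : in_bidegree p q x -> p + q = n ->
  homogeneous n x.
Proof.
move=> xpq pqn p' q' ne; rewrite (dc_proj_bideg _ _ xpq); case: ifP => //.
by move=> /andP[/eqP pE /eqP qE]; rewrite pE qE pqn eqxx in ne.
Qed.

Lemma bideg_filtration A i m p q n (x : A) : in_bidegree p q x -> p + q = n ->
  m <= (if i then q else p) -> filtration i m n x.
Proof.
move=> xpq pqn mpq p' q' ne; rewrite (dc_proj_bideg _ _ xpq); case: ifP => //.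
by move=> /andP[/eqP pE /eqP qE]; rewrite pE qE pqn eqxx mpq in ne.
Qed.

Lemma homogeneous_total A n (x : A) : homogeneous n x -> homogeneous (n + 1) (dc_total x).
Proof.
move=> hx p q pq; rewrite proj_total !hx ?linear0 ?addr0 //; lia.
Qed.

Lemma filtration_total A i m n (x : A) : filtration i m n x ->
  filtration i m (n + 1) (dc_total x).
Proof.
move=> hx p q pq; rewrite proj_total !hx ?linear0 ?addr0 //; case: i pq {hx}; lia.
Qed.

Lemma bounded_range A : bounded A -> exists N : nat, forall p q (x : A),
  (N%:Z < `|p|) || (N%:Z < `|q|) -> dc_proj A p q x = 0.
Proof.
case=> s sA; exists (\max_(t <- s) (`|t.1| + `|t.2|))%N => p q x pq; apply: sA.
apply/negP => pqs; have := @leq_bigmax_seq _ s xpredT (fun t => (`|t.1| + `|t.2|)%N) _ pqs isT.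
rewrite /=; lia.
Qed.

Lemma bounded_filtration0 A : bounded A -> exists N : int, forall i m n (x : A),
  N <= m -> filtration i m n x -> x = 0.
Proof.
case/bounded_range=> N NA; exists (N%:Z + 1) => i m n x Nm xF.
apply: dc_proj_eq => p q; rewrite linear0.
have [pq|/xF//] := boolP ((p + q == n) && (m <= if i then q else p)).
apply: NA; case: i pq {xF}; lia.
Qed.

Lemma bounded_filtration_full A : bounded A -> exists N : int, forall i m n (x : A),
  m <= N -> homogeneous n x -> filtration i m n x.
Proof.
case/bounded_range=> N NA; exists (- N%:Z) => i m n x Nm xn p q.
have [pq|/xn//] := eqVneq (p + q) n => mpq; apply: NA.
case: i mpq; lia.
Qed.

Section Morphism.
Variables (A B : dcomplex K) (f : {linear A -> B}) (fM : dc_morphism f).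

Lemma morph_proj p q x : f (dc_proj A p q x) = dc_proj B p q (f x).
Proof. by case: fM. Qed.

Lemma morph_d1 x : f (dc_d1 A x) = dc_d1 B (f x).
Proof. by case: fM. Qed.

Lemma morph_d2 x : f (dc_d2 A x) = dc_d2 B (f x).
Proof. by case: fM. Qed.

Lemma morph_total x : f (dc_total x) = dc_total (f x).
Proof. by rewrite /dc_total linearD /= morph_d1 morph_d2. Qed.

Lemma morph_bideg p q x : in_bidegree p q x -> in_bidegree p q (f x).
Proof. by rewrite /in_bidegree -morph_proj => ->. Qed.

Lemma morph_homogeneous n x : homogeneous n x -> homogeneous n (f x).
Proof. by move=> h p q pq; rewrite -morph_proj h // linear0. Qed.

Lemma morph_filtration i m n x : filtration i m n x -> filtration i m n (f x).
Proof. by move=> h p q pq; rewrite -morph_proj h // linear0. Qed.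

Lemma morph_cycles i r m n x : page_cycles i r m n x -> page_cycles i r m n (f x).
Proof.
case=> xF dx; split; first exact: morph_filtration.
case: r dx => [r|] /= dx; rewrite -morph_total; first exact: morph_filtration.
by rewrite dx linear0.
Qed.

Lemma morph_boundaries i r m n x :
  page_boundaries i r m n x -> page_boundaries i r m n (f x).
Proof.
case=> y [z [-> h]]; exists (f y), (f z); rewrite linearD /= morph_total; split=> //.
case: r h => [r|] [hy hz]; first by split; apply: morph_cycles.
split; first exact: morph_cycles.
case: hz => hz zF; split; first exact: morph_homogeneous.
by rewrite -morph_total; apply: morph_filtration.
Qed.

End Morphism.

Lemma page_cycles_subspace A i r m n : subspace (@page_cycles K A i r m n).
Proof.
split; first exact: page_cycles0.
move=> a x y [xF dx] [yF dy]; split.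
  by case: (filtration_subspace A i m n) => _; apply.
case: r dx dy => [r|] /= dx dy; rewrite dc_total_linear.
  by case: (filtration_subspace A i (m + r%:Z) (n + 1)) => _; apply.
by rewrite dx dy scaler0 addr0.
Qed.

Lemma page_boundaries_subspace A i r m n : subspace (@page_boundaries K A i r m n).
Proof.
split.
  exists 0, 0; rewrite linear0 addr0; split=> //.
  case: r => [r|]; split; try exact: page_cycles0.
  by split; rewrite ?linear0; [case: (homogeneous_subspace A (n - 1)) |
    case: (filtration_subspace A i m n)].
move=> a _ _ [y [z [-> h]]] [y' [z' [-> h']]].
exists (a *: y + y'), (a *: z + z'); split.
  by rewrite dc_total_linear scalerDr addrACA.
case: r h h' => [r|] [hy hz] [hy' hz'].
  by split; apply: (proj2 (page_cycles_subspace _ _ _ _ _)).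
split; first exact: (proj2 (page_cycles_subspace _ _ _ _ _)).
case: hz hz' => [hz zF] [hz' zF']; split.
  exact: (proj2 (homogeneous_subspace _ _)).
by rewrite dc_total_linear; apply: (proj2 (filtration_subspace _ _ _ _)).
Qed.

End Graded.

(** * Pages and isomorphisms *)

Section Pages.
Variable K : fieldType.
Implicit Types (A B C : dcomplex K) (V : lmodType K).

(** Exchanging the two directions turns the row filtration into the column filtration, so that
    arguments on spectral sequences are carried out for columns only. *)
Definition transpose A : dcomplex K.
Proof.
apply: (@DComplex K A (fun p q => dc_proj A q p) (dc_d2 A) (dc_d1 A)).
- by move=> p q p' q' x; rewrite dc_projM andbC.
- move=> x; have [s xE] := dc_proj_sum x.
  by exists [seq (t.2, t.1) | t <- s]; rewrite big_map.
- by move=> p q x; apply: dc_d2_deg.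
- by move=> p q x; apply: dc_d1_deg.
- exact: dc_d2d2.
- exact: dc_d1d1.
- by move=> x; rewrite addrC dc_d1d2.
Defined.

Lemma transpose_total A (x : A) : dc_total (x : transpose A) = dc_total x.
Proof. by rewrite /dc_total addrC. Qed.

Lemma transpose_filtration A i m n (x : A) :
  filtration i m n (x : transpose A) <-> filtration (~~ i) m n x.
Proof.
by split=> h p q pq; apply: h; move: pq; rewrite addrC; case: i.
Qed.

Lemma transpose_homogeneous A n (x : A) :
  homogeneous n (x : transpose A) <-> homogeneous n x.
Proof. by split=> h p q pq; apply: h; rewrite addrC. Qed.

Lemma transpose_cycles A i r m n (x : A) :
  page_cycles i r m n (x : transpose A) <-> page_cycles (~~ i) r m n x.
Proof.
rewrite /page_cycles transpose_filtration transpose_total.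
by case: r => [r|//]; rewrite (transpose_filtration _ _ _ (dc_total x)).
Qed.

Lemma transpose_boundaries A i r m n (x : A) :
  page_boundaries i r m n (x : transpose A) <-> page_boundaries (~~ i) r m n x.
Proof.
split=> -[y [z [-> h]]]; exists y, z; rewrite transpose_total; split=> //; case: r h => [r|].
- by move=> [/transpose_cycles hy /transpose_cycles hz].
- move=> [/transpose_cycles hy [/transpose_homogeneous hz]].
  by rewrite transpose_total => /transpose_filtration.
- by move=> [hy hz]; split; apply/transpose_cycles.
- move=> [hy [hz hdz]]; split; first exact/transpose_cycles.
  by split; [apply/transpose_homogeneous|apply/transpose_filtration].
Qed.

Lemma transpose_bounded A : bounded A -> bounded (transpose A).
Proof.
case=> s sA; exists [seq (t.2, t.1) | t <- s] => p q pq x; apply: sA.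
by apply: contra pq => qs; apply/mapP; exists (q, p).
Qed.

Lemma transpose_morphism A B (f : {linear A -> B}) : dc_morphism f ->
  @dc_morphism K (transpose A) (transpose B) f.
Proof. by case=> fP f1 f2; split=> // p q x; apply: fP. Qed.

Lemma transpose_Er_isomorphism r A B (f : {linear A -> B}) :
  Er_isomorphism r f -> @Er_isomorphism K r (transpose A) (transpose B) f.
Proof.
case=> fM iso; split; first exact: transpose_morphism.
move=> i m n; have [h1 h2 h3 h4] := iso (~~ i) m n; split.
- by move=> x /transpose_cycles/h1 ?; apply/transpose_cycles.
- by move=> x /transpose_boundaries/h2 ?; apply/transpose_boundaries.
- move=> x /transpose_cycles xZ /transpose_boundaries /(h3 _ xZ) ?.
  exact/transpose_boundaries.
- move=> y /transpose_cycles /h4[x xZ h]; exists x; first exact/transpose_cycles.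
  exact/transpose_boundaries.
Qed.

(** ** Homotopies *)

Definition lowers A (h : {linear A -> A}) := forall n x,
  homogeneous n x -> homogeneous (n - 1) (h x).

Definition homotopic0 A (D e : A -> A) := exists2 h : {linear A -> A}, lowers h &
  forall x, D (h x) + h (D x) = e x.

(** The first page is the cohomology of [dc_d2] for the column filtration and of [dc_d1] for the row
    filtration, whence two unrelated homotopies when [r] is finite; [E_oo] is governed by one
    homotopy of the total differential. The homotopies respect only the total degree. *)
Definition null_homotopic (r : option nat) A (e : A -> A) :=
  if r is Some _ then homotopic0 (dc_d1 A) e /\ homotopic0 (dc_d2 A) e
  else homotopic0 (@dc_total K A) e.

Lemma null_homotopic_columns A (e : {linear A -> A}) : dc_morphism e ->
  homotopic0 (dc_d2 A) e -> forall m n x, page_cycles false (Some 1%N) m n x ->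
  page_boundaries false (Some 1%N) m n (e x).
Proof.
move=> eM [h hl hE] m n x [xF dxF].
(* On the first page only the component in column [m] counts. Since [h] ignores the bigrading, its
   value is projected back to column [m]; [dc_d2 z] then cancels the leading component of [e x]. *)
pose z := dc_proj A m (n - 1 - m) (h (dc_proj A m (n - m) x)).
have zb : in_bidegree m (n - 1 - m) z by apply: dc_proj_in.
have d2z : dc_d2 A z = e (dc_proj A m (n - m) x).
  have d2x : dc_d2 A (dc_proj A m (n - m) x) = 0.
    have := dxF m (n - m + 1); rewrite proj_total addrK xF ?linear0 ?add0r; last lia.
    by apply; lia.
  rewrite /z dc_d2_deg (_ : n - 1 - m + 1 = n - m); last by lia.
  have := hE (dc_proj A m (n - m) x); rewrite d2x linear0 addr0 => ->.
  by rewrite (morph_proj eM) dc_proj_in.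
have zF : filtration false m (n - 1) z by apply: (bideg_filtration zb) => //=; lia.
have eF := morph_filtration eM xF.
have yF : filtration false (m + 1) n (e x - dc_total z).
  move=> p q pq; rewrite linearB /=; have [pE|pm] := eqVneq p m; last first.
    rewrite eF; last by lia.
    have := filtration_total zF; rewrite subrK => dzF.
    have [pqn|pqn] := boolP ((p + q == n) && (m <= p)); last by rewrite dzF // subrr.
    by lia.
  rewrite {}pE in pq *; have [qE|qn] := eqVneq q (n - m); last first.
    rewrite eF ?sub0r; last by lia.
    have := filtration_total zF; rewrite subrK => ->; rewrite ?oppr0 //; lia.
  rewrite qE proj_total -(morph_proj eM) -d2z (dc_proj_bideg _ _ zb).
  rewrite (dc_proj_bideg _ _ zb) ifF ?linear0 ?add0r; last by lia.
  by rewrite ifT ?subrr //; lia.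
exists (e x - dc_total z), z; split; first by rewrite subrK.
split; split=> //=.
- rewrite linearB /= dc_totalK -(morph_total eM) (subr0 (e _)).
  by apply: (filtration_le (morph_filtration eM dxF)); lia.
- by apply: (filtration_le zF); lia.
rewrite (subrK 1) -[dc_total z](subKr (e x)).
apply: (subspaceB (@filtration_subspace _ _ _ _ _)).
  by apply: (filtration_le eF); lia.
by apply: (filtration_le yF); lia.
Qed.

Definition r1infty (r : option nat) := r = None \/ r = Some 1%N.

Lemma null_homotopic_pages r A (e : {linear A -> A}) : r1infty r -> dc_morphism e ->
  null_homotopic r e -> forall i m n x, page_cycles i r m n x ->
  page_boundaries i r m n (e x).
Proof.
case=> -> eM; last first.
  case=> h1 h2 [] m n x; last exact: null_homotopic_columns.
  move=> xZ; apply/(@transpose_boundaries A false).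
  apply: (@null_homotopic_columns (transpose A)) => //; first exact: transpose_morphism.
    case: h1 => h hl hE; exists h => // k y /transpose_homogeneous /hl.
    by move/transpose_homogeneous.
  exact/transpose_cycles.
case=> h hl hE i m n x [xF dx]; exists 0, (h x); rewrite add0r.
have dhx : dc_total (h x) = e x by rewrite -hE dx linear0 addr0.
rewrite dhx; split=> //; split; first exact: page_cycles0.
split; last exact: morph_filtration.
exact/hl/filtration_homogeneous/xF.
Qed.

Lemma morphism_comp A B C (f : {linear A -> B}) (g : {linear B -> C}) :
  dc_morphism f -> dc_morphism g -> dc_morphism (g \o f).
Proof.
case=> f1 f2 f3 [g1 g2 g3]; split=> [p q x|x|x] /=.
- by rewrite f1 g1.
- by rewrite f2 g2.
- by rewrite f3 g3.
Qed.

Lemma morphism_sub A B (f g : {linear A -> B}) :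
  dc_morphism f -> dc_morphism g -> dc_morphism (f \- g).
Proof.
by case=> f1 f2 f3 [g1 g2 g3]; split=> [p q x|x|x] /=;
  rewrite linearB /= (f1, f2, f3) (g1, g2, g3).
Qed.

Lemma morphism_id A : dc_morphism (idfun : {linear A -> A}).
Proof. by []. Qed.

Lemma homotopy_equivalence_Er r A B (f : {linear A -> B}) (g : {linear B -> A}) :
  r1infty r -> dc_morphism f -> dc_morphism g ->
  null_homotopic r (idfun \- (g \o f)) -> null_homotopic r (idfun \- (f \o g)) ->
  Er_isomorphism r f.
Proof.
move=> hr fM gM hA hB; split=> // i m n; split.
- by move=> x; apply: morph_cycles.
- by move=> x; apply: morph_boundaries.
- move=> x xZ /(morph_boundaries gM) gfN.
  have := null_homotopic_pages hr (morphism_sub (@morphism_id A) (morphism_comp fM gM)) hA xZ.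
  move=> /= h; rewrite -[x](subrK (g (f x))).
  by apply: subspaceD h gfN; apply: page_boundaries_subspace.
- move=> y yZ; exists (g y); first exact: morph_cycles.
  exact: (null_homotopic_pages hr (morphism_sub (@morphism_id B) (morphism_comp gM fM)) hB yZ).
Qed.

Lemma null_homotopic0 r A (e : A -> A) : (forall x, e x = 0) -> null_homotopic r e.
Proof.
move=> e0; have zL : linear (fun _ : A => 0 : A) by move=> a x y; rewrite scaler0 addr0.
have h (D : {linear A -> A}) : homotopic0 D e.
  exists (mklin zL) => [n x _|x] /=; first by case: (homogeneous_subspace A (n - 1)).
  by rewrite linear0 addr0 e0.
by case: r => [r|]; [split; apply: h | apply: h].
Qed.

End Pages.

(** * Mapping cones and the comparison of pages *)

Section Cone.
Variable K : fieldType.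
Implicit Types (A B C : dcomplex K).

Section ConeAcyclic.
Variables (A B : dcomplex K) (f : {linear A -> B}) (fM : dc_morphism f).
Hypothesis iso : forall m n, subquotient_iso
  (@page_cycles K A false (Some 1%N) m n) (@page_boundaries K A false (Some 1%N) m n)
  (@page_cycles K B false (Some 1%N) m n) (@page_boundaries K B false (Some 1%N) m n) f.

Local Notation F := (filtration false).

(* Acyclicity of the quotient [F^m / F^(m+k)] of the mapping cone of [f]. *)
Lemma cone_acyclic k m n (x : A) (y : B) : F m (n + 1) x -> F m n y ->
  F (m + k%:Z) (n + 1 + 1) (dc_total x) ->
  F (m + k%:Z) (n + 1) (f x + dc_total y) ->
  exists w z, [/\ F m n w, F m (n - 1) z, F (m + k%:Z) (n + 1) (x - dc_total w) &
    F (m + k%:Z) n (y + f w - dc_total z)].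
Proof.
elim: k m x y => [|k IHk] m x y xF yF dxF fxF.
  exists 0, 0; rewrite !linear0 !subr0 addr0.
  by split; rewrite ?addr0 //; apply: (subspace0 (@filtration_subspace _ _ _ _ _)).
(* One column at a time: injectivity on [E_1] makes [x] a boundary up to column [m + 1], and
   surjectivity then corrects [y] in the same column. Both errors lie in column [m + 1] on, where
   the induction hypothesis takes over. *)
have [w0 [z0 [w0F z0F xw yw]]] : exists w z, [/\ F m n w, F m (n - 1) z,
    F (m + 1) (n + 1) (x - dc_total w) & F (m + 1) n (y + f w - dc_total z)].
  have [_ _ inj surj] := iso m (n + 1).
  have xZ : page_cycles false (Some 1%N) m (n + 1) x.
    by split=> //=; apply: (filtration_le dxF); lia.
  have fxN : page_boundaries false (Some 1%N) m (n + 1) (f x).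
    have fyF : F (m + 1) (n + 1) (f x + dc_total y).
      by apply: (filtration_le fxF); lia.
    exists (f x + dc_total y), (- y); split; first by rewrite linearN addrK.
    have yN := subspaceN (@filtration_subspace _ _ _ _ _) yF.
    split; split=> //=.
    - by apply: (filtration_le (filtration_total fyF)); lia.
    - by rewrite (addrK 1); apply: (filtration_le yN); lia.
    - by rewrite (addrK 1); apply: (filtration_le (filtration_total yN)); lia.
  have [u [w [xE [[/= uF duF] [/= wF dwF]]]]] := inj _ xZ fxN.
  rewrite (addrK 1) in wF dwF.
  have {}wF : F m n w by apply: (filtration_le wF); lia.
  have uE : x - dc_total w = u by rewrite xE addrK.
  have [|w' [w'F dw'F] [v [z [vE [[/= vF _] [/= zF _]]]]]] := (let: And4 _ _ _ s := iso m n in s) (y + f w).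
    split; first by apply: (subspaceD (@filtration_subspace _ _ _ _ _)) => //; apply: morph_filtration.
    rewrite /= linearD /= -(morph_total fM).
    have -> : dc_total y + f (dc_total w) = (f x + dc_total y) - f u.
      by rewrite -uE linearB /= opprB [RHS]addrC addrA addrNK [LHS]addrC.
    apply: (subspaceB (@filtration_subspace _ _ _ _ _)).
      by apply: (filtration_le fxF); lia.
    by apply: (morph_filtration fM).
  exists (w - w'), z; split.
  - exact: (subspaceB (@filtration_subspace _ _ _ _ _)).
  - by apply: (filtration_le zF); lia.
  - rewrite linearB /= opprB addrCA uE addrC.
    exact: (subspaceD (@filtration_subspace _ _ _ _ _)).
  by rewrite linearB /= addrA vE addrK.
have [||||w [z [wF zF h1 h2]]] := IHk (m + 1) (x - dc_total w0) (y + f w0 - dc_total z0) => //.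
- by rewrite dc_totalB dc_totalK subr0; apply: (filtration_le dxF); lia.
- rewrite dc_totalB dc_totalD dc_totalK subr0 linearB /= (morph_total fM) addrCA.
  by rewrite subrK addrC; apply: (filtration_le fxF); lia.
exists (w0 + w), (z0 + z); split.
- apply: (subspaceD (@filtration_subspace _ _ _ _ _)) => //.
  by apply: (filtration_le wF); lia.
- apply: (subspaceD (@filtration_subspace _ _ _ _ _)) => //.
  by apply: (filtration_le zF); lia.
- by rewrite dc_totalD opprD addrA; apply: (filtration_le h1); lia.
have -> : y + f (w0 + w) - dc_total (z0 + z) = y + f w0 - dc_total z0 + f w - dc_total z.
  by rewrite dc_totalD linearD /= opprD !addrA; congr (_ - _); rewrite [LHS]addrAC.
by apply: (filtration_le h2); lia.
Qed.

Lemma columns_page_iso k m n : subquotient_iso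
  (@page_cycles K A false (Some k.+1) m n) (@page_boundaries K A false (Some k.+1) m n)
  (@page_cycles K B false (Some k.+1) m n) (@page_boundaries K B false (Some k.+1) m n) f.
Proof.
split.
- by move=> x; apply: morph_cycles.
- by move=> x; apply: morph_boundaries.
- move=> x [xF dxF] [y [z [fxE [[/= yF dyF] [/= zF dzF]]]]].
  (* Boundaries of [E_(k+1)] come from as far as column [m - k], so the pair [(x, -z)] is read as a
     cocycle of the cone in [F^(m-k) / F^(m+1)]. *)
  have mk : m - k%:Z + k.+1%:Z = m + 1 by lia.
  have [||||w [_ [wF _ xw _]]] := @cone_acyclic k.+1 (m - k%:Z) (n - 1) x (- z).
  + by rewrite subrK; apply: (filtration_le xF); lia.
  + exact: (subspaceN (@filtration_subspace _ _ _ _ _)).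
  + by rewrite mk subrK; apply: (filtration_le dxF); lia.
  + by rewrite mk subrK linearN /= fxE addrK.
  rewrite mk subrK in xw.
  exists (x - dc_total w), w; rewrite subrK; split=> //; split; split=> //=.
    by rewrite dc_totalB dc_totalK subr0; apply: (filtration_le dxF); lia.
  rewrite !subrK -[dc_total w](subKr x); apply: (subspaceB (@filtration_subspace _ _ _ _ _)) => //.
  by apply: (filtration_le xw); lia.
move=> y [yF dyF].
have [||||w [z [wF zF wdF yE]]] := @cone_acyclic k.+1 m n 0 y => //.
- exact: (subspace0 (@filtration_subspace _ _ _ _ _)).
- by rewrite linear0; apply: (subspace0 (@filtration_subspace _ _ _ _ _)).
- by rewrite linear0 add0r.
rewrite sub0r -linearN in wdF.
exists (- w); first by split=> //; apply: (subspaceN (@filtration_subspace _ _ _ _ _)).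
exists (y + f w - dc_total z), z; rewrite subrK linearN opprK; split=> //; split; split=> /=.
- by apply: (filtration_le yE); lia.
- by apply: (filtration_le (filtration_total yE)); lia.
- by apply: (filtration_le zF); lia.
rewrite !subrK; have -> : dc_total z = (y + f w) - (y + f w - dc_total z) by rewrite subKr.
apply: (subspaceB (@filtration_subspace _ _ _ _ _)); last by apply: (filtration_le yE); lia.
apply: (subspaceD (@filtration_subspace _ _ _ _ _)) => //.
exact: (morph_filtration fM).
Qed.

End ConeAcyclic.

(** For large [k] the differentials leaving column [m] land where the filtration is zero, and those
    arriving start where it is everything; these are the two lower bounds on [k]. *)
Lemma page_infty A : bounded A -> exists N : int, forall i m n (k : nat) (x : A),
  N <= m + k%:Z -> N <= k%:Z - m ->
  (page_cycles i (Some k.+1) m n x <-> page_cycles i None m n x) /\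
  (page_boundaries i (Some k.+1) m n x <-> page_boundaries i None m n x).
Proof.
move=> bA; have [N N0] := bounded_filtration0 bA; have [M MF] := bounded_filtration_full bA.
exists (Num.max N (1 - M)) => i m n k x; rewrite !ge_max => /andP[h1 _] /andP[_ h2].
have cyc (l : nat) m' n' (y : A) : N <= m' + l%:Z ->
    page_cycles i (Some l) m' n' y <-> page_cycles i None m' n' y.
  move=> Nm; split=> -[yF /= dy]; split=> //=; first exact: N0 dy.
  by rewrite dy; apply: (subspace0 (@filtration_subspace _ _ _ _ _)).
split; first by apply: cyc; lia.
split=> -[y [z [xE [yZ zZ]]]]; exists y, z; split=> //.
  case: zZ => /= [zF dzF]; split; first by apply/(cyc k) => //; lia.
  split; first exact: filtration_homogeneous zF.
  by rewrite !subrK in dzF.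
case: zZ => zn dzF; split; first by apply/cyc => //=; lia.
split=> /=; last by rewrite !subrK.
by apply: MF => //; lia.
Qed.

Lemma E1_isomorphism_pages A B (f : {linear A -> B}) r : bounded A -> bounded B ->
  Er_isomorphism (Some 1%N) f -> r != Some 0%N -> Er_isomorphism r f.
Proof.
move=> bA bB [fM iso] r0; split=> // i m n.
have fin k m' n' : subquotient_iso
    (@page_cycles K A i (Some k.+1) m' n') (@page_boundaries K A i (Some k.+1) m' n')
    (@page_cycles K B i (Some k.+1) m' n') (@page_boundaries K B i (Some k.+1) m' n') f.
  case: i; last exact: columns_page_iso.
  have [_ isoT] := transpose_Er_isomorphism (conj fM iso).
  have [h1 h2 h3 h4] := @columns_page_iso (transpose A) (transpose B) f
    (transpose_morphism fM) (isoT false) k m' n'.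
  split.
  - by move=> x /(@transpose_cycles K A false)/h1/transpose_cycles.
  - by move=> x /(@transpose_boundaries K A false)/h2/transpose_boundaries.
  - move=> x /(@transpose_cycles K A false) xZ /(@transpose_boundaries K B false) /(h3 _ xZ).
    by move/transpose_boundaries.
  - move=> y /(@transpose_cycles K B false)/h4[x /transpose_cycles xZ /transpose_boundaries h].
    by exists x.
case: r r0 => [[|k]|] // _.
have [N NA] := page_infty bA; have [M MB] := page_infty bB.
pose k := (`|N| + `|M| + `|m|)%N.
have NZ x := proj1 (NA i m n k x ltac:(lia) ltac:(lia)).
have NN x := proj2 (NA i m n k x ltac:(lia) ltac:(lia)).
have MZ x := proj1 (MB i m n k x ltac:(lia) ltac:(lia)).
have MN x := proj2 (MB i m n k x ltac:(lia) ltac:(lia)).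
have [h1 h2 h3 h4] := fin k m n; split.
- by move=> x /NZ/h1/MZ.
- by move=> x /NN/h2/MN.
- by move=> x /NZ xZ /MN /(h3 _ xZ)/NN.
- by move=> y /MZ/h4[x /NZ xZ /MN h]; exists x.
Qed.

(* An [E_oo]-isomorphism is an isomorphism on total cohomology that is strictly
   compatible with both filtrations. *)
Lemma Einfty_strict A B (f : {linear A -> B}) : bounded A -> bounded B ->
  Er_isomorphism None f ->
  (forall i m n (y : B), filtration i m n y -> dc_total y = 0 ->
    exists x z, [/\ filtration i m n x, dc_total x = 0 & y = f x + dc_total z]) /\
  (forall n (x : A) z, homogeneous n x -> dc_total x = 0 -> f x = dc_total z ->
    homogeneous (n - 1) z -> exists w, x = dc_total w).
Proof.
move=> bA bB [fM iso]; have [N N0A] := bounded_filtration0 bA.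
have [M M0B] := bounded_filtration0 bB; have [L LA] := bounded_filtration_full bA.
have [L' LB] := bounded_filtration_full bB; split.
  move=> i m n y yF dy.
  (* [k] bounds the number of filtration steps left before [F] vanishes on [B]; each use of the page
     isomorphism removes one step. *)
  have [k mk] : exists k : nat, M <= m + k%:Z by exists `|M - m|%N; lia.
  elim: k m y mk yF dy => [|k IHk] m y mk yF dy.
    exists 0, 0; rewrite !linear0 addr0; split=> //.
      exact: (subspace0 (@filtration_subspace _ _ _ _ _)).
    by apply: M0B yF; lia.
  have [_ _ _ surj] := iso i m n; have [|x [xF dx] [y' [z [yE [[y'F dy'] _]]]]] := surj y.
    by split.
  have [|x' [z' [x'F dx' y'E]]] := IHk (m + 1) y' _ y'F dy'; first by lia.
  exists (x + x'), (z' + z); rewrite !dc_totalD dx dx' addr0 linearD /=; split=> //.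
    apply: (subspaceD (@filtration_subspace _ _ _ _ _)) => //.
    by apply: (filtration_le x'F); lia.
  by rewrite -[y](subrK (f x)) yE y'E addrC !addrA.
move=> n x z xn dx fx zn.
have [m xF] : exists m, filtration false m n x.
  by exists L; apply: LA.
have [k mk] : exists k : nat, N <= m + k%:Z by exists `|N - m|%N; lia.
elim: k m x z mk xF dx fx zn {xn} => [|k IHk] m x z mk xF dx fx zn.
  exists 0; rewrite linear0; apply: N0A xF; lia.
have [_ _ inj _] := iso false m n; have [||y [w [xE [[yF dy] [wn _]]]]] := inj x.
- by split.
- exists 0, z; rewrite add0r; split=> //; split; first exact: page_cycles0.
  by split=> //; rewrite -fx; apply: morph_filtration.
have [|||||w' yE] := IHk (m + 1) y (z - f w) => //.
- by lia.
- by rewrite dc_totalB -fx xE linearD /= (morph_total fM) addrK.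
- apply: (subspaceB (@homogeneous_subspace _ _ _)) => //.
  exact: morph_homogeneous.
by exists (w' + w); rewrite dc_totalD xE yE.
Qed.

Lemma Er_isomorphism_comp r A B C (f : {linear A -> B}) (g : {linear B -> C}) :
  Er_isomorphism r f -> Er_isomorphism r g -> Er_isomorphism r (g \o f).
Proof.
case=> fM fI [gM gI]; split; first exact: morphism_comp.
move=> i m n; have [f1 f2 f3 f4] := fI i m n; have [g1 g2 g3 g4] := gI i m n.
split.
- by move=> x /f1/g1.
- by move=> x /f2/g2.
- by move=> x xZ /= h; apply: f3 => //; apply: g3 => //; apply: f1.
- move=> z /g4[y /f4[x xZ xy] yz]; exists x => //=.
  rewrite -[z](subrK (g y)) -addrA -linearB.
  by apply: subspaceD yz (g2 _ xy); apply: page_boundaries_subspace.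
Qed.

Lemma dc_bijective_Er r A B (f : {linear A -> B}) (g : {linear B -> A}) :
  dc_morphism f -> cancel f g -> cancel g f -> dc_morphism g /\ Er_isomorphism r f.
Proof.
move=> fM fg gf; have gM : dc_morphism g.
  by case: fM => f1 f2 f3; split=> [p q x|x|x]; apply: (can_inj fg);
    rewrite gf (f1, f2, f3) gf.
split=> //; split=> // i m n; split.
- by move=> x; apply: morph_cycles.
- by move=> x; apply: morph_boundaries.
- by move=> x _ /(morph_boundaries gM); rewrite fg.
- move=> y /(morph_cycles gM) yZ; exists (g y) => //; rewrite gf subrr.
  exact: (subspace0 (@page_boundaries_subspace _ _ _ _ _ _)).
Qed.

Lemma Er_equiv_refl r A : Er_equiv r A A.
Proof.
exists (idfun : {linear A -> A}).
by case: (@dc_bijective_Er r A A idfun idfun (@morphism_id _ A)).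
Qed.

Lemma Er_equiv_trans r A B C : Er_equiv r A B -> Er_equiv r B C -> Er_equiv r A C.
Proof. by case=> f fI [g gI]; exists (g \o f); apply: Er_isomorphism_comp. Qed.

End Cone.

(** * Tensor products *)

Section TensorSpace.
Variables (K : fieldType) (U V : lmodType K).

(** The default [0] off bilinear forms makes equality of two encodings mean agreement on bilinear
    forms and nothing more. *)
Definition form_sum (l : seq (U * V)) (b : U -> V -> K^o) : K^o :=
  if `[< bilinear_map b >] then \sum_(x <- l) b x.1 x.2 else 0.

(* A tensor is encoded by its values on all bilinear forms. *)
Definition tensor := {F : (U -> V -> K^o) -> K^o | exists l, F = form_sum l}.

HB.instance Definition _ := gen_eqMixin tensor.
HB.instance Definition _ := gen_choiceMixin tensor.

Definition tensor_of l : tensor := exist _ (form_sum l) (ex_intro _ l erefl).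

Definition tensor_repr (x : tensor) : seq (U * V) := sval (cid (svalP x)).

Lemma tensor_reprK x : tensor_of (tensor_repr x) = x.
Proof. by case: x => F hF; apply: eq_exist; rewrite /tensor_repr; case: cid. Qed.

Lemma tensor_ofP l m : tensor_of l = tensor_of m <->
  forall b : U -> V -> K^o, bilinear_map b ->
    \sum_(x <- l) b x.1 x.2 = \sum_(x <- m) b x.1 x.2.
Proof.
split=> [[lm] b bb|h].
  by move/(congr1 (@^~ b)): lm; rewrite /form_sum asboolT.
apply: eq_exist; apply/funext => b; rewrite /form_sum; case: asboolP => // bb.
exact: h.
Qed.

Lemma tensor_repr_sum l (b : U -> V -> K^o) : bilinear_map b ->
  \sum_(x <- tensor_repr (tensor_of l)) b x.1 x.2 = \sum_(x <- l) b x.1 x.2.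
Proof. by move=> bb; apply: (proj1 (tensor_ofP _ _)) => //; apply: tensor_reprK. Qed.

Lemma bilinearZl (W : lmodType K) (b : U -> V -> W) a u v : bilinear_map b ->
  b (a *: u) v = a *: b u v.
Proof.
case=> _ /(_ v) h; have h0 : b 0 v = 0.
  by have := h (-1) 0 0; rewrite scaler0 addr0 scaleN1r addNr.
by have := h a u 0; rewrite h0 !addr0.
Qed.

Definition tensor_add x y := tensor_of (tensor_repr x ++ tensor_repr y).
Definition tensor_scale a x := tensor_of [seq (a *: t.1, t.2) | t <- tensor_repr x].

Fact tensor_addA : associative tensor_add.
Proof.
by move=> x y z; apply/tensor_ofP => b bb; rewrite !big_cat !tensor_repr_sum // !big_cat /= addrA.
Qed.

Fact tensor_addC : commutative tensor_add.
Proof. by move=> x y; apply/tensor_ofP => b bb; rewrite !big_cat /= addrC. Qed.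

Fact tensor_add0 : left_id (tensor_of [::]) tensor_add.
Proof.
move=> x; rewrite -[RHS]tensor_reprK; apply/tensor_ofP => b bb.
by rewrite big_cat /= tensor_repr_sum // big_nil /= add0r.
Qed.

Fact tensor_addN : left_inverse (tensor_of [::]) (tensor_scale (-1)) tensor_add.
Proof.
move=> x; apply/tensor_ofP => b bb; rewrite big_cat /= tensor_repr_sum // big_map big_nil.
rewrite -big_split big1 // => t _ /=.
by rewrite (bilinearZl _ _ _ bb) scaleN1r addNr.
Qed.

HB.instance Definition _ := GRing.isZmodule.Build tensor
  tensor_addA tensor_addC tensor_add0 tensor_addN.

Fact tensor_scaleA a b x : tensor_scale a (tensor_scale b x) = tensor_scale (a * b) x.
Proof.
apply/tensor_ofP => f bf; rewrite !big_map.
under eq_bigr do rewrite (bilinearZl _ _ _ bf).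
rewrite -scaler_sumr tensor_repr_sum // big_map scaler_sumr; apply: eq_bigr => t _.
by rewrite !(bilinearZl _ _ _ bf) scalerA.
Qed.

Fact tensor_scale1 : left_id 1 tensor_scale.
Proof.
move=> x; rewrite -[RHS]tensor_reprK; apply/tensor_ofP => f bf; rewrite big_map.
by apply: eq_bigr => t _; rewrite scale1r.
Qed.

Fact tensor_scaleDr : right_distributive tensor_scale +%R.
Proof.
move=> a x y; apply/tensor_ofP => f bf; rewrite big_cat /= !tensor_repr_sum // !big_map.
under eq_bigr do rewrite (bilinearZl _ _ _ bf).
rewrite -scaler_sumr tensor_repr_sum // big_cat scalerDr !scaler_sumr /=.
by congr (_ + _); apply: eq_bigr => t _; rewrite (bilinearZl _ _ _ bf).
Qed.

Fact tensor_scaleDl x : {morph tensor_scale^~ x : a b / a + b}.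
Proof.
move=> a b; apply/tensor_ofP => f bf; rewrite big_cat /= !tensor_repr_sum // !big_map -big_split.
by apply: eq_bigr => t _; rewrite /= !(bilinearZl _ _ _ bf) scalerDl.
Qed.

HB.instance Definition _ := GRing.Zmodule_isLmodule.Build K tensor
  tensor_scaleA tensor_scale1 tensor_scaleDr tensor_scaleDl.

Definition tensor_pure u v : tensor := tensor_of [:: (u, v)].

Lemma tensor_pure_bilinear : bilinear_map tensor_pure.
Proof.
split=> [u a v v'|v a u u'].
  change (tensor_pure u (a *: v + v') =
    tensor_add (tensor_scale a (tensor_pure u v)) (tensor_pure u v')).
  apply/tensor_ofP => f bf; rewrite big_cat /= !tensor_repr_sum // !big_map.
  under [X in _ = X + _]eq_bigr do rewrite (bilinearZl _ _ _ bf).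
  by rewrite -scaler_sumr tensor_repr_sum // !big_seq1 /= (proj1 bf).
change (tensor_pure (a *: u + u') v =
  tensor_add (tensor_scale a (tensor_pure u v)) (tensor_pure u' v)).
apply/tensor_ofP => f bf; rewrite big_cat /= !tensor_repr_sum // !big_map.
under [X in _ = X + _]eq_bigr do rewrite (bilinearZl _ _ _ bf).
by rewrite -scaler_sumr tensor_repr_sum // !big_seq1 /= (proj2 bf).
Qed.

(** Scalar forms suffice to define a map into any [X], because linear functionals separate the
    points of [X]. *)
Lemma tensor_of_sum l m (X : lmodType K) (b : U -> V -> X) : bilinear_map b ->
  tensor_of l = tensor_of m ->
  \sum_(x <- l) b x.1 x.2 = \sum_(x <- m) b x.1 x.2.
Proof.
move=> bb lm; apply: contrapT => ne.
have [||f [_ f1]] := @functional_separate _ X (fun x => x = 0)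
  (\sum_(x <- l) b x.1 x.2 - \sum_(x <- m) b x.1 x.2).
- by split=> // a x y -> ->; rewrite scaler0 addr0.
- by move/eqP; rewrite subr_eq0 => /eqP /ne.
have fb : bilinear_map (fun u v => f (b u v) : K^o).
  split=> [u a v v'|v a u u'] /=.
    by rewrite (proj1 bb) linearP.
  by rewrite (proj2 bb) linearP.
have := proj1 (tensor_ofP l m) lm _ fb.
rewrite -!linear_sum => /eqP; rewrite -subr_eq0 -linearB f1 => /eqP/esym e.
by have := oner_neq0 K; rewrite e eqxx.
Qed.

Lemma tensor_universal : tensor_product tensor_pure.
Proof.
split=> [|X b bb]; first exact: tensor_pure_bilinear.
pose g x := \sum_(t <- tensor_repr x) b t.1 t.2.
have gE l : g (tensor_of l) = \sum_(t <- l) b t.1 t.2.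
  by apply: tensor_of_sum => //; apply: tensor_reprK.
have gL : linear g.
  move=> a x y; have -> : a *: x + y = tensor_of (tensor_repr (tensor_scale a x) ++ tensor_repr y) by [].
  rewrite gE big_cat /= -/(g _) -/(g _) gE big_map scaler_sumr; congr (_ + _).
  by apply: eq_bigr => t _; rewrite (bilinearZl _ _ _ bb).
exists (mklin gL); split=> [u v|g' g'E] /=; first by rewrite gE big_seq1.
have sumE l : tensor_of l = \sum_(t <- l) tensor_pure t.1 t.2.
  elim: l => [|t l IHl]; first by rewrite big_nil.
  rewrite big_cons -IHl; change (tensor_of (t :: l) = tensor_add (tensor_pure t.1 t.2) (tensor_of l)).
  by apply/tensor_ofP => f bf; rewrite big_cat /= !tensor_repr_sum // big_cons big_seq1.
move=> x; rewrite -[x in LHS]tensor_reprK sumE linear_sum; apply: eq_bigr => t _.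
exact: g'E.
Qed.

End TensorSpace.

Section TensorMaps.
Variable K : fieldType.

Lemma tensor_lift (U V W X : lmodType K) (t : U -> V -> W) (b : U -> V -> X) :
  tensor_product t -> bilinear_map b ->
  exists g : {linear W -> X}, forall u v, g (t u v) = b u v.
Proof. by case=> _ tu /tu[g [gE _]]; exists g. Qed.

Lemma tensor_ext (U V W X : lmodType K) (t : U -> V -> W) (f g : {linear W -> X}) :
  tensor_product t -> (forall u v, f (t u v) = g (t u v)) -> forall x, f x = g x.
Proof.
move=> [tb tu] fg x; have [|h [_ hU]] := tu X (fun u v => g (t u v)).
  by split=> [u a v v'|v a u u'] /=; rewrite (proj1 tb, proj2 tb) linearP.
by rewrite (hU f) // (hU g).
Qed.

Lemma tensor_map (U V W U' V' W' : lmodType K) (t : U -> V -> W) (t' : U' -> V' -> W')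
    (f : {linear U -> U'}) (g : {linear V -> V'}) :
  tensor_product t -> bilinear_map t' ->
  exists h : {linear W -> W'}, forall u v, h (t u v) = t' (f u) (g v).
Proof.
move=> tt t'b; apply: (tensor_lift (b := fun u v => t' (f u) (g v))) => //.
split=> [u a v v'|v a u u'] /=; rewrite linearP.
  exact: (proj1 t'b).
exact: (proj2 t'b).
Qed.

Section Bilinear.
Variables (U V W : lmodType K) (t : U -> V -> W) (tb : bilinear_map t).

Lemma bilinDr u v v' : t u (v + v') = t u v + t u v'.
Proof. by have := proj1 tb u 1 v v'; rewrite !scale1r. Qed.

Lemma bilinDl u u' v : t (u + u') v = t u v + t u' v.
Proof. by have := proj2 tb v 1 u u'; rewrite !scale1r. Qed.

Lemma bilin0r u : t u 0 = 0.
Proof. by have := proj1 tb u (-1) 0 0; rewrite scaler0 addr0 scaleN1r addNr. Qed.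

Lemma bilin0l v : t 0 v = 0.
Proof. by have := proj2 tb v (-1) 0 0; rewrite scaler0 addr0 scaleN1r addNr. Qed.

Lemma bilinZr a u v : t u (a *: v) = a *: t u v.
Proof. by have := proj1 tb u a v 0; rewrite bilin0r !addr0. Qed.

Lemma bilinZl a u v : t (a *: u) v = a *: t u v.
Proof. by have := proj2 tb v a u 0; rewrite bilin0l !addr0. Qed.

Lemma bilinNr u v : t u (- v) = - t u v.
Proof. by rewrite -scaleN1r bilinZr scaleN1r. Qed.

Lemma bilinNl u v : t (- u) v = - t u v.
Proof. by rewrite -scaleN1r bilinZl scaleN1r. Qed.

Lemma bilinBr u v v' : t u (v - v') = t u v - t u v'.
Proof. by rewrite bilinDr bilinNr. Qed.

Lemma bilinBl u u' v : t (u - u') v = t u v - t u' v.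
Proof. by rewrite bilinDl bilinNl. Qed.

End Bilinear.

End TensorMaps.

Section TensorComplex.
Variable K : fieldType.
Implicit Types A B C : dcomplex K.

(** As a linear operator, the sign [(-1)^|a|] turns the Leibniz rule into a bilinear formula valid
    for all elements, not only homogeneous ones. *)
Definition koszul A : {linear A -> A} := weight A (fun p q => (-1) ^ (p + q)).

Lemma koszul_bideg A p q (x : A) : in_bidegree p q x -> koszul A x = (-1) ^ (p + q) *: x.
Proof. exact: weight_bideg. Qed.

Lemma signS (n : int) : (-1) ^ (n + 1) = - (-1) ^ n :> K.
Proof. by rewrite expfzDr ?oppr_eq0 ?oner_eq0 // expr1z mulrN1. Qed.

Lemma signK (n : int) : (-1) ^ n * (-1) ^ n = 1 :> K.
Proof. by rewrite -expfzMl mulrNN mulr1 exp1rz. Qed.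

Lemma tensor_ext_bideg A B (W X : lmodType K) (t : A -> B -> W) (f g : {linear W -> X}) :
  tensor_product t ->
  (forall p q p' q' a b, in_bidegree p q a -> in_bidegree p' q' b ->
     f (t a b) = g (t a b)) -> forall x, f x = g x.
Proof.
move=> tt fg; apply: (tensor_ext tt) => a b.
have [[tr tl] _] := tt.
have rL (h : {linear W -> X}) u : linear (fun v => h (t u v)).
  by move=> c v v'; rewrite tr linearP.
have lL (h : {linear W -> X}) v : linear (fun u => h (t u v)).
  by move=> c u u'; rewrite tl linearP.
apply: (@graded_ext K A X (mklin (lL f b)) (mklin (lL g b))) => p q {}a apq /=.
apply: (@graded_ext K B X (mklin (rL f a)) (mklin (rL g a))) => p' q' {}b bpq /=.
exact: fg apq bpq.
Qed.

Lemma tensor_exists A B : bounded A -> bounded B ->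
  exists2 C, bounded C & is_tensor A B C.
Proof.
move=> [sA sA0] [sB sB0]; pose W : lmodType K := tensor A B.
pose t : A -> B -> W := @tensor_pure K A B.
have tt : tensor_product t by apply: tensor_universal.
have tb : bilinear_map t by case: tt.
have sum_bilinear (I : Type) (r : seq I) (F : I -> A -> B -> W) :
    (forall i, bilinear_map (F i)) -> bilinear_map (fun a b => \sum_(i <- r) F i a b).
  move=> Fb; split=> [u c v v'|v c u u'] /=; rewrite scaler_sumr -big_split;
    by apply: eq_bigr => i _; first [exact: (proj1 (Fb i)) | exact: (proj2 (Fb i))].
have map_bilinear (f : {linear A -> A}) (g : {linear B -> B}) :
    bilinear_map (fun a b => t (f a) (g b)).
  by split=> [u a v v'|v a u u'] /=; rewrite linearP; first [exact: (proj1 tb) | exact: (proj2 tb)].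
pose s := undup sA.
(* [A] is bounded, so the projection to a bidegree of the tensor product is a finite sum over the
   bidegrees that the first factor can have. *)
have pr p q : {f : {linear W -> W} | forall a b, f (t a b) =
    \sum_(x <- s) t (dc_proj A x.1 x.2 a) (dc_proj B (p - x.1) (q - x.2) b)}.
  by apply: cid; apply: tensor_lift => //; apply: sum_bilinear => x; apply: map_bilinear.
have add_bilinear (f f' : A -> B -> W) : bilinear_map f -> bilinear_map f' ->
    bilinear_map (fun a b => f a b + f' a b).
  move=> [f1 f2] [f1' f2']; split=> [u c v v'|v c u u'] /=.
    by rewrite f1 f1' scalerDr addrACA.
  by rewrite f2 f2' scalerDr addrACA.
have [d1 d1E] : exists f : {linear W -> W}, forall a b, f (t a b) =
    t (dc_d1 A a) b + t (koszul A a) (dc_d1 B b).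
  apply: tensor_lift => //; apply: add_bilinear; last exact: map_bilinear.
  exact: (map_bilinear (dc_d1 A) idfun).
have [d2 d2E] : exists f : {linear W -> W}, forall a b, f (t a b) =
    t (dc_d2 A a) b + t (koszul A a) (dc_d2 B b).
  apply: tensor_lift => //; apply: add_bilinear; last exact: map_bilinear.
  exact: (map_bilinear (dc_d2 A) idfun).
pose P p q := sval (pr p q).
have PE p q p1 q1 p2 q2 a b : in_bidegree p1 q1 a -> in_bidegree p2 q2 b ->
    P p q (t a b) = if (p == p1 + p2) && (q == q1 + q2) then t a b else 0.
  move=> ha hb; rewrite /P; case: (pr p q) => f /= ->.
  have [inS|notS] := boolP ((p1, q1) \in s); last first.
    have -> : a = 0 by rewrite -ha sA0 //; apply: contra notS; rewrite mem_undup.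
    rewrite (bilin0l tb) if_same big1 // => x _.
    by rewrite linear0 (bilin0l tb).
  rewrite (bigD1_seq _ inS (undup_uniq _)) /= ha (dc_proj_bideg _ _ hb).
  rewrite big1 ?addr0 => [|[x y] /= ne]; last first.
    rewrite (dc_proj_bideg _ _ ha) -[_ && _]/((x, y) == (p1, q1)) (negbTE ne).
    exact: (bilin0l tb).
  have -> : (p - p1 == p2) && (q - q1 == q2) = (p == p1 + p2) && (q == q1 + q2) by lia.
  by case: ifP => // _; apply: (bilin0r tb).
have dE1 p q a b : in_bidegree p q a ->
    d1 (t a b) = t (dc_d1 A a) b + (-1) ^ (p + q) *: t a (dc_d1 B b).
  by move=> ha; rewrite d1E (koszul_bideg ha) (bilinZl tb).
have dE2 p q a b : in_bidegree p q a ->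
    d2 (t a b) = t (dc_d2 A a) b + (-1) ^ (p + q) *: t a (dc_d2 B b).
  by move=> ha; rewrite d2E (koszul_bideg ha) (bilinZl tb).
pose T : seq (int * int) := undup [seq (x.1 + y.1, x.2 + y.2) | x <- sA, y <- sB].
have PT (x : W) : x = \sum_(u <- T) P u.1 u.2 x.
  have SL : linear (fun x => \sum_(u <- T) P u.1 u.2 x).
    move=> c u v; rewrite scaler_sumr -big_split; apply: eq_bigr => i _.
    exact: linearP.
  apply: (@tensor_ext_bideg A B W W t idfun (mklin SL)) => // p q p' q' a b ha hb /=.
  have [inT|notT] := boolP ((p + p', q + q') \in T).
    rewrite (bigD1_seq _ inT (undup_uniq _)) /= (PE _ _ _ _ _ _ _ _ ha hb) !eqxx /=.
    rewrite big1 ?addr0 // => -[x1 y1] /= ne; rewrite (PE _ _ _ _ _ _ _ _ ha hb) /=.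
    by rewrite -[_ && _]/((x1, y1) == (p + p', q + q')) (negbTE ne).
  have t0 : t a b = 0.
    apply: contrapT => tn; case/negP: notT; rewrite mem_undup.
    apply/allpairsP; exists ((p, q), (p', q')); split=> //=.
      by apply: contrapT => /negP /sA0 h; apply: tn; rewrite -ha h (bilin0l tb).
    by apply: contrapT => /negP /sB0 h; apply: tn; rewrite -hb h (bilin0r tb).
  by rewrite t0 big1 // => u _; rewrite linear0.
have lin_ext (f g : {linear W -> W}) := @tensor_ext_bideg A B W W t f g tt.
have zL : linear (fun _ : W => 0 : W) by move=> a x y; rewrite scaler0 addr0.
have projM p q p' q' x : P p q (P p' q' x) =
    if (p == p') && (q == q') then P p q x else 0.
  have fg (f : {linear W -> W}) : (forall p1 q1 p2 q2 a b, in_bidegree p1 q1 a ->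
      in_bidegree p2 q2 b -> P p q (P p' q' (t a b)) = f (t a b)) -> P p q (P p' q' x) = f x.
    by move=> h; apply: (lin_ext (P p q \o P p' q') f) => p1 q1 p2 q2 a b ha hb; apply: h ha hb.
  case: ifPn => pq; [apply: (fg (P p q)) | apply: (fg (mklin zL))] => p1 q1 p2 q2 a b ha hb /=;
    rewrite !(PE _ _ _ _ _ _ _ _ ha hb); last first.
    case: ifP => [pq'|_]; last by rewrite linear0.
    rewrite (PE _ _ _ _ _ _ _ _ ha hb) ifF //; lia.
  case/andP: pq => /eqP <- /eqP <-; case: ifP => e; last by rewrite linear0.
  by rewrite (PE _ _ _ _ _ _ _ _ ha hb) e.
have d1_deg p q x : d1 (P p q x) = P (p + 1) q (d1 x).
  apply: (lin_ext (d1 \o P p q) (P (p + 1) q \o d1)) => p1 q1 p2 q2 a b ha hb /=.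
  rewrite (PE _ _ _ _ _ _ _ _ ha hb) (dE1 _ _ _ _ ha) linearD linearZ /=.
  rewrite (PE _ _ _ _ _ _ _ _ (bideg_d1 ha) hb) (PE _ _ _ _ _ _ _ _ ha (bideg_d1 hb)).
  have -> : (p + 1 == p1 + 1 + p2) = (p == p1 + p2) by lia.
  have -> : (p + 1 == p1 + (p2 + 1)) = (p == p1 + p2) by lia.
  by case: ifP => _; rewrite ?(dE1 _ _ _ _ ha) // linear0 scaler0 addr0.
have d2_deg p q x : d2 (P p q x) = P p (q + 1) (d2 x).
  apply: (lin_ext (d2 \o P p q) (P p (q + 1) \o d2)) => p1 q1 p2 q2 a b ha hb /=.
  rewrite (PE _ _ _ _ _ _ _ _ ha hb) (dE2 _ _ _ _ ha) linearD linearZ /=.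
  rewrite (PE _ _ _ _ _ _ _ _ (bideg_d2 ha) hb) (PE _ _ _ _ _ _ _ _ ha (bideg_d2 hb)).
  have -> : (q + 1 == q1 + 1 + q2) = (q == q1 + q2) by lia.
  have -> : (q + 1 == q1 + (q2 + 1)) = (q == q1 + q2) by lia.
  by case: ifP => _; rewrite ?(dE2 _ _ _ _ ha) // linear0 scaler0 addr0.
have d1d1 x : d1 (d1 x) = 0.
  apply: (lin_ext (d1 \o d1) (mklin zL)) => p1 q1 p2 q2 a b ha hb /=.
  rewrite (dE1 _ _ _ _ ha) linearD linearZ /= (dE1 _ _ _ _ (bideg_d1 ha)) (dE1 _ _ _ _ ha).
  rewrite !dc_d1d1 (bilin0l tb) (bilin0r tb) scaler0 add0r addr0 -scalerDl addrAC signS.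
  by rewrite addNr scale0r.
have d2d2 x : d2 (d2 x) = 0.
  apply: (lin_ext (d2 \o d2) (mklin zL)) => p1 q1 p2 q2 a b ha hb /=.
  rewrite (dE2 _ _ _ _ ha) linearD linearZ /= (dE2 _ _ _ _ (bideg_d2 ha)) (dE2 _ _ _ _ ha).
  rewrite !dc_d2d2 (bilin0l tb) (bilin0r tb) scaler0 add0r addr0 -scalerDl addrA signS.
  by rewrite addNr scale0r.
have d1d2 x : d1 (d2 x) + d2 (d1 x) = 0.
  apply: (lin_ext ((d1 \o d2) \+ (d2 \o d1)) (mklin zL)) => p1 q1 p2 q2 a b ha hb /=.
  rewrite (dE2 _ _ _ _ ha) (dE1 _ _ _ _ ha) !linearD !linearZ /=.
  rewrite (dE1 _ _ _ _ (bideg_d2 ha)) (dE1 _ _ _ _ ha) (dE2 _ _ _ _ (bideg_d1 ha)) (dE2 _ _ _ _ ha).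
  rewrite dc_d2d1 (bilinNl tb) dc_d2d1 (bilinNr tb).
  rewrite (addrA p1) (addrAC p1 1) !signS !scalerDr !scaleNr !scalerN !scalerA !signK.
  set u := t _ b; set v := (_ *: _) ; set w := (_ *: _); set z := _ *: _.
  rewrite !addrA (addrAC _ z (- u)) (addrAC _ z (- w)) (addrAC _ z v) addrK.
  by rewrite (addrAC _ w (- u)) addrK (addrAC _ (- u)) subrK subrr.
have PS x : exists s : seq (int * int), x = \sum_(t <- s) P t.1 t.2 x by exists T.
pose C := @DComplex K W P d1 d2 projM PS d1_deg d2_deg d1d1 d2d2 d1d2.
exists C.
  exists T => p q pq x; rewrite [x]PT linear_sum big_seq big1 // => -[p' q'] us.
  rewrite /= projM ifF //; apply/negP => /andP[/eqP pE /eqP qE].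
  by rewrite pE qE us in pq.
exists t; split=> //.
move=> p q p' q' a b ha hb.
by rewrite /in_bidegree /= (PE _ _ _ _ _ _ _ _ ha hb) !eqxx.
Qed.

End TensorComplex.

Section TensorHomotopy.
Variable K : fieldType.
Implicit Types A B C M : dcomplex K.

Definition degree_one A (D : A -> A) := forall n x,
  homogeneous n x -> homogeneous (n + 1) (D x).

Lemma homogeneous_d1 A : degree_one (dc_d1 A).
Proof. by move=> n x h p q pq; rewrite proj_d1 h ?linear0 //; lia. Qed.

Lemma homogeneous_d2 A : degree_one (dc_d2 A).
Proof. by move=> n x h p q pq; rewrite proj_d2 h ?linear0 //; lia. Qed.

Lemma koszul_homogeneous A n (x : A) : homogeneous n x -> koszul A x = (-1) ^ n *: x.
Proof.
move=> xn; apply: dc_proj_eq => p q; rewrite weight_proj linearZ /=.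
by have [<-//|/xn ->] := eqVneq (p + q) n; rewrite !scaler0.
Qed.

Lemma koszulK A (x : A) : koszul A (koszul A x) = x.
Proof. by apply: dc_proj_eq => p q; rewrite !weight_proj scalerA signK scale1r. Qed.

Lemma koszul_anticommute A (D : {linear A -> A}) (e : int) :
  (forall n x, homogeneous n x -> homogeneous (n + e) (D x)) -> (-1) ^ e = -1 :> K ->
  forall x, D (koszul A x) = - koszul A (D x).
Proof.
move=> De e1 x; have nL : linear (fun x => - koszul A (D x)).
  by move=> a u v; rewrite (linearP D) (linearP (koszul A)) opprD scalerN.
apply: (@graded_ext K A A (D \o koszul A) (mklin nL)) => p q {}x xpq /=.
rewrite (koszul_bideg xpq) linearZ /= (koszul_homogeneous (De (p + q) x _)); last first.
  exact: bideg_homogeneous xpq _.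
by rewrite (expfzDr (p + q)) ?oppr_eq0 ?oner_eq0 // e1 mulrN1 scaleNr opprK.
Qed.

Lemma graded_support A B (H : {linear A -> B}) (c : int -> int -> bool) p q (x : A) :
  (forall p' q', ~~ c p' q' -> dc_proj A p' q' x = 0) ->
  (forall p' q', c p' q' -> dc_proj B p q (H (dc_proj A p' q' x)) = 0) ->
  dc_proj B p q (H x) = 0.
Proof.
move=> cx cH; have [s xE] := dc_proj_sum x.
rewrite xE !linear_sum big1 // => -[p' q'] _ /=.
by have [/cH|/cx ->] := boolP (c p' q'); rewrite // !linear0.
Qed.

Section Tensor.
Variables (A B C : dcomplex K) (t : A -> B -> C).
Hypothesis tt : tensor_product t.
Hypothesis tdeg : forall p q p' q' a b, in_bidegree p q a -> in_bidegree p' q' b ->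
  in_bidegree (p + p') (q + q') (t a b).
Let tb : bilinear_map t := proj1 tt.

Lemma tensor_proj0 p q (c c' : int -> int -> bool) a b :
  (forall p' q', ~~ c p' q' -> dc_proj A p' q' a = 0) ->
  (forall p' q', ~~ c' p' q' -> dc_proj B p' q' b = 0) ->
  (forall p1 q1 p2 q2, c p1 q1 -> c' p2 q2 -> (p != p1 + p2) || (q != q1 + q2)) ->
  dc_proj C p q (t a b) = 0.
Proof.
move=> ca cb pq.
have rL u : linear (fun v => t u v) by apply: (proj1 tb).
have lL v : linear (fun u => t u v) by apply: (proj2 tb).
apply: (@graded_support A C (mklin (lL b)) c p q a ca) => p1 q1 c1 /=.
apply: (@graded_support B C (mklin (rL _)) c' p q b cb) => p2 q2 c2 /=.
rewrite (dc_proj_bideg _ _ (tdeg (dc_proj_in _ _ _) (dc_proj_in _ _ _))) ifF //.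
by have := pq _ _ _ _ c1 c2; lia.
Qed.

Lemma tensor_homogeneous n n' a b : homogeneous n a -> homogeneous n' b ->
  homogeneous (n + n') (t a b).
Proof.
move=> ha hb p q pq.
apply: (tensor_proj0 (c := fun p q => p + q == n) (c' := fun p q => p + q == n')) => //.
by move=> p1 q1 p2 q2 /eqP e1 /eqP e2; lia.
Qed.

Lemma tensor_filtration i m n m' n' a b : filtration i m n a -> filtration i m' n' b ->
  filtration i (m + m') (n + n') (t a b).
Proof.
move=> ha hb p q pq; apply: (tensor_proj0 ha hb) => p1 q1 p2 q2.
by case: i pq {ha hb}; lia.
Qed.

Lemma tensor_graded (c d : int -> int -> bool) (H : {linear C -> C}) (x : C) :
  (forall p1 q1 p2 q2 a b, in_bidegree p1 q1 a -> in_bidegree p2 q2 b ->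
     c (p1 + p2) (q1 + q2) -> forall p q, ~~ d p q -> dc_proj C p q (H (t a b)) = 0) ->
  (forall p q, ~~ c p q -> dc_proj C p q x = 0) ->
  forall p q, ~~ d p q -> dc_proj C p q (H x) = 0.
Proof.
move=> Hab cx p q pq; apply: (graded_support cx) => p' q' cpq.
have zL : linear (fun _ : C => 0 : C) by move=> a u v; rewrite scaler0 addr0.
apply: (@tensor_ext_bideg K A B C C t (dc_proj C p q \o H \o dc_proj C p' q') (mklin zL)) => //.
move=> p1 q1 p2 q2 a b ha hb /=; rewrite (dc_proj_bideg _ _ (tdeg ha hb)).
case: ifP => [/andP[/eqP e1 /eqP e2]|_]; last by rewrite !linear0.
by apply: (Hab _ _ _ _ _ _ ha hb) => //; rewrite -e1 -e2.
Qed.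

Variables (DA : {linear A -> A}) (DB : {linear B -> B}) (DC : {linear C -> C}).
Hypothesis DAB : forall a b, DC (t a b) = t (DA a) b + t (koszul A a) (DB b).
Hypotheses (DA1 : degree_one DA) (DA2 : forall x, DA (DA x) = 0).
Variables (pA : {linear A -> A}) (pB : {linear B -> B}) (pC : {linear C -> C}).
Hypothesis pAB : forall a b, pC (t a b) = t (pA a) (pB b).
Hypothesis pA1 : forall n x, homogeneous n x -> homogeneous n (pA x).
Variables (hA : {linear A -> A}) (hB : {linear B -> B}).
Hypotheses (hA1 : lowers hA) (hAE : forall x, DA (hA x) + hA (DA x) = x - pA x).
Hypotheses (hB1 : lowers hB) (hBE : forall x, DB (hB x) + hB (DB x) = x - pB x).

(* The homotopy is [h (x) 1 + eps p (x) h'], with [eps] the sign operator. *)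
Lemma tensor_homotopy : exists H : {linear C -> C},
  [/\ forall a b, H (t a b) = t (hA a) b + t (koszul A (pA a)) (hB b),
      lowers H & forall x, DC (H x) + H (DC x) = x - pC x].
Proof.
have Hb : bilinear_map (fun a b => t (hA a) b + t (koszul A (pA a)) (hB b)).
  split=> [u c v v'|v c u u'].
    by rewrite (linearP hB) !(proj1 tb) scalerDr addrACA.
  by rewrite (linearP hA) (linearP pA) (linearP (koszul A)) !(proj2 tb) scalerDr addrACA.
have [H HE] := tensor_lift tt Hb; exists H; split=> //.
  move=> n x xn p q pq; apply: (tensor_graded (c := fun p q => p + q == n)
    (d := fun p q => p + q == n - 1)) => // p1 q1 p2 q2 a b ha hb /eqP e1 p' q' pq'.
  have an := bideg_homogeneous ha erefl; have bn := bideg_homogeneous hb erefl.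
  rewrite HE linearD (tensor_homogeneous (hA1 an) bn); last by lia.
  rewrite add0r; have kn : homogeneous (p1 + q1) (koszul A (pA a)).
    rewrite (koszul_homogeneous (pA1 an)); apply: (subspaceZ (@homogeneous_subspace _ _ _)).
    exact: pA1.
  by rewrite (tensor_homogeneous kn (hB1 bn)) //; lia.
(* Apply [DA] to the homotopy identity at [x] and compare with the identity at [DA x]: this shows
   that [pA] commutes with [DA]. *)
have pD x : DA (pA x) = pA (DA x).
  have := hAE (DA x); rewrite DA2 linear0 addr0 => e.
  have /(congr1 DA) := hAE x; rewrite [LHS]linearD [RHS]linearB DA2 add0r e.
  by move/addrI/oppr_inj.
have Dk x : DA (koszul A x) = - koszul A (DA x).
  by apply: (@koszul_anticommute A DA 1) => //; rewrite expr1z.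
have hk x : hA (koszul A x) = - koszul A (hA x).
  by apply: (@koszul_anticommute A hA (-1)) => //; rewrite exprN1 invrN1.
have pk x : pA (koszul A x) = koszul A (pA x).
  apply: (@graded_ext K A A (pA \o koszul A) (koszul A \o pA)) => p q {}x xpq /=.
  have xn := bideg_homogeneous xpq erefl.
  by rewrite (koszul_homogeneous xn) linearZ (koszul_homogeneous (pA1 xn)).
have LL : linear (fun x => DC (H x) + H (DC x)).
  by move=> c u v; rewrite !(linearP DC, linearP H) scalerDr addrACA.
have RL : linear (fun x => x - pC x).
  by move=> c u v; rewrite (linearP pC) scalerBr opprD addrACA.
apply: (@tensor_ext K A B C C t (mklin LL) (mklin RL)) => // a b /=.
rewrite HE pAB DAB !linearD /= !DAB !HE Dk hk pk !koszulK.
rewrite pD !(bilinNl tb).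
(* The mixed terms [v] and [w] each occur twice with opposite signs, because the sign operator
   anticommutes with [DA] and with [hA]. What remains is [(1 - pA) (x) 1 + pA (x) (1 - pB)], that is
   [1 - pA (x) pB]. *)
set v := t (koszul A (hA a)) (DB b); set w := t (koszul A (pA (DA a))) (hB b).
rewrite addrACA (addrACA _ v) (addrACA (- w)) -(opprD w v) (addrC v w).
rewrite (addrA _ (- (w + v))) addrK -(bilinDl tb) -(bilinDr tb).
by rewrite hAE hBE (bilinBl tb) (bilinBr tb) addrA subrK.
Qed.

End Tensor.
End TensorHomotopy.

(** * Homotopy retractions *)

Section RetractTensor.
Variable K : fieldType.
Implicit Types A B C M : dcomplex K.

(** With [s i = 1] strictly, both maps are [E_r]-isomorphisms, so a retract is comparable with [A]
    in both directions; and the notion passes to composites, sums and tensor products. *)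
Definition retract r M A := exists (i : {linear M -> A}) (s : {linear A -> M}),
  [/\ dc_morphism i, dc_morphism s, forall x, s (i x) = x &
      null_homotopic r (idfun \- (i \o s))].

Lemma retract_Er r M A : r1infty r -> retract r M A ->
  (exists2 i : {linear M -> A}, Er_isomorphism r i & injective i) /\
  exists s : {linear A -> M}, Er_isomorphism r s.
Proof.
move=> hr [i [s [iM sM si his]]].
have h0 : null_homotopic r ((idfun : {linear M -> M}) \- (s \o i)).
  by apply: null_homotopic0 => x /=; rewrite si subrr.
split; first by exists i; [apply: (homotopy_equivalence_Er hr iM sM) | apply: can_inj si].
by exists s; apply: (homotopy_equivalence_Er hr sM iM).
Qed.

Lemma retract_refl r A : retract r A A.
Proof.
exists idfun, idfun; split=> //; apply: null_homotopic0 => x /=; exact: subrr.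
Qed.

Lemma retract_iso r A B (f : {linear A -> B}) (g : {linear B -> A}) :
  dc_morphism f -> cancel f g -> cancel g f -> retract r A B.
Proof.
move=> fM fg gf; have [gM _] := dc_bijective_Er r fM fg gf.
exists f, g; split=> //; apply: null_homotopic0 => x /=; by rewrite gf subrr.
Qed.

Lemma retract_trans r M N A : retract r M N -> retract r N A -> retract r M A.
Proof.
move=> [i [s [iM sM si his]]] [j [u [jM uM uj hju]]].
exists (j \o i), (s \o u); split; [exact: morphism_comp | exact: morphism_comp |
  by move=> x /=; rewrite uj si |].
have comb (DN : {linear N -> N}) (DA : {linear A -> A}) :
    (forall x, j (DN x) = DA (j x)) -> (forall x, u (DA x) = DN (u x)) ->
    homotopic0 DN (idfun \- (i \o s)) -> homotopic0 DA (idfun \- (j \o u)) ->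
    homotopic0 DA (idfun \- ((j \o i) \o (s \o u))).
  move=> jD uD [h hl hE] [k kl kE].
  exists (k \+ (j \o h \o u)) => [n x xn /=|x /=].
    apply: (subspaceD (@homogeneous_subspace _ _ _)); first exact: kl.
    by apply: (morph_homogeneous jM); apply: hl; apply: morph_homogeneous.
  rewrite linearD /= addrACA [_ + k _]kE uD -jD -linearD hE /= linearB /=.
  by rewrite addrA subrK.
case: r his hju => [r|] /=; last first.
  exact: (comb _ _ (morph_total jM) (morph_total uM)).
move=> [h1 h2] [k1 k2]; split.
  exact: (comb _ _ (morph_d1 jM) (morph_d1 uM)).
exact: (comb _ _ (morph_d2 jM) (morph_d2 uM)).
Qed.

Section Koszul.
Variables (A B C : dcomplex K) (t : A -> B -> C).
Hypothesis tb : bilinear_map t.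

Lemma tensor_Leibniz (DA : {linear A -> A}) (DB : {linear B -> B}) (DC : {linear C -> C}) :
  (forall p q a b, in_bidegree p q a ->
    DC (t a b) = t (DA a) b + (-1) ^ (p + q) *: t a (DB b)) ->
  forall a b, DC (t a b) = t (DA a) b + t (koszul A a) (DB b).
Proof.
move=> hD a b; have lL v : linear (fun u => t u v) by apply: (proj2 tb).
have fL : linear (fun a => DC (t a b)) by move=> c x y; rewrite (proj2 tb) linearP.
have gL : linear (fun a => t (DA a) b + t (koszul A a) (DB b)).
  move=> c x y; rewrite (linearP DA) (linearP (koszul A)) !(proj2 tb) scalerDr.
  by rewrite addrACA.
apply: (@graded_ext K A C (mklin fL) (mklin gL)) => p q {}a apq /=.
by rewrite (hD p q) // (koszul_bideg apq) (bilinZl tb).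
Qed.

End Koszul.

Lemma is_tensorP A B C : is_tensor A B C -> exists t : A -> B -> C,
  [/\ tensor_product t,
      forall p q p' q' a b, in_bidegree p q a -> in_bidegree p' q' b ->
        in_bidegree (p + p') (q + q') (t a b),
      forall a b, dc_d1 C (t a b) = t (dc_d1 A a) b + t (koszul A a) (dc_d1 B b),
      forall a b, dc_d2 C (t a b) = t (dc_d2 A a) b + t (koszul A a) (dc_d2 B b) &
      forall a b, dc_total (t a b) = t (dc_total a) b + t (koszul A a) (dc_total b)].
Proof.
case=> t [tt td t1 t2]; have tb : bilinear_map t by case: tt.
have h1 := tensor_Leibniz tb t1; have h2 := tensor_Leibniz tb t2; exists t; split=> // a b.
by rewrite /dc_total h1 h2 (bilinDl tb) (bilinDr tb) addrACA.
Qed.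

Lemma tensor_morphism A B C A' B' C' (t : A -> B -> C) (t' : A' -> B' -> C')
    (f : {linear A -> A'}) (g : {linear B -> B'}) (h : {linear C -> C'}) :
  tensor_product t ->
  (forall p q p' q' a b, in_bidegree p q a -> in_bidegree p' q' b ->
    in_bidegree (p + p') (q + q') (t a b)) ->
  (forall p q p' q' a b, in_bidegree p q a -> in_bidegree p' q' b ->
    in_bidegree (p + p') (q + q') (t' a b)) -> bilinear_map t' ->
  (forall a b, dc_d1 C (t a b) = t (dc_d1 A a) b + t (koszul A a) (dc_d1 B b)) ->
  (forall a b, dc_d2 C (t a b) = t (dc_d2 A a) b + t (koszul A a) (dc_d2 B b)) ->
  (forall a b, dc_d1 C' (t' a b) = t' (dc_d1 A' a) b + t' (koszul A' a) (dc_d1 B' b)) ->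
  (forall a b, dc_d2 C' (t' a b) = t' (dc_d2 A' a) b + t' (koszul A' a) (dc_d2 B' b)) ->
  dc_morphism f -> dc_morphism g -> (forall a b, h (t a b) = t' (f a) (g b)) ->
  dc_morphism h.
Proof.
move=> tt td td' tb' t1 t2 t1' t2' fM gM hE.
have fk x : f (koszul A x) = koszul A' (f x).
  apply: dc_proj_eq => p q.
  by rewrite weight_proj -!(morph_proj fM) weight_proj linearZ.
split=> [p q x|x|x].
- apply: (@tensor_ext_bideg K A B C C' t (h \o dc_proj C p q) (dc_proj C' p q \o h)) => //.
  move=> p1 q1 p2 q2 a b ha hb /=; rewrite (dc_proj_bideg _ _ (td _ _ _ _ _ _ ha hb)) hE.
  rewrite (dc_proj_bideg _ _ (td' _ _ _ _ _ _ (morph_bideg fM ha) (morph_bideg gM hb))).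
  by case: ifP; rewrite ?linear0.
- apply: (@tensor_ext K A B C C' t (h \o dc_d1 C) (dc_d1 C' \o h)) => // a b /=.
  by rewrite hE t1 t1' linearD !hE (morph_d1 fM) (morph_d1 gM) fk.
- apply: (@tensor_ext K A B C C' t (h \o dc_d2 C) (dc_d2 C' \o h)) => // a b /=.
  by rewrite hE t2 t2' linearD !hE (morph_d2 fM) (morph_d2 gM) fk.
Qed.

Lemma retract_tensor r A B C M N P : retract r M A -> retract r N B ->
  is_tensor A B C -> is_tensor M N P -> retract r P C.
Proof.
move=> [i [s [iM sM si his]]] [j [u [jM uM uj hju]]].
move=> /is_tensorP[t [tt td t1 t2 tD]] /is_tensorP[t' [tt' td' t1' t2' tD']].
have tb : bilinear_map t by case: tt.
have tb' : bilinear_map t' by case: tt'.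
have [f fE] := tensor_map i j tt' tb; have [g gE] := tensor_map s u tt tb'.
have fM := tensor_morphism tt' td' td tb t1' t2' t1 t2 iM jM fE.
have gM := tensor_morphism tt td td' tb' t1 t2 t1' t2' sM uM gE.
exists f, g; split=> // [x|].
  by apply: (@tensor_ext K M N P P t' (g \o f) idfun) => // a b /=; rewrite fE gE si uj.
have fg a b : (f \o g) (t a b) = t ((i \o s) a) ((j \o u) b) by rewrite /= gE fE.
have is1 n x : homogeneous n x -> homogeneous n ((i \o s) x).
  by move=> xn; apply: (morph_homogeneous iM); apply: morph_homogeneous.
have comb (DA : {linear A -> A}) (DB : {linear B -> B}) (DC : {linear C -> C}) :
    (forall a b, DC (t a b) = t (DA a) b + t (koszul A a) (DB b)) ->
    degree_one DA -> (forall x, DA (DA x) = 0) ->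
    homotopic0 DA (idfun \- (i \o s)) -> homotopic0 DB (idfun \- (j \o u)) ->
    homotopic0 DC (idfun \- (f \o g)).
  move=> DE D1 D2 [h hl hE] [k kl kE].
  have [H [_ Hl HE]] := tensor_homotopy tt td DE D1 D2 fg is1 hl hE kl kE.
  by exists H.
case: r his hju => [r|] /=; last first.
  by apply: comb => //; [move=> n x; apply: homogeneous_total | apply: dc_totalK].
move=> [h1 h2] [k1 k2]; split.
  by apply: (comb _ _ _ t1) h1 k1; [apply: homogeneous_d1 | apply: dc_d1d1].
by apply: (comb _ _ _ t2) h2 k2; [apply: homogeneous_d2 | apply: dc_d2d2].
Qed.

Lemma dsum_homogeneous A B n (x : dsum A B) :
  homogeneous n x <-> homogeneous n x.1 /\ homogeneous n x.2.
Proof.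
split=> [h|[h1 h2] p q pq]; last by congr pair; [apply: h1 | apply: h2].
by split=> p q /h; case.
Qed.

Lemma pair_morphism A B A' B' (f : {linear A -> A'}) (g : {linear B -> B'}) :
  dc_morphism f -> dc_morphism g ->
  @dc_morphism K (dsum A B) (dsum A' B') (pair_map f g).
Proof.
move=> [f1 f2 f3] [g1 g2 g3]; split=> [p q x|x|x];
  by congr pair; rewrite /= ?(f1, f2, f3) ?(g1, g2, g3).
Qed.

Lemma retract_dsum r A B M N : retract r M A -> retract r N B ->
  retract r (dsum M N) (dsum A B).
Proof.
move=> [i [s [iM sM si his]]] [j [u [jM uM uj hju]]].
exists (pair_map i j), (pair_map s u).
split; [exact: pair_morphism | exact: pair_morphism |
  by case=> x y; congr pair; [apply: si | apply: uj] |].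
have comb (DA : A -> A) (DB : B -> B) (DC : dsum A B -> dsum A B) :
    (forall x, DC x = (DA x.1, DB x.2)) -> homotopic0 DA (idfun \- (i \o s)) ->
    homotopic0 DB (idfun \- (j \o u)) ->
    homotopic0 DC (idfun \- (pair_map i j \o pair_map s u)).
  move=> DE [h hl hE] [k kl kE]; exists (pair_map h k) => [n x|x].
    by move=> /dsum_homogeneous[h1 h2]; apply/dsum_homogeneous; split; [apply: hl | apply: kl].
  by rewrite !DE; congr pair; [apply: hE | apply: kE].
case: r his hju => [r [h1 h2] [k1 k2]|h k]; last exact: (comb (@dc_total K A) (@dc_total K B)).
split; first exact: (comb (dc_d1 A) (dc_d1 B)).
exact: (comb (dc_d2 A) (dc_d2 B)).
Qed.

End RetractTensor.

(** * Models *)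

Section Models.
Variable K : fieldType.
Implicit Types A B C M : dcomplex K.

(* [A] is filtered chain homotopic, by homotopies lowering the filtration by
   at most [k], to a subcomplex with basis [v] on which the differential raises
   the filtration by more than [k]; then [v] induces bases of the terms of the
   page [E_(k+1)] of the column filtration. *)
Definition column_model (k : nat) A (I : finType) (deg : I -> int * int) :=
  exists (v : I -> A) (l : I -> {linear A -> K^o}) (h : {linear A -> A}),
  [/\ forall i, filtration false (deg i).1 (deg i).2 (v i) /\
        filtration false ((deg i).1 + k.+1%:Z) ((deg i).2 + 1) (dc_total (v i)),
      forall i p q x, in_bidegree p q x -> l i x != 0 ->
        p <= (deg i).1 /\ p + q = (deg i).2,
      forall i j, l i (v j) = (i == j)%:R,
      lowers h /\ forall m n x, filtration false m n x ->
        filtration false (m - k%:Z) (n - 1) (h x) &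
      forall x, dc_total (h x) + h (dc_total x) = x - \sum_i l i x *: v i].

(** A basis of total cohomology adapted to both filtrations at once. For [deg i = (p, q, n)], the
    representatives [v i] and [v' i] of one class bound its column degree and its row degree from
    below by [p] and [q]; the dual functionals [l i] and [l' i], which vanish in higher filtration,
    bound them from above. *)
Definition bifiltered_model A (I : finType) (deg : I -> int * int * int) :=
  exists (v v' w : I -> A) (l l' : I -> {linear A -> K^o}) (h : {linear A -> A}),
  [/\ forall i, [/\ filtration false (deg i).1.1 (deg i).2 (v i),
        filtration true (deg i).1.2 (deg i).2 (v' i),
        dc_total (v i) = 0, dc_total (v' i) = 0 & v i - v' i = dc_total (w i)],
      forall i p q x, in_bidegree p q x ->
        (l i x != 0 -> p <= (deg i).1.1 /\ p + q = (deg i).2) /\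
        (l' i x != 0 -> q <= (deg i).1.2 /\ p + q = (deg i).2),
      forall i x, l i (dc_total x) = 0 /\ l' i (dc_total x) = 0,
      forall i j, l i (v j) = (i == j)%:R /\ l' i (v' j) = (i == j)%:R &
      lowers h /\ forall x, dc_total (h x) + h (dc_total x) = x - \sum_i l i x *: v i].

Lemma functional_graded A (l : {linear A -> K^o}) (x : A) : l x != 0 ->
  exists p q, l (dc_proj A p q x) != 0.
Proof.
move=> lx; apply: contrapT => h; case/eqP: lx.
have [s xE] := dc_proj_sum x; rewrite xE linear_sum big1 // => t _.
by apply: contrapT => /eqP n; apply: h; exists t.1, t.2.
Qed.

Lemma functional_filtration A (l : {linear A -> K^o}) i d e :
  (forall p q x, in_bidegree p q x -> l x != 0 ->
    (if i then q else p) <= d /\ p + q = e) ->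
  forall m n x, filtration i m n x -> l x != 0 -> m <= d /\ n = e.
Proof.
move=> lP m n x xF /functional_graded[p [q lx]].
have [h1 h2] := lP p q _ (dc_proj_in _ _ _) lx.
have [|/xF x0] := boolP ((p + q == n) && (m <= if i then q else p)).
  move=> /andP[/eqP <-]; split=> //; by apply: le_trans h1.
by rewrite x0 linear0 eqxx in lx.
Qed.

Lemma model_span_filtration A (I : finType) (l : I -> {linear A -> K^o}) (v : I -> A)
    (c : pred I) i m n (x : A) :
  (forall j, c j -> filtration i m n (v j)) -> (forall j, l j x != 0 -> c j) ->
  filtration i m n (\sum_j l j x *: v j).
Proof.
move=> cv lc; apply: (subspace_sum (@filtration_subspace _ _ _ _ _)) => j _.
have [->|/lc /cv h] := eqVneq (l j x) 0.
  by rewrite scale0r; apply: (subspace0 (@filtration_subspace _ _ _ _ _)).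
by apply: (subspaceZ (@filtration_subspace _ _ _ _ _)).
Qed.

Lemma column_model_iso k A B (I : finType) (deg : I -> int * int) (f : {linear A -> B})
    (g : {linear B -> A}) : dc_morphism f -> cancel f g -> cancel g f ->
  column_model k A deg -> column_model k B deg.
Proof.
move=> fM fg gf [v [l [h [vF lF lv [hl hF] hE]]]].
have [gM _] := dc_bijective_Er None fM fg gf.
exists (f \o v), (fun i => l i \o g), (f \o h \o g); split=> /=.
- move=> i; have [v1 v2] := vF i; rewrite -(morph_total fM).
  by split; apply: morph_filtration.
- by move=> i p q x /(morph_bideg gM)/lF h'; apply: h'.
- by move=> i j; rewrite fg.
- split=> [n x xn|m n x xF].
    by apply: (morph_homogeneous fM); apply: hl; apply: morph_homogeneous.
  by apply: (morph_filtration fM); apply: hF; apply: morph_filtration.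
- move=> x; rewrite -(morph_total fM) (morph_total gM) -linearD hE linearB gf.
  by rewrite linear_sum; congr (_ - _); apply: eq_bigr => i _; rewrite linearZ.
Qed.

Definition sum_fun (I J T : Type) (f : I -> T) (g : J -> T) (x : I + J) :=
  match x with inl i => f i | inr j => g j end.

Lemma fst_linear (U V : lmodType K) : linear (fst : U * V -> U). Proof. by []. Qed.
Lemma snd_linear (U V : lmodType K) : linear (snd : U * V -> V). Proof. by []. Qed.

Lemma inl_linear (U V : lmodType K) : linear (fun x : U => (x, 0) : U * V).
Proof. by move=> a x y; congr pair; rewrite /= scaler0 addr0. Qed.

Lemma inr_linear (U V : lmodType K) : linear (fun x : V => (0, x) : U * V).
Proof. by move=> a x y; congr pair; rewrite /= scaler0 addr0. Qed.

Lemma dsum_model_sum A B (I J : finType) (F : I -> K) (G : J -> K) (v : I -> A) (v' : J -> B) :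
  \sum_i F i *: ((v i, 0) : dsum A B) + \sum_j G j *: ((0, v' j) : dsum A B) =
  ((\sum_i F i *: v i, \sum_j G j *: v' j) : dsum A B).
Proof.
have -> : \sum_i F i *: ((v i, 0) : dsum A B) = mklin (@inl_linear A B) (\sum_i F i *: v i).
  by rewrite linear_sum; apply: eq_bigr => i _; rewrite linearZ.
have -> : \sum_i G i *: ((0, v' i) : dsum A B) = mklin (@inr_linear A B) (\sum_i G i *: v' i).
  by rewrite linear_sum; apply: eq_bigr => i _; rewrite linearZ.
by congr pair; rewrite /= (addr0, add0r).
Qed.

Lemma column_model_dsum k A B (I J : finType) (deg : I -> int * int) (deg' : J -> int * int) :
  column_model k A deg -> column_model k B deg' ->
  column_model k (dsum A B) (sum_fun deg deg').
Proof.
move=> [v [l [h [vF lF lv [hl hF] hE]]]] [v' [l' [h' [vF' lF' lv' [hl' hF'] hE']]]].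
pose L (x : I + J) : {linear dsum A B -> K^o} := match x with
  | inl i => l i \o mklin (@fst_linear A B) | inr j => l' j \o mklin (@snd_linear A B) end.
exists (sum_fun (fun i => (v i, 0) : dsum A B) (fun j => (0, v' j))), L, (pair_map h h').
have F0 (M : dcomplex K) i m n : filtration i m n (0 : M).
  exact: (subspace0 (@filtration_subspace _ _ _ _ _)).
split.
- case=> i /=; [have [v1 v2] := vF i | have [v1 v2] := vF' i];
    split; apply/dsum_filtration; split=> //=; rewrite /dc_total /= ?linear0 ?addr0;
    by try exact: F0.
- move=> [i|j] p q [x y] /= [x1 x2]; first exact: lF x1.
  exact: lF' x2.
- by move=> [i|i] [j|j] /=; rewrite ?linear0 // (lv, lv').
- split=> [n x /dsum_homogeneous[x1 x2]|m n x /dsum_filtration[x1 x2]].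
    by apply/dsum_homogeneous; split; [apply: hl|apply: hl'].
  by apply/dsum_filtration; split; [apply: hF|apply: hF'].
case=> x y; transitivity ((dc_total (h x) + h (dc_total x), dc_total (h' y) + h' (dc_total y)) : dsum A B) => //.
rewrite hE hE' big_sumType /= dsum_model_sum.
by [].
Qed.

Lemma column_model_tensor k A B C (I J : finType) (deg : I -> int * int) (deg' : J -> int * int) :
  is_tensor A B C -> column_model k A deg -> column_model k B deg' ->
  column_model k C (fun x : I * J =>
    ((deg x.1).1 + (deg' x.2).1, (deg x.1).2 + (deg' x.2).2)).
Proof.
move=> /is_tensorP[t [tt td _ _ tD]].
move=> [v [l [h [vF lF lv [hl hF] hE]]]] [v' [l' [h' [vF' lF' lv' [hl' hF'] hE']]]].
have tb : bilinear_map t by case: tt.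
have LP x : {f : {linear C -> K^o} | forall a b, f (t a b) = l x.1 a * l' x.2 b}.
  apply: cid; apply: (tensor_lift (b := fun a b => l x.1 a * l' x.2 b : K^o)) => //.
  split=> [a c b b'|b c a a']; rewrite linearP.
    by rewrite mulrDr -scalerAr.
  by rewrite mulrDl -scalerAl.
pose L x := sval (LP x); have LE x a b : L x (t a b) = l x.1 a * l' x.2 b.
  by rewrite /L; case: (LP x).
have pL : linear (fun x => \sum_i l i x *: v i).
  move=> c x y; rewrite scaler_sumr -big_split; apply: eq_bigr => i _.
  by rewrite linearP scalerDl scalerA.
have pL' : linear (fun x => \sum_i l' i x *: v' i).
  move=> c x y; rewrite scaler_sumr -big_split; apply: eq_bigr => i _.
  by rewrite linearP scalerDl scalerA.
have PL : linear (fun x => \sum_i L i x *: t (v i.1) (v' i.2)).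
  move=> c x y; rewrite scaler_sumr -big_split; apply: eq_bigr => i _.
  by rewrite linearP scalerDl scalerA.
have pF m n x : filtration false m n x -> filtration false m n (mklin pL x).
  move=> xF; apply: (model_span_filtration (c := fun i => (m <= (deg i).1) && (n == (deg i).2))).
    move=> i /andP[mi /eqP ->]; exact: (filtration_le (proj1 (vF i))).
  by move=> i /(functional_filtration (i := false) (lF i) xF)[-> ->]; rewrite eqxx.
have pn n x : homogeneous n x -> homogeneous n (mklin pL x).
  move=> xn p q pq /=; rewrite linear_sum big1 // => i _; rewrite linearZ /=.
  have [->|] := eqVneq (l i x) 0; first exact: scale0r.
  move=> /functional_graded[p' [q' lx]].
  have [e|/xn x0] := eqVneq (p' + q') n; last by rewrite x0 linear0 eqxx in lx.
  have [_ e'] := lF i _ _ _ (dc_proj_in _ _ _) lx.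
  rewrite (filtration_homogeneous (proj1 (vF i))) ?scaler0 //.
  by rewrite -e' e.
have PE a b : mklin PL (t a b) = t (mklin pL a) (mklin pL' b).
  have rL u : linear (fun v => t u v) by apply: (proj1 tb).
  have lL u : linear (fun v => t v u) by apply: (proj2 tb).
  rewrite -[RHS]/(mklin (lL _) (\sum_i l i a *: v i)) linear_sum.
  transitivity (\sum_i \sum_j L (i, j) (t a b) *: t (v i) (v' j)).
    by rewrite pair_bigA; apply: eq_bigr => -[].
  apply: eq_bigr => i _; rewrite -[RHS]/(mklin (rL _) (\sum_j l' j b *: v' j)) linear_sum.
  apply: eq_bigr => j _ /=; rewrite LE (bilinZl tb) (bilinZr tb) scalerA //.
have [H [HE Hl HD]] := tensor_homotopy tt td tD (@homogeneous_total K A) (@dc_totalK K A)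
  PE pn hl hE hl' hE'.
exists (fun x => t (v x.1) (v' x.2)), L, H; split.
- move=> [i j] /=; have [v1 v2] := vF i; have [v1' v2'] := vF' j; split.
    exact: (tensor_filtration tt td v1 v1').
  rewrite tD (koszul_homogeneous (filtration_homogeneous v1)) (bilinZl tb).
  apply: (subspaceD (@filtration_subspace _ _ _ _ _)).
    by have := tensor_filtration tt td v2 v1'; rewrite (addrAC _ k.+1%:Z) (addrAC _ 1).
  apply: (subspaceZ (@filtration_subspace _ _ _ _ _)).
  have := tensor_filtration tt td v1 v2'; rewrite !addrA //.
- move=> [i j] p q x xpq Lx /=.
  apply: contrapT => npq; case/eqP: Lx; rewrite -xpq.
  have zL : linear (fun _ : C => 0 : K^o) by move=> a u w; rewrite scaler0 addr0.
  apply: (@tensor_ext_bideg K A B C _ t (L (i, j) \o dc_proj C p q) (mklin zL)) => //.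
  move=> p1 q1 p2 q2 a b ha hb /=; rewrite (dc_proj_bideg _ _ (td _ _ _ _ _ _ ha hb)).
  case: ifP => [/andP[/eqP e1 /eqP e2]|_]; last by rewrite linear0.
  rewrite LE /=; have [->|la] := eqVneq (l i a) 0; first by rewrite mul0r.
  have [->|lb] := eqVneq (l' j b) 0; first by rewrite mulr0.
  have [h1 h2] := lF i _ _ _ ha la; have [h1' h2'] := lF' j _ _ _ hb lb.
  by case: npq; rewrite e1 e2 -h2 -h2'; split; [exact: lerD | rewrite addrACA].
- by move=> [i j] [i' j']; rewrite LE /= lv lv' -natrM mulnb.
- split=> // m n x xF p q pq.
  apply: (tensor_graded tt td (c := fun p q => (p + q == n) && (m <= p))
     (d := fun p q => (p + q == n - 1) && (m - k%:Z <= p))) => //.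
  move=> p1 q1 p2 q2 a b ha hb c p' q' npq; rewrite HE linearD.
  have aF : filtration false p1 (p1 + q1) a by apply: bideg_filtration ha _ _.
  have bF : filtration false p2 (p2 + q2) b by apply: bideg_filtration hb _ _.
  have h1 := tensor_filtration tt td (hF _ _ _ aF) bF.
  (* The projection to the model preserves the filtration, so in each summand of [H] only one factor
     is lowered, and the loss stays [k]. *)
  have kF : filtration false p1 (p1 + q1) (koszul A (mklin pL a)).
    rewrite (koszul_homogeneous (filtration_homogeneous (pF _ _ _ aF))).
    by apply: (subspaceZ (@filtration_subspace _ _ _ _ _)); apply: pF.
  have h2 := tensor_filtration tt td kF (hF' _ _ _ bF).
  by rewrite h1 ?h2 ?addr0 //; lia.
- exact: HD.
Qed.

End Models.

Section BifilteredModels.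
Variable K : fieldType.
Implicit Types A B C M : dcomplex K.

Lemma bifiltered_model_dsum A B (I J : finType) (deg : I -> int * int * int)
    (deg' : J -> int * int * int) :
  bifiltered_model A deg -> bifiltered_model B deg' ->
  bifiltered_model (dsum A B) (sum_fun deg deg').
Proof.
move=> [v1 [w1 [u1 [l1 [m1 [h1 [vF1 lF1 ld1 lv1 [hl1 hE1]]]]]]]].
move=> [v2 [w2 [u2 [l2 [m2 [h2 [vF2 lF2 ld2 lv2 [hl2 hE2]]]]]]]].
pose ext (l : I -> {linear A -> K^o}) (m : J -> {linear B -> K^o}) (x : I + J) :
    {linear dsum A B -> K^o} := match x with
  | inl i => l i \o mklin (@fst_linear K A B) | inr j => m j \o mklin (@snd_linear K A B) end.
pose vec (v : I -> A) (w : J -> B) := sum_fun (fun i => (v i, 0) : dsum A B) (fun j => (0, w j)).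
exists (vec v1 v2), (vec w1 w2), (vec u1 u2), (ext l1 l2), (ext m1 m2), (pair_map h1 h2).
have F0 (M : dcomplex K) i m n : filtration i m n (0 : M).
  exact: (subspace0 (@filtration_subspace _ _ _ _ _)).
have tE (x : A) (y : B) : dc_total ((x, y) : dsum A B) = (dc_total x, dc_total y) by [].
split.
- case=> i /=; [have [a1 a2 a3 a4 a5] := vF1 i | have [a1 a2 a3 a4 a5] := vF2 i]; rewrite !tE;
    rewrite ?a3 ?a4 -?a5 ?linear0; (split=> //; first by [apply/dsum_filtration];
    first by [apply/dsum_filtration]); by congr pair; rewrite /= ?subr0.
- by case=> i p q [x y] /= [x1 x2]; [apply: lF1 | apply: lF2].
- by case=> i [x y]; [apply: (ld1 i x) | apply: (ld2 i y)].
- by move=> [i|i] [j|j] /=; rewrite ?linear0 //; split=> //; rewrite (lv1, lv2).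
split=> [n x /dsum_homogeneous[x1 x2]|].
  by apply/dsum_homogeneous; split; [apply: hl1|apply: hl2].
case=> x y; transitivity ((dc_total (h1 x) + h1 (dc_total x), dc_total (h2 y) + h2 (dc_total y)) : dsum A B) => //.
by rewrite hE1 hE2 big_sumType /= dsum_model_sum.
Qed.

Lemma bifiltered_model_tensor A B C (I J : finType) (deg : I -> int * int * int)
    (deg' : J -> int * int * int) : is_tensor A B C ->
  bifiltered_model A deg -> bifiltered_model B deg' ->
  bifiltered_model C (fun x : I * J =>
    ((deg x.1).1.1 + (deg' x.2).1.1, (deg x.1).1.2 + (deg' x.2).1.2,
     (deg x.1).2 + (deg' x.2).2)).
Proof.
move=> /is_tensorP[t [tt td _ _ tD]].
move=> [v1 [w1 [u1 [l1 [m1 [h1 [vF1 lF1 ld1 lv1 [hl1 hE1]]]]]]]].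
move=> [v2 [w2 [u2 [l2 [m2 [h2 [vF2 lF2 ld2 lv2 [hl2 hE2]]]]]]]].
have tb : bilinear_map t by case: tt.
have LP (l : I -> {linear A -> K^o}) (m : J -> {linear B -> K^o}) x :
    {f : {linear C -> K^o} | forall a b, f (t a b) = l x.1 a * m x.2 b}.
  apply: cid; apply: (tensor_lift (b := fun a b => l x.1 a * m x.2 b : K^o)) => //.
  split=> [a c b b'|b c a a']; rewrite linearP.
    by rewrite mulrDr -scalerAr.
  by rewrite mulrDl -scalerAl.
pose L l m x := sval (LP l m x).
have LE l m x a b : L l m x (t a b) = l x.1 a * m x.2 b.
  by rewrite /L; case: (LP l m x).
have sumL (A' : dcomplex K) (I' : finType) (l : I' -> {linear A' -> K^o}) v :
    linear (fun x => \sum_i l i x *: v i : A').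
  move=> c x y; rewrite scaler_sumr -big_split; apply: eq_bigr => i _.
  by rewrite linearP scalerDl scalerA.
have pL := sumL A I l1 v1; have pL' := sumL B J l2 v2.
have PL := sumL C _ (L l1 l2) (fun x => t (v1 x.1) (v2 x.2)).
have deg1 i p q x : in_bidegree p q x -> l1 i x != 0 -> p <= (deg i).1.1 /\ p + q = (deg i).2.
  by move=> /(lF1 i)[].
have pn n x : homogeneous n x -> homogeneous n (mklin pL x).
  move=> xn p q pq /=; rewrite linear_sum big1 // => i _; rewrite linearZ /=.
  have [->|] := eqVneq (l1 i x) 0; first exact: scale0r.
  move=> /functional_graded[p' [q' lx]].
  have [e|/xn x0] := eqVneq (p' + q') n; last by rewrite x0 linear0 eqxx in lx.
  have [_ e'] := deg1 i _ _ _ (dc_proj_in _ _ _) lx; have [vi _ _ _ _] := vF1 i.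
  rewrite (filtration_homogeneous vi) ?scaler0 //.
  by rewrite -e' e.
have PE a b : mklin PL (t a b) = t (mklin pL a) (mklin pL' b).
  have rL u : linear (fun v => t u v) by apply: (proj1 tb).
  have lL u : linear (fun v => t v u) by apply: (proj2 tb).
  rewrite -[RHS]/(mklin (lL _) (\sum_i l1 i a *: v1 i)) linear_sum.
  transitivity (\sum_i \sum_j L l1 l2 (i, j) (t a b) *: t (v1 i) (v2 j)).
    by rewrite pair_bigA; apply: eq_bigr => -[].
  apply: eq_bigr => i _; rewrite -[RHS]/(mklin (rL _) (\sum_j l2 j b *: v2 j)) linear_sum.
  by apply: eq_bigr => j _ /=; rewrite LE (bilinZl tb) (bilinZr tb) scalerA.
have [H [HE Hl HD]] := tensor_homotopy tt td tD (@homogeneous_total K A) (@dc_totalK K A)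
  PE pn hl1 hE1 hl2 hE2.
exists (fun x => t (v1 x.1) (v2 x.2)), (fun x => t (w1 x.1) (w2 x.2)).
(* From [v1 (x) v2 - w1 (x) w2 = (v1 - w1) (x) v2 + w1 (x) (v2 - w2)]; the sign operator offsets the
   sign in the Leibniz rule. *)
exists (fun x => t (u1 x.1) (v2 x.2) + t (koszul A (w1 x.1)) (u2 x.2)).
exists (L l1 l2), (L m1 m2), H; split.
- move=> [i j] /=; have [a1 a2 a3 a4 a5] := vF1 i; have [b1 b2 b3 b4 b5] := vF2 j.
  split.
  + exact: (tensor_filtration tt td).
  + exact: (tensor_filtration tt td).
  + by rewrite tD a3 b3 (bilin0l tb) (bilin0r tb) addr0.
  + by rewrite tD a4 b4 (bilin0l tb) (bilin0r tb) addr0.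
  rewrite dc_totalD !tD b3 (bilin0r tb) addr0 koszulK -a5 -b5.
  have wk := filtration_homogeneous a2.
  rewrite (koszul_homogeneous wk) linearZ /= a4 scaler0 (bilin0l tb) add0r.
  by rewrite (bilinBl tb) (bilinBr tb) addrA subrK.
- have aux (l : I -> {linear A -> K^o}) (m : J -> {linear B -> K^o}) i j
      (s : bool) (x y n n' : int) p q (z : C) :
      (forall p q x', in_bidegree p q x' -> l i x' != 0 -> (if s then q else p) <= x /\ p + q = n) ->
      (forall p q x', in_bidegree p q x' -> m j x' != 0 -> (if s then q else p) <= y /\ p + q = n') ->
      in_bidegree p q z -> L l m (i, j) z != 0 ->
      (if s then q else p) <= x + y /\ p + q = n + n'.
    move=> hl hm zpq Lz; apply: contrapT => npq; case/eqP: Lz; rewrite -zpq.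
    have zL : linear (fun _ : C => 0 : K^o) by move=> a u w; rewrite scaler0 addr0.
    apply: (@tensor_ext_bideg K A B C _ t (L l m (i, j) \o dc_proj C p q) (mklin zL)) => //.
    move=> p1 q1 p2 q2 a b ha hb /=; rewrite (dc_proj_bideg _ _ (td _ _ _ _ _ _ ha hb)).
    case: ifP => [/andP[/eqP e1 /eqP e2]|_]; last by rewrite linear0.
    rewrite LE /=; have [->|la] := eqVneq (l i a) 0; first by rewrite mul0r.
    have [->|lb] := eqVneq (m j b) 0; first by rewrite mulr0.
    have [c1 c2] := hl _ _ _ ha la; have [c1' c2'] := hm _ _ _ hb lb.
    case: npq; rewrite e1 e2 -c2 -c2'; split; last by rewrite addrACA.
    by move: c1 c1'; case: (s) => /=; apply: lerD.
  move=> [i j] p q z zpq /=; split; [apply: (aux _ _ _ _ false) zpq | apply: (aux _ _ _ _ true) zpq].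
  + by move=> ? ? ? /(lF1 i)[].
  + by move=> ? ? ? /(lF2 j)[].
  + by move=> ? ? ? /(lF1 i)[].
  + by move=> ? ? ? /(lF2 j)[].
- have aux (l : I -> {linear A -> K^o}) (m : J -> {linear B -> K^o}) i j z :
      (forall x, l i (dc_total x) = 0) -> (forall x, m j (dc_total x) = 0) ->
      L l m (i, j) (dc_total z) = 0.
    move=> hl hm; have zL : linear (fun _ : C => 0 : K^o) by move=> a u w; rewrite scaler0 addr0.
    apply: (@tensor_ext K A B C _ t (L l m (i, j) \o @dc_total K C) (mklin zL)) => // a b /=.
    by rewrite tD linearD !LE /= hl hm mul0r mulr0 addr0.
  by move=> [i j] z; split; apply: aux => x; [case: (ld1 i x) | case: (ld2 j x) | case: (ld1 i x) | case: (ld2 j x)].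
- move=> [i j] [i' j']; rewrite !LE /=.
  have [-> ->] := lv1 i i'; have [-> ->] := lv2 j j'.
  by rewrite -natrM mulnb.
- by split=> // x; apply: HD.
Qed.

End BifilteredModels.

(** * Invariance *)

Section Bases.
Variable K : fieldType.

Definition qbasis (V : lmodType K) (Z N : V -> Prop) (J : finType) (P : pred J) (v : J -> V) :=
  [/\ forall j, P j -> Z (v j),
      forall x, Z x -> exists c : J -> K, N (x - \sum_(j | P j) c j *: v j) &
      forall c : J -> K, N (\sum_(j | P j) c j *: v j) -> forall j, P j -> c j = 0].

Lemma qbasis_leq (V : lmodType K) (Z N : V -> Prop) (J J' : finType) (P : pred J)
    (P' : pred J') v v' : subspace N -> qbasis Z N P v -> qbasis Z N P' v' ->
  (#|P| <= #|P'|)%N.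
Proof.
move=> sN [vZ _ vfree] [_ v'span _]; rewrite leqNgt; apply/negP => lt.
have /choice[c cP] : forall j, exists c : J' -> K, P j ->
    N (v j - \sum_(j' | P' j') c j' *: v' j').
  move=> j; have [Pj|nPj] := boolP (P j); last by exists (fun=> 0).
  by have [c cN] := v'span _ (vZ _ Pj); exists c.
pose C := \matrix_(a < #|P|, b < #|P'|) c (enum_val a) (enum_val b).
have : kermx C != 0.
  rewrite kermx_eq0 /row_free; apply/negP => /eqP e.
  by have := rank_leq_col C; rewrite e leqNgt lt.
case/rowV0Pn=> u /sub_kermxP uC un0.
pose d j := \sum_a (enum_val a == j)%:R * u 0 a.
have dE a : d (enum_val a) = u 0 a.
  rewrite /d (bigD1 a) //= eqxx mul1r big1 ?addr0 // => b ba.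
  by rewrite (inj_eq enum_val_inj) (negbTE ba) mul0r.
have dN : N (\sum_(j | P j) d j *: v j).
  rewrite -[\sum_(j | P j) _]/(\sum_(j in P) _) big_enum_val /=.
  have -> : \sum_(i < #|P|) d (enum_val i) *: v (enum_val i) =
      \sum_(a < #|P|) u 0 a *: (v (enum_val a) - \sum_(j' | P' j') c (enum_val a) j' *: v' j').
    under [RHS]eq_bigr do rewrite scalerBr; rewrite sumrB [X in _ - X](_ : _ = 0).
      by rewrite subr0; apply: eq_bigr => a _; rewrite dE.
    under eq_bigr do rewrite -[\sum_(j' | P' j') _]/(\sum_(j' in P') _) big_enum_val scaler_sumr.
    rewrite exchange_big big1 //= => b _.
    have /matrixP/(_ 0 b) := uC; rewrite !mxE => e.
    rewrite -[RHS](scale0r (v' (enum_val b))) -e scaler_suml; apply: eq_bigr => a _.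
    by rewrite scalerA !mxE.
  apply: (subspace_sum sN) => a _; apply: (subspaceZ sN); apply: cP.
  exact: (enum_valP a).
case/eqP: un0; apply/rowP => a; rewrite mxE -dE.
exact: (vfree _ dN _ (enum_valP a)).
Qed.

Lemma qbasis_image (V W : lmodType K) (Z N : V -> Prop) (Z' N' : W -> Prop)
    (f : {linear V -> W}) (J : finType) (P : pred J) v :
  subspace Z -> subspace N' -> subquotient_iso Z N Z' N' f ->
  qbasis Z N P v -> qbasis Z' N' P (f \o v).
Proof.
move=> sZ sN' [f1 f2 f3 f4] [vZ vspan vfree].
have fs (c : J -> K) : \sum_(j | P j) c j *: f (v j) = f (\sum_(j | P j) c j *: v j).
  by rewrite linear_sum; apply: eq_bigr => j _; rewrite linearZ.
split=> [j /vZ/f1 //|y /f4[x /vspan[c cN] xy]|c /=].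
  exists c; rewrite /= fs -[y](subrK (f x)) -addrA -linearB.
  by apply: (subspaceD sN') => //; apply: f2.
rewrite fs => /f3 h; apply: vfree; apply: h.
by apply: (subspace_sum sZ) => j Pj; apply: (subspaceZ sZ); apply: vZ.
Qed.

Lemma qbasis_card (V W : lmodType K) (Z N : V -> Prop) (Z' N' : W -> Prop)
    (f : {linear V -> W}) (J J' : finType) (P : pred J) (P' : pred J') v v' :
  subspace Z -> subspace N' -> subquotient_iso Z N Z' N' f ->
  qbasis Z N P v -> qbasis Z' N' P' v' -> #|P| = #|P'|.
Proof.
move=> sZ sN' iso /(qbasis_image sZ sN' iso) h h'.
by apply/eqP; rewrite eqn_leq (qbasis_leq sN' h h') (qbasis_leq sN' h' h).
Qed.

Lemma eq_count_sum (I J : finType) (T : eqType) (V : nmodType) (f : I -> T) (g : J -> T)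
    (F : T -> V) : (forall d, #|[pred i | f i == d]| = #|[pred j | g j == d]|) ->
  \sum_i F (f i) = \sum_j F (g j).
Proof.
move=> fg; have E (I' : finType) (h : I' -> T) : \sum_i F (h i) = \sum_(d <- map h (enum I')) F d.
  by rewrite big_map big_enum.
rewrite !E; apply: perm_big; apply/allP => d _ /=; rewrite !count_map.
by have := fg d; rewrite !cardE /enum_mem !size_filter -!enumT /= => ->.
Qed.

End Bases.

Section Invariance.
Variable K : fieldType.
Implicit Types A B : dcomplex K.

Lemma column_model_basis k A (I : finType) (deg : I -> int * int) :
  column_model k A deg -> exists v : I -> A, forall m n,
    qbasis (@page_cycles K A false (Some k.+1) m n)
      (@page_boundaries K A false (Some k.+1) m n) [pred i | deg i == (m, n)] v.
Proof.
move=> [v [l [h [vF lF lv [hl hF] hE]]]]; exists v => m n.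
have lFF i m' n' x := @functional_filtration K A (l i) false _ _ (lF i) m' n' x.
split=> [i /eqP iE|x [xF dxF]|c [y [z [cE [[/= yF dyF] [/= zF dzF]]]]] i di].
- by have := vF i; rewrite iE.
- exists (fun i => l i x).
  (* [dc_total x] lies in [F^(m+k+1)], so [h] brings it down to [F^(m+1)] at worst, and the basis
     vectors of other degrees that occur in [x] lie in higher columns. Both parts are therefore
     boundaries of [E_(k+1)]. *)
  exists (h (dc_total x) + \sum_(i | deg i != (m, n)) l i x *: v i), (h x).
  split.
    rewrite addrAC (addrC (h _)) hE (bigID (fun i => deg i == (m, n)) xpredT) /=.
    by rewrite opprD addrA subrK.
  have hxF := hF _ _ _ xF; have hdxF := hF _ _ _ dxF.
  have restF : filtration false (m + 1) n (\sum_(i | deg i != (m, n)) l i x *: v i).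
    apply: (subspace_sum (@filtration_subspace _ _ _ _ _)) => j dj.
    have [->|lx] := eqVneq (l j x) 0.
      by rewrite scale0r; apply: (subspace0 (@filtration_subspace _ _ _ _ _)).
    apply: (subspaceZ (@filtration_subspace _ _ _ _ _)).
    have [mj nj] := lFF _ _ _ _ xF lx; rewrite nj.
    apply: (filtration_le (proj1 (vF j))); move: dj mj; rewrite nj.
    by case: (deg j) => a b /=; rewrite xpair_eqE; lia.
  have spanF m' n' x' : filtration false m' n' x' ->
      filtration false m' n' (\sum_j l j x' *: v j).
    move=> x'F; apply: (model_span_filtration (c := fun i => (m' <= (deg i).1) && (n' == (deg i).2))).
      by move=> j /andP[mj /eqP ->]; apply: (filtration_le (proj1 (vF j))).
    by move=> j /(lFF _ _ _ _ x'F)[-> ->]; rewrite eqxx.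
  split; split=> /=.
  + apply: (subspaceD (@filtration_subspace _ _ _ _ _)) => //.
    by rewrite addrK in hdxF; apply: (filtration_le hdxF); lia.
  + rewrite dc_totalD; apply: (subspaceD (@filtration_subspace _ _ _ _ _)).
      have := hE (dc_total x); rewrite dc_totalK linear0 addr0 => ->.
      apply: (@filtration_le _ _ _ (m + k.+1%:Z)); last by lia.
      by apply: (subspaceB (@filtration_subspace _ _ _ _ _)) => //; apply: spanF.
    rewrite linear_sum; apply: (subspace_sum (@filtration_subspace _ _ _ _ _)) => j dj.
    rewrite linearZ /=; have [->|lx] := eqVneq (l j x) 0.
      by rewrite scale0r; apply: (subspace0 (@filtration_subspace _ _ _ _ _)).
    apply: (subspaceZ (@filtration_subspace _ _ _ _ _)).
    have [mj nj] := lFF _ _ _ _ xF lx; rewrite nj.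
    apply: (filtration_le (proj2 (vF j))); move: dj mj; rewrite nj.
    by case: (deg j) => a b /=; rewrite xpair_eqE; lia.
  + exact: hxF.
  + rewrite !subrK; have -> : dc_total (h x) = x - \sum_i l i x *: v i - h (dc_total x).
      by rewrite -hE addrK.
    apply: (subspaceB (@filtration_subspace _ _ _ _ _)); last first.
      by rewrite addrK in hdxF; apply: (filtration_le hdxF); lia.
    by apply: (subspaceB (@filtration_subspace _ _ _ _ _)) => //; apply: spanF.
have {}di := eqP di.
have lsum (a : I -> K) : l i (\sum_j a j *: v j) = a i.
  rewrite linear_sum (bigD1 i) //= linearZ /= lv eqxx big1 ?addr0 => [|j ji].
    by rewrite -[RHS]mulr1.
  by rewrite linearZ /= lv eq_sym (negbTE ji) scaler0.
have <- : l i (\sum_(j | deg j == (m, n)) c j *: v j) = c i.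
  rewrite big_mkcond -[RHS](_ : (if deg i == (m, n) then c i else 0) = _); last first.
    by rewrite di eqxx.
  rewrite -(lsum (fun j => if deg j == (m, n) then c j else 0)); congr (l i _).
  by apply: eq_bigr => j _; case: ifP; rewrite ?scale0r.
rewrite cE linearD /=.
have l0 x : filtration false (m + 1) n x -> l i x = 0.
  move=> xF; apply: contrapT => /eqP /(lFF _ _ _ _ xF)[]; rewrite di /=; lia.
rewrite l0 // add0r.
(* The functionals intertwine [dc_total] with the differential of the model, which raises the column
   by more than [k]. As [z] starts in column [m - k], the coefficient of [dc_total z] at a vector of
   column [m] vanishes. *)
have dE : \sum_j l j (dc_total z) *: v j = \sum_j l j z *: dc_total (v j).
  have /(congr1 (@dc_total K A)) := hE z; rewrite dc_totalD dc_totalK add0r dc_totalB.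
  have := hE (dc_total z); rewrite dc_totalK linear0 addr0 => -> /addrI /oppr_inj ->.
  by rewrite linear_sum; apply: eq_bigr => j _; rewrite linearZ.
rewrite -(lsum (fun j => l j (dc_total z))) dE; apply: l0.
apply: (subspace_sum (@filtration_subspace _ _ _ _ _)) => j _.
have [->|lz] := eqVneq (l j z) 0.
  by rewrite scale0r; apply: (subspace0 (@filtration_subspace _ _ _ _ _)).
apply: (subspaceZ (@filtration_subspace _ _ _ _ _)).
have [mj nj] := lFF _ _ _ _ zF lz.
have := proj2 (vF j); rewrite -nj subrK => vj; apply: (filtration_le vj); lia.
Qed.

Lemma column_model_unique k A B (I J : finType) (deg : I -> int * int)
    (deg' : J -> int * int) (f : {linear A -> B}) (V : nmodType) (F : int * int -> V) :
  bounded A -> bounded B -> Er_isomorphism (Some 1%N) f ->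
  column_model k A deg -> column_model k B deg' ->
  \sum_i F (deg i) = \sum_j F (deg' j).
Proof.
move=> bA bB fE /column_model_basis[v vP] /column_model_basis[v' v'P].
apply: eq_count_sum => -[m n].
have [_ iso] := E1_isomorphism_pages bA bB fE (isT : Some k.+1 != Some 0%N).
apply: (qbasis_card _ _ (iso false m n) (vP m n) (v'P m n)).
  exact: page_cycles_subspace.
exact: page_boundaries_subspace.
Qed.

(** The cocycles whose class lies in the intersection of the [p]-th step of the column filtration
    and the [q]-th step of the row filtration on total cohomology. The dimensions of these
    intersections determine how many classes of a model have given degrees. *)
Definition bifiltered_class A p q n (x : A) := exists x1 x2 y1 y2,
  [/\ filtration false p n x1 /\ dc_total x1 = 0, filtration true q n x2 /\ dc_total x2 = 0,
      x = x1 + dc_total y1 & x = x2 + dc_total y2].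

Definition exact A (x : A) := exists y, x = dc_total y.

Lemma exact_subspace A : subspace (@exact A).
Proof.
split=> [|a _ _ [y ->] [y' ->]]; first by exists 0; rewrite linear0.
by exists (a *: y + y'); rewrite dc_total_linear.
Qed.

Lemma bifiltered_class_subspace A p q n : subspace (@bifiltered_class A p q n).
Proof.
split.
  exists 0, 0, 0, 0; rewrite linear0 addr0; split=> //; split=> //;
    exact: (subspace0 (@filtration_subspace _ _ _ _ _)).
move=> a x y [x1 [x2 [b1 [b2 [[h1 h2] [h3 h4] h5 h6]]]]] [x1' [x2' [b1' [b2' [[h1' h2'] [h3' h4'] h5' h6']]]]].
exists (a *: x1 + x1'), (a *: x2 + x2'), (a *: b1 + b1'), (a *: b2 + b2').
rewrite !dc_total_linear h2 h2' h4 h4' scaler0 addr0; split.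
- by split=> //; apply: (proj2 (@filtration_subspace _ _ _ _ _)).
- by split=> //; apply: (proj2 (@filtration_subspace _ _ _ _ _)).
- by rewrite h5 h5' scalerDr addrACA.
- by rewrite h6 h6' scalerDr addrACA.
Qed.

Lemma bifiltered_model_basis A (I : finType) (deg : I -> int * int * int) :
  bifiltered_model A deg -> exists v : I -> A, forall p q n,
    qbasis (@bifiltered_class A p q n) (@exact A)
      [pred i | [&& p <= (deg i).1.1, q <= (deg i).1.2 & n == (deg i).2]] v.
Proof.
move=> [v [v' [w [l [l' [h [vF lF ld lv [hl hE]]]]]]]]; exists v => p q n.
have l1F i m' n' x := @functional_filtration K A (l i) false _ _ (fun p q x h => proj1 (lF i p q x h)) m' n' x.
have l2F i m' n' x := @functional_filtration K A (l' i) true _ _ (fun p q x h => proj2 (lF i p q x h)) m' n' x.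
split=> [i /and3P[pi qi /eqP ni]|x [x1 [x2 [y1 [y2 [[x1F dx1] [x2F dx2] xE xE']]]]]|c [y cE] i].
- have [v1 v2 v3 v4 v5] := vF i; exists (v i), (v' i), 0, (w i).
  rewrite linear0 addr0 -v5 ni; split=> //; [split | split |] => //.
  + exact: (filtration_le v1).
  + exact: (filtration_le v2).
  + by rewrite addrC subrK.
- have dx : dc_total x = 0 by rewrite xE dc_totalD dx1 dc_totalK addr0.
  (* On cocycles [l] and [l'] agree: both kill boundaries and are dual to the same basis of
     cohomology, since [v] and [v'] are cohomologous. *)
  have ll i : l' i x = l i x.
    have := hE x; rewrite dx linear0 addr0 => e.
    have : l' i (x - \sum_j l j x *: v j) = 0 by rewrite -e; case: (ld i (h x)).
    rewrite linearB /= linear_sum (bigD1 i) //= linearZ /= big1 => [|j ji].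
      have -> : l' i (v i) = 1.
        have [_ _ _ _ /eqP] := vF i; rewrite subr_eq => /eqP ->; rewrite linearD /=.
        by have [_ ->] := ld i (w i); have [_ ->] := lv i i; rewrite eqxx add0r.
      by rewrite addr0 => /eqP; rewrite subr_eq0 => /eqP ->; apply: mulr1.
    rewrite linearZ /=; have -> : l' i (v j) = 0; last by rewrite scaler0.
    have [_ _ _ _ /eqP] := vF j; rewrite subr_eq => /eqP ->; rewrite linearD /=.
    by have [_ ->] := ld i (w j); have [_ ->] := lv i j; rewrite eq_sym (negbTE ji) add0r.
  exists (fun i => l i x), (h x).
  have := hE x; rewrite dx linear0 addr0 => ->; congr (_ - _).
  rewrite [LHS]big_mkcond; apply: eq_bigr => i _ /=; case: ifP => // nP.
  have [->|lx] := eqVneq (l i x) 0; first by rewrite scale0r.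
  have lx1 : l i x1 != 0.
    by move: lx; rewrite xE linearD /=; have [-> _] := ld i y1; rewrite addr0.
  have lx2 : l' i x2 != 0.
    by move: lx; rewrite -ll xE' linearD /=; have [_ ->] := ld i y2; rewrite addr0.
  have [a1 a2] := l1F _ _ _ _ x1F lx1; have [b1 _] := l2F _ _ _ _ x2F lx2.
  by rewrite a1 b1 a2 eqxx in nP.
rename i into j; move=> Pj.
have := congr1 (l j) cE; have [-> _] := ld j y.
rewrite linear_sum (bigD1 j) //= linearZ /= big1 => [|k /andP[_ kj]].
  by have [-> _] := lv j j; rewrite eqxx addr0 => <-; rewrite -[LHS]mulr1.
by rewrite linearZ /=; have [-> _] := lv j k; rewrite eq_sym (negbTE kj) scaler0.
Qed.

End Invariance.

Section BifilteredInvariance.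
Variable K : fieldType.
Implicit Types A B : dcomplex K.

Lemma bifiltered_class_iso A B (f : {linear A -> B}) p q n :
  bounded A -> bounded B -> Er_isomorphism None f ->
  subquotient_iso (@bifiltered_class K A p q n) (@exact K A)
    (@bifiltered_class K B p q n) (@exact K B) f.
Proof.
move=> bA bB fE; have [surj inj] := Einfty_strict bA bB fE; have [fM _] := fE.
have {}inj (x : A) : homogeneous n x -> dc_total x = 0 -> exact (f x) -> exact x.
  move=> xn dx [z fx].
  apply: (inj n x (cut B (fun p q => p + q == n - 1) z)) => //; last first.
    by move=> p' q' pq; rewrite cut_proj (negbTE pq).
  rewrite fx; apply: dc_proj_eq => p' q'; rewrite !proj_total !cut_proj.
  have [e|ne] := eqVneq (p' + q') n.
    have -> : p' - 1 + q' == n - 1 by lia.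
    by have -> : p' + (q' - 1) == n - 1 by lia.
  have -> : (p' - 1 + q' == n - 1) = false by lia.
  have -> : (p' + (q' - 1) == n - 1) = false by lia.
  rewrite !linear0 addr0 -proj_total -fx -(morph_proj fM) xn ?linear0 //.
have fex (x : A) : exact x -> exact (f x).
  by case=> y ->; exists (f y); rewrite (morph_total fM).
split=> //.
- move=> x [x1 [x2 [y1 [y2 [[x1F dx1] [x2F dx2] xE xE']]]]].
  exists (f x1), (f x2), (f y1), (f y2).
  rewrite -!(morph_total fM) -!linearD -xE -xE' dx1 dx2 linear0.
  by split=> //; split=> //; apply: morph_filtration.
- move=> x [x1 [x2 [y1 [y2 [[x1F dx1] _ xE _]]]]] fx.
  rewrite xE; apply: (subspaceD (@exact_subspace _ _)); last by exists y1.
  apply: inj => //; first exact: filtration_homogeneous x1F.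
  have -> : x1 = x - dc_total y1 by rewrite xE addrK.
  rewrite linearB; apply: (subspaceB (@exact_subspace _ _)) => //.
  by apply: fex; exists y1.
move=> y [y1 [y2 [b1 [b2 [[y1F dy1] [y2F dy2] yE yE']]]]].
have [x1 [z1 [x1F dx1 y1E]]] := surj _ _ _ _ y1F dy1.
have [x2 [z2 [x2F dx2 y2E]]] := surj _ _ _ _ y2F dy2.
(* The two filtrations are lifted separately; the lifts are cohomologous in [A] because their images
   are cohomologous in [B] and [f] is injective on cohomology. *)
have [w wE] : exact (x1 - x2).
  apply: inj.
  - apply: (subspaceB (@homogeneous_subspace _ _ _));
      [exact: filtration_homogeneous x1F | exact: filtration_homogeneous x2F].
  - by rewrite dc_totalB dx1 dx2 subrr.
  have e1 : f x1 = y - dc_total (z1 + b1).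
    by rewrite yE y1E dc_totalD opprD addrA -addrA -addrA addrA addrACA addrK subrr addr0.
  have e2 : f x2 = y - dc_total (z2 + b2).
    by rewrite yE' y2E dc_totalD opprD addrA -addrA -addrA addrA addrACA addrK subrr addr0.
  exists ((z2 + b2) - (z1 + b1)); rewrite linearB dc_totalB e1 e2.
  by rewrite opprB [LHS]addrC addrA subrK.
exists x1.
  exists x1, x2, 0, w; rewrite linear0 addr0 -wE; split=> //.
  by rewrite addrC subrK.
exists (z1 + b1); rewrite dc_totalD {1}yE y1E addrAC (addrAC (f x1)) subrr add0r.
by [].
Qed.

Lemma bifiltered_model_unique A B (I J : finType) (deg : I -> int * int * int)
    (deg' : J -> int * int * int) (f : {linear A -> B}) (V : nmodType) (F : int * int * int -> V) :
  bounded A -> bounded B -> Er_isomorphism None f ->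
  bifiltered_model A deg -> bifiltered_model B deg' ->
  \sum_i F (deg i) = \sum_j F (deg' j).
Proof.
move=> bA bB fE /bifiltered_model_basis[v vP] /bifiltered_model_basis[v' v'P].
have cardE p q n := qbasis_card (@bifiltered_class_subspace K A p q n) (@exact_subspace K B)
  (bifiltered_class_iso p q n bA bB fE) (vP p q n) (v'P p q n).
apply: eq_count_sum => -[[p q] n].
(* Inclusion and exclusion over the corners [(p, q)], [(p + 1, q)], [(p, q + 1)], [(p + 1, q + 1)]
   isolates the indices of degree exactly [(p, q, n)]. *)
have inc (I' : finType) (e : I' -> int * int * int) :
    (#|[pred i | [&& p <= (e i).1.1, q <= (e i).1.2 & n == (e i).2]%R]| +
     #|[pred i | [&& p + 1 <= (e i).1.1, q + 1 <= (e i).1.2 & n == (e i).2]%R]| =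
     #|[pred i | e i == (p, q, n)]| +
     (#|[pred i | [&& p + 1 <= (e i).1.1, q <= (e i).1.2 & n == (e i).2]%R]| +
      #|[pred i | [&& p <= (e i).1.1, q + 1 <= (e i).1.2 & n == (e i).2]%R]|))%N.
  have cs (Q : pred I') : #|[pred i | Q i]| = (\sum_i Q i)%N.
    by rewrite -sum1_card big_mkcond; apply: eq_bigr => i _; rewrite inE; case: (Q i).
  rewrite !cs -!big_split; apply: eq_bigr => i _ /=; case: (e i) => [[a b] c] /=; rewrite !xpair_eqE.
  lia.
have := inc _ deg; have := inc _ deg'; rewrite !cardE => -> /eqP.
by rewrite eqn_add2r => /eqP.
Qed.

End BifilteredInvariance.

(** * Zigzags *)

Section Zigzag.
Variable K : fieldType.

(* [(P, Q, b, n)] stands for the zigzag with basis [e_0, ..., e_(n-1)]; the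
   sources of the arrows are the [e_j] with [b + j] even, and for these
   [d1 e_j = e_(j+1)] and [d2 e_j = e_(j-1)]. *)
Definition zigzag := (int * int * bool * nat)%type.

Implicit Type z : zigzag.

Definition zlen z : nat := z.2.
Definition zpar z (j : nat) : nat := z.1.2 + j.
Definition zsource z (j : nat) := ~~ odd (zpar z j).
Arguments zsource : simpl never.
(** From a source to the next element one moves a column to the right, from a target to the next
    element a row down; hence the two ways of rounding the half. *)
Definition zcol z (j : nat) : int := z.1.1.1 + (uphalf (zpar z j))%:Z.
Definition zrow z (j : nat) : int := z.1.1.2 - ((zpar z j)./2)%:Z.

Definition zspace z := {ffun 'I_(zlen z) -> K^o}.

(** Coordinates outside the range are [0], so arrows leaving the zigzag at its right end vanish
    without a separate case. *)
Definition zco z (x : zspace z) (j : nat) : K :=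
  if insub j is Some i then x i else 0.

Definition zmk z (F : nat -> K) : zspace z := [ffun i : 'I_(zlen z) => F i].

Lemma zcoE z F j : zco (zmk z F) j = if (j < zlen z)%N then F j else 0.
Proof. by rewrite /zco; case: insubP => [i -> <-|/negbTE ->] //; rewrite ffunE. Qed.

Lemma zco_out z (x : zspace z) j : (zlen z <= j)%N -> zco x j = 0.
Proof. by rewrite /zco; case: insubP => // i lt _; rewrite leqNgt lt. Qed.

Lemma zspace_eq z (x y : zspace z) : (forall j, (j < zlen z)%N -> zco x j = zco y j) -> x = y.
Proof.
move=> xy; apply/ffunP => i; have := xy i (ltn_ord i).
by rewrite /zco valK.
Qed.

Lemma zco_linear z j : linear (fun x : zspace z => zco x j : K^o).
Proof.
move=> a x y; rewrite /zco; case: insub => [i|]; last by rewrite scaler0 addr0.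
by rewrite !ffunE.
Qed.

Lemma zcoD z (x y : zspace z) j : zco (x + y) j = zco x j + zco y j.
Proof. exact: (linearD (mklin (@zco_linear z j))). Qed.

Lemma zcoN z (x : zspace z) j : zco (- x) j = - zco x j.
Proof. exact: (linearN (mklin (@zco_linear z j))). Qed.

Lemma zcoZ z a (x : zspace z) j : zco (a *: x) j = a * zco x j.
Proof. by rewrite -[LHS]/(mklin (@zco_linear z j) (a *: x)) linearZ. Qed.

Lemma zco0 z j : zco (0 : zspace z) j = 0.
Proof. exact: (linear0 (mklin (@zco_linear z j))). Qed.

Lemma zco_sum z (I : Type) (r : seq I) (P : pred I) (F : I -> zspace z) j :
  zco (\sum_(i <- r | P i) F i) j = \sum_(i <- r | P i) zco (F i) j.
Proof. exact: (linear_sum (mklin (@zco_linear z j))). Qed.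

Definition zd1_fun z (x : zspace z) := zmk z (fun j =>
  if ~~ zsource z j && (0 < j)%N then zco x j.-1 else 0).
Definition zd2_fun z (x : zspace z) := zmk z (fun j =>
  if ~~ zsource z j then zco x j.+1 else 0).
Definition zproj_fun z p q (x : zspace z) := zmk z (fun j =>
  if (zcol z j == p) && (zrow z j == q) then zco x j else 0).

Lemma zd1_linear z : linear (@zd1_fun z).
Proof.
move=> a x y; apply: zspace_eq => j jl; rewrite zcoD zcoZ !zcoE jl.
by case: ifP; rewrite ?zcoD ?zcoZ // mulr0 addr0.
Qed.

Lemma zd2_linear z : linear (@zd2_fun z).
Proof.
move=> a x y; apply: zspace_eq => j jl; rewrite zcoD zcoZ !zcoE jl.
by case: ifP; rewrite ?zcoD ?zcoZ // mulr0 addr0.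
Qed.

Lemma zproj_linear z p q : linear (@zproj_fun z p q).
Proof.
move=> a x y; apply: zspace_eq => j jl; rewrite zcoD zcoZ !zcoE jl.
by case: ifP; rewrite ?zcoD ?zcoZ // mulr0 addr0.
Qed.

Definition zd1 z := mklin (@zd1_linear z).
Definition zd2 z := mklin (@zd2_linear z).
Definition zproj z p q := mklin (@zproj_linear z p q).

Lemma zsourceS z j : zsource z j.+1 = ~~ zsource z j.
Proof. by rewrite /zsource /zpar addnS. Qed.

Lemma zcolS z j : zcol z j.+1 = zcol z j + (zsource z j)%:Z.
Proof. rewrite /zcol /zsource /zpar addnS; lia. Qed.

Lemma zrowS z j : zrow z j.+1 = zrow z j - (~~ zsource z j)%:Z.
Proof. rewrite /zrow /zsource /zpar addnS; lia. Qed.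

Lemma zco_d1 z (x : zspace z) j : zco (zd1 z x) j =
  if (j < zlen z)%N && ~~ zsource z j && (0 < j)%N then zco x j.-1 else 0.
Proof. by rewrite zcoE; case: ifP. Qed.

Lemma zco_d2 z (x : zspace z) j : zco (zd2 z x) j =
  if (j < zlen z)%N && ~~ zsource z j then zco x j.+1 else 0.
Proof. by rewrite zcoE; case: ifP. Qed.

Lemma zco_proj z p q (x : zspace z) j : zco (zproj z p q x) j =
  if (zcol z j == p) && (zrow z j == q) then zco x j else 0.
Proof.
rewrite zcoE; case: ltnP => // h; by rewrite zco_out // if_same.
Qed.

Fact zprojM z p q p' q' x : zproj z p q (zproj z p' q' x) =
  if (p == p') && (q == q') then zproj z p q x else 0.
Proof.
apply: zspace_eq => j jl; rewrite !zco_proj.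
case: (altP (p =P p')) => [->|pn]; case: (altP (q =P q')) => [->|qn] /=;
  rewrite ?zco_proj ?zco0; do !case: ifP => //; lia.
Qed.

Fact zproj_sum z x : exists s : seq (int * int), x = \sum_(t <- s) zproj z t.1 t.2 x.
Proof.
exists (undup [seq (zcol z j, zrow z j) | j <- iota 0 (zlen z)]).
apply: zspace_eq => j jl; rewrite zco_sum.
have jin : (zcol z j, zrow z j) \in undup [seq (zcol z j, zrow z j) | j <- iota 0 (zlen z)].
  by rewrite mem_undup; apply/mapP; exists j => //; rewrite mem_iota.
rewrite (bigD1_seq _ jin (undup_uniq _)) /= zco_proj !eqxx big1 ?addr0 // => -[p q] /= ne.
rewrite zco_proj ifF //; apply: contraNF ne => /andP[/eqP <- /eqP <-]; exact: eqxx.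
Qed.

Fact zd1_deg z p q x : zd1 z (zproj z p q x) = zproj z (p + 1) q (zd1 z x).
Proof.
apply: zspace_eq => j jl; rewrite zco_proj !zco_d1 jl.
case: j jl => [|j] jl; rewrite ?andbF ?if_same // zco_proj /= andbT zsourceS zcolS zrowS.
by case: (zsource z j) => //=; rewrite ?if_same // subr0 (inj_eq (addIr 1)).
Qed.

Fact zd2_deg z p q x : zd2 z (zproj z p q x) = zproj z p (q + 1) (zd2 z x).
Proof.
apply: zspace_eq => j jl; rewrite zco_proj !zco_d2 jl zco_proj zcolS zrowS /=.
case: (zsource z j) => //=; rewrite ?if_same // addr0.
by have -> : (zrow z j - 1 == q) = (zrow z j == q + 1) by lia.
Qed.

Fact zd1d1 z x : zd1 z (zd1 z x) = 0.
Proof.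
apply: zspace_eq => j jl; rewrite zco0 !zco_d1; case: j jl => [|j] jl; first by rewrite !andbF.
by rewrite zsourceS /= negbK; case: (zsource z j); rewrite /= ?andbF // if_same.
Qed.

Fact zd2d2 z x : zd2 z (zd2 z x) = 0.
Proof.
apply: zspace_eq => j jl; rewrite zco0 !zco_d2 zsourceS negbK.
by case: (zsource z j); rewrite /= ?andbF ?if_same.
Qed.

Fact zd1d2 z x : zd1 z (zd2 z x) + zd2 z (zd1 z x) = 0.
Proof.
apply: zspace_eq => j jl; rewrite zco0 zcoD !zco_d1 !zco_d2 zco_d1 zsourceS.
case: j jl => [|j] jl; rewrite ?zsourceS; case: (zsource z _);
  by rewrite /= ?andbF /= ?if_same ?addr0.
Qed.

Definition zcomplex z : dcomplex K := DComplex (@zprojM z) (@zproj_sum z)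
  (@zd1_deg z) (@zd2_deg z) (@zd1d1 z) (@zd2d2 z) (@zd1d2 z).

Lemma zcomplex_bounded z : bounded (zcomplex z).
Proof.
exists [seq (zcol z j, zrow z j) | j <- iota 0 (zlen z)] => p q pq x.
apply: (@zspace_eq z) => j jl; rewrite zco_proj zco0 ifF //.
apply: contraNF pq => /andP[/eqP <- /eqP <-].
by apply/mapP; exists j => //; rewrite mem_iota.
Qed.

Definition zbasis z k : zspace z := zmk z (fun j => (j == k)%:R).

Lemma zco_basis z k j : zco (zbasis z k) j = ((j < zlen z)%N && (j == k))%:R.
Proof. by rewrite zcoE; case: ifP. Qed.

Lemma zbideg z k : @in_bidegree K (zcomplex z) (zcol z k) (zrow z k) (zbasis z k).
Proof.
apply: (@zspace_eq z) => j jl; rewrite zco_proj zco_basis jl /=.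
by have [->|_] := eqVneq j k; rewrite ?eqxx // if_same.
Qed.

Lemma zin_bidegree z p q (x : zcomplex z) : in_bidegree p q x <->
  forall j, zco (x : zspace z) j != 0 -> zcol z j = p /\ zrow z j = q.
Proof.
split=> [<- j|h].
  by rewrite zco_proj; case: ifP => [/andP[/eqP-> /eqP->]|]; rewrite ?eqxx.
apply: (@zspace_eq z) => j jl; rewrite zco_proj; case: ifPn => // ne.
by apply/esym; apply: contrapT => /eqP /h[e1 e2]; rewrite e1 e2 !eqxx in ne.
Qed.

Lemma zbideg_inj z i j : zcol z i = zcol z j -> zrow z i = zrow z j -> i = j.
Proof.
rewrite /zcol /zrow /zpar !uphalf_half.
have := odd_double_half (z.1.2 + i); have := odd_double_half (z.1.2 + j); lia.
Qed.

End Zigzag.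

Section ZigzagShape.
Variable K : fieldType.
Implicit Type z : zigzag.

Definition zsupport z := [seq (zcol z j, zrow z j) | j <- iota 0 (zlen z)].

Lemma zsupportP z p q :
  reflect (exists2 j, (j < zlen z)%N & p = zcol z j /\ q = zrow z j) ((p, q) \in zsupport z).
Proof.
apply: (iffP mapP) => [[j]|[j jl [-> ->]]]; last by exists j; rewrite ?mem_iota.
by rewrite mem_iota => jl [-> ->]; exists j.
Qed.

Lemma zadjacent1 z i j : zcol z i = zcol z j + 1 -> zrow z i = zrow z j ->
  i = j.+1 /\ zsource z j.
Proof.
rewrite /zcol /zrow /zsource /zpar !uphalf_half.
have := odd_double_half (z.1.2 + i); have := odd_double_half (z.1.2 + j); lia.
Qed.

Lemma zadjacent2 z i j : zcol z i = zcol z j -> zrow z i = zrow z j + 1 ->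
  j = i.+1 /\ zsource z j.
Proof.
rewrite /zcol /zrow /zsource /zpar !uphalf_half.
have := odd_double_half (z.1.2 + i); have := odd_double_half (z.1.2 + j); lia.
Qed.

Lemma zbideg_scale z j (x : zcomplex K z) :
  in_bidegree (zcol z j) (zrow z j) x -> x = zco (x : zspace K z) j *: (zbasis K z j : zcomplex K z).
Proof.
move=> /zin_bidegree xj; apply: (@zspace_eq _ z) => i il; rewrite zcoZ zco_basis il /=.
have [->|ij] := eqVneq i j; first by rewrite mulr1.
rewrite mulr0; apply: contrapT => /eqP /xj[/zbideg_inj h /h e].
by rewrite e eqxx in ij.
Qed.

Lemma has_shape_zcomplex z S : S =i zsupport z -> has_shape S (zcomplex K z).
Proof.
move=> SE; split.
- move=> p q; rewrite SE => /zsupportP[j jl [-> ->]]; exists (zbasis K z j); split.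
  + apply/eqP => /(congr1 (fun x : zspace K z => zco x j)) /eqP.
    by rewrite zco_basis zco0 jl eqxx oner_eq0.
  + exact: zbideg.
  + by move=> x /zbideg_scale xE; exists (zco (x : zspace K z) j).
- move=> p q; rewrite SE => pq x; apply: (@zspace_eq _ z) => j jl.
  rewrite zco_proj zco0 ifF //; apply: contraNF pq => /andP[/eqP <- /eqP <-].
  by apply/zsupportP; exists j.
- move=> p q; rewrite !SE => /zsupportP[j jl [-> ->]] /zsupportP[i il [/esym ic /esym ir]].
  have [iE js] := zadjacent1 ic ir; rewrite {}iE in il ic ir *.
  rewrite -ic -ir => y yb; have yE := zbideg_scale yb; rewrite ir.
  have dE (x : zcomplex K z) : in_bidegree (zcol z j) (zrow z j) x ->
      dc_d1 (zcomplex K z) x = zco (x : zspace K z) j *: (zbasis K z j.+1 : zcomplex K z).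
    move=> xb; have db := bideg_d1 xb; rewrite -ic -ir in db.
    by rewrite [LHS](zbideg_scale db) zco_d1 il zsourceS js.
  exists (zco (y : zspace K z) j.+1 *: (zbasis K z j : zcomplex K z)); split.
    have xb : in_bidegree (zcol z j) (zrow z j)
        (zco (y : zspace K z) j.+1 *: (zbasis K z j : zcomplex K z)).
      by rewrite /in_bidegree linearZ; congr (_ *: _); apply: zbideg.
    split=> //; apply: (etrans (dE _ xb)); rewrite zcoZ zco_basis jl eqxx mulr1 -yE //.
  move=> x [xb dx]; rewrite -dx [in LHS](dE _ xb) zcoZ zco_basis il eqxx mulr1.
  by rewrite -zbideg_scale.
move=> p q; rewrite !SE => /zsupportP[j jl [-> ->]] /zsupportP[i il [/esym ic /esym ir]].
have [jE js] := zadjacent2 ic ir; rewrite {}jE in jl ic ir js *.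
rewrite -ic -ir => y yb; have yE := zbideg_scale yb; rewrite ic.
have dE (x : zcomplex K z) : in_bidegree (zcol z i.+1) (zrow z i.+1) x ->
    dc_d2 (zcomplex K z) x = zco (x : zspace K z) i.+1 *: (zbasis K z i : zcomplex K z).
  move=> xb; have db := bideg_d2 xb; rewrite -ic -ir in db.
  by rewrite [LHS](zbideg_scale db) zco_d2 il; move: js; rewrite zsourceS => ->.
exists (zco (y : zspace K z) i *: (zbasis K z i.+1 : zcomplex K z)); split.
  have xb : in_bidegree (zcol z i.+1) (zrow z i.+1)
      (zco (y : zspace K z) i *: (zbasis K z i.+1 : zcomplex K z)).
    by rewrite /in_bidegree linearZ; congr (_ *: _); apply: zbideg.
  split=> //; apply: (etrans (dE _ xb)); rewrite zcoZ zco_basis jl eqxx mulr1 -yE //.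
move=> x [xb dx]; rewrite -dx [in LHS](dE _ xb) zcoZ zco_basis il eqxx mulr1.
by rewrite -zbideg_scale.
Qed.

(** Exchanging the two differentials reverses the numbering, so the new data are read off at the
    last element. The first coordinate is diminished by one when that element is a target, because
    [zcol] adds it back there. *)
Definition ztranspose z : zigzag :=
  let j := (zlen z).-1 in
  (zrow z j - (~~ zsource z j)%:Z, zcol z j, ~~ zsource z j, zlen z).

Lemma ztransposeP z j : (j < zlen z)%N ->
  [/\ zcol (ztranspose z) j = zrow z ((zlen z).-1 - j),
      zrow (ztranspose z) j = zcol z ((zlen z).-1 - j) &
      zsource (ztranspose z) j = zsource z ((zlen z).-1 - j)].
Proof.
move: z => [[[P Q] b] n]; rewrite /zlen /= => jn.
rewrite /zcol /zrow /zsource /zpar /ztranspose /zcol /zrow /zsource /zpar /zlen /= !uphalf_half.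
have := odd_double_half (b + n.-1); have := odd_double_half (b + (n.-1 - j)).
set c := ~~ ~~ _; have := odd_double_half (c + j).
by rewrite {}/c; split; lia.
Qed.

Definition zrev_fun z z' (x : zspace K z) : zspace K z' :=
  zmk z' (fun j => zco x ((zlen z).-1 - j)).

Lemma zrev_linear z z' : linear (@zrev_fun z z').
Proof.
move=> a x y; apply: zspace_eq => j jl; rewrite zcoD zcoZ !zcoE jl.
by rewrite zcoD zcoZ.
Qed.

Lemma ztranspose_iso z : exists (f : {linear zcomplex K (ztranspose z) -> transpose (zcomplex K z)})
    (g : {linear transpose (zcomplex K z) -> zcomplex K (ztranspose z)}),
  [/\ dc_morphism f, cancel f g & cancel g f].
Proof.
pose f : {linear zcomplex K (ztranspose z) -> transpose (zcomplex K z)} :=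
  mklin (@zrev_linear (ztranspose z) z).
pose g : {linear transpose (zcomplex K z) -> zcomplex K (ztranspose z)} :=
  mklin (@zrev_linear z (ztranspose z)).
have fco x j : (j < zlen z)%N -> zco (f x : zspace K z) j = zco (x : zspace K (ztranspose z)) ((zlen z).-1 - j).
  by move=> jl; rewrite /f /= zcoE jl.
have gco x j : (j < zlen z)%N -> zco (g x : zspace K (ztranspose z)) j = zco (x : zspace K z) ((zlen z).-1 - j).
  by move=> jl; rewrite /g /= zcoE jl.
exists f, g; split.
- have lt j : (j < zlen z)%N -> ((zlen z).-1 - j < zlen z)%N by lia.
  have kk j : (j < zlen z)%N -> ((zlen z).-1 - ((zlen z).-1 - j) = j)%N by lia.
  split=> [p q x|x|x]; apply: (@zspace_eq _ z) => j jl; rewrite fco //.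
  + rewrite [LHS]zco_proj [RHS]zco_proj fco //.
    by have [-> -> _] := ztransposeP (lt _ jl); rewrite kk // andbC.
  + rewrite [LHS]zco_d1 [RHS]zco_d2 jl; have [_ _ ->] := ztransposeP (lt _ jl).
    rewrite kk // [zlen (ztranspose z)]/(zlen z) lt //=.
    case: (zsource z j) => //=; case: ifPn => h.
      by rewrite fco; [congr (zco _ _); lia | lia].
    by rewrite zco_out //; lia.
  + rewrite [LHS]zco_d2 [RHS]zco_d1 jl; have [_ _ ->] := ztransposeP (lt _ jl).
    rewrite kk // [zlen (ztranspose z)]/(zlen z) lt //=.
    case: (zsource z j) => //=; case: ifPn => h.
      by rewrite fco; [congr (zco _ _); lia | lia].
    by rewrite zco_out //= /zlen /=; move: h jl; rewrite /zlen; lia.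
- move=> x; apply: (@zspace_eq _ (ztranspose z)) => j; rewrite -[zlen _]/(zlen z) => jl.
  by rewrite gco // fco; [congr (zco _ _); lia | lia].
- move=> x; apply: (@zspace_eq _ z) => j jl; rewrite fco // gco; last by lia.
  by congr (zco _ _); lia.
Qed.

Lemma zlen_transpose z : zlen (ztranspose z) = zlen z. Proof. by []. Qed.

End ZigzagShape.

(** * Homotopies and models of zigzags *)

Section ZigzagModels.
Variable K : fieldType.
Implicit Type z : zigzag.

(* The alternating sums [x_(j-1) - x_(j-3) + x_(j-5) - ...]. *)
Fixpoint altsum (x : nat -> K) (j : nat) : K :=
  if j is j'.+1 then x j' - (if j' is j''.+1 then altsum x j'' else 0) else 0.

Lemma altsumSS x j : altsum x j.+2 = x j.+1 - altsum x j. Proof. by []. Qed.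

Lemma nat_ind2 (P : nat -> Prop) : P 0%N -> P 1%N -> (forall n, P n -> P n.+2) -> forall n, P n.
Proof.
move=> P0 P1 PS n; suff [] : P n /\ P n.+1 by [].
by elim: n => [//|n [h1 h2]]; split=> //; apply: PS.
Qed.

Lemma altsum_linear a x y j : altsum (fun i => a * x i + y i) j = a * altsum x j + altsum y j.
Proof.
elim/nat_ind2: j => [||j IHj]; rewrite ?altsumSS /= ?mulr0 ?addr0 ?subr0 // IHj.
by rewrite mulrBr opprD addrACA.
Qed.

Lemma eq_altsum x y j : x =1 y -> altsum x j = altsum y j.
Proof. by move=> xy; elim/nat_ind2: j => [||j IHj]; rewrite ?altsumSS /= ?xy // IHj. Qed.

Lemma altsum0 x j : (forall i, (i < j)%N -> odd (i + j) -> x i = 0) -> altsum x j = 0.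
Proof.
elim/nat_ind2: j => [//|h|j IHj h]; first by rewrite /= subr0 h.
rewrite altsumSS h //; last by rewrite addnS oddS addnn odd_double.
rewrite IHj ?subrr // => i ij oi; apply: h; first by lia.
by rewrite !addnS /= negbK.
Qed.

Lemma altsum_supp x j : altsum x j != 0 -> exists i, [/\ (i < j)%N, odd (i + j) & x i != 0].
Proof.
move=> n; apply: contrapT => h; case/eqP: n; apply: altsum0 => i ij oi.
by apply: contrapT => /eqP xi; apply: h; exists i.
Qed.

Variable z : zigzag.
Let n := zlen z.
Let Z := zcomplex K z.

Definition zco' (x : Z) (j : nat) : K := zco (x : zspace K z) j.

Lemma zsource_total j : zcol z j + zrow z j = z.1.1.1 + z.1.1.2 + (~~ zsource z j)%:Z.
Proof. rewrite /zcol /zrow /zsource uphalf_half; lia. Qed.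

Lemma zcol_le i j : (i <= j)%N -> zcol z i <= zcol z j.
Proof. rewrite /zcol /zpar => ij; have := uphalf_leq (leq_add (leqnn z.1.2) ij); lia. Qed.

Lemma zco_total (x : Z) j : (j < n)%N -> zco' (dc_total x) j =
  if ~~ zsource z j then (if j is i.+1 then zco' x i else 0) + zco' x j.+1 else 0.
Proof.
move=> jn; rewrite /zco' /dc_total zcoD zco_d1 zco_d2 jn.
by case: j jn => [|j] jn /=; rewrite ?andbF ?andbT; case: (zsource z _); rewrite /= ?addr0.
Qed.

Lemma zfiltration i m d (x : Z) : filtration i m d x <->
  forall j, zco' x j != 0 -> zcol z j + zrow z j = d /\ m <= (if i then zrow z j else zcol z j).
Proof.
split=> [xF j xj|h p q pq].
  apply: contrapT => nP.
  have /xF : ~~ ((zcol z j + zrow z j == d) && (m <= (if i then zrow z j else zcol z j))).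
    by apply/negP => /andP[/eqP e1 e2]; apply: nP.
  move/(congr1 (fun x : Z => zco' x j)); rewrite /zco' zco_proj !eqxx zco0 => /eqP.
  by rewrite (negbTE xj).
apply: (@zspace_eq _ z) => j jl; rewrite zco_proj zco0.
case: ifP => // /andP[/eqP e1 /eqP e2]; apply: contrapT => /eqP /h[e3 e4].
by rewrite e1 e2 in e3 e4; rewrite e3 eqxx e4 in pq.
Qed.

Lemma zhomogeneous d (x : Z) : homogeneous d x <->
  forall j, zco' x j != 0 -> zcol z j + zrow z j = d.
Proof.
split=> [xF j xj|h p q pq].
  apply: contrapT => /eqP /xF/(congr1 (fun x : Z => zco' x j)).
  by rewrite /zco' zco_proj !eqxx zco0 => /eqP; rewrite (negbTE xj).
apply: (@zspace_eq _ z) => j jl; rewrite zco_proj zco0.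
case: ifP => // /andP[/eqP e1 /eqP e2]; apply: contrapT => /eqP /h e3.
by rewrite -e1 -e2 e3 eqxx in pq.
Qed.

(** The coefficients solve [d y = x] at the targets, from left to right: a target receives the sum
    of the coefficients of its two neighbouring sources, so each source is determined by the
    previous one. *)
Definition zhtpy_fun (x : Z) : Z :=
  zmk z (fun j => if zsource z j then altsum (zco' x) j else 0).

Lemma zhtpy_linear : linear zhtpy_fun.
Proof.
move=> a x y; apply: (@zspace_eq _ z) => j jl; rewrite zcoD zcoZ !zcoE jl.
case: ifP => _; rewrite ?mulr0 ?addr0 // -altsum_linear; apply: eq_altsum => i.
by rewrite /zco' zcoD zcoZ.
Qed.

Definition zhtpy : {linear Z -> Z} := mklin zhtpy_linear.

Lemma zco_htpy x j : zco' (zhtpy x) j =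
  if (j < n)%N && zsource z j then altsum (zco' x) j else 0.
Proof. by rewrite /zco' zcoE; case: ifP. Qed.

(** When [e_0] is a source, the boundary of this alternating sum cancels at every target that has a
    source on both sides; only a target at the right end can survive. *)
Definition zhead : Z := zmk z (fun j => if zsource z j then (-1) ^+ j./2 else 0).
Definition ztail : Z := zbasis K z n.-1.

Lemma zco_head j : zco' zhead j = if (j < n)%N && zsource z j then (-1) ^+ j./2 else 0.
Proof. by rewrite /zco' zcoE; case: ifP. Qed.

Lemma altsum_total (x : Z) j : (j <= n)%N -> zsource z j ->
  altsum (zco' (dc_total x)) j =
  zco' x j - (if zsource z 0 then (-1) ^+ j./2 * zco' x 0 else 0).
Proof.
elim/nat_ind2: j => [_ s0|n1 s1|j IHj jn].
- by rewrite s0 /= expr0 mul1r subrr.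
- move: (s1); rewrite zsourceS => /negbTE s0.
  by rewrite /= subr0 zco_total // s0 /= add0r subr0.
rewrite !zsourceS => /negPn sj; rewrite altsumSS IHj //; last by lia.
rewrite zco_total // zsourceS sj /= opprB addrC addrA subrK addrC; congr (_ + _).
by case: ifP => _; rewrite ?oppr0 // exprS mulN1r mulNr opprK.
Qed.

(** The homotopy can fail only at the two ends: on the left when the first element is a source,
    since nothing maps onto it, and on the right when the last element is a target, since no later
    source corrects it. The four combinations of ends give all the models of zigzags. *)
Lemma zhtpyE (x : Z) : dc_total (zhtpy x) + zhtpy (dc_total x) =
  x - ((if zsource z 0 then zco' x 0 else 0) *: zhead +
       (if ~~ zsource z n.-1 then altsum (zco' x) n else 0) *: ztail).
Proof.
apply: (@zspace_eq _ z) => j; rewrite -/n => jn.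
have co (u : Z) : zco (u : zspace K z) j = zco' u j by [].
have rhs c d : zco' (c *: zhead + d *: ztail) j = c * zco' zhead j + d * zco' ztail j.
  by rewrite /zco' zcoD !zcoZ.
rewrite [LHS]zcoD [RHS]zcoD zcoN !co rhs zco_head jn zco_total // (zco_htpy (dc_total x) j) jn.
rewrite [zco' ztail j]zco_basis jn /=.
have [sj|sj] := boolP (zsource z j); rewrite /=.
  rewrite altsum_total ?(ltnW jn) // add0r; have [jE|jE] := eqVneq j n.-1.
    by rewrite -jE sj mul0r addr0; case: ifP; rewrite ?mul0r // mulrC.
  by rewrite mulr0 addr0; case: ifP; rewrite ?mul0r // mulrC.
rewrite addr0 mulr0 add0r.
have -> : (if j is i.+1 then zco' (zhtpy x) i else 0) =
    (if j is i.+1 then altsum (zco' x) i else 0).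
  case: j jn sj {co rhs} => [//|i] jn; rewrite zsourceS => /negPn si.
  by rewrite zco_htpy si (ltn_trans _ jn).
rewrite zco_htpy zsourceS sj andbT.
have sumE : altsum (zco' x) j.+1 = zco' x j - (if j is i.+1 then altsum (zco' x) i else 0) by [].
have [jE|jE] := eqVneq j n.-1.
  have -> : (j.+1 < n)%N = false by lia.
  have nE : n = j.+1 by lia.
  by rewrite -jE sj addr0 mulr1 nE sumE subKr.
have -> : (j.+1 < n)%N by lia.
by rewrite mulr0 subr0 sumE addrC subrK.
Qed.

Lemma zhtpy_lowers : lowers zhtpy.
Proof.
move=> d x /zhomogeneous xd; apply/zhomogeneous => j; rewrite zco_htpy.
case: ifP => [/andP[jn sj]|]; last by rewrite eqxx.
case/altsum_supp=> i [ij oij /xd]; rewrite !zsource_total sj.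
suff -> : zsource z i = false by lia.
by move: sj oij; rewrite /zsource /zpar !oddD; case: odd; case: odd; case: odd.
Qed.

Lemma zhtpy_filtration m d x : filtration false m d x -> filtration false m (d - 1) (zhtpy x).
Proof.
move=> xF; have hl := zhtpy_lowers (filtration_homogeneous xF); move/zfiltration: xF => xF.
apply/zfiltration => j xj; split; first by move/zhomogeneous: hl; apply.
move: xj; rewrite zco_htpy; case: ifP => [/andP[jn sj]|]; last by rewrite eqxx.
case/altsum_supp=> i [ij _ /xF[_ mi]].
by apply: le_trans mi _; apply: zcol_le; apply: ltnW.
Qed.

End ZigzagModels.

Section ZigzagModelList.
Variable K : fieldType.
Variable z : zigzag.
Let n := zlen z.
Let Z := zcomplex K z.
Hypothesis n0 : (0 < n)%N.
Let N := z.1.1.1 + z.1.1.2.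

Lemma zfirst_linear : linear (fun x : Z => zco' x 0 : K^o).
Proof. exact: zco_linear. Qed.

Lemma zlast_linear : linear (fun x : Z => zco' x n.-1 : K^o).
Proof. exact: zco_linear. Qed.

Lemma zalt_linear : linear (fun x : Z => altsum (zco' x) n : K^o).
Proof.
move=> a x y; rewrite -[RHS]altsum_linear; apply: eq_altsum => i.
by rewrite /zco' zcoD zcoZ.
Qed.

Definition zfirst : {linear Z -> K^o} := mklin zfirst_linear.
Definition zlast : {linear Z -> K^o} := mklin zlast_linear.
Definition zalt : {linear Z -> K^o} := mklin zalt_linear.

Let head : Z := zhead K z.
Let tail : Z := ztail K z.

Lemma zhead_filtration : zsource z 0 -> filtration false (zcol z 0) N head.
Proof.
move=> s0; apply/zfiltration => j; rewrite zco_head; case: ifP => [/andP[_ sj] _|]; last by rewrite eqxx.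
by rewrite zsource_total sj addr0; split=> //; apply: zcol_le.
Qed.

Lemma ztail_filtration : ~~ zsource z n.-1 -> filtration false (zcol z n.-1) (N + 1) tail.
Proof.
move=> s1; apply/zfiltration => j; rewrite [zco' _ _]zco_basis.
case: (altP (j =P n.-1)) => [-> _|_]; last by rewrite andbF eqxx.
by split; first rewrite zsource_total s1.
Qed.

Lemma zfirst_bideg : zsource z 0 -> forall p q (x : Z), in_bidegree p q x -> zfirst x != 0 ->
  p = zcol z 0 /\ p + q = N.
Proof. by move=> s0 p q x /zin_bidegree xb /xb[<- <-]; rewrite zsource_total s0 addr0. Qed.

Lemma zalt_bideg : ~~ zsource z n.-1 -> forall p q (x : Z), in_bidegree p q x -> zalt x != 0 ->
  p <= zcol z n.-1 /\ p + q = N + 1.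
Proof.
move=> s1 p q x /zin_bidegree xb /altsum_supp[i [ilt oi /xb[<- <-]]].
split; first by apply: zcol_le; lia.
have -> : zcol z i + zrow z i = N + (~~ zsource z i)%:Z by apply: zsource_total.
have -> : zsource z i = zsource z n.-1; last by rewrite s1.
have nE : n = n.-1.+1 by lia.
by move: oi; rewrite nE /zsource /zpar !oddD /=; case: odd; case: odd; case: odd.
Qed.

Lemma zalt_tail : zalt tail = 1.
Proof.
rewrite /= (_ : altsum _ _ = altsum (zco' tail) n.-1.+1); last by congr altsum; lia.
have tE i : (i < n)%N -> zco' tail i = (i == n.-1)%:R.
  by move=> il; rewrite [zco' _ _]zco_basis il.
case En : (n.-1) => [|m] /=; first by rewrite tE // En eqxx subr0.
rewrite altsum0 ?subr0; first by rewrite tE ?En ?eqxx //; lia.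
by move=> i im _; rewrite tE ?En; [case: eqP => //; lia | lia].
Qed.

Lemma zalt_head : ~~ zsource z n.-1 -> zalt head = 0.
Proof.
move=> s1; apply: altsum0 => i il oi; rewrite zco_head il.
suff -> : zsource z i = false by [].
have nE : n = n.-1.+1 by lia.
by apply: negbTE; move: oi s1; rewrite -/n {1}nE /zsource /zpar !oddD /=; case: odd; case: odd; case: odd.
Qed.

Lemma zfirst_head : zsource z 0 -> zfirst head = 1.
Proof. by move=> s0; rewrite /= zco_head n0 s0. Qed.

Lemma zfirst_tail : (1 < n)%N -> zfirst tail = 0.
Proof.
move=> n1; rewrite /= [zco' _ _]zco_basis; case: eqP => [e|]; last by rewrite andbF.
by have : (1 < n)%N by []; lia.
Qed.

Lemma zsource_head_total j : (j < n)%N -> zsource z 0 -> zco' (dc_total head) j =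
  if ~~ zsource z j && (j.+1 == n) then (-1) ^+ (j.-1)./2 else 0.
Proof.
move=> jn s0; rewrite zco_total //; case: ifPn => //= sj.
case: j jn sj => [|j] jn; first by rewrite s0.
rewrite zsourceS => /negPn sj; rewrite !zco_head -/n (ltnW jn) sj !zsourceS sj andbT.
have [e|ne] := eqVneq j.+2 n; first by rewrite -e ltnn addr0.
have -> : (j.+2 < n)%N by move: jn ne; lia.
by rewrite /= exprS mulN1r subrr.
Qed.

Lemma ztail_total : ~~ zsource z n.-1 -> dc_total tail = 0.
Proof.
move=> s1; apply: (@zspace_eq _ z) => j jn.
rewrite -[LHS]/(zco' (dc_total tail) j) zco_total // zco0.
case: ifPn => // sj.
have t0 i : zsource z i -> zco' tail i = 0.
  move=> si; rewrite [zco' _ _]zco_basis; case: eqP => [e|]; rewrite ?andbF //.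
  by rewrite -e si in s1.
rewrite t0 ?zsourceS ?sj // addr0.
by case: j sj {jn} => [//|j]; rewrite zsourceS => /negPn /t0.
Qed.

Lemma zcolumn_model_head k : zsource z 0 -> zsource z n.-1 ->
  column_model k Z (fun _ : unit => (zcol z 0, N)).
Proof.
move=> s0 s1; exists (fun=> head), (fun=> zfirst), (zhtpy K z).
have dh : dc_total head = 0.
  apply: (@zspace_eq _ z) => j jn; rewrite -[LHS]/(zco' (dc_total head) j).
  rewrite zsource_head_total // zco0; case: ifP => // /andP[sj /eqP e].
  by rewrite -/n -e /= (negbTE sj) in s1.
split=> [_|_ p q x xb|[] []||x] /=.
- split; first exact: zhead_filtration.
  by rewrite dh; apply: (subspace0 (@filtration_subspace _ _ _ _ _)).
- by move=> /(zfirst_bideg s0 xb)[-> ->].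
- exact: zfirst_head.
- split; first exact: zhtpy_lowers.
  by move=> m d x /zhtpy_filtration h; apply: (filtration_le h); lia.
- by rewrite zhtpyE // s0 s1 scale0r addr0 (big_pred1 tt) //; case.
Qed.

Lemma zcolumn_model_tail k : ~~ zsource z 0 -> ~~ zsource z n.-1 ->
  column_model k Z (fun _ : unit => (zcol z n.-1, N + 1)).
Proof.
move=> s0 s1; exists (fun=> tail), (fun=> zalt), (zhtpy K z).
split=> [_|_ p q x xb|[] []||x] /=.
- split; first exact: ztail_filtration.
  by rewrite ztail_total //; apply: (subspace0 (@filtration_subspace _ _ _ _ _)).
- exact: (zalt_bideg s1 xb).
- exact: zalt_tail.
- split; first exact: zhtpy_lowers.
  by move=> m d x /zhtpy_filtration h; apply: (filtration_le h); lia.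
- by rewrite zhtpyE // (negbTE s0) s1 scale0r add0r (big_pred1 tt) //; case.
Qed.

Lemma zcolumn_model_acyclic k : ~~ zsource z 0 -> zsource z n.-1 ->
  column_model k Z (fun x : void => of_void _ x).
Proof.
move=> s0 s1; exists (fun x => of_void _ x), (fun x => of_void _ x), (zhtpy K z).
split=> [[]|[]|[]||x] //=.
  split; first exact: zhtpy_lowers.
  by move=> m d x /zhtpy_filtration h; apply: (filtration_le h); lia.
by rewrite zhtpyE // (negbTE s0) s1 !scale0r addr0 big_pred0 //; case.
Qed.

(** An even zigzag starting in a source carries one nonzero differential of the column spectral
    sequence, from its first column to its last, which is [n./2] columns further. *)
Lemma zhead_tail : zsource z 0 -> ~~ zsource z n.-1 ->
  [/\ (1 < n)%N, zcol z n.-1 = zcol z 0 + (n./2)%:Z &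
      dc_total head = (-1) ^+ (n./2).-1 *: tail].
Proof.
move=> s0 s1; have n1 : (1 < n)%N.
  by case E : n n0 => [|[|m]] // _; rewrite E /= s0 in s1.
have on : odd n = false.
  rewrite -(prednK n0) oddS; move: s0 s1; rewrite -/n /zsource /zpar !oddD /=.
  by case: (odd z.1.2); case: (odd n.-1).
split=> //.
  move: s0 s1; rewrite /zcol /zsource /zpar !uphalf_half !oddD addn0 => s0 s1.
  have := odd_double_half n; have := odd_double_half (z.1.2 + n.-1).
  have := odd_double_half (z.1.2); rewrite oddD on; move: s0 s1.
  by case: (odd z.1.2); case: (odd n.-1) => //= _ _; lia.
apply: (@zspace_eq _ z) => j; rewrite -/n => jn.
rewrite -[LHS]/(zco' (dc_total head) j) zsource_head_total // zcoZ zco_basis jn /=.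
have [e|ne] := eqVneq j n.-1; last first.
  by rewrite mulr0 ifF //; apply/negbTE; rewrite negb_and; apply/orP; right; lia.
rewrite {}e s1 mulr1 (_ : n.-1.+1 == n); last by lia.
by congr (_ ^+ _); lia.
Qed.

Lemma zcolumn_model_arrow k : zsource z 0 -> ~~ zsource z n.-1 -> (k.+1 <= n./2)%N ->
  column_model k Z (fun b : bool => if b then (zcol z n.-1, N + 1) else (zcol z 0, N)).
Proof.
move=> s0 s1 kn; have [n1 cE dE] := zhead_tail s0 s1.
exists (fun b => if b then tail else head), (fun b : bool => if b then zalt else zfirst), (zhtpy K z).
split=> [[] /=|[] p q x xb /=|[] []||x].
- split; first exact: ztail_filtration.
  by rewrite ztail_total //; apply: (subspace0 (@filtration_subspace _ _ _ _ _)).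
- split; first exact: zhead_filtration.
  rewrite dE; apply: (subspaceZ (@filtration_subspace _ _ _ _ _)).
  by apply: (filtration_le (ztail_filtration s1)); rewrite cE; lia.
- exact: (zalt_bideg s1 xb).
- by move=> /(zfirst_bideg s0 xb)[-> ->].
- exact: zalt_tail.
- exact: zalt_head.
- exact: zfirst_tail.
- exact: zfirst_head.
- split; first exact: zhtpy_lowers.
  by move=> m d x /zhtpy_filtration h; apply: (filtration_le h); lia.
- by rewrite zhtpyE // s0 s1 big_bool [in LHS](addrC (_ *: zhead K z)).
Qed.

(** On a page after the differential, head and tail cancel. The extra term of the homotopy maps the
    tail back to a multiple of the head and lowers the filtration by [n./2], which is allowed
    because [n./2 <= k]; the sign [c] is its own inverse. *)
Lemma zcolumn_model_arrow0 k : zsource z 0 -> ~~ zsource z n.-1 -> (n./2 <= k)%N ->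
  column_model k Z (fun x : void => of_void _ x).
Proof.
move=> s0 s1 kn; have [n1 cE dE] := zhead_tail s0 s1.
pose c : K := (-1) ^+ (n./2).-1.
have cc : c * c = 1 by rewrite /c -exprD addnn -mul2n exprM sqrrN !expr1n.
have hL : linear (fun x : Z => zhtpy K z x + (c * zalt x) *: head).
  move=> a x y; rewrite (linearP (zhtpy K z)) (linearP zalt) scalerDr mulrDr scalerDl.
  by rewrite scalerA mulrCA addrACA.
exists (fun x => of_void _ x), (fun x => of_void _ x), (mklin hL).
have altF m d (x : Z) : filtration false m d x -> zalt x != 0 -> m <= zcol z n.-1 /\ d = N + 1.
  exact: (@functional_filtration K Z zalt false _ _ (zalt_bideg s1)).
have hF m d x : filtration false m d x -> filtration false (m - k%:Z) (d - 1) (mklin hL x).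
  move=> xF; rewrite -[mklin hL x]/(zhtpy K z x + (c * zalt x) *: head).
  apply: (subspaceD (@filtration_subspace _ _ _ _ _)).
    by apply: (filtration_le (zhtpy_filtration xF)); lia.
  have [->|ax] := eqVneq (zalt x) 0.
    by rewrite mulr0 scale0r; apply: (subspace0 (@filtration_subspace _ _ _ _ _)).
  apply: (subspaceZ (@filtration_subspace _ _ _ _ _)); have [h1 ->] := altF _ _ _ xF ax.
  by rewrite addrK; apply: (filtration_le (zhead_filtration s0)); lia.
split=> [[]|[]|[]||x] //.
- split=> // d x xd; have [L LF] := bounded_filtration_full (zcomplex_bounded K z).
  by apply: filtration_homogeneous (hF L _ _ _); apply: LF.
- rewrite big_pred0 ?subr0 /=; last by case.
  rewrite dc_totalD addrACA zhtpyE // s0 s1 [dc_total (_ *: head)]linearZ /= dE scalerA.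
  have -> : altsum (zco' (dc_total x)) n = c * zco' x 0.
    rewrite altsum_total // ?s0; last by rewrite -/n -(prednK n0) zsourceS.
    rewrite {1}/zco' zco_out // sub0r -mulNr /c; congr (_ * _).
    by rewrite -[in LHS](prednK (n := n./2)) ?exprS ?mulN1r ?opprK //; lia.
  rewrite mulrA cc mul1r (mulrC c (zalt x)) -mulrA cc mulr1.
  by rewrite (addrC (zco' x 0 *: _)) subrK.
Qed.

Lemma zbifiltered_model_head : zsource z 0 -> zsource z n.-1 ->
  bifiltered_model Z (fun _ : unit => (zcol z 0, zrow z n.-1, N)).
Proof.
(* The head class has its column degree at the first element and its row degree at the last one. The
   coefficient there is [a], so [a] times the last coordinate is the functional dual for rows. *)
move=> s0 s1; pose a : K := (-1) ^+ (n.-1)./2.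
have aa : a * a = 1 by rewrite /a -exprD addnn -mul2n exprM sqrrN !expr1n.
have lL : linear (fun x : Z => a * zlast x : K^o).
  by move=> b x y; rewrite linearP mulrDr /= mulrCA.
exists (fun=> head), (fun=> head), (fun=> 0), (fun=> zfirst), (fun=> mklin lL), (zhtpy K z).
have dh : dc_total head = 0.
  apply: (@zspace_eq _ z) => j jn; rewrite -[LHS]/(zco' (dc_total head) j).
  rewrite zsource_head_total // zco0; case: ifP => // /andP[sj /eqP e].
  by rewrite -/n -e /= (negbTE sj) in s1.
have n1 : (n.-1 < n)%N by rewrite prednK.
split=> [_|_ p q x xb|_ x|[] []|] /=.
- rewrite subrr linear0; split=> //; first exact: zhead_filtration.
  apply/zfiltration => j; rewrite zco_head -/n; case: ifP => [/andP[jn sj] _|]; last by rewrite eqxx.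
  rewrite zsource_total sj addr0; split=> //.
  have : zcol z j <= zcol z n.-1 by apply: zcol_le; lia.
  have := zsource_total z j; have := zsource_total z n.-1; rewrite sj s1; lia.
- split; first by move=> /(zfirst_bideg s0 xb)[-> ->].
  have [->|x1 _] := eqVneq (zco' x n.-1) 0; first by rewrite mulr0 eqxx.
  move/zin_bidegree: xb => /(_ _ x1)[<- <-].
  by rewrite zsource_total s1 addr0.
- by rewrite !zco_total // s0 s1 mulr0.
- split; first exact: zfirst_head.
  by rewrite zco_head -/n n1 s1.
- split=> [|x]; first exact: zhtpy_lowers.
  by rewrite zhtpyE // s0 s1 scale0r addr0 (big_pred1 tt) //; case.
Qed.

Lemma zbifiltered_model_tail : ~~ zsource z 0 -> ~~ zsource z n.-1 ->
  bifiltered_model Z (fun _ : unit => (zcol z n.-1, zrow z 0, N + 1)).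
Proof.
move=> s0 s1; have n1 : (n.-1 < n)%N by rewrite prednK.
pose a : K := (-1) ^+ (n.-1)./2.
have aa : a * a = 1 by rewrite /a -exprD addnn -mul2n exprM sqrrN !expr1n.
pose e0 : Z := zbasis K z 0.
(* Each source makes its two neighbouring targets cohomologous up to sign. Telescoping over all
   sources links the last target, which realises the column degree, with the first one, which
   realises the row degree. *)
pose w : Z := zmk z (fun j => if zsource z j then (-1) ^+ (j.-1)./2 else 0).
have wE j : zco' w j = if (j < n)%N && zsource z j then (-1) ^+ (j.-1)./2 else 0.
  by rewrite /zco' zcoE; case: ifP.
have on : odd n.
  rewrite -(prednK n0) oddS; move: s0 s1; rewrite -/n /zsource /zpar !oddD /=.
  by case: (odd z.1.2); case: (odd n.-1).
have dw : tail - a *: e0 = dc_total (- a *: w).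
  rewrite [RHS]linearZ /=; apply: (@zspace_eq _ z) => j; rewrite -/n => jn.
  rewrite [LHS]zcoD zcoN !zcoZ -[zco (dc_total w) j]/(zco' (dc_total w) j) zco_total //.
  rewrite !zco_basis jn /= !wE -/n; case: ifPn => sj; last first.
    have j0 : j != 0%N by apply: contraNneq sj => ->.
    have jl : j != n.-1 by apply: contraNneq sj => ->.
    by rewrite (negbTE j0) (negbTE jl) !mulr0 subr0.
  case: j jn sj => [|j] jn sj.
    rewrite /= add0r zsourceS s0 andbT expr0 mulr1.
    have [e|e] := eqVneq n 1%N.
      by rewrite e /= mulr0 /a e /= expr0 subrr.
    have -> : (1 < n)%N by lia.
    have -> : (0 == n.-1)%N = false by lia.
    by rewrite mulr1 sub0r.
  rewrite zsourceS in sj; move/negPn: sj => sj; rewrite wE (ltnW jn) sj !zsourceS sj andbT mulr0 subr0.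
  have [e|ne] := eqVneq j.+1 n.-1.
    have -> : (j.+2 < n)%N = false by lia.
    rewrite addr0 mulNr /= /a -e; have -> : j = j.-1.+1.
      by case: (j) sj => [|//]; rewrite (negbTE s0).
    by rewrite /= exprS mulN1r mulNr opprK -exprD addnn -mul2n exprM sqrrN !expr1n.
  have -> : (j.+2 < n)%N by lia.
  case: j jn sj ne => [|j] jn sj ne; first by rewrite (negbTE s0) in sj.
  by rewrite /= exprS mulN1r subrr mulr0.
have ld x : zalt (dc_total x) = 0.
  rewrite /= altsum_total //; last by rewrite -/n -(prednK n0) zsourceS.
  by rewrite (negbTE s0) subr0 /zco' zco_out.
exists (fun=> tail), (fun=> a *: e0), (fun=> - a *: w), (fun=> zalt), (fun=> zalt), (zhtpy K z).
split=> [_|_ p q x xb|_ x|[] []|].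
- split=> //; first exact: ztail_filtration.
  + apply: (subspaceZ (@filtration_subspace _ _ _ _ _)); apply/zfiltration => j.
    rewrite [zco' _ _]zco_basis; have [-> _|_] := eqVneq j 0%N; last by rewrite andbF eqxx.
    by split; first rewrite zsource_total s0.
  + exact: ztail_total.
  + have -> : a *: e0 = tail - dc_total (- a *: w) by rewrite -dw subKr.
    by rewrite dc_totalB dc_totalK subr0; apply: ztail_total.
- split; first exact: (zalt_bideg s1 xb).
  move=> /[dup] /(zalt_bideg s1 xb)[_ pq] /altsum_supp[i [il _ xi]]; split=> //.
  move/zin_bidegree: xb => /(_ _ xi)[e1 e2].
  have : zcol z 0 <= zcol z i by apply: zcol_le.
  have := zsource_total z 0; rewrite s0 -/N /= => e3; lia.
- by rewrite ld.
- split; first exact: zalt_tail.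
  have -> : a *: e0 = tail - dc_total (- a *: w) by rewrite -dw subKr.
  by rewrite linearB ld subr0; apply: zalt_tail.
- split=> [|x]; first exact: zhtpy_lowers.
  by rewrite zhtpyE // (negbTE s0) s1 scale0r add0r (big_pred1 tt) //; case.
Qed.

Lemma zbifiltered_model_acyclic : zsource z 0 = ~~ zsource z n.-1 ->
  bifiltered_model Z (fun x : void => of_void _ x).
Proof.
(* With [k := n] the bound [n./2 <= k] holds, so each of the two kinds of even zigzag has an empty
   column model, whose homotopy contracts the complex. *)
move=> s01; have [v [l [h [_ _ _ [hl _] hE]]]] :
    column_model n Z (fun x : void => of_void _ x).
  have [s0|s0] := boolP (zsource z 0).
    by apply: zcolumn_model_arrow0 => //; [rewrite -s01 | lia].
  by apply: zcolumn_model_acyclic => //; rewrite s01 negbK in s0.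
exists v, v, v, l, l, h; split=> [[]|[]|[]|[]|] //.
Qed.

End ZigzagModelList.

(** * Splitting off zigzags *)

Section SubComplex.
Variables (K : fieldType) (A : dcomplex K) (S : A -> Prop).

Definition subpred (sS : subspace S) : {pred A} := fun x => `[< S x >].

Fact subpred_closed (sS : subspace S) : submod_closed (subpred sS).
Proof.
split; first by apply/asboolP; case: sS.
by move=> a x y /asboolP xS /asboolP yS; apply/asboolP; case: sS => _; apply.
Qed.

HB.instance Definition _ (sS : subspace S) :=
  GRing.isSubmodClosed.Build K A (subpred sS) (subpred_closed sS).

Record subtype_of (sS : subspace S) := SubOf {
  sub_val :> A;
  _ : sub_val \in subpred sS }.

HB.instance Definition _ sS := [isSub for @sub_val sS].
HB.instance Definition _ sS := [Choice of subtype_of sS by <:].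
HB.instance Definition _ sS := [SubChoice_isSubLmodule of subtype_of sS by <:].

Hypothesis sS : subspace S.

Lemma sub_valP (x : subtype_of sS) : S (sub_val x).
Proof. exact/asboolP/(valP x). Qed.

Definition sub_of (x : A) (xS : S x) : subtype_of sS := SubOf (asboolT xS).

Section Restriction.
Variable f : {linear A -> A}.
Hypothesis fS : forall x, S x -> S (f x).

Definition sub_map (x : subtype_of sS) : subtype_of sS := sub_of (fS (sub_valP x)).

Lemma sub_map_linear : linear sub_map.
Proof. by move=> a x y; apply: val_inj; rewrite /= linearP. Qed.
End Restriction.

Hypothesis SP : forall p q x, S x -> S (dc_proj A p q x).
Hypothesis S1 : forall x, S x -> S (dc_d1 A x).
Hypothesis S2 : forall x, S x -> S (dc_d2 A x).

Definition subcomplex : dcomplex K.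
Proof.
apply: (@DComplex K (subtype_of sS) (fun p q => mklin (@sub_map_linear _ (SP p q)))
  (mklin (@sub_map_linear _ S1)) (mklin (@sub_map_linear _ S2))).
- move=> p q p' q' x; apply: val_inj; rewrite /= dc_projM; by case: ifP.
- move=> x; have [s xE] := dc_proj_sum (sub_val x); exists s; apply: val_inj.
  by rewrite [LHS]xE raddf_sum.
- by move=> p q x; apply: val_inj; apply: dc_d1_deg.
- by move=> p q x; apply: val_inj; apply: dc_d2_deg.
- by move=> x; apply: val_inj; apply: dc_d1d1.
- by move=> x; apply: val_inj; apply: dc_d2d2.
- by move=> x; apply: val_inj; apply: dc_d1d2.
Defined.

End SubComplex.

Section SplitOff.
Variable K : fieldType.
Implicit Types A B : dcomplex K.

Lemma sub_val_linear (A : dcomplex K) (S : A -> Prop) (sS : subspace S) :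
  linear (@sub_val K A S sS).
Proof. by []. Qed.

(** The complement is the kernel of [s], a subcomplex because [s] is a morphism. *)
Lemma complement_exists A (Z : dcomplex K) (i : {linear Z -> A}) (s : {linear A -> Z}) :
  dc_morphism i -> dc_morphism s -> (forall x, s (i x) = x) ->
  exists (A' : dcomplex K) (j : {linear A' -> A}) (u : {linear A -> A'}),
  [/\ dc_morphism j, dc_morphism u, forall x, u (j x) = x, forall x, u (i x) = 0 &
    exists (f : {linear dsum Z A' -> A}) (g : {linear A -> dsum Z A'}),
      [/\ dc_morphism f, cancel f g & cancel g f]].
Proof.
move=> iM sM si; pose S x := s x = 0.
have sS : subspace S.
  by split=> [|a x y xS yS]; rewrite /S ?linear0 // linearP xS yS scaler0 addr0.
have SP p q x : S x -> S (dc_proj A p q x) by rewrite /S (morph_proj sM) => ->; rewrite linear0.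
have S1 x : S x -> S (dc_d1 A x) by rewrite /S (morph_d1 sM) => ->; rewrite linear0.
have S2 x : S x -> S (dc_d2 A x) by rewrite /S (morph_d2 sM) => ->; rewrite linear0.
pose A' := subcomplex sS SP S1 S2.
pose j : {linear A' -> A} := mklin (@sub_val_linear A S sS).
have uS x : S (x - i (s x)) by rewrite /S linearB si subrr.
have uL : linear (fun x => sub_of sS (uS x) : A').
  move=> a x y; apply: val_inj => /=.
  by rewrite (linearP s) (linearP i) scalerBr opprD addrACA.
pose u : {linear A -> A'} := mklin uL.
have jM : dc_morphism j by split.
have js x : s (j x) = 0 by apply: (sub_valP x).
exists A', j, u; split=> //.
- by split=> [p q x|x|x]; apply: val_inj; rewrite /= ?linearB /= ?(morph_proj sM, morph_d1 sM, morph_d2 sM)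
    ?(morph_proj iM, morph_d1 iM, morph_d2 iM).
- by move=> x; apply: val_inj => /=; have := js x; rewrite /= => ->; rewrite linear0 subr0.
- by move=> x; apply: val_inj => /=; rewrite si subrr.
have fL : linear (fun x : dsum Z A' => i x.1 + j x.2).
  by move=> a x y; rewrite (linearP i) (linearP j) scalerDr addrACA.
have gL : linear (fun x => (s x, u x) : dsum Z A').
  by move=> a x y; congr pair; apply: linearP.
exists (mklin fL), (mklin gL); split.
- split=> [p q [x y]|[x y]|[x y]] /=; rewrite linearD /=.
  + by rewrite (morph_proj iM).
  + by rewrite (morph_d1 iM).
  + by rewrite (morph_d2 iM).
- move=> [x y]; congr pair; first by rewrite linearD /= si [s _](js y) addr0.
  apply: val_inj => /=; rewrite linearD si /=.
  by have := js y; rewrite /= => ->; rewrite addr0 addrC addKr.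
- by move=> x /=; rewrite addrC subrK.
Qed.

Lemma zbasis_ext z (V : lmodType K) (f g : {linear zcomplex K z -> V}) :
  (forall k, (k < zlen z)%N -> f (zbasis K z k) = g (zbasis K z k)) -> forall x, f x = g x.
Proof.
move=> fg x; have -> : x = \sum_(k < zlen z) zco (x : zspace K z) k *: (zbasis K z k : zcomplex K z).
  apply: (@zspace_eq _ z) => j jn; rewrite zco_sum (bigD1 (Ordinal jn)) //=.
  rewrite zcoZ zco_basis jn eqxx mulr1 big1 ?addr0 // => k kj.
  rewrite zcoZ zco_basis jn /= (_ : (j == k) = false) ?mulr0 //.
  by apply: contraNF kj => /eqP e; apply/eqP/val_inj.
rewrite !linear_sum; apply: eq_bigr => k _; rewrite !linearZ; congr (_ *: _).
exact: fg.
Qed.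

Lemma zbasis_d1 z k : (k < zlen z)%N -> dc_d1 (zcomplex K z) (zbasis K z k) =
  if zsource z k && (k.+1 < zlen z)%N then zbasis K z k.+1 else 0.
Proof.
move=> kn; apply: (@zspace_eq _ z) => -[|j] jn; rewrite [LHS]zco_d1 jn /=.
  by rewrite andbF; case: ifP; rewrite ?zco_basis ?zco0 ?andbF.
rewrite zsourceS andbT zco_basis; have [jk|ne] := eqVneq j k.
  by rewrite jk in jn *; rewrite jn kn andbT; case: (zsource z k); rewrite /= ?zco0 // zco_basis jn eqxx.
by rewrite andbF if_same; case: ifP => _; rewrite ?zco0 // zco_basis eqSS (negbTE ne) andbF.
Qed.

Lemma zbasis_d2 z k : (k < zlen z)%N -> dc_d2 (zcomplex K z) (zbasis K z k) =
  if zsource z k && (0 < k)%N then zbasis K z k.-1 else 0.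
Proof.
case: k => [|k] kn; apply: (@zspace_eq _ z) => j jn; rewrite [LHS]zco_d2 jn /=.
  by rewrite andbF zco0 zco_basis andbF if_same.
rewrite andbT zsourceS zco_basis eqSS; have [->|ne] := eqVneq j k.
  by rewrite kn; case: (zsource z k); rewrite /= ?zco0 // zco_basis (ltnW kn) eqxx.
by rewrite andbF if_same; case: ifP => _; rewrite ?zco0 // zco_basis (negbTE ne) andbF.
Qed.

Lemma zbasis_proj z p q k : dc_proj (zcomplex K z) p q (zbasis K z k) =
  if (p == zcol z k) && (q == zrow z k) then zbasis K z k else 0.
Proof. exact: (dc_proj_bideg _ _ (@zbideg K z k)). Qed.

(** The [x j] map the zigzag into [A], and the [f j] are the coordinates of a map back. Their
    conditions are dual and force the number [f j (x j)] to be the same for all [j]; one nonzero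
    value therefore suffices, and dividing by it gives a retraction. *)
Lemma zigzag_split A z (x : nat -> A) (f : nat -> {linear A -> K^o}) j0 :
  (forall j, (j < zlen z)%N -> in_bidegree (zcol z j) (zrow z j) (x j)) ->
  (forall j, (j < zlen z)%N -> zsource z j ->
     dc_d1 A (x j) = (if (j.+1 < zlen z)%N then x j.+1 else 0) /\
     dc_d2 A (x j) = (if (0 < j)%N then x j.-1 else 0)) ->
  (forall j, (j < zlen z)%N -> ~~ zsource z j -> dc_d1 A (x j) = 0 /\ dc_d2 A (x j) = 0) ->
  (forall j y, (j < zlen z)%N -> f j (dc_proj A (zcol z j) (zrow z j) y) = f j y) ->
  (forall j y, (j < zlen z)%N -> ~~ zsource z j ->
     f j (dc_d1 A y) = (if (0 < j)%N then f j.-1 y else 0) /\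
     f j (dc_d2 A y) = (if (j.+1 < zlen z)%N then f j.+1 y else 0)) ->
  (forall j y, (j < zlen z)%N -> zsource z j -> f j (dc_d1 A y) = 0 /\ f j (dc_d2 A y) = 0) ->
  (j0 < zlen z)%N -> f j0 (x j0) != 0 ->
  exists (i : {linear zcomplex K z -> A}) (s : {linear A -> zcomplex K z}),
    [/\ dc_morphism i, dc_morphism s & forall u, s (i u) = u].
Proof.
move=> xb xs xt fb ft fs j0n c0; pose n := zlen z.
have step j : (j.+1 < n)%N -> f j (x j) = f j.+1 (x j.+1).
  move=> jn; have jn' := ltnW jn; have [sj|tj] := boolP (zsource z j).
    have [d1x _] := xs j jn' sj; rewrite jn in d1x; rewrite -d1x.
    by have [-> _] := ft j.+1 (x j) jn ltac:(by rewrite zsourceS sj).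
  have sj : zsource z j.+1 by rewrite zsourceS.
  have [_] := xs j.+1 jn sj; rewrite /= => <-.
  by have [_ ->] := ft j (x j.+1) jn' tj; rewrite jn.
pose c := f 0%N (x 0%N).
have cE j : (j < n)%N -> f j (x j) = c.
  by elim: j => [//|j IHj] jn; rewrite -step // IHj // ltnW.
rewrite cE // in c0.
have iL : linear (fun u : zcomplex K z => \sum_(j < n) zco (u : zspace K z) j *: x j).
  move=> a u v; rewrite scaler_sumr -big_split; apply: eq_bigr => j _.
  by rewrite zcoD zcoZ scalerDl scalerA.
have sL : linear (fun y => zmk z (fun j => c^-1 * f j y) : zcomplex K z).
  move=> a y y'; apply: (@zspace_eq _ z) => j jn; rewrite zcoD zcoZ !zcoE jn.
  by rewrite linearP mulrDr -[_ *: _]/(_ * _) mulrCA.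
have iE k : (k < n)%N -> mklin iL (zbasis K z k) = x k.
  move=> kn; rewrite /= (bigD1 (Ordinal kn)) //= zco_basis kn eqxx scale1r big1 ?addr0 //.
  move=> j jk; rewrite zco_basis (_ : (val j == k) = false) ?andbF ?scale0r //.
  by apply: contraNF jk => /eqP e; apply/eqP/val_inj.
have sE y j : zco (mklin sL y : zspace K z) j = if (j < n)%N then c^-1 * f j y else 0.
  by rewrite /= zcoE.
exists (mklin iL), (mklin sL); split.
- split=> [p q u|u|u].
  + apply: (@zbasis_ext z A (mklin iL \o dc_proj _ p q) (dc_proj A p q \o mklin iL)) => k kn.
    rewrite -[LHS]/(mklin iL (dc_proj _ p q _)) -[RHS]/(dc_proj A p q (mklin iL _)) zbasis_proj iE //.
    rewrite (dc_proj_bideg _ _ (xb k kn)); case: ifP => _; first exact: iE.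
    exact: (linear0 (mklin iL)).
  + apply: (@zbasis_ext z A (mklin iL \o dc_d1 _) (dc_d1 A \o mklin iL)) => k kn.
    rewrite -[LHS]/(mklin iL (dc_d1 _ _)) -[RHS]/(dc_d1 A (mklin iL _)) zbasis_d1 // iE //.
    have [sk|tk] := boolP (zsource z k); last first.
      by have [-> _] := xt k kn tk; apply: linear0.
    have [-> _] := xs k kn sk; rewrite /=; case: ifP => h; first exact: iE.
    exact: (linear0 (mklin iL)).
  + apply: (@zbasis_ext z A (mklin iL \o dc_d2 _) (dc_d2 A \o mklin iL)) => k kn.
    rewrite -[LHS]/(mklin iL (dc_d2 _ _)) -[RHS]/(dc_d2 A (mklin iL _)) zbasis_d2 // iE //.
    have [sk|tk] := boolP (zsource z k); last first.
      by have [_ ->] := xt k kn tk; apply: linear0.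
    have [_ ->] := xs k kn sk; rewrite /=; case: ifP => h; last exact: (linear0 (mklin iL)).
    by apply: iE; rewrite (leq_ltn_trans _ kn) // leq_pred.
- split=> [p q y|y|y]; apply: (@zspace_eq _ z) => j jn; rewrite sE jn.
  + rewrite [RHS]zco_proj sE jn -fb //.
    by rewrite dc_projM; case: ifP => _; rewrite ?fb // linear0 mulr0.
  + rewrite [RHS]zco_d1 jn sE; have [sj|tj] := boolP (zsource z j).
      by have [-> _] := fs j y jn sj; rewrite mulr0.
    have [-> _] := ft j y jn tj; case: j jn {tj} => [|j] jn /=; rewrite ?mulr0 //.
    by rewrite (ltnW jn).
  + rewrite [RHS]zco_d2 jn sE; have [sj|tj] := boolP (zsource z j).
      by have [_ ->] := fs j y jn sj; rewrite mulr0.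
    by have [_ ->] := ft j y jn tj; rewrite /=; case: ifP; rewrite ?mulr0.
apply: (@zbasis_ext z _ (mklin sL \o mklin iL) idfun) => k kn.
rewrite -[LHS]/(mklin sL (mklin iL _)) iE //; apply: (@zspace_eq _ z) => j jn.
rewrite sE jn zco_basis jn /=; have [->|jk] := eqVneq j k.
  by rewrite cE // mulVf.
(* Different positions of a zigzag have different bidegrees, so [f j] kills [x k]. *)
rewrite -fb // (dc_proj_bideg _ _ (xb k kn)) ifF ?linear0 ?mulr0 //.
apply: contraNF jk => /andP[/eqP e1 /eqP e2]; apply/eqP; exact: zbideg_inj e1 e2.
Qed.

End SplitOff.

(** * Even zigzags from nonzero differentials *)

Section EvenSplit.
Variable K : fieldType.
Variable A : dcomplex K.

(* A chain represents an element of the page [E_l] of the column filtration, and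
   [d1] of its last term is the value of the differential of this page. *)
Definition chain p q (l : nat) (c : nat -> A) :=
  [/\ forall u, (u < l)%N -> in_bidegree (p + u%:Z) (q - u%:Z) (c u),
      dc_d2 A (c 0%N) = 0 &
      forall u, (u.+1 < l)%N -> dc_d1 A (c u) = dc_d2 A (c u.+1)].

Definition extends l (c : nat -> A) := exists y, dc_d1 A (c l.-1) = dc_d2 A y.

Lemma chain_extend p q l c : (0 < l)%N -> chain p q l c -> extends l c ->
  exists c', chain p q l.+1 c' /\ c' 0%N = c 0%N.
Proof.
move=> l0 [cb c0 cd] [y yE].
exists (fun u => if (u < l)%N then c u else dc_proj A (p + l%:Z) (q - l%:Z) y).
rewrite l0; split=> //; split=> [u|//|u]; first 1 last.
- by rewrite l0.
- rewrite ltnS => ul; rewrite ul; case: ltnP => ul'; first exact: cd.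
  have -> : u = l.-1 by lia.
  rewrite dc_d2_deg -yE; have := bideg_d1 (cb l.-1 ltac:(lia)).
  have -> : p + l.-1%:Z + 1 = p + l%:Z by lia.
  by have -> : q - l.-1%:Z = q - l%:Z + 1 by lia.
rewrite ltnS leq_eqVlt => /orP[/eqP -> | ul]; last by rewrite ul; apply: cb.
by rewrite ltnn; apply: dc_proj_in.
Qed.

(** A non-extendable chain of minimal length [l] is a nonzero value of the differential of [E_l],
    all earlier differentials being zero. The chain and its images under [dc_d1] give the zigzag;
    minimality is what makes the dual functionals exist. *)
Lemma even_split : (exists p q l c, [/\ (0 < l)%N, chain p q l c & ~ extends l c]) ->
  exists z : zigzag, [/\ zlen z != 0%N, ~~ odd (zlen z), z.1.2 = false &
    exists (i : {linear zcomplex K z -> A}) (s : {linear A -> zcomplex K z}),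
    [/\ dc_morphism i, dc_morphism s & forall u, s (i u) = u]].
Proof.
move=> [p0 [q0 [l0 [c0 h0]]]].
have ex : exists l, `[< exists p q c, [/\ (0 < l)%N, chain p q l c & ~ extends l c] >].
  by exists l0; apply/asboolP; exists p0, q0, c0.
have [l /asboolP[p [q [c [l_gt0 [cb c_0 cd] nc]]]] lmin] := ex_minnP ex.
have ext p' q' m c' : (0 < m)%N -> (m < l)%N -> chain p' q' m c' -> extends m c'.
  move=> m0 ml hc; apply: contrapT => ne; move: ml; rewrite ltnNge lmin //.
  by apply/asboolP; exists p', q', c'.
have long p' q' y m : in_bidegree p' q' y -> dc_d2 A y = 0 -> (0 < m)%N -> (m <= l)%N ->
    exists c', chain p' q' m c' /\ c' 0%N = y.
  move=> yb dy; case: m => // m _; elim: m => [_|m IHm ml].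
    exists (fun=> y); split=> //; split=> //.
    by move=> u; rewrite ltnS leqn0 => /eqP ->; rewrite addr0 subr0.
  have [c' [hc c'0]] := IHm (ltnW ml).
  have [c'' [hc' c''0]] := chain_extend (ltn0Sn m) hc (ext _ _ _ _ (ltn0Sn m) ml hc).
  by exists c''; split=> //; rewrite c''0.
have [g [g0 g1]] : exists g : {linear A -> K^o}, (forall y, g (dc_d2 A y) = 0) /\
    g (dc_d1 A (c l.-1)) = 1.
  have sD : subspace (fun x => exists y, x = dc_d2 A y).
    split=> [|a _ _ [y ->] [y' ->]]; first by exists 0; rewrite linear0.
    by exists (a *: y + y'); rewrite linearP.
  have [g [gS g1]] := functional_separate sD nc; exists g; split=> // y.
  by apply: gS; exists y.
pose supp s (f : {linear A -> K^o}) := forall y,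
  f (dc_proj A (p + l%:Z - s%:Z) (q - l%:Z + s%:Z + 1) y) = f y.
(* [G s] is a functional on the target [s] places before the right end. [G 0] detects the
   obstruction to extending the chain, and each further one must give the same functional on the
   source in between as its predecessor does. *)
have [G [[G0 G1] Gd GS]] : exists G : nat -> {linear A -> K^o},
    [/\ (forall y, G 0%N (dc_d2 A y) = 0) /\ G 0%N (dc_d1 A (c l.-1)) = 1,
        forall s y, (s.+1 < l)%N -> G s.+1 (dc_d2 A y) = G s (dc_d1 A y) &
        forall s, (s < l)%N -> supp s (G s)].
  suff build m : (m < l)%N -> exists G : nat -> {linear A -> K^o},
    [/\ (forall y, G 0%N (dc_d2 A y) = 0) /\ G 0%N (dc_d1 A (c l.-1)) = 1,
        forall s y, (s.+1 < m.+1)%N -> G s.+1 (dc_d2 A y) = G s (dc_d1 A y) &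
        forall s, (s < m.+1)%N -> supp s (G s)].
    by have [] := build l.-1; rewrite prednK // => G; exists G.
  elim: m => [_|m IHm ml].
    exists (fun=> g \o dc_proj A (p + l%:Z) (q - l%:Z + 1)); split=> //=.
    - split=> [y|]; first by rewrite proj_d2 g0.
      rewrite (_ : dc_proj _ _ _ _ = dc_d1 A (c l.-1)) //.
      have := bideg_d1 (cb l.-1 ltac:(lia)).
      have -> : p + l.-1%:Z + 1 = p + l%:Z by lia.
      by have -> : q - l.-1%:Z = q - l%:Z + 1 by lia.
    - move=> s; rewrite ltnS leqn0 => /eqP -> y /=.
      by rewrite subr0 addr0 dc_projM !eqxx.
  have [G [[G0 G1] Gd GS]] := IHm (ltnW ml).
  have [|G' G'E] := @functional_factor K A A (dc_d2 A) (G m \o dc_d1 A).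
    move=> y dy /=; rewrite -(GS m (ltnSn m)) proj_d1.
    set y0 := dc_proj A _ _ y.
    have dy0 : dc_d2 A y0 = 0 by rewrite dc_d2_deg dy linear0.
    have [c' [hc c'0]] := long _ _ y0 m.+1 (dc_proj_in _ _ _) dy0 (ltn0Sn m) (ltnW ml).
    have [y' y'E] := ext _ _ _ _ (ltn0Sn m) ml hc; have [_ _ c'd] := hc.
    (* To factor through [dc_d2], the functional [G m] after [dc_d1] must kill its kernel. An
       element of the kernel starts a chain of length [m.+1], which extends since [m.+1 < l]; moving
       along it trades [G m] step by step for [G 0], which finally meets an image of [dc_d2]. *)
    have tel u : (u <= m)%N -> G m (dc_d1 A y0) = G (m - u)%N (dc_d1 A (c' u)).
      elim: u => [|u IHu] um; first by rewrite subn0 c'0.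
      rewrite IHu; last by lia.
      rewrite c'd //; have -> : (m - u = (m - u.+1).+1)%N by lia.
      by rewrite Gd //; lia.
    by rewrite (tel m) // subnn y'E G0.
  pose H := G' \o dc_proj A (p + l%:Z - m.+1%:Z) (q - l%:Z + m.+1%:Z + 1).
  exists (fun s => if (s <= m)%N then G s else H); split=> //.
    move=> s y; rewrite !ltnS => sm; case: (ltnP s m) => sm'.
      by rewrite (ltnW sm') Gd.
    rewrite sm /= proj_d2 G'E /=; have -> : s = m by lia.
    rewrite -(GS m _ (dc_d1 A y)) // proj_d1; congr (G m (dc_d1 A (dc_proj A _ _ y))); lia.
  move=> s; rewrite ltnS => sm; case: (leqP s m) => sm' y; first exact: (GS s _ y).
  have -> : s = m.+1 by lia.
  by rewrite /H /= dc_projM !eqxx.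
pose z : zigzag := (p, q, false, (2 * l)%N).
have zs j : zsource z j = ~~ odd j by [].
have zc j : zcol z j = p + (uphalf j)%:Z by [].
have zr j : zrow z j = q - (j./2)%:Z by [].
have zl : zlen z = (2 * l)%N by [].
exists z; split=> //; [by rewrite zl; lia | by rewrite zl; lia |].
pose x j := if odd j then dc_d1 A (c j./2) else c j./2.
pose f j : {linear A -> K^o} := if odd j then G (l.-1 - j./2)%N else G (l.-1 - j./2)%N \o dc_d1 A.
apply: (@zigzag_split K A z x f (2 * l).-1).
- move=> j; rewrite zl zc zr /x => jl.
  have jb := cb j./2 ltac:(lia); case: ifP => oj.
    by rewrite (_ : p + (uphalf j)%:Z = p + (j./2)%:Z + 1); [apply: bideg_d1 | lia].
  by have -> : uphalf j = j./2 by lia.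
- move=> j; rewrite zl zs /x => jl oj.
  rewrite (negbTE oj) /= oj /=; have -> : (j.+1 < 2 * l)%N by lia.
  have -> : uphalf j = j./2 by lia.
  split=> //; case: j jl oj => [//|j] jl oj /=.
  have -> : odd j by lia.
  by rewrite (_ : uphalf j = j./2.+1) ?cd //; lia.
- move=> j; rewrite zl zs negbK /x => jl oj; rewrite oj dc_d1d1 dc_d2d1; split=> //.
  case E : (j./2) => [|u]; first by rewrite c_0 linear0 oppr0.
  by rewrite -cd ?dc_d1d1 ?oppr0 //; lia.
- move=> j y; rewrite zl zc zr /f => jl.
  have sj := GS (l.-1 - j./2)%N ltac:(lia); case: ifP => oj.
    rewrite -[RHS]sj; congr (G _ (dc_proj A _ _ y)); lia.
  rewrite /= -[RHS]sj -[LHS]sj !proj_d1 dc_projM ifT; last by lia.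
  by [].
- move=> j y; rewrite zl zs negbK /f => jl oj; rewrite oj /= oj /=.
  have -> : (0 < j)%N by lia.
  have oj' : odd j.-1 = false by lia.
  rewrite oj' /=; split; first by congr (G _ _); lia.
  case: ifPn => h; last first.
    by have -> : (l.-1 - j./2 = 0)%N by lia.
  have -> : (l.-1 - j./2 = (l.-1 - uphalf j).+1)%N by lia.
  by rewrite Gd //; lia.
- move=> j y; rewrite zl zs /f => jl oj; rewrite (negbTE oj) /= dc_d1d1 linear0; split=> //.
  rewrite -[dc_d1 A _]opprK -dc_d2d1 linearN /=; apply/eqP; rewrite oppr_eq0; apply/eqP.
  case E : (l.-1 - j./2)%N => [|m]; first exact: G0.
  by rewrite Gd ?dc_d1d1 ?linear0 //; lia.
- by rewrite zl; lia.
rewrite /x /f; have -> : odd (2 * l).-1 by lia.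
have -> : ((2 * l).-1./2 = l.-1)%N by lia.
by rewrite subnn G1 oner_eq0.
Qed.

End EvenSplit.

(** * Odd zigzags from total cohomology *)

Section OddSplit.
Variable K : fieldType.

Lemma int_max (P : int -> Prop) lo hi : P lo -> (forall m, hi <= m -> ~ P m) ->
  exists m, P m /\ forall m', m < m' -> ~ P m'.
Proof.
move=> Plo Phi; pose Q k := `[< P (lo + k%:Z) >].
have Q0 : exists k, Q k by exists 0%N; apply/asboolP; rewrite addr0.
have Qb k : Q k -> (k <= `|hi - lo|)%N.
  move=> /asboolP Pk; rewrite leqNgt; apply/negP => h; apply: Phi Pk; lia.
have [k /asboolP Pk kmax] := ex_maxnP Q0 Qb; exists (lo + k%:Z); split=> // m' lt Pm'.
have := kmax `|m' - lo|%N; rewrite /Q (_ : lo + _ = m'); last by lia.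
by move=> /(_ (asboolT Pm')); lia.
Qed.

Lemma exact_homogeneous (A : dcomplex K) n (x : A) : homogeneous n x -> exact x ->
  exists2 y, homogeneous (n - 1) y & x = dc_total y.
Proof.
move=> xn [y xE]; exists (cut A (fun p q => p + q == n - 1) y).
  by move=> p q pq; rewrite cut_proj (negbTE pq).
rewrite xE; apply: dc_proj_eq => p q; rewrite !proj_total !cut_proj.
have [e|ne] := eqVneq (p + q) n.
  have -> : p - 1 + q == n - 1 by lia.
  by have -> : p + (q - 1) == n - 1 by lia.
have -> : (p - 1 + q == n - 1) = false by lia.
have -> : (p + (q - 1) == n - 1) = false by lia.
by rewrite !linear0 addr0 -proj_total -xE xn.
Qed.

Variables (A : dcomplex K) (bA : bounded A).

(* A class of total cohomology whose column degree [p] is maximal, and whose row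
   degree [q] is maximal among those, together with a dual functional [l],
   represented by functionals [l1] and [l2] of the same filtration degrees. *)
Lemma cohomology_class n (x : A) : homogeneous n x -> dc_total x = 0 -> ~ exact x ->
  exists (p q : int) (a b c : A) (l1 l2 m : {linear A -> K^o}),
  [/\ [/\ filtration false p n a, filtration true q n b, dc_total a = 0 & a - b = dc_total c],
      forall y, l1 (dc_total y) = 0 /\ l2 (dc_total y) = 0,
      forall y, m (dc_total y) = l1 y - l2 y,
      (forall y, filtration false (p + 1) n y -> l1 y = 0) /\
      (forall y, filtration true (q + 1) n y -> l2 y = 0) & l1 a = 1].
Proof.
move=> xn dx nx; have [N N0] := bounded_filtration0 bA; have [L LF] := bounded_filtration_full bA.
have [p [[a0 [a0F da0 na0]] pmax]] : exists p,
    (exists a, [/\ filtration false p n a, dc_total a = 0 & ~ @exact K A a]) /\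
    forall p', p < p' -> ~ exists a, [/\ filtration false p' n a, dc_total a = 0 & ~ @exact K A a].
  apply: (@int_max _ L N); first by exists x; split=> //; apply: LF.
  move=> m Nm [a [aF _ na]]; apply: na; rewrite (N0 _ _ _ _ Nm aF).
  exact: subspace0 (@exact_subspace _ _).
pose Q q := exists a b, [/\ filtration false p n a /\ dc_total a = 0,
  filtration true q n b /\ dc_total b = 0, @exact K A (a - b) & ~ @exact K A a].
have [q [[a [b [[aF da] [bF db] [c cE] na]]] qmax]] : exists q, Q q /\ forall q', q < q' -> ~ Q q'.
  apply: (@int_max _ L N).
    exists a0, a0; split=> //; last by rewrite subrr; apply: (subspace0 (@exact_subspace _ _)).
    by split=> //; apply: LF => //; apply: filtration_homogeneous a0F.
  move=> m Nm [a [b [_ [bF _] e na]]]; apply: na.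
  by rewrite (N0 _ _ _ _ Nm bF) subr0 in e.
pose S (x : A) := exists b y, [/\ filtration true (q + 1) n b, dc_total b = 0 & x = b + dc_total y].
have F0 i m d : filtration i m d (0 : A) by apply: (subspace0 (@filtration_subspace _ _ _ _ _)).
have sS : subspace S.
  split=> [|e _ _ [b1 [y1 [h1 h2 ->]]] [b2 [y2 [h1' h2' ->]]]].
    by exists 0, 0; rewrite !linear0 addr0; split.
  exists (e *: b1 + b2), (e *: y1 + y2); rewrite !dc_total_linear h2 h2' scaler0 addr0; split=> //.
    exact: (proj2 (@filtration_subspace _ _ _ _ _)).
  by rewrite scalerDr addrACA.
have naS : ~ S a.
  move=> [b' [y [b'F db' aE]]]; apply: (qmax (q + 1)); first by lia.
  by exists a, b'; split=> //; exists y; rewrite aE addrC addKr.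
have [l [lS l1]] := functional_separate sS naS.
have ld y : l (dc_total y) = 0 by apply: lS; exists 0, y; rewrite add0r linear0; split.
have sK : subspace (fun y : A => dc_total y = 0).
  by split=> [|e y y' h h']; rewrite ?linear0 // dc_total_linear h h' scaler0 addr0.
(* [m1] and [m2] equal [l] on cocycles and vanish on the next step of their filtration. For columns
   this is consistent because cocycles of [F^(p+1)] are exact by maximality of [p], for rows because
   [l] kills [S]. Their difference kills cocycles and so factors through [dc_total]. *)
have [|m1 [m1K m1F]] := functional_glue (l := l) sK (@filtration_subspace K A false (p + 1) n).
  move=> y dy yF; have [w ->] : exact y.
    by apply: contrapT => ny; apply: (pmax (p + 1)); [lia | exists y].
  exact: ld.
have [|m2 [m2K m2F]] := functional_glue (l := l) sK (@filtration_subspace K A true (q + 1) n).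
  by move=> y dy yF; apply: lS; exists y, 0; rewrite linear0 addr0.
have [|m mE] := functional_factor (f := @dc_total K A) (l := m1 \- m2).
  by move=> y dy /=; rewrite m1K // m2K // subrr.
exists p, q, a, b, c, m1, m2, m; split=> //.
- by move=> y; rewrite m1K ?m2K ?dc_totalK.
- by rewrite m1K.
Qed.

Let split_off (z : zigzag) := exists (i : {linear zcomplex K z -> A}) (s : {linear A -> zcomplex K z}),
  [/\ dc_morphism i, dc_morphism s & forall u, s (i u) = u].

Section Cases.
Variables (n p q : int) (a b c : A) (l1 l2 m : {linear A -> K^o}).
Hypotheses (aF : filtration false p n a) (bF : filtration true q n b).
Hypotheses (da : dc_total a = 0) (abc : a - b = dc_total c).
Hypotheses (ld : forall y, l1 (dc_total y) = 0 /\ l2 (dc_total y) = 0).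
Hypothesis mE : forall y, m (dc_total y) = l1 y - l2 y.
Hypotheses (l1F : forall y, filtration false (p + 1) n y -> l1 y = 0).
Hypotheses (l2F : forall y, filtration true (q + 1) n y -> l2 y = 0) (la : l1 a = 1).

Let P i j := dc_proj A i j.

Lemma l1_col i j y : in_bidegree i j y -> i + j = n -> p < i -> l1 y = 0.
Proof. by move=> yb ij pi; apply/l1F/(bideg_filtration yb) => //; lia. Qed.

Lemma l2_row i j y : in_bidegree i j y -> i + j = n -> q < j -> l2 y = 0.
Proof. by move=> yb ij pi; apply/l2F/(bideg_filtration yb) => //; lia. Qed.

Lemma l1d1 y : l1 (dc_d1 A y) = - l1 (dc_d2 A y).
Proof. by apply/eqP; rewrite -addr_eq0 -linearD; have [e _] := ld y; apply/eqP. Qed.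

Lemma l1_proj y : filtration false p n y -> l1 y = l1 (P p (n - p) y).
Proof.
move=> yF; apply/eqP; rewrite -subr_eq0 -linearB; apply/eqP/l1F => i j ij.
rewrite linearB /P dc_projM; case: ifPn => [/andP[/eqP -> /eqP ->]|nij]; first exact: subrr.
by rewrite subr0 yF //; lia.
Qed.

Lemma md1 y : m (dc_d1 A y) = l1 y - l2 y - m (dc_d2 A y).
Proof. by rewrite -mE /dc_total linearD addrK. Qed.

(** For [p + q <= n] the class has a cocycle concentrated in the columns from [p] to [n - q]. Its
    components are the sources of a zigzag that begins and ends with a source. *)
Lemma long_split : p + q <= n -> split_off (p, n - p, false, (2 * absz (n - q - p)%R).+1).
Proof.
move=> pqn; pose z : zigzag := (p, n - p, false, (2 * absz (n - q - p)%R).+1); pose L := absz (n - q - p)%R.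
have LE : L%:Z = n - q - p by rewrite /L; lia.
have zs j : zsource z j = ~~ odd j by [].
have zc j : zcol z j = p + (uphalf j)%:Z by [].
have zr j : zrow z j = n - p - (j./2)%:Z by [].
have zl : zlen z = (2 * L).+1 by [].
have [c' c'n abc'] : exists2 c', homogeneous (n - 1) c' & a - b = dc_total c'.
  apply: exact_homogeneous; last by exists c.
  by apply: (subspaceB (@homogeneous_subspace _ _ _)); [apply: filtration_homogeneous aF | apply: filtration_homogeneous bF].
(* Cutting [c'] at column [p] yields a cocycle equal both to [a - d(c' from p on)] and to
   [b + d(c' before p)]. The first form has nothing before column [p], the second nothing after
   column [n - q]. *)
pose ch := cut A (fun i _ => p <= i) c'.
pose x := a - dc_total ch.
have dx : dc_total x = 0 by rewrite dc_totalB da dc_totalK subrr.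
have chF : filtration false p (n - 1) ch.
  move=> i j ij; rewrite cut_proj; case: ifP => // pi; apply: c'n; move: ij; rewrite pi andbT //.
have xF : filtration false p n x.
  apply: (subspaceB (@filtration_subspace _ _ _ _ _)) => //.
  by have := filtration_total chF; rewrite subrK.
have xF' i j : n - q < i -> P i j x = 0.
  move=> iq; have [ij|ij] := eqVneq (i + j) n; last by apply: (filtration_homogeneous xF).
  have xE : x = b + dc_total (cut A (fun i _ => ~~ (p <= i)) c').
    by rewrite /x -[a](subrK b) abc' {1}(cutC (fun i _ => p <= i) c') dc_totalD addrAC (addrAC (dc_total ch)) subrr add0r addrC.
  rewrite xE linearD /= bF; last by lia.
  rewrite add0r proj_total !cut_proj !ifF ?linear0 ?addr0 //; lia.
pose X u := P (p + u%:Z) (n - p - u%:Z) x.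
have Xb u : in_bidegree (p + u%:Z) (n - p - u%:Z) (X u) by apply: dc_proj_in.
have dX u : dc_d1 A (X u) + dc_d2 A (X u.+1) = 0.
  have := proj_total (p + u.+1%:Z) (n - p - u%:Z) x; rewrite dx linear0 /X /P => ->.
  by congr (dc_d1 A (dc_proj A _ _ x) + dc_d2 A (dc_proj A _ _ x)); lia.
have d2X0 : dc_d2 A (X 0%N) = 0.
  have e : dc_proj A (p - 1) (n - p + 1) x = 0 by apply: xF; lia.
  have := proj_total p (n - p + 1) x; rewrite dx e !linear0 add0r addrK.
  by rewrite /X /P addr0 subr0.
have d1XL : dc_d1 A (X L) = 0.
  have := dX L; have -> : X L.+1 = 0 by apply: xF'; lia.
  by rewrite linear0 addr0.
(* By [mE], [l1 - m dc_d2 = l2 + m dc_d1]. In rows above [q], where [l2] vanishes, this is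
   [m dc_d1]; in columns above [p], where [l1] vanishes, it is [- m dc_d2]. So the sources are
   linked to the adjacent targets, which carry [m]; the signs alternate as those of the [x j]. *)
have [f fE] : exists f : nat -> {linear A -> K^o}, forall j y, f j y = (-1) ^+ j./2 *
    (if odd j then m (P (p + (j./2)%:Z + 1) (n - p - (j./2)%:Z) y)
     else l1 (P (p + (j./2)%:Z) (n - p - (j./2)%:Z) y) - m (dc_d2 A (P (p + (j./2)%:Z) (n - p - (j./2)%:Z) y))).
  have fL j : linear (fun y => (-1) ^+ j./2 *
    (if odd j then m (P (p + (j./2)%:Z + 1) (n - p - (j./2)%:Z) y)
     else l1 (P (p + (j./2)%:Z) (n - p - (j./2)%:Z) y) - m (dc_d2 A (P (p + (j./2)%:Z) (n - p - (j./2)%:Z) y))) : K^o).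
    move=> e y y'; case: (odd j).
      by rewrite /P (linearP (dc_proj A _ _)) (linearP m) mulrDr -[_ *: _]/(_ * _) -[e *: _ in RHS]/(_ * _) mulrCA.
    rewrite /P (linearP (dc_proj A _ _)) (linearP l1) (linearP (dc_d2 A)) (linearP m).
    rewrite -![_ *: _]/(_ * _); ring.
  by exists (fun j => mklin (fL j)).
have sgn2 u : (-1) ^+ u.+1 = - (-1) ^+ u :> K by rewrite exprS mulN1r.
apply: (@zigzag_split K A z (fun j => (-1) ^+ j./2 *: (if odd j then dc_d1 A (X j./2) else X j./2)) f 0).
- move=> j jl; rewrite zc zr /in_bidegree linearZ /=; congr (_ *: _); case: ifP => oj.
    have -> : p + (uphalf j)%:Z = p + (j./2)%:Z + 1 by lia.
    exact: (bideg_d1 (Xb _)).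
  by rewrite (_ : uphalf j = j./2); [apply: Xb | lia].
- move=> j; rewrite zl zs => jl oj; rewrite (negbTE oj) /= oj !linearZ /=; split.
    have -> : uphalf j = j./2 by lia.
    case: ifP => // h; have -> : j./2 = L by lia.
    by rewrite d1XL scaler0.
  case: j jl oj => [|j] jl oj; first by rewrite d2X0 scaler0.
  rewrite /=; have -> : odd j by lia.
  have -> : uphalf j = (j./2).+1 by lia.
  by rewrite sgn2 scaleNr -scalerN; congr (_ *: _); apply/eqP; rewrite eq_sym -addr_eq0 dX.
- move=> j; rewrite zs negbK => _ oj; rewrite oj !linearZ /= dc_d1d1 dc_d2d1 scaler0; split=> //.
  case: (j./2) => [|u]; first by rewrite d2X0 linear0 oppr0 scaler0.
  have /eqP := dX u; rewrite addrC addr_eq0 => /eqP ->.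
  by rewrite (linearN (dc_d1 A)) /= dc_d1d1 !oppr0 scaler0.
- move=> j y jl; rewrite zc zr !fE /P; congr (_ * _); case: ifP => oj.
    by rewrite dc_projM ifT //; apply/andP; split; apply/eqP; lia.
  rewrite dc_projM ifT //; by apply/andP; split; apply/eqP; lia.
- move=> j y; rewrite zl zs negbK => jl oj; rewrite !fE oj /=.
  set u := j./2; have jE : j = u.*2.+1 by lia.
  have -> : (0 < j)%N by lia.
  have -> : (j.+1 < (2 * L).+1)%N by lia.
  rewrite jE /= !odd_double /= ?uphalf_double ?doubleK ?fE /= ?odd_double /= ?doubleK.
  split.
    congr (_ * _); rewrite /P -dc_d1_deg.
    set y0 := dc_proj A _ _ y; rewrite md1.
    rewrite (@l2_row (p + u%:Z) (n - p - u%:Z) y0) ?subr0 //; [exact: dc_proj_in | lia | lia].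
  rewrite sgn2 mulNr -mulrN; congr (_ * _); rewrite opprB /P proj_d2.
  have -> : p + u%:Z + 1 = p + u.+1%:Z by lia.
  have -> : n - p - u%:Z - 1 = n - p - u.+1%:Z by lia.
  set y0 := dc_proj A _ _ y; rewrite (@l1_col (p + u.+1%:Z) (n - p - u.+1%:Z) y0) ?subr0 //;
    [exact: dc_proj_in | lia | lia].
- move=> j y; rewrite zl zs => jl oj; rewrite !fE (negbTE oj); set u := j./2.
  rewrite /P proj_d1 proj_d2; split.
    set y0 := dc_proj A _ _ y; have y0b : in_bidegree (p + u%:Z - 1) (n - p - u%:Z) y0 by apply: dc_proj_in.
    rewrite dc_d2d1 linearN /= opprK md1 dc_d2d2 linear0 subr0 l1d1.
    rewrite (l2_row (bideg_d2 y0b)); [|lia|lia].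
    by rewrite subr0 addNr mulr0.
  set y0 := dc_proj A _ _ y; have y0b : in_bidegree (p + u%:Z) (n - p - u%:Z - 1) y0 by apply: dc_proj_in.
  rewrite dc_d2d2 linear0 subr0 -[l1 _]opprK -l1d1 (l1_col (bideg_d1 y0b)); [|lia|lia].
  by rewrite oppr0 mulr0.
- by rewrite zl.
rewrite fE /= !expr0 scale1r mul1r -[Posz 0]/(0 : int) (addr0 p) (subr0 (n - p)).
have -> : P p (n - p) (X 0%N) = X 0%N by rewrite /X /P addr0 subr0 dc_projM !eqxx.
rewrite d2X0 linear0 subr0 /X addr0 subr0 -l1_proj // /x linearB la.
by have [-> _] := ld ch; rewrite subr0 oner_eq0.
Qed.

(** For [n < p + q] the representatives [a] and [b] lie in disjoint ranges of columns, and the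
    cochain [c] between them carries the zigzag: components of [c] are the sources, and both ends
    are targets. *)
Lemma short_split : n < p + q -> split_off (n - q - 1, q, true, (2 * absz (p + q - n)%R).+1).
Proof.
move=> pqn; pose z : zigzag := (n - q - 1, q, true, (2 * absz (p + q - n)%R).+1); pose L := absz (p + q - n)%R.
have LE : L%:Z = p + q - n by rewrite /L; lia.
have zs j : zsource z j = odd j by rewrite /zsource /=; case: (odd j).
have zc j : zcol z j = n - q + (j./2)%:Z by rewrite /zcol /= /zpar /=; lia.
have zr j : zrow z j = q - (uphalf j)%:Z by rewrite /zrow /= /zpar /=; lia.
have zl : zlen z = (2 * L).+1 by [].
pose C u := P (n - q + u%:Z) (q - u%:Z - 1) c.
pose a_ u := P (n - q + u%:Z) (q - u%:Z) a.
have abC u : dc_d1 A (C u) + dc_d2 A (C u.+1) = a_ u.+1.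
  have -> : a_ u.+1 = P (n - q + u.+1%:Z) (q - u.+1%:Z) (a - b).
    by rewrite linearB /= [X in _ - X]bF ?subr0 //; lia.
  rewrite abc /P proj_total; congr (dc_d1 A (dc_proj A _ _ c) + dc_d2 A (dc_proj A _ _ c)); lia.
have a0 u : (u < L)%N -> a_ u = 0 by move=> uL; apply: aF; lia.
have da_ u : dc_d1 A (a_ u) + dc_d2 A (a_ u.+1) = 0.
  have := proj_total (n - q + u.+1%:Z) (q - u%:Z) a; rewrite da linear0 /a_ /P => ->.
  by congr (dc_d1 A (dc_proj A _ _ a) + dc_d2 A (dc_proj A _ _ a)); lia.
have d2a u : (u <= L)%N -> dc_d2 A (a_ u) = 0.
  move=> uL; have [lt|ge] := ltnP u L; first by rewrite a0 // linear0.
  case: u uL ge => [|u] uL ge; first by lia.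
  by have := da_ u; rewrite a0 ?linear0 ?add0r.
(* [l1] serves on all targets. At the first one it is corrected by [m dc_d2], which makes it
   [l2 + m dc_d1], so that it also kills the image of [dc_d1] from the column before the zigzag. *)
have [f fE] : exists f : nat -> {linear A -> K^o}, forall j y, f j y = (-1) ^+ j./2 *
    (let y0 := P (n - q + (j./2)%:Z) (q - (uphalf j)%:Z) y in
     if odd j then l1 (dc_d2 A y0) else if j == 0%N then l1 y0 - m (dc_d2 A y0) else l1 y0).
  have fL j : linear (fun y => (-1) ^+ j./2 *
    (let y0 := P (n - q + (j./2)%:Z) (q - (uphalf j)%:Z) y in
     if odd j then l1 (dc_d2 A y0) else if j == 0%N then l1 y0 - m (dc_d2 A y0) else l1 y0) : K^o).
    move=> e y y' /=; rewrite /P (linearP (dc_proj A _ _)) (linearP (dc_d2 A)) (linearP l1) (linearP m).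
    by case: ifP => _; last case: ifP => _; rewrite ?(linearP l1) -![_ *: _]/(_ * _); ring.
  by exists (fun j => mklin (fL j)).
have sgn2 u : (-1) ^+ u.+1 = - (-1) ^+ u :> K by rewrite exprS mulN1r.
(* [a_] vanishes before the last target; there, subtracting it turns [dc_d2 (C L)] into
   [- dc_d1 (C L.-1)], so the last target is hit by the last source although [C L] is outside the
   zigzag. The nonzero pairing is taken at this target, where [l1 a = 1]. *)
apply: (@zigzag_split K A z (fun j => (-1) ^+ j./2 *: (if odd j then C j./2 else dc_d2 A (C j./2) - a_ j./2)) f (2 * L)).
- move=> j jl; rewrite zc zr /in_bidegree linearZ /=; congr (_ *: _); case: ifP => oj.
    have -> : q - (uphalf j)%:Z = q - (j./2)%:Z - 1 by lia.
    exact: dc_proj_in.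
  have -> : uphalf j = j./2 by lia.
  rewrite linearB /= [dc_proj A _ _ (a_ _)]dc_proj_in; congr (_ - _).
  by have := bideg_d2 (@dc_proj_in _ A (n - q + (j./2)%:Z) (q - (j./2)%:Z - 1) c); rewrite subrK.
- move=> j; rewrite zl zs => jl oj; set u := j./2; have jE : j = u.*2.+1 by lia.
  rewrite jE /= !odd_double /= ?uphalf_double ?doubleK !linearZ /=.
  have -> : (u.*2.+2 < (2 * L).+1)%N by lia.
  split; last by rewrite (a0 u) ?subr0 //; lia.
  by rewrite sgn2 scaleNr -scalerN opprB -abC addrK.
- move=> j; rewrite zl zs => jl oj; rewrite (negbTE oj) /= !linearZ /= !linearB /= dc_d2d2 d2a; last by lia.
  rewrite -!scalerBr subrr scaler0; split=> //.
  suff -> : dc_d1 A (dc_d2 A (C j./2)) - dc_d1 A (a_ j./2) = 0 by rewrite scaler0.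
  have := da_ j./2; rewrite -abC linearD /= dc_d2d2 addr0 dc_d2d1 => /eqP.
  by rewrite subr_eq0 => /eqP ->; rewrite subrr.
- move=> j y jl; rewrite zc zr !fE /P dc_projM !eqxx //.
- move=> j y; rewrite zl zs => jl oj; rewrite !fE (negbTE oj) /=.
  set u := j./2; have jE : j = u.*2 by lia.
  rewrite jE /= ?odd_double /= ?uphalf_double ?doubleK /P proj_d1 proj_d2; split.
    case: u jE => [|u] jE /=.
      rewrite expr0 mul1r; set y0 := dc_proj A _ _ y.
      rewrite dc_d2d1 (linearN m) /= opprK md1 dc_d2d2 linear0 subr0 l1d1 (@l2_row (n - q - 1) (q + 1)) ?subr0 ?addNr //; try lia.
      have := @dc_proj_in _ A (n - q + 0%:Z - 1) (q - 0%:Z) y; rewrite -/y0.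
      rewrite (_ : n - q + 0%:Z - 1 = n - q - 1); last by lia.
      by rewrite (_ : q - 0%:Z = q); [exact: bideg_d2 | lia].
    rewrite ?odd_double /= ?uphalf_double ?doubleK ?fE /= ?odd_double /= ?uphalf_double ?doubleK /P.
    rewrite l1d1 sgn2 mulrNN; congr (_ * l1 (dc_d2 A (dc_proj A _ _ y))); lia.
  have [uL|uL] := ltnP u L.
    have -> : (u.*2.+1 < (2 * L).+1)%N by lia.
    rewrite ?fE /= ?odd_double /= ?uphalf_double ?doubleK /P; congr (_ * _).
    have -> : q - u.+1%:Z = q - u%:Z - 1 by lia.
    by rewrite dc_d2d2 linear0 subr0; case: ifP.
  have -> : (u.*2.+1 < (2 * L).+1)%N = false by lia.
  have -> : (u.*2 == 0)%N = false by lia.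
  set y0 := dc_proj A _ _ y; have y0b : in_bidegree p (n - p - 1) y0.
    rewrite /y0; have -> : n - q + u%:Z = p by lia.
    have -> : q - u%:Z - 1 = n - p - 1 by lia.
    exact: dc_proj_in.
  rewrite -[l1 _]opprK -l1d1 (l1_col (bideg_d1 y0b)); [|lia|lia].
  by rewrite oppr0 mulr0.
- move=> j y; rewrite zl zs => jl oj; rewrite !fE oj /= /P proj_d1 proj_d2.
  rewrite dc_d2d2 dc_d2d1 (linearN l1) /= l1d1 dc_d2d2 (linear0 l1) !oppr0.
  by split; rewrite mulr0.
- by rewrite zl.
rewrite fE mul2n odd_double /= uphalf_double doubleK linearZ /= mulf_neq0 ?signr_eq0 //.
have -> : (L.*2 == 0)%N = false by lia.
rewrite linearZ /= mulf_neq0 ?signr_eq0 //.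
have -> : n - q + L%:Z = p by lia.
have -> : q - L%:Z = n - p by lia.
have -> : C L = P p (n - p - 1) c by rewrite /C; congr (P _ _ c); lia.
have -> : a_ L = P p (n - p) a by rewrite /a_; congr (P _ _ a); lia.
have cb : in_bidegree p (n - p - 1) (P p (n - p - 1) c) by apply: dc_proj_in.
have := bideg_d2 cb; rewrite subrK => d2cb.
rewrite linearB /= [P p (n - p) (dc_d2 _ _)]d2cb /P dc_projM !eqxx /=.
rewrite linearB /= -l1_proj // la -[l1 (dc_d2 _ _)]opprK -l1d1 (l1_col (bideg_d1 cb)); [|lia|lia].
by rewrite oppr0 sub0r oppr_eq0 oner_eq0.
Qed.

End Cases.

Lemma odd_split n (x : A) : homogeneous n x -> dc_total x = 0 -> ~ exact x ->
  exists z : zigzag, [/\ odd (zlen z), (z.1.2 -> (1 < zlen z)%N) & split_off z].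
Proof.
move=> xn dx nx.
have [p [q [a [b [c [l1 [l2 [m [[aF bF da abc] ld mE [l1F l2F] la]]]]]]]]] := cohomology_class xn dx nx.
have [le|lt] := lerP (p + q) n.
  by eexists; split; last exact: long_split aF bF da abc ld mE l1F l2F la le; rewrite /zlen //=; lia.
by eexists; split; last exact: short_split aF bF da abc ld mE l1F l2F la lt; rewrite /zlen //=; lia.
Qed.

End OddSplit.

(** * Contractions of exact complexes *)

Section Contraction.
Variable K : fieldType.
Implicit Types A B M : dcomplex K.

(** With a quasi-inverse [s] of [D], the element [x - s (D x)] is a cocycle, hence exact, and
    applying [s] to it gives a contraction. Keeping only the component one degree lower makes the
    contraction homogeneous and preserves the identity. *)
Lemma graded_contraction A (D : {linear A -> A}) : degree_one D ->
  (forall x, D x = 0 <-> exists y, x = D y) -> homotopic0 D (fun x : A => x).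
Proof.
move=> D1 ex; have DD y : D (D y) = 0 by apply/ex; exists y.
have [s sE] := quasi_inverse D.
have h0L : linear (fun x => s (x - s (D x))).
  move=> a x y; rewrite -(linearP s); congr (s _); rewrite (linearP D) (linearP s) scalerBr.
  by rewrite opprD addrACA.
have [h0 h0E] : exists h0 : {linear A -> A}, forall x, D (h0 x) + h0 (D x) = x.
  exists (mklin h0L) => x /=; have [y yE] : exists y, x - s (D x) = D y by apply/ex; rewrite linearB sE subrr.
  by rewrite DD (linear0 s) subr0 yE sE -yE subrK.
pose deg n := cut A (fun p q => p + q == n).
have degE n x : homogeneous n x -> deg n x = x by move=> xn; apply: cut_id => p q /xn.
have degH n x : homogeneous n (deg n x) by move=> p q pq; rewrite cut_proj (negbTE pq).
pose h := graded_map (fun p q => deg (p + q - 1) \o h0).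
have hE n x : homogeneous n x -> h x = deg (n - 1) (h0 x).
  move=> xn; rewrite -(degE _ _ xn).
  apply: (@graded_ext K A A (h \o deg n) (deg (n - 1) \o h0 \o deg n)) => p q {xn}x xb /=.
  have [pq|pq] := eqVneq (p + q) n.
    by rewrite (degE n x) ?(graded_mapE _ xb) /= ?pq //; exact: bideg_homogeneous xb _.
  suff -> : deg n x = 0 by rewrite !linear0.
  apply: dc_proj_eq => p' q'; rewrite cut_proj linear0 (dc_proj_bideg _ _ xb).
  case: eqP => [e|//]; case: ifP => [/andP[/eqP ep /eqP eq]|//].
  by move: pq; rewrite -ep -eq e eqxx.
exists h => [n x xn|]; first by rewrite (hE n).
have comm n x : D (deg n x) = deg (n + 1) (D x).
  apply: (@graded_ext K A A (D \o deg n) (deg (n + 1) \o D)) => p q {}x xb /=.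
  have xh : homogeneous (p + q) x by apply: bideg_homogeneous xb _.
  have off m k y : m != k -> homogeneous m y -> deg k y = 0.
    move=> mk ym; apply: dc_proj_eq => p' q'; rewrite cut_proj linear0; case: eqP => // e.
    by rewrite ym // e eq_sym.
  have [e|ne] := eqVneq (p + q) n.
    by rewrite !degE // -e //; apply: D1.
  rewrite (off (p + q) n x) // linear0 (off (p + q + 1)) //; last exact: D1.
  by apply: contra_neq ne => /addIr.
apply: (@graded_ext K A A ((D \o h) \+ (h \o D)) idfun) => p q x xb /=.
have xh : homogeneous (p + q) x by apply: bideg_homogeneous xb _.
rewrite (hE _ x xh) (hE _ _ (D1 _ _ xh)) comm (addrK 1 (p + q)) (subrK 1 (p + q)) -linearD h0E.
exact: degE.
Qed.

Lemma zigzag_nil z : zlen z = 0%N -> forall x : zcomplex K z, x = 0.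
Proof. by move=> z0 x; apply: (@zspace_eq K z) => j; rewrite z0. Qed.

Lemma retract_nil r A z : zlen z = 0%N -> null_homotopic r (fun x : A => x) ->
  retract r (zcomplex K z) A.
Proof.
move=> z0 h.
have iL : linear (fun _ : zcomplex K z => 0 : A) by move=> a x y; rewrite scaler0 addr0.
have sL : linear (fun _ : A => 0 : zcomplex K z) by move=> a x y; rewrite scaler0 addr0.
exists (mklin iL), (mklin sL); split=> /=.
- by split=> *; rewrite /= linear0.
- by split=> *; apply/esym/(zigzag_nil z0).
- by move=> x; rewrite (zigzag_nil z0 x).
suff -> : (idfun \- (mklin iL \o mklin sL) : A -> A) = (fun x => x) by [].
by apply/funext => x /=; rewrite subr0.
Qed.

(* A [d2]-cocycle that extends to arbitrarily long chains is the lowest term of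
   a total cocycle [dc_total y], and the part of [y] in lower columns is a chain. *)
Lemma columns_exact A : bounded A ->
  (forall p q l (c : nat -> A), (0 < l)%N -> chain p q l c -> extends l c) ->
  (forall n (x : A), homogeneous n x -> dc_total x = 0 -> exact x) ->
  forall x : A, dc_d2 A x = 0 <-> exists y, x = dc_d2 A y.
Proof.
move=> bA ext exA x; split=> [d2x|[y ->]]; last exact: dc_d2d2.
have [N NE] := bounded_range bA.
have SI : subspace (fun x : A => exists y, x = dc_d2 A y).
  split=> [|a _ _ [y ->] [y' ->]]; first by exists 0; rewrite linear0.
  by exists (a *: y + y'); rewrite linearP.
have [s xE] := dc_proj_sum x; rewrite xE; apply: (subspace_sum SI) => -[p q] _ /=.
have : dc_d2 A (dc_proj A p q x) = 0 by rewrite dc_d2_deg d2x linear0.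
move: (dc_proj_in p q x); set x0 := dc_proj A p q x => xb {}d2x.
have chains l : exists c, chain p q l.+1 c /\ c 0%N = x0.
  elim: l => [|l [c [cc c0]]].
    exists (fun _ => x0); split=> //; split=> // u; rewrite ltnS leqn0 => /eqP ->.
    by rewrite addr0 subr0.
  have [c' [cc' c0']] := chain_extend (ltn0Sn l) cc (ext _ _ _ _ (ltn0Sn l) cc).
  by exists c'; rewrite c0' c0.
(* Column [p + l] is outside the bounded region, so the last term of the chain is [0] and the
   alternating sum of the others is a total cocycle. *)
pose l := (N + absz p).+1.
have [c [[cb _ cd] c0]] := chains l.
have cl : c l = 0.
  by rewrite -(cb l (ltnSn l)); apply: NE; apply/orP; left; rewrite /l; lia.
pose X := \sum_(u < l) (-1) ^+ u *: c u.
have dX : dc_total X = 0.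
  have E k : (k <= l)%N -> dc_total (\sum_(u < k) (-1) ^+ u *: c u) = - ((-1) ^+ k *: dc_d2 A (c k)).
    elim: k => [|k IHk] kl.
      by rewrite big_ord0 c0 d2x scaler0 oppr0 linear0.
    rewrite big_ord_recr /= dc_totalD IHk 1?ltnW // exprS mulN1r scaleNr opprK.
    rewrite -cd // /dc_total [dc_d1 A (_ *: _)]linearZ [dc_d2 A (_ *: _)]linearZ /=.
    by rewrite addrCA addNr addr0.
  by rewrite /X E // cl linear0 scaler0 oppr0.
have cproj i j (u : nat) : (u <= l)%N -> dc_proj A i j (c u) =
    if (i == p + u%:Z) && (j == q - u%:Z) then c u else 0.
  by move=> ul; apply: dc_proj_bideg; apply: cb.
have Xn : homogeneous (p + q) X.
  apply: (subspace_sum (@homogeneous_subspace _ _ _)) => u _.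
  apply: (subspaceZ (@homogeneous_subspace _ _ _)).
  by apply: bideg_homogeneous (cb u (ltnW (ltn_ord u))) _; lia.
have [y yE] := exA _ _ Xn dX.
(* Below column [p] the boundary of [y] vanishes, so the components of [y] there, with alternating
   signs, form a chain that starts outside the bounded region. Extending it turns [dc_d1] of the
   component in column [p - 1] into an image of [dc_d2], and with it [x0]. *)
pose lo := (N + absz p).+1.
pose c' u := (-1) ^+ u *: dc_proj A (p - lo%:Z + u%:Z) (q - 1 + lo%:Z - u%:Z) y.
have Xlow i j : i < p -> dc_proj A i j X = 0.
  move=> ip; rewrite /X linear_sum big1 // => u _; rewrite linearZ /= cproj 1?ltnW //.
  by rewrite ifF ?scaler0 //; lia.
have Xp : dc_proj A p q X = x0.
  rewrite /X linear_sum big_ord_recl /= expr0 scale1r c0 xb big1 ?addr0 // => u _.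
  have ul := ltn_ord u; rewrite linearZ /= cproj /bump; last by rewrite /l; lia.
  rewrite ifF ?scaler0 //; lia.
have dy i : i < p -> dc_d1 A (dc_proj A (i - 1) (p + q - i) y) +
    dc_d2 A (dc_proj A i (p + q - i - 1) y) = 0.
  by move=> ip; rewrite -proj_total -yE Xlow.
have cc' : chain (p - lo%:Z) (q - 1 + lo%:Z) lo c'.
  split=> [u ul||u ul].
  - by rewrite /c' /in_bidegree linearZ /= dc_projM !eqxx.
  - rewrite /c' expr0 scale1r; have := dy (p - lo%:Z); rewrite (NE _ _ y); last first.
      by apply/orP; left; rewrite /lo; lia.
    rewrite linear0 add0r -[Posz 0]/(0 : int) addr0 subr0 => h.
    rewrite -[RHS]h; last by rewrite /lo; lia.
    by congr (dc_d2 A (dc_proj A _ _ y)); lia.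
  rewrite /c' exprS mulN1r scaleNr (linearN (dc_d2 A)) !linearZ /=; congr (_ *: _).
  apply/eqP; rewrite -addr_eq0; apply/eqP; rewrite -[RHS](dy (p - lo%:Z + u.+1%:Z)); last by lia.
  by congr (dc_d1 A (dc_proj A _ _ y) + dc_d2 A (dc_proj A _ _ y)); lia.
have [w] := ext _ _ _ _ (ltn0Sn _) cc'; rewrite /c' linearZ /= => wE.
have := proj_total p q y; rewrite -yE Xp => ->; apply: (subspaceD SI); last by eexists.
exists ((-1) ^+ lo.-1 *: w); rewrite linearZ /= -wE scalerA -signr_odd -expr2 sqrr_sign scale1r.
by congr (dc_d1 A (dc_proj A _ _ y)); lia.
Qed.
End Contraction.

(** * Counting homology by spanning families *)

Section Span.
Variable K : fieldType.
Implicit Types V W : lmodType K.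

Definition extend_by V (N : V -> Prop) e x := exists c, N (x - c *: e).

Lemma extend_by_subspace V (N : V -> Prop) e : subspace N -> subspace (extend_by N e).
Proof.
move=> sN; split=> [|a x y [c h1] [d h2]]; first by exists 0; rewrite scale0r subr0; apply: subspace0.
by exists (a * c + d); rewrite scalerDl opprD addrACA -scalerA -scalerBr; apply: (proj2 sN).
Qed.

(* [Z / N] is spanned by [k] elements. *)
Fixpoint spanned V (k : nat) (Z N : V -> Prop) : Prop :=
  if k is k'.+1 then exists2 e, Z e & spanned k' Z (extend_by N e) else forall x, Z x -> N x.

Lemma spanned_sub V k (Z N N' : V -> Prop) : (forall x, N x -> N' x) ->
  spanned k Z N -> spanned k Z N'.
Proof.
elim: k N N' => [|k IHk] N N' sub /= => [h x /h /sub //|[e Ze h]].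
by exists e => //; apply: IHk h => x [c /sub h]; exists c.
Qed.

Lemma spanned_image V W (f : {linear V -> W}) k (Z N : V -> Prop) (Z' N' : W -> Prop) :
  (forall x, Z x -> Z' (f x)) -> (forall x, N x -> N' (f x)) ->
  (forall y, Z' y -> exists2 x, Z x & f x = y) -> spanned k Z N -> spanned k Z' N'.
Proof.
move=> ZZ' NN' surj; elim: k N N' NN' => [|k IHk] N N' NN' /=.
  by move=> h y /surj[x /h /NN' ? <-].
move=> [e Ze h]; exists (f e); first exact: ZZ'.
by apply: IHk h => x [c /NN']; rewrite linearB linearZ; exists c.
Qed.

(** Steinitz exchange. It makes the count drop when a zigzag splits off, since the complement only
    sees homology modulo a class of that zigzag. *)
Lemma spanned_exchange V k (Z N : V -> Prop) v : subspace N ->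
  spanned k.+1 Z N -> Z v -> ~ N v -> spanned k Z (extend_by N v).
Proof.
elim: k N => [|k IHk] N sN [e Ze h] Zv nv.
all: have sub : extend_by N e v -> forall x, extend_by N e x -> extend_by N v x.
1,3: move=> [c h1] x [d h2]; have c0 : c != 0 by
  apply: contra_notN nv => /eqP c0; move: h1; rewrite c0 scale0r subr0.
1,2: exists (d / c); suff -> : x - (d / c) *: v = - (d / c) *: (v - c *: e) + (x - d *: e) by
  apply: (proj2 sN).
1,2: by rewrite scalerBr scalerA mulNr divfK // !scaleNr opprK addrACA subrr addr0 addrC.
  by move=> x Zx; apply: sub; apply: h.
have [ev|ne] := pselect (extend_by N e v); first exact: (@spanned_sub _ k.+1 _ _ _ (sub ev) h).
exists e => //; apply: spanned_sub (IHk _ (extend_by_subspace e sN) h Zv ne).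
by move=> x [c [d hd]]; exists d, c; rewrite addrAC.
Qed.

Fixpoint combination V (e : seq V) (x : V) : Prop :=
  if e is a :: e' then exists c, combination e' (x - c *: a) else x = 0.

Lemma combination_subspace V (e : seq V) : subspace (combination e).
Proof.
elim: e => [|a e IHe] /=; last exact: extend_by_subspace.
by split=> // a x y -> ->; rewrite scaler0 addr0.
Qed.

Lemma combination_cat V (e e' : seq V) x y : combination e x -> combination e' y ->
  combination (e ++ e') (x + y).
Proof.
elim: e x => [|a e IHe] x /= => [-> ?|[c h] h']; first by rewrite add0r.
by exists c; rewrite addrAC; apply: IHe.
Qed.

Lemma combination_map V W (f : {linear V -> W}) e x :
  combination e x -> combination (map f e) (f x).
Proof.
elim: e x => [|a e IHe] x /= => [->|[c /IHe]]; first exact: linear0.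
by rewrite linearB linearZ; exists c.
Qed.

Lemma combination_mem V (e : seq V) a : a \in e -> combination e a.
Proof.
elim: e => //= b e IHe; rewrite inE; case: eqP => [-> _|_ /= /IHe h].
  by exists 1; rewrite scale1r subrr; apply: (subspace0 (combination_subspace e)).
by exists 0; rewrite scale0r subr0.
Qed.

Lemma combination_spanned V (Z N : V -> Prop) (e : seq V) : (forall a, a \in e -> Z a) ->
  (forall x, Z x -> exists2 y, combination e y & N (x - y)) -> spanned (size e) Z N.
Proof.
elim: e N => [|a e IHe] N eZ h /=; first by move=> x /h[y ->]; rewrite subr0.
exists a; first by apply: eZ; rewrite mem_head.
apply: IHe => [b be|x /h[y [c hc] hy]]; first by apply: eZ; rewrite inE be orbT.
by exists (y - c *: a) => //; exists c; rewrite opprB addrA addrAC addrK.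
Qed.

Lemma findim_combination V (Z N : V -> Prop) : subquotient_findim Z N ->
  exists e : seq V, (forall a, a \in e -> Z a) /\
    forall x, Z x -> exists2 y, combination e y & N (x - y).
Proof.
move=> [k [e [eZ eS]]]; exists (codom e); split=> [a /codomP[j ->] //|x /eS[c h]].
exists (\sum_j c j *: e j) => //; apply: (subspace_sum (combination_subspace _)) => j _.
by apply: (subspaceZ (combination_subspace _)); apply: combination_mem; apply: codom_f.
Qed.

Lemma pieces_spanned V (T : Type) (s : seq T) (f : T -> V -> V) (Z N : V -> Prop) : subspace N ->
  (forall x, Z x -> N (x - \sum_(t <- s) f t x)) ->
  (forall t, exists e : seq V, (forall a, a \in e -> Z a) /\
    forall x, Z x -> exists2 y, combination e y & N (f t x - y)) ->
  exists k, spanned k Z N.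
Proof.
move=> sN fs h; suff [e [eZ eS]] : exists e : seq V, (forall a, a \in e -> Z a) /\
    forall x, Z x -> exists2 y, combination e y & N (\sum_(t <- s) f t x - y).
  exists (size e); apply: combination_spanned => // x Zx.
  have [y ey Ny] := eS x Zx; exists y => //.
  by rewrite -(subrK (\sum_(t <- s) f t x) x) -addrA; apply: (subspaceD sN) => //; apply: fs.
elim: s {fs} => [|t s [e [eZ eS]]].
  exists [::]; split=> // x _; exists 0 => //; rewrite big_nil subrr; exact: subspace0.
have [e' [e'Z e'S]] := h t; exists (e' ++ e); split=> [a|x Zx].
  by rewrite mem_cat => /orP[/e'Z|/eZ].
have [y ey hy] := eS x Zx; have [y' ey' hy'] := e'S x Zx.
exists (y' + y); first exact: combination_cat.
by rewrite big_cons opprD addrACA; apply: (subspaceD sN).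
Qed.
End Span.

(** * Finiteness of homology and its behaviour under splitting *)

Section Homology.
Variable K : fieldType.
Implicit Types A B M : dcomplex K.

Definition image_of A (D : A -> A) (x : A) := exists y, x = D y.

Lemma image_subspace A (D : {linear A -> A}) : subspace (image_of D).
Proof.
split=> [|a _ _ [y ->] [y' ->]]; first by exists 0; rewrite linear0.
by exists (a *: y + y'); rewrite linearP.
Qed.

(** The terms of the first page for columns are the bidegree parts of the cohomology of [dc_d2], and
    boundedness leaves finitely many of them. *)
Lemma columns_findim A : bounded A -> findim_pages (Some 1%N) A ->
  exists k, spanned k (fun x : A => dc_d2 A x = 0) (image_of (dc_d2 A)).
Proof.
move=> [s sA] fA; apply: (@pieces_spanned K A _ (undup s) (fun t => dc_proj A t.1 t.2)).
- exact: image_subspace.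
- move=> x _; have <- : x = \sum_(t <- undup s) dc_proj A t.1 t.2 x.
    by apply: dc_sum_support => [|p q]; rewrite ?undup_uniq // mem_undup => /sA.
  by rewrite subrr; exact: (subspace0 (image_subspace _)).
move=> [p q] /=; have [e [eZ eS]] := findim_combination (fA false p (p + q)).
have Zd x : page_cycles false (Some 1%N) p (p + q) x -> dc_d2 A (dc_proj A p q x) = 0.
  move=> [xF dx]; have := dx p (q + 1); rewrite proj_total addrK xF ?linear0 ?add0r; last by lia.
  by apply; apply/negP => /andP[_]; lia.
exists (map (dc_proj A p q) e); split=> [_ /mapP[a /eZ ae ->]|x dx]; first exact: Zd.
have [|y ey] := eS (dc_proj A p q x).
  split; first exact: (bideg_filtration (dc_proj_in _ _ _)).
  rewrite /dc_total dc_d2_deg dx linear0 addr0.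
  by apply: (bideg_filtration (bideg_d1 (dc_proj_in _ _ _))); lia.
move=> [w [z [xE [[wF _] [zF _]]]]]; exists (dc_proj A p q y); first exact: combination_map.
exists (dc_proj A p (q - 1) z).
have := congr1 (dc_proj A p q) xE; rewrite linearB linearD /= dc_projM !eqxx /= => ->.
rewrite wF ?add0r; last by lia.
by rewrite proj_total (zF (p - 1)) ?linear0 ?add0r //; lia.
Qed.

Definition degree_part A n : {linear A -> A} := cut A (fun p q => p + q == n).

Lemma degree_part_homogeneous A n (x : A) : homogeneous n (degree_part A n x).
Proof. by move=> p q pq; rewrite cut_proj (negbTE pq). Qed.

Lemma degree_part_cocycle A n (x : A) : dc_total x = 0 -> dc_total (degree_part A n x) = 0.
Proof.
move=> dx; apply: dc_proj_eq => p q; rewrite proj_total !cut_proj linear0.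
have := congr1 (dc_proj A p q) dx; rewrite proj_total linear0.
have [e|ne] := eqVneq (p - 1 + q) n; have [e'|ne'] := eqVneq (p + (q - 1)) n => //; try lia.
by rewrite !linear0 addr0.
Qed.

Lemma degree_part_sum A (s : seq (int * int)) (x : A) :
  (forall p q, (p, q) \notin s -> dc_proj A p q x = 0) ->
  x = \sum_(n <- undup [seq t.1 + t.2 | t <- s]) degree_part A n x.
Proof.
move=> sx; apply/dc_proj_eq => p q.
rewrite linear_sum; have [pqs|/sx x0] := boolP ((p, q) \in s); last first.
  by rewrite x0 big1 // => n _; rewrite /= cut_proj x0; case: ifP.
rewrite (bigD1_seq (p + q)) ?undup_uniq //=; last first.
  by rewrite mem_undup; apply/mapP; exists (p, q).
rewrite cut_proj eqxx big1 ?addr0 // => n ne; by rewrite cut_proj ifF // eq_sym (negbTE ne).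
Qed.

Lemma total_findim A : bounded A -> findim_pages None A ->
  exists k, spanned k (fun x : A => dc_total x = 0) (image_of (@dc_total K A)).
Proof.
move=> bA fA; have [N N0] := bounded_filtration0 bA; have [L LF] := bounded_filtration_full bA.
have [s sA] := bA.
apply: (@pieces_spanned K A _ (undup [seq t.1 + t.2 | t <- s]) (fun n => degree_part A n)).
- exact: image_subspace.
- move=> x _; rewrite -degree_part_sum ?subrr; first exact: (subspace0 (image_subspace _)).
  by move=> p q /sA.
move=> n.
suff [e [eZ eS]] : exists e : seq A, (forall a, a \in e -> dc_total a = 0) /\
    forall x, page_cycles false None L n x -> exists2 y, combination e y & image_of (@dc_total K A) (x - y).
  exists e; split=> // x dx; apply: eS; split; [apply: LF => //; exact: degree_part_homogeneous | exact: degree_part_cocycle].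
(* The cohomology in degree [n] is exhausted by finitely many terms of [E_oo]; [k] counts the
   filtration steps that are left. *)
have [k kE] : exists k : nat, N <= L + k%:Z by exists (absz (N - L)); lia.
elim: k L kE {LF} => [|k IHk] m mk.
  exists [::]; split=> // x [xF _]; exists 0 => //; rewrite subr0 (N0 _ _ _ _ _ xF); last by lia.
  exact: (subspace0 (image_subspace _)).
have [|e [eZ eS]] := IHk (m + 1); first by lia.
have [e' [e'Z e'S]] := findim_combination (fA false m n).
exists (e' ++ e); split=> [a|x /e'S[y ey [w [z [xE [wZ _]]]]]].
  by rewrite mem_cat => /orP[/e'Z[]|/eZ].
have [y' ey' [u uE]] := eS w wZ; exists (y + y'); first exact: combination_cat.
exists (u + z); rewrite dc_totalD -uE opprD addrA xE.
by rewrite [LHS]addrAC.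
Qed.

(** [D] is any differential natural in morphisms, so that one statement serves for [dc_d1], [dc_d2]
    and [dc_total]. A class of the split-off part dies in the complement, which lowers the count by
    one. *)
Lemma spanned_split (A A' Z : dcomplex K) (D : forall A : dcomplex K, {linear A -> A}) (i : {linear Z -> A}) (s : {linear A -> Z})
    (j : {linear A' -> A}) (u : {linear A -> A'}) k :
  (forall A B (f : {linear A -> B}), dc_morphism f -> forall x, f (D A x) = D B (f x)) ->
  dc_morphism i -> dc_morphism s -> dc_morphism j -> dc_morphism u ->
  (forall x, s (i x) = x) -> (forall x, u (j x) = x) -> (forall x, u (i x) = 0) ->
  spanned k (fun x => D A x = 0) (image_of (D A)) ->
  spanned k (fun x => D A' x = 0) (image_of (D A')) /\
  ((exists2 x : Z, D Z x = 0 & ~ image_of (D Z) x) ->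
   (0 < k)%N /\ spanned k.-1 (fun x => D A' x = 0) (image_of (D A'))).
Proof.
move=> DM iM sM jM uM si uj ui h.
have surj y : D A' y = 0 -> exists2 x, D A x = 0 & u x = y.
  by move=> dy; exists (j y) => //; rewrite -(DM _ _ j) // dy linear0.
have ker x : D A x = 0 -> D A' (u x) = 0 by move=> dx; rewrite -(DM _ _ u) // dx linear0.
split.
  apply: (spanned_image ker _ surj) h => x [y ->]; exists (u y); exact: DM.
move=> [v dv nv].
have dv' : D A (i v) = 0 by rewrite -(DM _ _ i) // dv linear0.
have nv' : ~ image_of (D A) (i v).
  by move=> [y yE]; apply: nv; exists (s y); rewrite -(DM _ _ s) // -yE si.
case: k h => [|k] h; first by case: nv'; apply: h.
split=> //; have := spanned_exchange (image_subspace _) h dv' nv'.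
apply: (spanned_image ker _ surj) => x [c [y xE]]; exists (u y).
by rewrite -(DM _ _ u) // -xE linearB linearZ /= ui scaler0 subr0.
Qed.
End Homology.

(** * Decomposition into zigzags *)

Section Decomposition.
Variable K : fieldType.
Implicit Types (A B M : dcomplex K) (z : zigzag).

Definition split_off A z := exists (i : {linear zcomplex K z -> A}) (s : {linear A -> zcomplex K z}),
  [/\ dc_morphism i, dc_morphism s & forall u, s (i u) = u].

(** A single element is coded as a source only, so that different codes are different zigzags. For
    [E_oo] the length must be odd, since even zigzags have no total cohomology. *)
Definition zvalid (r : option nat) z :=
  [&& (0 < zlen z)%N, z.1.2 ==> (1 < zlen z)%N & (r == None) ==> odd (zlen z)].

Definition zsum (zs : seq zigzag) : dcomplex K :=
  foldr (fun z M => dsum (zcomplex K z) M) (zcomplex K (0, 0, false, 0%N)) zs.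

Lemma zsum_bounded zs : bounded (zsum zs).
Proof.
by elim: zs => [|z zs IHzs]; [apply: zcomplex_bounded | apply: dsum_bounded => //; apply: zcomplex_bounded].
Qed.

Lemma zcomplex_not_exact2 z : (0 < zlen z)%N -> (z.1.2 -> odd (zlen z)) ->
  exists2 x : zcomplex K z, dc_d2 _ x = 0 & ~ image_of (dc_d2 _) x.
Proof.
move=> z0 zo; case: (boolP z.1.2) => zb; last first.
  exists (zbasis K z 0%N); first by rewrite zbasis_d2 // andbF.
  move=> [y /(congr1 (fun x : zspace K z => zco x 0%N))].
  rewrite zco_basis z0 /= zco_d2 /zsource /zpar (negbTE zb) andbF => /eqP.
  by rewrite oner_eq0.
have nt : zsource z (zlen z).-1 = false by rewrite /zsource /zpar zb; have := zo zb; lia.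
exists (zbasis K z (zlen z).-1); first by rewrite zbasis_d2 ?nt //; lia.
move=> [y /(congr1 (fun x : zspace K z => zco x (zlen z).-1))].
rewrite zco_basis zco_d2 nt prednK // leqnn eqxx zco_out ?prednK // => /eqP.
by rewrite oner_eq0.
Qed.

Lemma zcomplex_not_exact z : odd (zlen z) ->
  exists2 x : zcomplex K z, dc_total x = 0 & ~ image_of (@dc_total K _) x.
Proof.
move=> zo; have z0 : (0 < zlen z)%N by lia.
have nex (I : finType) (deg : I -> int * int * int) (i : I) : bifiltered_model (zcomplex K z) deg ->
    exists2 x : zcomplex K z, dc_total x = 0 & ~ image_of (@dc_total K _) x.
  move=> [v [v' [w [l [l' [h [vP _ lP lv _]]]]]]]; exists (v i); first by case: (vP i).
  move=> [y yE]; have [/eqP] := lv i i; rewrite yE; have [-> _] := lP i y.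
  by rewrite eqxx eq_sym oner_eq0.
have [s0|t0] := boolP (zsource z 0).
  apply: (nex _ _ tt (zbifiltered_model_head K z0 s0 _)); move: s0; rewrite /zsource /zpar; lia.
apply: (nex _ _ tt (zbifiltered_model_tail K z0 t0 _)); move: t0; rewrite /zsource /zpar; lia.
Qed.

Lemma retract_step r A z : split_off A z ->
  exists (A' : dcomplex K) (i : {linear zcomplex K z -> A}) (s : {linear A -> zcomplex K z})
    (j : {linear A' -> A}) (u : {linear A -> A'}),
  [/\ [/\ dc_morphism i, dc_morphism s, dc_morphism j & dc_morphism u],
      [/\ forall x, s (i x) = x, forall x, u (j x) = x & forall x, u (i x) = 0],
      bounded A -> bounded A' &
      forall zs, retract r (zsum zs) A' -> retract r (zsum (z :: zs)) A].
Proof.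
move=> [i [s [iM sM si]]]; have [A' [j [u [jM uM uj ui [f [g [fM fg gf]]]]]]] := complement_exists iM sM si.
exists A', i, s, j, u; split=> // [[l lA]|zs ret].
  by exists l => p q /lA h x; rewrite -[LHS]uj (morph_proj jM) [dc_proj _ _ _ (j x)]h linear0.
apply: retract_trans (retract_iso r fM fg gf).
by apply: retract_dsum ret; apply: retract_refl.
Qed.

Lemma retract_zsum_nil r A : null_homotopic r (fun x : A => x) -> retract r (zsum [::]) A.
Proof. exact: retract_nil. Qed.

Lemma exact_or_split A : bounded A -> (forall x : A, dc_total x = 0 -> exact x) \/
  exists z, zvalid None z /\ split_off A z.
Proof.
move=> bA; have [|nex] := pselect (forall x : A, dc_total x = 0 -> exact x); first by left.
right; have [n [x [xn dx nx]]] : exists n (x : A), [/\ homogeneous n x, dc_total x = 0 & ~ exact x].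
  apply: contrapT => h; apply: nex => x dx; have [s [_ xs]] := dc_support x.
  rewrite (degree_part_sum xs); apply: (subspace_sum (@exact_subspace _ _)) => n _.
  apply: contrapT => nx; apply: h; exists n, (degree_part A n x); split=> //.
    exact: degree_part_homogeneous.
  exact: degree_part_cocycle.
have [z [zo zp zs]] := odd_split bA xn dx nx; exists z; split=> //.
by apply/and3P; split; [lia | apply/implyP | apply/implyP].
Qed.

Lemma decomposition_infty A k : bounded A ->
  spanned k (fun x : A => dc_total x = 0) (image_of (@dc_total K A)) ->
  exists zs, all (zvalid None) zs /\ retract None (zsum zs) A.
Proof.
elim/ltn_ind: k A => k IHk A bA hk; have [ex|[z [zv zs]]] := exact_or_split bA.
  exists [::]; split=> //; apply: retract_zsum_nil; apply: graded_contraction.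
    by move=> n x; apply: homogeneous_total.
  by move=> x; split=> [/ex|[y ->]]; last exact: dc_totalK.
have [A' [i [s [j [u [[iM sM jM uM] [si uj ui] bA' ret]]]]]] := retract_step None zs.
have zo : odd (zlen z) by case/and3P: zv.
have [_] := spanned_split (D := fun A => @dc_total K A) (fun A B f fM => morph_total fM) iM sM jM uM si uj ui hk.
move=> /(_ (zcomplex_not_exact zo))[k0 hk'].
have [zs' [vs /ret r']] := IHk k.-1 ltac:(lia) A' (bA' bA) hk'.
by exists (z :: zs'); rewrite /= zv.
Qed.

Lemma transpose_split_off A z : split_off (transpose A) z -> split_off A (ztranspose z).
Proof.
move=> [i [s [iM sM si]]]; have [f [g [fM fg gf]]] := ztranspose_iso K z.
have [gM _] := dc_bijective_Er None fM fg gf.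
exists (i \o f), (g \o s); split=> [||x]; last by rewrite /= si fg.
  by have := morphism_comp fM (transpose_morphism iM).
by have := morphism_comp (transpose_morphism sM) gM.
Qed.

(** The last disjunction records that the zigzag has cohomology for at least one of the two
    differentials; this is what makes the recursion on the number of spanning classes terminate. *)
Lemma exact_or_split1 A : bounded A ->
  (forall x : A, dc_d1 A x = 0 <-> exists y, x = dc_d1 A y) /\
  (forall x : A, dc_d2 A x = 0 <-> exists y, x = dc_d2 A y) \/
  exists z, [/\ zvalid (Some 1%N) z, split_off A z &
    (exists2 x : zcomplex K z, dc_d2 _ x = 0 & ~ image_of (dc_d2 _) x) \/
    (exists2 x : zcomplex K z, dc_d1 _ x = 0 & ~ image_of (dc_d1 _) x)].
Proof.
move=> bA; have [ex|[z [/and3P[v1 v2 v3] zs]]] := exact_or_split bA; last first.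
  right; exists z; split=> //; first by apply/and3P.
  by left; apply: zcomplex_not_exact2 => //; lia.
have even B : bounded B -> (forall x : B, dc_total x = 0 -> exact x) ->
    (forall x : B, dc_d2 B x = 0 <-> exists y, x = dc_d2 B y) \/
    exists z, [/\ (0 < zlen z)%N, ~~ odd (zlen z), z.1.2 = false & split_off B z].
  move=> bB exB; have [|nh] := pselect (exists p q l (c : nat -> B), [/\ (0 < l)%N, chain p q l c & ~ extends l c]).
    by move=> /even_split[z [z0 zo zb zs]]; right; exists z; split=> //; rewrite lt0n.
  left; apply: columns_exact => // [p q l c l0 cc|n x _ /exB //].
  by apply: contrapT => ne; apply: nh; exists p, q, l, c.
have [ex2|[z [z0 zo zb zs]]] := even A bA ex; last first.
  right; exists z; split=> //; first by apply/and3P; rewrite zb; split.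
  by left; apply: zcomplex_not_exact2 => //; rewrite zb.
have [|ex1|[z [z0 zo zb zs]]] := even (transpose A) (transpose_bounded bA).
- by move=> x; rewrite transpose_total => /ex[y ->]; exists y; rewrite transpose_total.
- by left.
right; exists (ztranspose z); split.
- by apply/and3P; rewrite zlen_transpose; split=> //; apply/implyP => _; lia.
- exact: transpose_split_off.
right; have [f [g [fM fg gf]]] := ztranspose_iso K z.
have [gM _] := dc_bijective_Er None fM fg gf.
have [|x dx nx] := @zcomplex_not_exact2 z z0; first by rewrite zb.
exists (g x); first by rewrite -(morph_d1 gM) [dc_d1 _ _]dx linear0.
move=> [y yE]; apply: nx; exists (f y); have := morph_d1 fM y; rewrite -yE gf => ->.
by [].
Qed.

(** The recursion is on [k1 + k2]: a zigzag that splits off may be exact for one of the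
    differentials but not for both. *)
Lemma decomposition1 A k1 k2 : bounded A ->
  spanned k1 (fun x : A => dc_d1 A x = 0) (image_of (dc_d1 A)) ->
  spanned k2 (fun x : A => dc_d2 A x = 0) (image_of (dc_d2 A)) ->
  exists zs, all (zvalid (Some 1%N)) zs /\ retract (Some 1%N) (zsum zs) A.
Proof.
move: {2}(k1 + k2)%N (erefl (k1 + k2)%N) => k; elim/ltn_ind: k A k1 k2 => k IHk A k1 k2 kE bA h1 h2.
have [[ex1 ex2]|[z [zv zs nex]]] := exact_or_split1 bA.
  exists [::]; split=> //; apply: retract_zsum_nil; split; apply: graded_contraction => //.
    exact: homogeneous_d1.
  exact: homogeneous_d2.
have [A' [i [s [j [u [[iM sM jM uM] [si uj ui] bA' ret]]]]]] := retract_step (Some 1%N) zs.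
have [g1 g1'] := spanned_split (D := fun A => dc_d1 A) (fun A B f fM => morph_d1 fM) iM sM jM uM si uj ui h1.
have [g2 g2'] := spanned_split (D := fun A => dc_d2 A) (fun A B f fM => morph_d2 fM) iM sM jM uM si uj ui h2.
have [zs' [vs /ret r']] : exists zs, all (zvalid (Some 1%N)) zs /\ retract (Some 1%N) (zsum zs) A'.
  by case: nex => [/g2'|/g1'] [k0 hk']; [apply: (IHk (k1 + k2.-1)%N _ A' k1 k2.-1) | apply: (IHk (k1.-1 + k2)%N _ A' k1.-1 k2)];
    rewrite // ?kE; try lia; exact: bA'.
by exists (z :: zs'); rewrite /= zv.
Qed.

Lemma transpose_findim r A : findim_pages r A -> findim_pages r (transpose A).
Proof.
move=> fA i m n; have [k [e [eZ eS]]] := fA (~~ i) m n; exists k, e; split=> [t|x].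
  exact/transpose_cycles.
by move=> /transpose_cycles/eS[c h]; exists c; apply/transpose_boundaries.
Qed.

Theorem decomposition r A : r1infty r -> bounded A -> findim_pages r A ->
  exists zs, all (zvalid r) zs /\ retract r (zsum zs) A.
Proof.
case=> -> bA fA.
  by have [k hk] := total_findim bA fA; apply: decomposition_infty hk.
have [k2 h2] := columns_findim bA fA.
have [k1 h1] := columns_findim (transpose_bounded bA) (transpose_findim fA).
exact: decomposition1 bA h1 h2.
Qed.
End Decomposition.

From mathcomp Require Import finmap mpoly monalg.

(** * Laurent monomials in the field of fractions *)

Section AbstractMonomials.
Variables (F : fieldType) (u r w : F) (u0 : u != 0) (r0 : r != 0) (w0 : w != 0).

Definition fmono (d : int * int * int) : F := u ^ d.1.1 * r ^ d.1.2 * w ^ d.2.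

Lemma fmonoM d e : fmono d * fmono e = fmono (d.1.1 + e.1.1, d.1.2 + e.1.2, d.2 + e.2).
Proof. by rewrite /fmono /= !expfzDr // mulrACA [X in X * _ = _]mulrACA. Qed.

Lemma fmono_neq0 d : fmono d != 0.
Proof. by rewrite !mulf_neq0 ?expfz_neq0. Qed.

Lemma fmono_diag k : (u * r * w) ^+ k = fmono (k%:Z, k%:Z, k%:Z).
Proof. by rewrite !exprMn. Qed.
End AbstractMonomials.

Section LaurentMonomials.

Local Notation poly3 := (mpoly.mpoly 3 int).
Local Notation frac3 := {fraction poly3}.
Local Notation "x %:F" := (tofrac x).

(** The third variable stays a parameter because the invariants of single pages replace [L] by [U]
    or by [R]. *)
Definition mono (w : frac3) := fmono fracU fracR w.

Lemma poly3_var_neq0 k : (poly3_var k)%:F != 0 :> frac3.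
Proof. by rewrite tofrac_eq0 -mpoly.msize_poly_eq0 /poly3_var mpoly.msizeX. Qed.

Lemma fracU_neq0 : fracU != 0. Proof. exact: poly3_var_neq0. Qed.
Lemma fracR_neq0 : fracR != 0. Proof. exact: poly3_var_neq0. Qed.
Lemma fracL_neq0 : fracL != 0. Proof. exact: poly3_var_neq0. Qed.

Lemma monoM w d e : w != 0 -> mono w d * mono w e = mono w (d.1.1 + e.1.1, d.1.2 + e.1.2, d.2 + e.2).
Proof. by move=> w0; exact: (fmonoM fracU_neq0 fracR_neq0 w0 d e). Qed.

Lemma mono_neq0 w d : w != 0 -> mono w d != 0.
Proof. by move=> w0; exact: (fmono_neq0 fracU_neq0 fracR_neq0 w0 d). Qed.

Lemma mono_diag w k : (fracU * fracR * w) ^+ k = mono w (k%:Z, k%:Z, k%:Z).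
Proof. exact: fmono_diag. Qed.

Definition mon3 (a b c : nat) : mpoly.multinom 3 :=
  mpoly.mnm_add (mpoly.mnm_add (mpoly.mnm_muln (mpoly.mnm1 0) a) (mpoly.mnm_muln (mpoly.mnm1 1) b))
    (mpoly.mnm_muln (mpoly.mnm1 2) c).

Lemma mon3E a b c : [/\ mon3 a b c 0 = a, mon3 a b c 1 = b & mon3 a b c 2 = c].
Proof. by split; rewrite /mon3 !mpoly.mnmDE !mpoly.mulmnE !mpoly.mnm1E /=; lia. Qed.

Lemma mon3_eta (m : mpoly.multinom 3) : m = mon3 (m 0) (m 1) (m 2).
Proof.
apply/mpoly.mnmP => i; have [h0 h1 h2] := mon3E (m 0) (m 1) (m 2).
have [->|->|->] : [\/ i = 0, i = 1 | i = 2].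
  by case: i => [[|[|[|//]]] hi]; [apply: Or31|apply: Or32|apply: Or33]; apply: val_inj.
- by rewrite h0.
- by rewrite h1.
by rewrite h2.
Qed.

Lemma mon3_mono a b c : (mpoly.mpolyX int (mon3 a b c))%:F = mono fracL (a%:Z, b%:Z, c%:Z).
Proof.
by rewrite /mon3 !mpoly.mpolyXD -!mpoly.mpolyXn !tofracM !tofracXn.
Qed.

Lemma tofrac_const (c : int) : (mpoly.mpolyC 3 c)%:F = c%:~R.
Proof. by rewrite -[c in LHS]intz !rmorph_int. Qed.

(* The monomials are linearly independent. *)
Lemma mono_indep (s : seq (int * (int * int * int))) :
  \sum_(t <- s) t.1%:~R * mono fracL t.2 = 0 -> forall d, \sum_(t <- s | t.2 == d) t.1 = 0.
Proof.
move=> s0 d; have [ds|nds] := boolP (d \in [seq t.2 | t <- s]); last first.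
  rewrite big_seq_cond big_pred0 // => t; apply/negP => /andP[ts /eqP td].
  by case/mapP: nds; exists t.
(* Multiplication by the [N]-th power of [U R L] makes all exponents natural numbers, and
   coefficients of polynomials can then be compared. *)
have [N Nle] : exists N, forall t, t \in s ->
    (absz t.2.1.1 + absz t.2.1.2 + absz t.2.2 <= N)%N.
  exists (\max_(t <- s) (absz t.2.1.1 + absz t.2.1.2 + absz t.2.2)%N) => t ts.
  by rewrite (big_rem t ts) /= leq_maxl.
pose e (d : int * int * int) := mon3 (absz (d.1.1 + N%:Z)) (absz (d.1.2 + N%:Z)) (absz (d.2 + N%:Z)).
have eE t : t \in s -> (mpoly.mpolyX int (e t.2))%:F = mono fracL t.2 * mono fracL (N%:Z, N%:Z, N%:Z).
  move=> /Nle; case: t => c0 [[x y] z] /= tN; rewrite (monoM _ _ fracL_neq0) /e mon3_mono; congr (mono _ (_, _, _)) => /=; lia.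
have : \sum_(t <- s) t.1 *: mpoly.mpolyX int (e t.2) = 0.
  apply/eqP; rewrite -tofrac_eq0 rmorph_sum /=; apply/eqP.
  transitivity ((\sum_(t <- s) t.1%:~R * mono fracL t.2) * mono fracL (N%:Z, N%:Z, N%:Z)).
    rewrite mulr_suml; apply: eq_big_seq => t ts.
    by rewrite -mulrA -eE // -mpoly.mul_mpolyC tofracM tofrac_const.
  by rewrite s0 mul0r.
move=> /(congr1 (mpoly.mcoeff (e d))); rewrite mpoly.mcoeff0 raddf_sum /= => h; rewrite -[RHS]h.
rewrite big_mkcond; apply: eq_big_seq => t ts /=.
rewrite mpoly.mcoeffZ mpoly.mcoeffX; case: eqVneq => [->|ne]; first by rewrite eqxx mulr1.
case: eqVneq => [ee|]; last by rewrite mulr0.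
case/eqP: ne; case/mapP: ds => t' t's dt'; rewrite dt' in ee *.
have [h0 h1 h2] := mon3E (absz (t.2.1.1 + N%:Z)) (absz (t.2.1.2 + N%:Z)) (absz (t.2.2 + N%:Z)).
rewrite -/(e t.2) ee in h0 h1 h2.
have [h0' h1' h2'] := mon3E (absz (t'.2.1.1 + N%:Z)) (absz (t'.2.1.2 + N%:Z)) (absz (t'.2.2 + N%:Z)).
have shift (i j : int) : (absz i <= N)%N -> (absz j <= N)%N -> absz (i + N%:Z) = absz (j + N%:Z) -> i = j.
  by lia.
move: (Nle _ ts) (Nle _ t's) (etrans (esym h0) h0') (etrans (esym h1) h1') (etrans (esym h2) h2').
clear -shift; case: t t' => c0 [[x y] z] [c0' [[x' y'] z']] /= le le' /shift-> //; try lia.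
by move=> /shift-> //; try lia; move=> /shift-> //; lia.
Qed.

Lemma laurent_val_monomial (n a b c : int) :
  laurent_val (n%:~R * laurent_monomial a b c) = n%:~R * mono fracL (a, b, c).
Proof.
have h : val (n%:~R : laurent) = n%:~R := rmorph_int (val : {rmorphism laurent -> frac3}) n.
by rewrite -[laurent_val _]/(val _) rmorphM /= h.
Qed.

Lemma laurent_val_sum (s : seq (int * (int * int * int))) :
  laurent_val (\sum_(t <- s) t.1%:~R * laurent_monomial t.2.1.1 t.2.1.2 t.2.2) =
  \sum_(t <- s) t.1%:~R * mono fracL t.2.
Proof.
rewrite -[LHS]/(val _) (rmorph_sum (val : {rmorphism laurent -> frac3})); apply: eq_bigr => t _.
by case: t => c [[x y] z]; exact: laurent_val_monomial.
Qed.

Lemma laurent_span (x : laurent) : exists s : seq (int * (int * int * int)),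
  x = \sum_(t <- s) t.1%:~R * laurent_monomial t.2.1.1 t.2.1.2 t.2.2.
Proof.
case/asboolP: (valP x) => k [p xE].
exists [seq (mpoly.mcoeff m p, ((m 0)%:Z - k%:Z, (m 1)%:Z - k%:Z, (m 2)%:Z - k%:Z)) | m : mpoly.multinom 3 <- mpoly.msupp p].
apply: val_inj; rewrite [RHS]laurent_val_sum big_map.
have k0 : (fracU * fracR * fracL) ^+ k != 0 by rewrite mono_diag (mono_neq0 _ fracL_neq0).
apply: (mulIf k0); rewrite [LHS]xE mulr_suml {1}(mpoly.mpolyE p) rmorph_sum /=.
apply: eq_bigr => m _; rewrite -mpoly.mul_mpolyC tofracM tofrac_const -[RHS]mulrA; congr (_ * _).
rewrite mono_diag {1}(mon3_eta m) mon3_mono [in RHS](monoM _ _ fracL_neq0).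
by congr (mono _ (_, _, _)) => /=; lia.
Qed.

End LaurentMonomials.

Lemma cancel_powers (F : fieldType) (e y y' : F) k l : e != 0 ->
  y * e ^+ k * e ^+ l = y' * e ^+ l * e ^+ k -> y = y'.
Proof. by move=> e0; rewrite [RHS]mulrAC => /(mulIf (expf_neq0 l e0))/(mulIf (expf_neq0 k e0)). Qed.

Lemma powers_sub (F : comNzRingType) (e y y' : F) k l :
  (y - y') * e ^+ (k + l) = y * e ^+ k * e ^+ l - y' * e ^+ l * e ^+ k.
Proof. by rewrite exprD; ring. Qed.

Lemma powers_mul (F : comNzRingType) (e y y' : F) k l :
  (y * y') * e ^+ (k + l) = (y * e ^+ k) * (y' * e ^+ l).
Proof. by rewrite exprD; ring. Qed.

(** * Substituting for [L] in Laurent polynomials *)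

Section Evaluation.

Local Notation poly3 := (mpoly.mpoly 3 int).
Local Notation frac3 := {fraction poly3}.
Local Notation "x %:F" := (tofrac x).

Variables (w : frac3) (w0 : w != 0).

Definition eval3 (p : poly3) : frac3 :=
  mpoly.mmap (fun c : int => c%:~R) (fun i => nth 0 [:: fracU; fracR; w] (val i)) p.

Lemma eval3D p q : eval3 (p + q) = eval3 p + eval3 q.
Proof. exact: mpoly.mmapD. Qed.

Lemma eval3N p : eval3 (- p) = - eval3 p.
Proof. exact: mpoly.mmapN. Qed.

Lemma eval3M p q : eval3 (p * q) = eval3 p * eval3 q.
Proof. exact: (mpoly.mmap_is_multiplicative _ _).1. Qed.

Lemma eval3_1 : eval3 1 = 1.
Proof. exact: (mpoly.mmap_is_multiplicative _ _).2. Qed.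

Lemma eval3X p k : eval3 (p ^+ k) = eval3 p ^+ k.
Proof. by elim: k => [|k IHk]; rewrite ?expr0 ?eval3_1 // !exprS eval3M IHk. Qed.

Lemma eval3_var i : eval3 (poly3_var i) = nth 0 [:: fracU; fracR; w] (val i).
Proof. by rewrite /eval3 mpoly.mmapX mpoly.mmap1U. Qed.

Let d3 := poly3_var 0 * poly3_var 1 * poly3_var 2.
Let dF : d3%:F = fracU * fracR * fracL. Proof. by rewrite !tofracM. Qed.
Let dE : eval3 d3 = fracU * fracR * w. Proof. by rewrite !eval3M !eval3_var. Qed.
Let dE0 : fracU * fracR * w != 0.
Proof. exact: mulf_neq0 (mulf_neq0 fracU_neq0 fracR_neq0) w0. Qed.

(** A Laurent polynomial is a fraction [p / (U R L)^k] in many ways. The value is first a relation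
    over all of them; injectivity of polynomials into fractions makes it single-valued. *)
Definition evaluates (x y : frac3) := exists k p,
  x * (fracU * fracR * fracL) ^+ k = p%:F /\ y * (fracU * fracR * w) ^+ k = eval3 p.

Lemma evaluates_inj x y y' : evaluates x y -> evaluates x y' -> y = y'.
Proof.
move=> [k [p [xp yp]]] [l [q [xq yq]]].
have : p * d3 ^+ l = q * d3 ^+ k.
  by apply/eqP; rewrite -tofrac_eq !tofracM !tofracXn dF -xp -xq; apply/eqP; rewrite mulrAC.
move=> /(congr1 eval3); rewrite !eval3M !eval3X dE -yp -yq; exact: cancel_powers.
Qed.

Lemma evaluates_ex (x : laurent) : exists y, evaluates x y.
Proof.
case/asboolP: (valP x) => k [p xE]; exists (eval3 p / (fracU * fracR * w) ^+ k), k, p.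
by split=> //; exact: (divfK (expf_neq0 k dE0)).
Qed.

Definition laurent_eval (x : laurent) : frac3 := projT1 (cid (evaluates_ex x)).

Lemma laurent_evalE (x : laurent) y : evaluates x y -> laurent_eval x = y.
Proof. by rewrite /laurent_eval; case: cid => y' /= h; apply: evaluates_inj. Qed.

Lemma laurent_evalP (x : laurent) : evaluates x (laurent_eval x).
Proof. by rewrite /laurent_eval; case: cid. Qed.

Lemma laurent_evalB : {morph laurent_eval : x y / x - y}.
Proof.
move=> x y; apply: laurent_evalE; have [k [p [xp yp]]] := laurent_evalP x.
have [l [q [xq yq]]] := laurent_evalP y; exists (k + l)%N, (p * d3 ^+ l - q * d3 ^+ k).
rewrite tofracB !tofracM !tofracXn dF -xp -xq eval3D eval3N !eval3M !eval3X dE -yp -yq.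
by split; apply: powers_sub.
Qed.

Lemma laurent_evalM : {morph laurent_eval : x y / x * y}.
Proof.
move=> x y; apply: laurent_evalE; have [k [p [xp yp]]] := laurent_evalP x.
have [l [q [xq yq]]] := laurent_evalP y; exists (k + l)%N, (p * q).
by rewrite tofracM -xp -xq eval3M -yp -yq; split; apply: powers_mul.
Qed.

Lemma laurent_eval1 : laurent_eval 1 = 1.
Proof. by apply: laurent_evalE; exists 0%N, 1; rewrite tofrac1 eval3_1 !expr0 !mulr1. Qed.

HB.instance Definition _ := GRing.isZmodMorphism.Build laurent frac3 laurent_eval laurent_evalB.
HB.instance Definition _ := GRing.isMonoidMorphism.Build laurent frac3 laurent_eval
  (laurent_eval1, laurent_evalM).

Lemma eval3_mon3 a b c : eval3 (mpoly.mpolyX int (mon3 a b c)) = mono w (a%:Z, b%:Z, c%:Z).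
Proof.
rewrite /mon3 !mpoly.mpolyXD -!mpoly.mpolyXn !eval3M !eval3X.
by rewrite (eval3_var 0) (eval3_var 1) (eval3_var 2).
Qed.

Lemma laurent_evalD : {morph laurent_eval : x y / x + y}.
Proof. exact: rmorphD. Qed.

Lemma laurent_eval_monomial a b c : laurent_eval (laurent_monomial a b c) = mono w (a, b, c).
Proof.
apply: laurent_evalE; pose n := (absz a + absz b + absz c)%N.
exists n, (mpoly.mpolyX int (mon3 (absz (a + n%:Z)) (absz (b + n%:Z)) (absz (c + n%:Z)))).
have E (v : frac3) : v != 0 -> mono v (a, b, c) * (fracU * fracR * v) ^+ n =
    mono v ((absz (a + n%:Z))%:Z, (absz (b + n%:Z))%:Z, (absz (c + n%:Z))%:Z).
  by move=> v0; rewrite mono_diag monoM //; congr (mono v (_, _, _)) => /=; lia.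
by split; [rewrite mon3_mono; exact: (E _ fracL_neq0) | rewrite eval3_mon3; exact: (E _ w0)].
Qed.
End Evaluation.

(** Substituting [L] for itself changes nothing; this identifies the invariant of the [E_oo] ring
    with the Laurent polynomial and yields injectivity there. *)
Lemma laurent_eval_val (x : laurent) : laurent_eval fracL_neq0 x = laurent_val x.
Proof.
have [s ->] := laurent_span x; rewrite laurent_val_sum rmorph_sum.
apply: eq_bigr => -[n [[a b] c]] _ /=.
by rewrite laurent_evalM laurent_eval_monomial [X in X * _ = _](rmorph_int (laurent_eval fracL_neq0)).
Qed.

Section MonomialEvaluation.
Local Open Scope fset_scope.
Variables (I : choiceType) (F : comNzRingType) (g : I -> F).

Definition cmonom_eval (m : cmonom I) : F := \prod_(i <- finsupp m) g i ^+ m i.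

Lemma cmonom_evalEw (d : {fset I}) (m : cmonom I) : finsupp m `<=` d ->
  cmonom_eval m = \prod_(i <- d) g i ^+ m i.
Proof.
move=> le; rewrite [LHS](big_fset_incl _ le) // => i _; rewrite memNfinsupp => /eqP ->.
by rewrite expr0.
Qed.

Lemma cmonom_eval_mmorphism : monalg.mmorphism cmonom_eval.
Proof.
split=> [m1 m2|]; last by rewrite /cmonom_eval mdom1 big_seq_fset0.
rewrite {1}/cmonom_eval mdomD (cmonom_evalEw (fsubsetUl _ (finsupp m2))).
rewrite (cmonom_evalEw (fsubsetUr (finsupp m1) _)) -big_split /=.
by apply: eq_bigr => i _; rewrite cmM exprD.
Qed.

HB.instance Definition _ := monalg.isMultiplicative.Build (cmonom I) F cmonom_eval
  cmonom_eval_mmorphism.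

Lemma cmonom_evalU i : cmonom_eval (ucm i) = g i.
Proof. by rewrite /cmonom_eval mdomU big_seq_fset1 ucmE eqxx expr1. Qed.
End MonomialEvaluation.

Lemma malg_ind (I : choiceType) (R : comNzRingType) (P : {malg R[{cmonom I}]} -> Prop) :
  (forall c : R, P c%:MP) -> (forall i, P << 1 *g ucm i >>) ->
  (forall x y, P x -> P y -> P (x + y)) -> (forall x y, P x -> P y -> P (x * y)) ->
  forall x, P x.
Proof.
move=> PC PU PD PM x; rewrite (monalgE x); apply: (big_ind P) => //.
  by rewrite -malgC0E; apply: PC.
move=> m _; have -> : << mcoeff m x *g m >> = (mcoeff m x)%:MP * << 1 *g m >> :> {malg R[{cmonom I}]}.
  by rewrite malgM_def fgmulUU mulr1 mul1m.
apply: (PM) => //.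
have [k] := ubnP (mdeg m); elim: k m => // k IHk m mk.
have [->|m1] := eqVneq m (@monalg.mone _); first by rewrite -[<< _ >>]/(1%:MP); apply: PC.
have [i im] : exists i, m i != 0%N.
  apply: contrapT => h; case/negP: m1; apply/eqP/eqP/cmP => i; rewrite cm1.
  by apply/eqP; apply: contrapT => /negP ne; apply: h; exists i.
have mE : m = mmul (ucm i) (divcm m (ucm i)).
  apply/eqP/cmP => j; rewrite cmM divcmE ucmE; case: eqVneq => [<-|_] /=; last by rewrite subn0.
  by rewrite subnKC // lt0n.
rewrite mE; have -> : << 1 *g mmul (ucm i) (divcm m (ucm i)) >> =
    << 1 *g ucm i >> * << 1 *g divcm m (ucm i) >> :> {malg R[{cmonom I}]} by rewrite malgM_def fgmulUU mulr1.
by apply: PM => //; apply: IHk; move: mk; rewrite {1}mE mdegM mdegU.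
Qed.

Section RingMorphisms.
Variables (P F : comNzRingType) (f : {rmorphism P -> F}).

Lemma rmorph_scalars a b x : f a = f b \/ f x = 0 -> f (a * x - b * x) = 0.
Proof. by rewrite rmorphB !rmorphM -mulrBl => -[->|->]; rewrite ?mulr0 // subrr mul0r. Qed.

Lemma rmorph_product c x y : f y = f c \/ f x = 0 -> f (x * y - c * x) = 0.
Proof. by rewrite rmorphB !rmorphM mulrC -mulrBl => -[->|->]; rewrite ?mulr0 // subrr mul0r. Qed.

Lemma rmorph_annihilates x y : f x = 0 \/ f y = 0 -> f (x * y) = 0.
Proof. by rewrite rmorphM => -[]->; rewrite ?mulr0 ?mul0r. Qed.

Lemma rmorph_combination (s : seq (P * P)) : (forall t, t \in s -> f t.2 = 0) ->
  f (\sum_(t <- s) t.1 * t.2) = 0.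
Proof. by move=> h; rewrite rmorph_sum big_seq big1 // => t /h; rewrite rmorphM => ->; rewrite mulr0. Qed.
End RingMorphisms.

(** * Specializations of the polynomial ring *)

Section Specialization.

Local Notation poly3 := (mpoly.mpoly 3 int).
Local Notation frac3 := {fraction poly3}.

(* [None] keeps [U, R, L] and kills the variables; [Some (false, k)] maps [L] to
   [U] and keeps the [X_l] with [l > k], and [Some (true, k)] does the same for
   [R] and the [Y_l]. *)
Implicit Type o : option (bool * nat).

Definition ovar o : frac3 :=
  match o with None => fracL | Some (false, _) => fracU | Some (true, _) => fracR end.

Lemma ovar_neq0 o : ovar o != 0.
Proof. by case: o => [[[] k]|]; [exact: fracR_neq0|exact: fracU_neq0|exact: fracL_neq0]. Qed.

Definition pole (v : bool) (l : nat) : int * int * int :=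
  if v then (l%:Z, 1 - l%:Z, 0) else (1 - l%:Z, l%:Z, 0).

(** The generating function of what remains of [X_l] or [Y_l] on the page [E_(k+1)]: both ends of
    its differential, in degrees [(0, 0)] and [pole], as long as [l > k], and nothing later. The
    index [i.2] is [l - 1], whence [k <= i.2]. *)
Definition ovalue o (i : bool * nat) : frac3 :=
  if o is Some (b, k) then
    if (i.1 == ~~ b) && (k <= i.2)%N then 1 + mono (ovar o) (pole i.1 i.2.+1) else 0
  else 0.

Definition specialize o (x : laurentXY) : frac3 :=
  mmap (laurent_eval (ovar_neq0 o)) (cmonom_eval (ovalue o)) x.

Lemma specializeB o : {morph specialize o : x y / x - y}.
Proof. exact: mmapB. Qed.

Lemma specialize_monoid o : GRing.monoid_morphism (specialize o).
Proof.
by have [hM h1] := @mmap_is_multiplicative _ _ _ (laurent_eval (ovar_neq0 o)) (cmonom_eval (ovalue o)); split.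
Qed.

HB.instance Definition _ o := GRing.isZmodMorphism.Build laurentXY frac3 (specialize o) (specializeB o).
HB.instance Definition _ o := GRing.isMonoidMorphism.Build laurentXY frac3 (specialize o) (specialize_monoid o).

Lemma specializeM o : {morph specialize o : x y / x * y}.
Proof. exact: (specialize_monoid o).2. Qed.

Lemma specialize_const o c : specialize o (constXY c) = laurent_eval (ovar_neq0 o) c.
Proof. exact: mmapC. Qed.

Definition var (v : bool) (l : nat) : laurentXY := << 1 *g ucm (v, l.-1) >>.

Lemma specialize_var o v l : specialize o (var v l) = ovalue o (v, l.-1).
Proof.
rewrite [LHS]mmapU; transitivity (1 * cmonom_eval (ovalue o) (ucm (v, l.-1))).
  by congr (_ * _); exact: laurent_eval1.
by rewrite mul1r cmonom_evalU.
Qed.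

Lemma fmono_unit (F : fieldType) (u r : F) :
  fmono u r u (0, 0, 1) = fmono u r u (1, 0, 0) /\ fmono u r r (0, 0, 1) = fmono u r r (0, 1, 0).
Proof. by rewrite /fmono /= !expr0z !expr1z !mulr1 !mul1r. Qed.

Definition monomial d := laurent_monomial d.1.1 d.1.2 d.2.

(** A specialization that keeps [X_l] identifies [L] with [U] and keeps every [X_m] with [m >= l],
    with value the very factor in the relation for [X_l X_m]. One that kills [X_l] kills both sides.
    None keeps an [X] together with a [Y]. *)
Lemma specialize_relation o x : XY_relation x -> specialize o x = 0.
Proof.
have ev d : laurent_eval (ovar_neq0 o) (monomial d) = mono (ovar o) d.
  by case: d => [[a b] c]; exact: laurent_eval_monomial.
have LV v l : specialize o (constXY laurentL * var v l -
    constXY (monomial (if v then (1, 0, 0) else (0, 1, 0))) * var v l) = 0.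
  suff h : laurent_eval (ovar_neq0 o) laurentL =
      laurent_eval (ovar_neq0 o) (monomial (if v then (1, 0, 0) else (0, 1, 0))) \/ ovalue o (v, l.-1) = 0.
    apply: (rmorph_scalars (f := specialize o)); case: h => h; [left | right].
      exact: etrans (specialize_const o _) (etrans h (esym (specialize_const o _))).
    exact: etrans (specialize_var o v l) h.
  rewrite ev laurent_eval_monomial /ovalue.
  have [h1 h2] := fmono_unit fracU fracR.
  by clear -h1 h2; case: o => [[[] k]|]; case: v; [right|left|left|right|right|right].
have VV v l m : (0 < l)%N -> (l <= m)%N -> specialize o (var v l * var v m -
    constXY (1 + monomial (pole v m)) * var v l) = 0.
  move=> l0 lm; suff h : ovalue o (v, m.-1) = 1 + mono (ovar o) (pole v m) \/ ovalue o (v, l.-1) = 0.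
    apply: (rmorph_product (f := specialize o)); case: h => h; [left | right].
      apply: etrans (specialize_var o v m) (etrans h (esym (etrans (specialize_const o _) _))).
      by rewrite laurent_evalD laurent_eval1 ev.
    exact: etrans (specialize_var o v l) h.
  rewrite /ovalue.
  clear -l0 lm; case: o => [[b k]|]; last by right.
  rewrite /=; case: eqP => [vb|_]; last by right.
  have [kl|_] := leqP k l.-1; last by right.
  have km : (k <= m.-1)%N by lia.
  have m0 : (0 < m)%N by lia.
  by left; rewrite km prednK.
case=> [l m _ _|l _|l _|l m l0 lm|l m l0 lm].
- apply: (rmorph_annihilates (f := specialize o)).
  have [h|h] : ovalue o (true, l.-1) = 0 \/ ovalue o (false, m.-1) = 0.
    by clear; case: o => [[[] k]|]; [left|right|left].
  + by left; exact: etrans (specialize_var o true l) h.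
  by right; exact: etrans (specialize_var o false m) h.
- exact: (LV true).
- exact: (LV false).
- exact: (VV true).
exact: (VV false).
Qed.

Lemma specialize_ideal o x : ideal_generated XY_relation x -> specialize o x = 0.
Proof.
move=> [s [sR ->]]; apply: (rmorph_combination (f := specialize o)) => t /sR.
exact: specialize_relation.
Qed.
End Specialization.

Section IdealCongruence.
Variable P : comNzRingType.

Definition is_ideal (I : P -> Prop) := I 0 /\ forall a x y, I x -> I y -> I (a * x + y).

Lemma ideal_generatedP (S : P -> Prop) : is_ideal (ideal_generated S) /\
  forall x, S x -> ideal_generated S x.
Proof.
split; last by move=> x Sx; exists [:: (1, x)]; split=> [t|]; rewrite ?inE ?big_seq1 ?mul1r // => /eqP ->.
split; first by exists [::]; rewrite big_nil.
move=> a _ _ [s [sS ->]] [t [tS ->]]; exists ([seq (a * u.1, u.2) | u <- s] ++ t).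
split=> [u|]; first by rewrite mem_cat => /orP[/mapP[v vs ->]|/tS //]; apply: (sS v).
by rewrite big_cat big_map mulr_sumr; congr (_ + _); apply: eq_bigr => u _; rewrite mulrA.
Qed.

Variables (I : P -> Prop) (hI : is_ideal I).

Lemma idealM a x : I x -> I (a * x).
Proof. by move=> Ix; rewrite -[_ * _]addr0; apply: hI.2 => //; apply: hI.1. Qed.

Lemma idealD x y : I x -> I y -> I (x + y).
Proof. by move=> Ix; rewrite -[x in x + y]mul1r; apply: hI.2. Qed.

Lemma idealN x : I x -> I (- x).
Proof. by rewrite -mulN1r; apply: idealM. Qed.

Variable (S : P -> Prop).
Hypotheses (S0 : S 0) (SD : forall x y, S x -> S y -> S (x + y)) (SN : forall x, S x -> S (- x)).

Lemma closed_muln x n : S x -> S (n%:~R * x).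
Proof.
move=> Sx; have Sn (k : nat) : S (k%:R * x).
  by elim: k => [|k IHk]; rewrite ?mul0r // -addn1 natrD mulrDl mul1r; apply: SD.
case: n => k; first exact: Sn.
by rewrite NegzE mulrNz mulNr; apply: SN; apply: Sn.
Qed.

Lemma closed_sum (T : eqType) (s : seq T) (f : T -> P) :
  (forall t, t \in s -> S (f t)) -> S (\sum_(t <- s) f t).
Proof. by move=> h; rewrite big_seq; apply: (big_ind S). Qed.
End IdealCongruence.

(** * Normal forms modulo the relations *)

Section NormalForm.
Variables (P : comNzRingType) (con : {rmorphism laurent -> P}) (var : bool -> nat -> P).
Variables (I : P -> Prop) (hI : is_ideal I).

Definition unit_of (v : bool) (n : int) : laurent := if v then laurent_monomial n 0 0 else laurent_monomial 0 n 0.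

Hypothesis rel_XY : forall l m, (0 < l)%N -> (0 < m)%N -> I (var true l * var false m).
Hypothesis rel_L : forall v l, (0 < l)%N -> I (con laurentL * var v l - con (unit_of v 1) * var v l).
Hypothesis rel_VV : forall v l m, (0 < l)%N -> (l <= m)%N ->
  I (var v l * var v m - con (1 + monomial (pole v m)) * var v l).

(** An odd zigzag is a translate of a power of [L], positive when both ends are targets and negative
    when both are sources. An even one is a translate of [X_m] or [Y_m]; the shift by [m] in the
    second case comes from [Y_m] being numbered from its upper end at [(-m, m)]. *)
Definition zelement (z : zigzag) : P := let: (p, q, b, n) := z in let m := n./2 in
  if odd n then con (if b then laurent_monomial (p + 1) (q - m%:Z) m%:Z
                     else laurent_monomial (p + m%:Z) q (- m%:Z))
  else con (if b then laurent_monomial (p + m%:Z) (q - m%:Z) 0 else laurent_monomial p q 0) * var (~~ b) m.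

Definition zcombination (s : seq (int * zigzag)) : P := \sum_(t <- s) t.1%:~R * zelement t.2.

Definition reducible x := exists s, all (fun t : int * zigzag => zvalid (Some 1%N) t.2) s /\
  I (x - zcombination s).

Lemma reducible0 : reducible 0.
Proof. by exists [::]; rewrite /zcombination big_nil subrr; split; last exact: hI.1. Qed.

Lemma reducibleD x y : reducible x -> reducible y -> reducible (x + y).
Proof.
move=> [s [sv sI]] [t [tv tI]]; exists (s ++ t); rewrite all_cat sv tv; split=> //.
by rewrite /zcombination big_cat opprD addrACA; apply: (idealD hI).
Qed.

Lemma reducibleN x : reducible x -> reducible (- x).
Proof.
move=> [s [sv sI]]; exists [seq (- t.1, t.2) | t <- s]; split; first by rewrite all_map.
rewrite /zcombination big_map (eq_bigr (fun t => - (t.1%:~R * zelement t.2))).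
  by rewrite sumrN -opprD; apply: (idealN hI).
by move=> t _; rewrite mulrNz mulNr.
Qed.

Lemma reducible_mod x y : I (x - y) -> reducible y -> reducible x.
Proof.
by move=> h [s [sv sI]]; exists s; split=> //; rewrite -(subrK y x) -addrA; apply: (idealD hI).
Qed.

Lemma reducible_zelement z : zvalid (Some 1%N) z -> reducible (zelement z).
Proof.
move=> zv; exists [:: (1, z)]; rewrite /= zv; split=> //.
by rewrite /zcombination big_seq1 mul1r subrr; exact: hI.1.
Qed.

Lemma laurent_monomialM a b c a' b' c' : laurent_monomial a b c * laurent_monomial a' b' c' =
  laurent_monomial (a + a') (b + b') (c + c').
Proof. by apply: val_inj; exact: (monoM (a, b, c) (a', b', c') fracL_neq0). Qed.

Lemma laurent_monomial0 : laurent_monomial 0 0 0 = 1.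
Proof. by apply: val_inj; rewrite /= !expr0z !mulr1. Qed.

Lemma reducible_con c : reducible (con c).
Proof.
have [s ->] := laurent_span c; rewrite rmorph_sum.
apply: (closed_sum reducible0 reducibleD) => -[n [[a b] d]] _.
rewrite rmorphM rmorph_int; apply: (closed_muln reducible0 reducibleD reducibleN) => /=.
have [d0|d0] := lerP d 0.
  have := @reducible_zelement (a + d, b, false, (2 * absz d).+1) isT.
  rewrite /zelement mul2n /= odd_double /= uphalf_double.
  have -> : a + d + (absz d)%:Z = a by lia.
  by have -> : - (absz d)%:Z = d by lia.
have v : zvalid (Some 1%N) (a - 1, b + d, true, (2 * absz d).+1).
  by rewrite /zvalid /zlen /=; lia.
have := reducible_zelement v; rewrite /zelement mul2n /= odd_double /= uphalf_double.
have -> : a - 1 + 1 = a by lia.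
have -> : (absz d)%:Z = d by lia.
by have -> : b + d - d = b by lia.
Qed.

Lemma invertible_sub (a b a' b' x : P) : a * a' = 1 -> b * b' = 1 ->
  a' * x - b' * x = - (a' * b') * (a * x - b * x).
Proof.
move=> h h'; transitivity (a' * (b * b') * x - (a * a') * b' * x); last by ring.
by rewrite h h' mulr1 mul1r.
Qed.

(** Positive powers follow by induction. A negative power is a unit multiple of the relation for the
    opposite exponent, since all monomials are invertible. *)
Lemma rel_L_power v l n : (0 < l)%N -> I (con (laurent_monomial 0 0 n) * var v l - con (unit_of v n) * var v l).
Proof.
move=> l0; have unitM i j : unit_of v i * unit_of v j = unit_of v (i + j).
  by rewrite /unit_of; case: v; rewrite laurent_monomialM; congr laurent_monomial; rewrite addr0.
have unit0 : unit_of v 0 = 1 by rewrite /unit_of; case: (v); exact: laurent_monomial0.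
have pos (k : nat) : I (con (laurent_monomial 0 0 k%:Z) * var v l - con (unit_of v k%:Z) * var v l).
  elim: k => [|k IHk]; first by rewrite unit0 laurent_monomial0 subrr; exact: hI.1.
  have -> : laurent_monomial 0 0 k.+1%:Z = laurent_monomial 0 0 k%:Z * laurentL.
    by rewrite [RHS]laurent_monomialM; congr laurent_monomial; lia.
  have -> : unit_of v k.+1%:Z = unit_of v 1 * unit_of v k%:Z by rewrite unitM; congr unit_of; lia.
  rewrite !rmorphM; have := hI.2 (con (laurent_monomial 0 0 k%:Z)) _ _ (rel_L v l0) (idealM hI (con (unit_of v 1)) IHk).
  by congr I; ring.
have [n0|n0] := lerP 0 n.
  by have -> : n = (absz n)%:Z by lia.
rewrite (invertible_sub (a := con (laurent_monomial 0 0 (- n))) (b := con (unit_of v (- n)))).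
- have -> : - n = (absz n)%:Z by lia.
  exact: (idealM hI).
- by rewrite -rmorphM laurent_monomialM !addr0 addNr laurent_monomial0 rmorph1.
by rewrite -rmorphM unitM addNr unit0 rmorph1.
Qed.

Lemma reducible_var c v m : (0 < m)%N -> reducible (con c * var v m).
Proof.
move=> m0; have [s ->] := laurent_span c; rewrite rmorph_sum mulr_suml.
apply: (closed_sum reducible0 reducibleD) => -[n [[a b] d]] _ /=.
rewrite rmorphM rmorph_int -mulrA; apply: (closed_muln reducible0 reducibleD reducibleN).
have red a' b' : reducible (con (laurent_monomial a' b' 0) * var v m).
  have zv : zvalid (Some 1%N) (if v then (a', b', false, m.*2) else (a' - m%:Z, b' + m%:Z, true, m.*2)).
    by case: v; rewrite /zvalid /zlen /=; lia.
  have := reducible_zelement zv; case: (v); rewrite /zelement odd_double doubleK //=.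
  by rewrite subrK addrK.
have -> : con (laurent_monomial a b d) = con (laurent_monomial a b 0) * con (laurent_monomial 0 0 d).
  by rewrite -rmorphM laurent_monomialM !addr0 add0r.
apply: (@reducible_mod _ (con (laurent_monomial a b 0 * unit_of v d) * var v m)); last first.
  have -> : laurent_monomial a b 0 * unit_of v d =
      laurent_monomial (if v then a + d else a) (if v then b else b + d) 0.
    by rewrite /unit_of; case: (v); rewrite laurent_monomialM ?addr0.
  exact: red.
rewrite rmorphM -!mulrA -mulrBr; apply: (idealM hI); exact: rel_L_power.
Qed.

Lemma reducible_varM c v v' l m : (0 < l)%N -> (0 < m)%N -> reducible (con c * (var v l * var v' m)).
Proof.
move=> l0 m0; have [<-|vv] := eqVneq v v'.
  wlog lm : l m l0 m0 / (l <= m)%N.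
    by move=> h; have [|/ltnW] := leqP l m; [exact: h | rewrite mulrC [var _ _ * _]mulrC mulrC; exact: h].
  apply: (@reducible_mod _ (con (c * (1 + monomial (pole v m))) * var v l)); last exact: reducible_var.
  by rewrite rmorphM -mulrA -mulrBr; apply: (idealM hI); apply: rel_VV.
apply: (@reducible_mod _ 0); last exact: reducible0.
rewrite subr0; apply: (idealM hI).
by case: v v' vv => [] [] // _; [| rewrite mulrC]; apply: rel_XY.
Qed.

Lemma reducibleM x y : reducible x -> reducible y -> reducible (x * y).
Proof.
move=> [s [sv sI]] [t [tv tI]].
apply: (@reducible_mod _ (zcombination s * zcombination t)).
  have -> : x * y - zcombination s * zcombination t =
    y * (x - zcombination s) + zcombination s * (y - zcombination t) by ring.
  by apply: hI.2 => //; apply: (idealM hI).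
rewrite {1}/zcombination mulr_suml; apply: (closed_sum reducible0 reducibleD) => -[n z] /(allP sv) /= zv.
rewrite -mulrA; apply: (closed_muln reducible0 reducibleD reducibleN).
rewrite /zcombination mulr_sumr; apply: (closed_sum reducible0 reducibleD) => -[n' z'] /(allP tv) /= zv'.
rewrite mulrCA; apply: (closed_muln reducible0 reducibleD reducibleN).
have form u : zvalid (Some 1%N) u -> (exists c, zelement u = con c) \/
    exists c v m, (0 < m)%N /\ zelement u = con c * var v m.
  case: u => [[[p q] b] k] /and3P[k0 _ _]; rewrite /zelement; case: ifP => ok; first by left; eexists.
  by right; do 3 eexists; split; last reflexivity; move: k0; rewrite /zlen /=; lia.
have [[c ->]|[c [v [m [m0 ->]]]]] := form z zv; have [[c' ->]|[c' [v' [m' [m0' ->]]]]] := form z' zv'.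
- by rewrite -rmorphM; apply: reducible_con.
- by rewrite mulrA -rmorphM; apply: reducible_var.
- by rewrite mulrC mulrA -rmorphM; apply: reducible_var.
by rewrite mulrACA -rmorphM; apply: reducible_varM.
Qed.

Lemma reducible_single v l : (0 < l)%N -> reducible (var v l).
Proof. by move=> l0; rewrite -[var v l]mul1r -(rmorph1 con); apply: reducible_var. Qed.
End NormalForm.

(** * Independence of the values of zigzags *)

Section ZigzagValues.

Local Notation poly3 := (mpoly.mpoly 3 int).
Local Notation frac3 := {fraction poly3}.

Implicit Types (o : option (bool * nat)) (z : zigzag).

Definition zdegree z : int * int * int := let: (p, q, b, n) := z in let m := n./2 in
  if odd n then if b then (p + 1, q - m%:Z, m%:Z) else (p + m%:Z, q, - m%:Z)
  else if b then (p + m%:Z, q - m%:Z, 0) else (p, q, 0).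

Definition zvalue o z : frac3 := let: (p, q, b, n) := z in
  if odd n then mono (ovar o) (zdegree z)
  else if o is Some (b', k) then
    if (b == b') && (k < n./2)%N then mono (ovar o) (zdegree z) * (1 + mono (ovar o) (pole (~~ b) n./2)) else 0
  else 0.

Lemma specialize_zelement o z : (0 < zlen z)%N ->
  specialize o (@zelement laurentXY (@malgC _ laurent) var z) = zvalue o z.
Proof.
case: z => [[[p q] b] n]; rewrite /zlen /= => n0; case: ifP => on.
  by apply: etrans (specialize_const o _) _; rewrite /= ?on; case: b; rewrite [LHS]laurent_eval_monomial.
have hvar : specialize o (var (~~ b) n./2) =
    if o is Some (b', k) then if (b == b') && (k < n./2)%N then 1 + mono (ovar o) (pole (~~ b) n./2) else 0 else 0.
  apply: etrans (specialize_var o _ _) _; rewrite /ovalue; case: (o) => [[b' k]|] //=.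
  rewrite prednK; last by lia.
  have -> : (k <= n./2.-1)%N = (k < n./2)%N by lia.
  by case: (b) (b') => [] [].
have hcon c d : c = monomial d -> specialize o ((@malgC _ laurent) c) = mono (ovar o) d.
  by move=> ->; case: d => [[? ?] ?]; apply: etrans (specialize_const o _) _; exact: laurent_eval_monomial.
apply: etrans (specializeM o _ _) _.
apply: etrans (congr2 *%R (hcon _ (if b then (p + (n./2)%:Z, q - (n./2)%:Z, 0) else (p, q, 0)) _) hvar) _.
  by case: (b).
clear hvar; case: o hcon => [[b' k]|] _; last exact: mulr0.
by case: (_ && _); [rewrite /= ?on | exact: mulr0].
Qed.

Lemma zdegree_odd_inj z z' : zvalid None z -> zvalid None z' -> zdegree z = zdegree z' -> z = z'.
Proof.
case: z z' => [[[p q] b] n] [[[p' q'] b'] n'] /and3P[_ v1 v2] /and3P[_ v1' v2'].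
rewrite /zlen /= in v1 v2 v1' v2' *; rewrite v2 v2'.
by case: b b' v1 v1' => [] [] /= v1 v1' [e1 e2 e3]; congr (_, _, _, _); lia.
Qed.

Lemma mono_drop (w w' : frac3) d : d.2 = 0 -> mono w d = mono w' d.
Proof. by case: d => d k /= ->; rewrite /mono /fmono /= !expr0z. Qed.

Lemma mono0 w : mono w (0, 0, 0) = 1.
Proof. by rewrite /mono /fmono /= !expr0z !mulr1. Qed.

Lemma mono_pole_neq0 (b : bool) m w : 1 + mono w (pole b m) != 0.
Proof.
apply/eqP => h; pose s : seq (int * (int * int * int)) := [:: (1, (0, 0, 0)); (1, pole b m)].
have s0 : \sum_(t <- s) t.1%:~R * mono fracL t.2 = 0.
  rewrite /s big_cons big_seq1 /= !mul1r mono0 -[RHS]h; congr (_ + _).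
  by apply: mono_drop; case: (b).
have := mono_indep s0 (0, 0, 0); rewrite /s !big_cons big_nil /=.
have -> : (pole b m == (0, 0, 0)) = false by case: (b); apply/eqP => -[]; lia.
by [].
Qed.

Lemma mono_extract (s : seq (int * zigzag)) (c : pred (int * zigzag)) z :
  \sum_(t <- s | c t) t.1%:~R * mono fracL (zdegree t.2) = 0 ->
  (forall t, t \in s -> (t.2 == z) = c t && (zdegree t.2 == zdegree z)) ->
  \sum_(t <- s | t.2 == z) t.1 = 0.
Proof.
move=> s0 cz; have := @mono_indep [seq (t.1, zdegree t.2) | t <- s & c t] _ (zdegree z).
rewrite !big_map !big_filter big_filter_cond => /(_ s0) h; rewrite -[RHS]h.
by rewrite big_seq_cond [RHS]big_seq_cond; apply: eq_bigl => t; case: (boolP (t \in s)) => //= /cz.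
Qed.

(** The invariant [None] kills even zigzags and sends the valid odd ones to distinct monomials, so
    it recovers their coefficients. The difference between the invariants [(b, m.-1)] and [(b, m)]
    keeps exactly the even zigzags of type [b] and half-length [m]: distinct monomials times one
    common factor, which is nonzero and can be cancelled. *)
Lemma zvalue_indep (r : option nat) (s : seq (int * zigzag)) :
  all (fun t : int * zigzag => zvalid r t.2) s ->
  (forall o, (o == None) || (r == Some 1%N) -> \sum_(t <- s) t.1%:~R * zvalue o t.2 = 0) ->
  r1infty r -> forall z, \sum_(t <- s | t.2 == z) t.1 = 0.
Proof.
move=> sv s0 hr z; have [zs|nzs] := boolP (z \in [seq t.2 | t <- s]); last first.
  rewrite big_seq_cond big_pred0 // => t; apply/negP => /andP[ts /eqP td].
  by case/mapP: nzs; exists t.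
have zv : zvalid r z by case/mapP: zs => t /(allP sv) tv ->.
have oddv u : zvalid r u -> odd (zlen u) -> zvalid None u.
  by move=> /and3P[h1 h2 _] h3; apply/and3P.
have [oz|ez] := boolP (odd (zlen z)).
  apply: (@mono_extract s (fun t => odd (zlen t.2))).
    rewrite -[RHS](s0 None isT) big_mkcond; apply: eq_bigr => -[n [[[p q] b] l]] _ /=.
    by rewrite /zlen /=; case: (odd l); rewrite ?mulr0.
  move=> t /(allP sv) /= tv; apply/eqP/andP => [->|[ot /eqP e]]; first by rewrite oz eqxx.
  by apply: zdegree_odd_inj e; apply: oddv.
have r1 : r == Some 1%N.
  by case: hr zv => -> // /and3P[_ _ /=]; rewrite (negbTE ez).
case: z zs zv ez => [[[p q] b] n] zs zv; rewrite /zlen /= => ez; pose m := n./2.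
have m0 : (0 < m)%N by case/and3P: zv; rewrite /zlen /m /=; lia.
apply: (@mono_extract s (fun t => [&& ~~ odd (zlen t.2), t.2.1.2 == b & (zlen t.2)./2 == m])).
  have c0 := mono_pole_neq0 (~~ b) m (ovar (Some (b, m))).
  suff /eqP : (\sum_(t <- s | [&& ~~ odd (zlen t.2), t.2.1.2 == b & (zlen t.2)./2 == m])
      t.1%:~R * mono fracL (zdegree t.2)) * (1 + mono (ovar (Some (b, m))) (pole (~~ b) m)) = 0.
    by rewrite mulf_eq0 (negbTE c0) orbF => /eqP.
  rewrite mulr_suml.
  transitivity (\sum_(t <- s) t.1%:~R * zvalue (Some (b, m.-1)) t.2 -
                \sum_(t <- s) t.1%:~R * zvalue (Some (b, m)) t.2); last first.
    by rewrite !s0 ?r1 ?orbT // subrr.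
  rewrite -sumrB big_mkcond; apply: eq_bigr => -[k [[[p' q'] b'] l]] _ /=.
  rewrite /zlen /= -mulrBr; case: (boolP (odd l)) => ol.
    by rewrite subrr mulr0.
  rewrite /=; have [bb|] := eqVneq b' b; last by rewrite subrr mulr0.
  have [lm|ne] := eqVneq l./2 m.
    rewrite lm ltnn prednK // leqnn subr0 -mulrA bb; congr (_ * (_ * _)).
    by apply: mono_drop => /=; rewrite ?(negbTE ol); case: (b).
  rewrite /=; have -> : (m.-1 < l./2)%N = (m < l./2)%N by lia.
  by rewrite subrr mulr0.
move=> [k [[[p' q'] b'] l]] _; rewrite /zlen /= /m; apply/eqP/andP => [[-> -> -> ->]|[/and3P[ol /eqP -> /eqP lm]]].
  by rewrite ez !eqxx.
rewrite (negbTE ol) (negbTE ez) lm; case: (b) => /eqP [e1 e2]; congr (_, _, _, _); lia.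
Qed.
End ZigzagValues.

(** * Invariants of complexes *)

Section Values.
Variable K : fieldType.
Implicit Types (A B C M : dcomplex K) (z : zigzag) (o : option (bool * nat)).

Local Notation poly3 := (mpoly.mpoly 3 int).
Local Notation frac3 := {fraction poly3}.

(** The exponents [(a, b, c)] of [U^a R^b L^c] whose class has column degree, row degree and total
    degree [d]: those of [U], [R], [L] are [(1, 0, 1)], [(0, 1, 1)], [(1, 1, 1)]. *)
Definition bifiltered_degree (d : int * int * int) : int * int * int :=
  (d.2 - d.1.2, d.2 - d.1.1, d.1.1 + d.1.2 - d.2).

Definition column_degree (b : bool) (d : int * int) : int * int * int :=
  if b then (d.2 - d.1, d.1, 0) else (d.1, d.2 - d.1, 0).

Definition flip (b : bool) M := if b then transpose M else M.

(** [y] is the generating function of some model of [M]. A relation, because a model has to be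
    exhibited; that all models of a complex share the same [y] is the content of the invariance
    lemmas. *)
Definition has_value o M (y : frac3) : Prop :=
  match o with
  | None => exists (I : finType) (deg : I -> int * int * int), bifiltered_model M deg /\
      y = \sum_i mono fracL (bifiltered_degree (deg i))
  | Some (b, k) => exists (I : finType) (deg : I -> int * int), column_model k (flip b M) deg /\
      y = \sum_i mono fracL (column_degree b (deg i))
  end.

Lemma sum_fun_big (I J : finType) (T : Type) (V : nmodType) (f : I -> T) (g : J -> T) (F : T -> V) :
  \sum_i F (sum_fun f g i) = \sum_i F (f i) + \sum_j F (g j).
Proof. by rewrite big_sumType. Qed.

Lemma flip_dsum b A B k (I : finType) (deg : I -> int * int) :
  column_model k (dsum (flip b A) (flip b B)) deg -> column_model k (flip b (dsum A B)) deg.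
Proof.
by case: b.
Qed.

Lemma transpose_tensor A B C : is_tensor A B C -> is_tensor (transpose A) (transpose B) (transpose C).
Proof.
move=> [t [tt td t1 t2]]; exists t; split=> //.
- by move=> p q p' q' a b ha hb; apply: td.
- by move=> p q a b ha; rewrite (addrC p q); apply: t2.
by move=> p q a b ha; rewrite (addrC p q); apply: t1.
Qed.

Lemma has_value_dsum o A B y y' : has_value o A y -> has_value o B y' -> has_value o (dsum A B) (y + y').
Proof.
case: o => [[b k]|] [I [deg [h ->]]] [J [deg' [h' ->]]].
  do 2 eexists; split; first exact: flip_dsum (column_model_dsum h h').
  exact: esym (sum_fun_big deg deg' (fun d => mono fracL (column_degree b d))).
do 2 eexists; split; first exact: bifiltered_model_dsum h h'.
exact: esym (sum_fun_big deg deg' (fun d => mono fracL (bifiltered_degree d))).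
Qed.

Lemma mono_prod (I J : finType) (f : I -> int * int * int) (g : J -> int * int * int) h :
  (forall x : I * J, h x = ((f x.1).1.1 + (g x.2).1.1, (f x.1).1.2 + (g x.2).1.2, (f x.1).2 + (g x.2).2)) ->
  (\sum_i mono fracL (f i)) * (\sum_j mono fracL (g j)) = \sum_x mono fracL (h x).
Proof.
move=> hE; rewrite big_distrlr /= pair_big /=; apply: eq_bigr => x _.
by rewrite hE; exact: (monoM _ _ fracL_neq0).
Qed.

Lemma has_value_tensor o A B C y y' : is_tensor A B C -> has_value o A y -> has_value o B y' ->
  has_value o C (y * y').
Proof.
move=> ten; case: o => [[b k]|] [I [deg [h ->]]] [J [deg' [h' ->]]].
  have ten' : is_tensor (flip b A) (flip b B) (flip b C) by case: (b) => //; apply: transpose_tensor.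
  do 2 eexists; split; first exact: column_model_tensor ten' h h'.
  by apply: mono_prod => x; rewrite /column_degree /=; case: (b) => /=; congr (_, _, _); ring.
do 2 eexists; split; first exact: bifiltered_model_tensor ten h h'.
by apply: mono_prod => x; rewrite /bifiltered_degree /=; congr (_, _, _); ring.
Qed.

Definition admissible (r : option nat) o := (o == None) || (r == Some 1%N).

Lemma has_value_unique r o A B (f : {linear A -> B}) y y' : admissible r o -> r1infty r ->
  bounded A -> bounded B -> Er_isomorphism r f -> has_value o A y -> has_value o B y' -> y = y'.
Proof.
move=> ao hr bA bB fE; case: o ao => [[b k]|] ao [I [deg [h ->]]] [J [deg' [h' ->]]].
  have r1 : r = Some 1%N by apply/eqP.
  rewrite r1 in fE; pose F d := mono fracL (column_degree b d).
  case: b h h' @F {ao} => h h' F; last exact: (column_model_unique F bA bB fE h h').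
  exact: (column_model_unique F (transpose_bounded bA) (transpose_bounded bB) (transpose_Er_isomorphism fE) h h').
apply: (bifiltered_model_unique (fun d => mono fracL (bifiltered_degree d)) bA bB _ h h').
by case: hr fE => -> fE; [exact: fE | exact: (E1_isomorphism_pages (r := None) bA bB fE isT)].
Qed.

Lemma zcolumn k z : (0 < zlen z)%N -> exists (I : finType) (deg : I -> int * int),
  column_model k (zcomplex K z) deg /\ forall F : int * int -> frac3, \sum_i F (deg i) =
  let: (p, q, b, n) := z in
  if odd n then F (if b then (p + (n./2)%:Z + 1, p + q + 1) else (p, p + q))
  else if ~~ b && (k < n./2)%N then F (p + (n./2)%:Z, p + q + 1) + F (p, p + q) else 0.
Proof.
case: z => [[[p q] b] n] n0; rewrite /zlen /= in n0; set z : zigzag := (p, q, b, n).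
have zc j : zcol z j = p + (uphalf (b + j))%:Z by [].
have s0 : zsource z 0 = ~~ b by rewrite /zsource /zpar /= addn0; case: (b).
have sl : zsource z n.-1 = if b then ~~ odd n else odd n.
  by rewrite /zsource /zpar /=; case: (b) => /=; lia.
have [on|en] := boolP (odd n); case bE: b.
- exists unit, (fun _ => (zcol z n.-1, p + q + 1)); split.
    by apply: (@zcolumn_model_tail K z n0 k); rewrite ?s0 ?sl bE ?on.
  by move=> F; rewrite (big_pred1 tt) => [|[]] //; rewrite zc bE; congr (F (_, _)); lia.
- exists unit, (fun _ => (zcol z 0%N, p + q)); split.
    by apply: (@zcolumn_model_head K z n0 k); rewrite ?s0 ?sl bE ?on.
  by move=> F; rewrite (big_pred1 tt) => [|[]] //; rewrite zc bE; congr (F (_, _)); lia.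
- exists void, (fun x => of_void _ x); split; last by move=> F; rewrite big1 // => -[].
  by apply: (@zcolumn_model_acyclic K z n0 k); rewrite ?s0 ?sl bE ?en.
have [km|mk] := ltnP k n./2.
  exists bool, (fun b : bool => if b then (zcol z n.-1, p + q + 1) else (zcol z 0%N, p + q)); split.
    by apply: (@zcolumn_model_arrow K z n0 k); rewrite ?s0 ?sl ?bE ?(negbTE en).
  by move=> F; rewrite big_bool !zc bE; congr (F (_, _) + F (_, _)); lia.
exists void, (fun x => of_void _ x); split; last by move=> F; rewrite big1 // => -[].
by apply: (@zcolumn_model_arrow0 K z n0 k); rewrite ?s0 ?sl ?bE ?(negbTE en).
Qed.

Lemma fmono_fold (F : fieldType) (u r : F) (a b c : int) : u != 0 -> r != 0 ->
  fmono u r u (a, b, c) = fmono u r r (a + c, b, 0) /\ fmono u r r (a, b, c) = fmono u r u (a, b + c, 0).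
Proof.
move=> u0 r0; rewrite /fmono /= !expr0z !mulr1 !expfzDr //; split; last by rewrite mulrA.
by rewrite mulrAC.
Qed.

Lemma mono_fold (b : bool) k (d : int * int * int) : mono (ovar (Some (b, k))) d =
  mono fracL (if b then (d.1.1, d.1.2 + d.2, 0) else (d.1.1 + d.2, d.1.2, 0)).
Proof.
case: d => [[x y] c]; have [h1 h2] := fmono_fold x y c fracU_neq0 fracR_neq0.
by case: b; [apply: etrans h2 _ | apply: etrans h1 _]; exact: mono_drop.
Qed.

Lemma zcomplex_value o z : (0 < zlen z)%N -> has_value o (zcomplex K z) (zvalue o z).
Proof.
case: z => [[[p q] b] n] n0; rewrite /zlen /= in n0; set z : zigzag := (p, q, b, n).
case: o => [[c k]|]; last first.
  have s0 : zsource z 0 = ~~ b by rewrite /zsource /zpar /= addn0; case: (b).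
  have sl : zsource z n.-1 = if b then ~~ odd n else odd n.
    by rewrite /zsource /zpar /=; case: (b) => /=; lia.
  have [on|en] := boolP (odd n); case bE: b.
  - exists unit, (fun _ => (zcol z n.-1, zrow z 0, p + q + 1)); split.
      by apply: (@zbifiltered_model_tail K z n0); rewrite ?s0 ?sl bE ?on.
    rewrite (big_pred1 tt) => [|[]] //; rewrite /zvalue /zdegree /z /= on bE /bifiltered_degree /zcol /zrow /zpar /=.
    by congr (mono _ (_, _, _)); lia.
  - exists unit, (fun _ => (zcol z 0, zrow z n.-1, p + q)); split.
      by apply: (@zbifiltered_model_head K z n0); rewrite ?s0 ?sl bE ?on.
    rewrite (big_pred1 tt) => [|[]] //; rewrite /zvalue /zdegree /z /= on bE /bifiltered_degree /zcol /zrow /zpar /=.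
    by congr (mono _ (_, _, _)); lia.
  - exists void, (fun x => of_void _ x); split; last by rewrite /zvalue /z /= (negbTE en) big1 // => -[].
    by apply: (@zbifiltered_model_acyclic K z n0); rewrite ?s0 ?sl bE ?en.
  exists void, (fun x => of_void _ x); split; last by rewrite /zvalue /z /= (negbTE en) big1 // => -[].
  by apply: (@zbifiltered_model_acyclic K z n0); rewrite ?s0 ?sl bE ?en.
have E (d1 d2 : int * int * int) : d1 = d2 -> mono fracL d1 = mono fracL d2 by move=> ->.
case: c.
  have [f [g [fM fg gf]]] := ztranspose_iso K z.
  have z0' : (0 < zlen (ztranspose z))%N by [].
  have [I [deg [h hF]]] := zcolumn k z0'; exists I, deg; split; first exact: column_model_iso fM fg gf h.
  rewrite (hF (fun d => mono fracL (column_degree true d))) /zvalue /z /ztranspose /zsource /zcol /zrow /zpar /zlen /=.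
  have sl : odd (b + n.-1) = if b then odd n else ~~ odd n by case: (b); rewrite /= ?add0n; lia.
  rewrite sl; have [on|en] := boolP (odd n).
    rewrite ?negbK (mono_fold true k); apply: E.
    by case: (b); rewrite /column_degree /zdegree /= ?on /=; congr (_, _, _); lia.
  rewrite /=; case: (b) => //=; case: ifP => // km.
  rewrite !(mono_fold true k) mulrDr mulr1 addrC (monoM _ _ fracL_neq0) /zdegree ?(negbTE en) /column_degree /=.
  by congr (_ + _); apply: E; congr (_, _, _); lia.
have [I [deg [h hF]]] := @zcolumn k z n0; exists I, deg; split; first exact: h.
rewrite (hF (fun d => mono fracL (column_degree false d))) /zvalue /z /=.
have [on|en] := boolP (odd n).
  rewrite (mono_fold false k); apply: E.
  by case: (b); rewrite /column_degree /zdegree /= ?on /=; congr (_, _, _); lia.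
case: (b) => //=; case: ifP => // km.
rewrite !(mono_fold false k) mulrDr mulr1 addrC (monoM _ _ fracL_neq0) /zdegree ?(negbTE en) /column_degree /=.
by congr (_ + _); apply: E; congr (_, _, _); lia.
Qed.

Lemma nil_value o z : zlen z = 0%N -> has_value o (zcomplex K z) 0.
Proof.
move=> z0; have Z0 := zigzag_nil z0; case: o => [[b k]|].
  exists void, (fun x => of_void _ x); split; last by rewrite big1 // => -[].
  have Z0' (x : flip b (zcomplex K z)) : x = 0 by case: b x => x; exact: Z0.
  exists (fun x => of_void _ x), (fun x => of_void _ x), idfun; split; try by case.
    by split=> [n x _ p q _|m n x _ p q _]; exact: Z0'.
  by move=> x; rewrite [LHS]Z0' [RHS]Z0'.
exists void, (fun x => of_void _ x); split; last by rewrite big1 // => -[].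
exists (fun x => of_void _ x), (fun x => of_void _ x), (fun x => of_void _ x),
  (fun x => of_void _ x), (fun x => of_void _ x), idfun; split; try by case.
split=> [n x _ p q _|x]; first exact: Z0.
by rewrite [LHS]Z0 [RHS]Z0.
Qed.

Lemma zsum_value o zs : all (fun z => 0 < zlen z)%N zs ->
  has_value o (zsum K zs) (\sum_(z <- zs) zvalue o z).
Proof.
elim: zs => [|z zs IHzs] /=; first by move=> _; rewrite big_nil; exact: (@nil_value o (0, 0, false, 0%N) erefl).
by move=> /andP[z0 /IHzs h]; rewrite big_cons; apply: has_value_dsum h; apply: zcomplex_value.
Qed.

Lemma qbasis_findim (V : lmodType K) (Z N : V -> Prop) (J : finType) (P : pred J) v :
  qbasis Z N P v -> subquotient_findim Z N.
Proof.
move=> [vZ vS _]; exists #|P|, (fun j => v (enum_val j)); split=> [j|x /vS[c h]].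
  by apply: vZ; exact: enum_valP.
by exists (fun j => c (enum_val j)); rewrite -(big_enum_val (A := P) (fun j => c j *: v j)).
Qed.

(** Finite models give finite bases of all finite pages from the first on. In a given column [E_oo]
    agrees with a late finite page, so it is covered as well. *)
Lemma model_findim r M : r1infty r -> bounded M ->
  (forall b k, exists y, has_value (Some (b, k)) M y) -> findim_pages r M.
Proof.
have main A k m n (I : finType) (deg : I -> int * int) : column_model k A deg -> subquotient_findim
    (@page_cycles K A false (Some k.+1) m n) (@page_boundaries K A false (Some k.+1) m n).
  by move=> /column_model_basis[v /(_ m n)/qbasis_findim].
have iff (V : lmodType K) (Z N Z' N' : V -> Prop) : (forall x, Z x <-> Z' x) -> (forall x, N x <-> N' x) ->
    subquotient_findim Z N -> subquotient_findim Z' N'.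
  move=> ZZ NN [k [e [eZ eS]]]; exists k, e; split=> [j|x /ZZ/eS[c /NN h]]; first exact/ZZ.
  by exists c.
have pages k i m n : bounded M -> (forall b k, exists y, has_value (Some (b, k)) M y) -> subquotient_findim
    (@page_cycles K M i (Some k.+1) m n) (@page_boundaries K M i (Some k.+1) m n).
  move=> bM hM; have [y [I [deg [h _]]]] := hM i k.
  case: i h => h; last exact: main h.
  by apply: iff (main _ _ m n _ _ h) => x; [apply: transpose_cycles | apply: transpose_boundaries].
move=> hr bM hM i m n; case: hr => ->; last exact: pages.
have [N hN] := page_infty bM; pose k := (absz N + absz m)%N.
apply: iff (pages k i m n bM hM) => x; have [h1 h2] := hN i m n k x ltac:(lia) ltac:(lia); [exact: h1 | exact: h2].
Qed.

Lemma findim_retract r M A : r1infty r -> retract r M A -> findim_pages r M -> findim_pages r A.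
Proof.
move=> hr ret fM i m n; have [[f [_ iso] _] _] := retract_Er hr ret.
have [h1 h2 _ h4] := iso i m n; have [k [e [eZ eS]]] := fM i m n.
exists k, (f \o e); split=> [j|y /h4[x /eS[c hc] hx]]; first exact: h1.
exists c; rewrite -(subrK (f x) y) -addrA; apply: (subspaceD (@page_boundaries_subspace K A i r m n)) => //.
have := h2 _ hc; rewrite linearB linear_sum; congr page_boundaries; congr (_ - _).
by apply: eq_bigr => j _; rewrite linearZ.
Qed.
End Values.

(** * Invariants of the Grothendieck group *)

Section GrothendieckValues.
Variables (K : fieldType) (r : option nat) (hr : r1infty r).

Local Notation poly3 := (mpoly.mpoly 3 int).
Local Notation frac3 := {fraction poly3}.
Local Notation fdc := (fdcomplex K r).
Implicit Types (A B C : fdc) (X Y Z : groth K r) (o : option (bool * nat)).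

Lemma decomposition_ex A : exists zs, all (zvalid r) zs /\ retract r (zsum K zs) (sval A).
Proof. by case: A => A [bA fA]; exact: (decomposition hr bA fA). Qed.

Definition pieces A : seq zigzag := projT1 (cid (decomposition_ex A)).

Lemma piecesP A : all (zvalid r) (pieces A) /\ retract r (zsum K (pieces A)) (sval A).
Proof. by rewrite /pieces; case: cid. Qed.

Definition jvalue o A : frac3 := \sum_(z <- pieces A) zvalue o z.

Lemma zvalid_pos zs : all (zvalid r) zs -> all (fun z => 0 < zlen z)%N zs.
Proof. by apply: sub_all => z /and3P[]. Qed.

(** The inclusion of the chosen sum of zigzags followed by the retraction to [M] is an
    [E_r]-isomorphism between bounded complexes that both have values, so the choice of the
    decomposition does not matter. *)
Lemma jvalueE o A (M : dcomplex K) y : admissible r o -> bounded M -> retract r M (sval A) ->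
  has_value o M y -> jvalue o A = y.
Proof.
move=> ao bM ret hM; have [/zvalid_pos pv pret] := piecesP A.
have [[i iE _] _] := retract_Er hr pret; have [_ [s sE]] := retract_Er hr ret.
have bZ : bounded (zsum K (pieces A)) by exact: zsum_bounded.
exact: (has_value_unique ao hr bZ bM (Er_isomorphism_comp iE sE) (zsum_value K o pv) hM).
Qed.

Lemma jvalue_equiv o A B : admissible r o -> Er_equiv r (sval A) (sval B) -> jvalue o A = jvalue o B.
Proof.
move=> ao [f fE]; have [/zvalid_pos pv pret] := piecesP A; have [/zvalid_pos pv' pret'] := piecesP B.
have [[i iE _] _] := retract_Er hr pret; have [_ [s sE]] := retract_Er hr pret'.
exact: (has_value_unique ao hr (zsum_bounded K _) (zsum_bounded K _)
  (Er_isomorphism_comp (Er_isomorphism_comp iE fE) sE) (zsum_value K o pv) (zsum_value K o pv')).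
Qed.

Lemma jvalue_dsum o A B : admissible r o -> jvalue o (fdsum A B) = jvalue o A + jvalue o B.
Proof.
move=> ao; have [/zvalid_pos pv pret] := piecesP A; have [/zvalid_pos pv' pret'] := piecesP B.
apply: (@jvalueE o (fdsum A B) (dsum (zsum K (pieces A)) (zsum K (pieces B)))) => //.
- by apply: dsum_bounded; exact: zsum_bounded.
- exact: retract_dsum.
by apply: has_value_dsum; exact: zsum_value.
Qed.

Lemma tensor_jvalue A B : exists2 C : fdc, is_tensor (sval A) (sval B) (sval C) &
  forall o, admissible r o -> jvalue o C = jvalue o A * jvalue o B.
Proof.
have [/zvalid_pos pv pret] := piecesP A; have [/zvalid_pos pv' pret'] := piecesP B.
have [C bC tC] := tensor_exists (proj1 (svalP A)) (proj1 (svalP B)).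
have [M bM tM] := tensor_exists (zsum_bounded K (pieces A)) (zsum_bounded K (pieces B)).
have ret := retract_tensor pret pret' tC tM.
have vM o := has_value_tensor tM (zsum_value K o pv) (zsum_value K o pv').
have fC : findim_pages r C.
  apply: (findim_retract hr ret); apply: model_findim => // b k; eexists; exact: vM.
exists (exist _ C (conj bC fC)) => // o ao.
exact: (@jvalueE o (exist _ C (conj bC fC)) M).
Qed.

Lemma zcomplex_findim z : (0 < zlen z)%N -> bounded (zcomplex K z) /\ findim_pages r (zcomplex K z).
Proof.
move=> z0; have bz := zcomplex_bounded K z; split=> //.
by apply: model_findim => // b k; eexists; exact: zcomplex_value.
Qed.

Definition fdzigzag z (z0 : (0 < zlen z)%N) : fdc := exist _ _ (zcomplex_findim z0).

Lemma jvalue_zigzag o z (z0 : (0 < zlen z)%N) : admissible r o -> jvalue o (fdzigzag z0) = zvalue o z.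
Proof.
move=> ao; apply: (@jvalueE o (fdzigzag z0) (zcomplex K z)) => //; first exact: zcomplex_bounded.
  exact: retract_refl.
exact: zcomplex_value.
Qed.

Definition fvalue o (x : formal K r) : frac3 := \sum_(t <- x) t.1%:~R * jvalue o t.2.

Lemma count_sub_all (T : Type) (a b : pred T) s : (forall u, a u -> b u) ->
  (count b s <= count a s)%N -> all (fun u => b u ==> a u) s.
Proof.
move=> sub; elim: s => //= u s IHs; have := sub_count sub s; have := sub u.
by case: (a u); case: (b u) => //= h1 h2 h3; first [by have := h1 isT | by apply: IHs; lia | lia].
Qed.

(* A class to which the fewest others are comparable is equivalent to each of
   those, so its terms cancel and can be dropped. *)
Lemma fvalue_class0 o (x : formal K r) : admissible r o -> (forall A, class_coef x A = 0) -> fvalue o x = 0.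
Proof.
move=> ao; have [k] := ubnP (size x); elim: k x => // k IHk x xk x0.
have [s0|sx] := posnP (size x); first by rewrite (size0nil s0) /fvalue big_nil.
have [t0 _] : exists t0 : int * fdc, True by case: (x) sx => // t; exists t.
pose below (A : fdc) (t : int * fdc) := `[< Er_equiv r (sval t.2) (sval A) >].
have ex : exists c, `[< exists2 i, (i < size x)%N & count (below (nth t0 x i).2) x = c >].
  by exists (count (below (nth t0 x 0).2) x); apply/asboolP; exists 0%N.
have [c /asboolP[i ix cE] cmin] := ex_minnP ex; pose A := (nth t0 x i).2.
have bA : below A (nth t0 x i) by apply/asboolP; apply: Er_equiv_refl.
have back j : (j < size x)%N -> below A (nth t0 x j) -> Er_equiv r (sval A) (sval (nth t0 x j).2).
  move=> jx /asboolP jA; have sub u : below (nth t0 x j).2 u -> below A u.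
    by move=> /asboolP uj; apply/asboolP; apply: Er_equiv_trans uj jA.
  (* Transitivity puts everything below the [j]-th term below [A]; minimality of the count then
     forces equality, so [A] itself lies below that term. *)
  have cnt : (count (below A) x <= count (below (nth t0 x j).2) x)%N.
    by rewrite cE; apply: cmin; apply/asboolP; exists j.
  by have /(all_nthP t0)/(_ i ix)/implyP/(_ bA)/asboolP := count_sub_all sub cnt.
rewrite /fvalue (bigID (below A)) /=.
have -> : \sum_(t <- x | below A t) t.1%:~R * jvalue o t.2 = 0.
  transitivity ((\sum_(t <- x | below A t) t.1)%:~R * jvalue o A).
    rewrite raddf_sum mulr_suml; apply: eq_bigr => t /asboolP tA.
    by rewrite (jvalue_equiv ao tA).
  by rewrite [\sum_(t <- x | _) _](x0 A) mul0r.
rewrite add0r -big_filter; apply: (IHk [seq t <- x | ~~ below A t]).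
  rewrite size_filter; have := count_predC (below A) x.
  have : (0 < count (below A) x)%N by rewrite -has_count; apply/(has_nthP t0); exists i.
  rewrite -(eq_count (a1 := predC (below A)) (a2 := fun t => ~~ below A t)) //; lia.
move=> B; rewrite /class_coef big_filter_cond.
have := x0 B; rewrite /class_coef (bigID (below A)) /= => h.
rewrite (eq_bigl (fun t => below B t && ~~ below A t)); last by move=> t; rewrite andbC.
suff h0 : \sum_(t <- x | below B t && below A t) t.1 = 0 by rewrite h0 add0r in h.
(* The coefficient at [B] counts either all of the dropped terms, whose sum is the coefficient at
   [A], or none of them. So dropping them keeps every coefficient zero. *)
have [AB|nAB] := pselect (Er_equiv r (sval A) (sval B)).
  rewrite -[RHS](x0 A); apply: eq_bigl => t; apply/andP/idP => [[] //|tA]; split=> //.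
  by apply/asboolP; apply: Er_equiv_trans AB; apply/asboolP.
rewrite (big_nth t0) big_nat_cond big1 // => j /andP[/andP[_ jx] /andP[/asboolP jB jA]].
by case: nAB; apply: Er_equiv_trans (back j jx jA) jB.
Qed.

Lemma fvalue_cat o x y : fvalue o (x ++ y) = fvalue o x + fvalue o y.
Proof. by rewrite /fvalue big_cat. Qed.

Definition fopp (x : formal K r) : formal K r := [seq (- t.1, t.2) | t <- x].

Lemma fvalue_opp o x : fvalue o (fopp x) = - fvalue o x.
Proof.
by rewrite /fvalue /fopp big_map -sumrN; apply: eq_bigr => t _; rewrite /= mulrNz mulNr.
Qed.

Lemma class_coef_opp x A : class_coef (fopp x) A = - class_coef x A.
Proof. by rewrite /class_coef /fopp big_map -sumrN. Qed.

Lemma fvalue_equiv o x y : admissible r o -> formal_equiv x y -> fvalue o x = fvalue o y.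
Proof.
move=> ao [s hs]; have rel0 : fvalue o (sum_relations s) = 0.
  elim: (s) => [|t s' IHs]; first by rewrite /fvalue big_nil.
  rewrite /fvalue /sum_relations /= !big_cons -/(fvalue o _) -/(sum_relations s') IHs /=.
  by rewrite jvalue_dsum // mulrNz addr0; ring.
have : fvalue o (x ++ fopp (y ++ sum_relations s)) = 0.
  by apply: fvalue_class0 => // A; rewrite class_coef_cat class_coef_opp hs subrr.
by rewrite fvalue_cat fvalue_opp fvalue_cat rel0 addr0 => /eqP; rewrite subr_eq0 => /eqP.
Qed.

Definition gvalue o X : frac3 := fvalue o (groth_repr X).

Lemma gvalue_of o x : admissible r o -> gvalue o (groth_of x) = fvalue o x.
Proof. by move=> ao; apply: fvalue_equiv => //; apply/groth_ofP; rewrite groth_reprK. Qed.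

Lemma gvalue_add o X Y : admissible r o -> gvalue o (groth_add X Y) = gvalue o X + gvalue o Y.
Proof. by move=> ao; rewrite gvalue_of // fvalue_cat. Qed.

Lemma gvalue_opp o X : admissible r o -> gvalue o (groth_opp X) = - gvalue o X.
Proof. by move=> ao; rewrite gvalue_of // -fvalue_opp. Qed.

Lemma gvalue_class o A : admissible r o -> gvalue o (groth_class A) = jvalue o A.
Proof. by move=> ao; rewrite gvalue_of // /fvalue big_seq1 mul1r. Qed.

Lemma gvalue_zero o : admissible r o -> gvalue o (groth_zero K r) = 0.
Proof. by move=> ao; rewrite gvalue_of // /fvalue big_nil. Qed.

Lemma formal_equiv_coef (x y : formal K r) : (forall A, class_coef x A = class_coef y A) -> formal_equiv x y.
Proof. by move=> h; exists [::] => A; rewrite cats0. Qed.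

Lemma formal_equiv_cat (x x' y y' : formal K r) : formal_equiv x x' -> formal_equiv y y' -> formal_equiv (x ++ y) (x' ++ y').
Proof.
move=> [s hs] [t ht]; exists (s ++ t) => A.
rewrite /sum_relations map_cat flatten_cat !class_coef_cat hs ht !class_coef_cat.
by rewrite addrACA !addrA.
Qed.

Lemma formal_equiv_trans (x y z : formal K r) : formal_equiv x y -> formal_equiv y z -> formal_equiv x z.
Proof. by move=> /groth_ofP h /groth_ofP h'; apply/groth_ofP; rewrite h. Qed.

(** The second branch is a dummy value that makes [fdz] total; the lemmas on it assume positive
    length. *)
Definition fdz z : fdc :=
  match pselect (is_true (0 < zlen z)%N) with
  | left h => fdzigzag h
  | right _ => fdzigzag (z := (0, 0, false, 1%N)) isT
  end.

Lemma fdzE z : (0 < zlen z)%N -> sval (fdz z) = zcomplex K z.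
Proof. by rewrite /fdz; case: pselect. Qed.

Lemma jvalue_fdz o z : admissible r o -> (0 < zlen z)%N -> jvalue o (fdz z) = zvalue o z.
Proof. by move=> ao; rewrite /fdz; case: pselect => // h _; apply: jvalue_zigzag. Qed.

Definition zformal (s : seq (int * zigzag)) : formal K r := [seq (t.1, fdz t.2) | t <- s].

Lemma fvalue_zformal o s : admissible r o -> all (fun t : int * zigzag => 0 < zlen t.2)%N s ->
  fvalue o (zformal s) = \sum_(t <- s) t.1%:~R * zvalue o t.2.
Proof.
move=> ao; elim: s => [|t s IHs] /=; first by rewrite /fvalue !big_nil.
by move=> /andP[t0 /IHs]; rewrite /fvalue !big_cons => ->; rewrite jvalue_fdz.
Qed.

Lemma zvalid_all r' s : all (fun t : int * zigzag => zvalid r' t.2) s ->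
  all (fun t : int * zigzag => 0 < zlen t.2)%N s.
Proof. by apply: sub_all => z /and3P[]. Qed.

Lemma class_coef1 c A B : class_coef [:: (c, A)] B = if `[< Er_equiv r (sval A) (sval B) >] then c else 0.
Proof. by rewrite /class_coef big_mkcond big_seq1. Qed.

Lemma formal_equiv_class c A B : Er_equiv r (sval A) (sval B) -> Er_equiv r (sval B) (sval A) ->
  formal_equiv [:: (c, A)] [:: (c, B)].
Proof.
move=> AB BA; apply: formal_equiv_coef => C; rewrite !class_coef1.
by congr (if _ then _ else _); apply: asbool_equiv_eq; split; apply: Er_equiv_trans.
Qed.

Lemma zsum_formal c zs (f : bounded (zsum K zs) /\ findim_pages r (zsum K zs)) :
  all (fun z => 0 < zlen z)%N zs ->
  formal_equiv [:: (c, exist _ (zsum K zs) f)] (zformal [seq (c, z) | z <- zs]).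
Proof.
elim: zs f => [|z zs IHzs] f /=.
  (* The zero complex [N] is equivalent to [N + N], so the relation for the pair [(N, N)] shows that
     its class is zero. *)
  move=> _; set N : fdc := exist _ _ f; exists [:: (c, (N, N))] => A.
  have iso : Er_equiv r (sval N) (sval (fdsum N N)) /\ Er_equiv r (sval (fdsum N N)) (sval N).
    have N0 := @zigzag_nil K (0, 0, false, 0%N) erefl.
    have nul (M : dcomplex K) : (forall x : M, x = 0) -> null_homotopic r (fun x : M => x).
      by move=> M0; apply: null_homotopic0.
    have ret : retract r (sval N) (sval (fdsum N N)).
      by apply: retract_nil => //; apply: nul => -[u v]; congr pair; apply: N0.
    have [[i iE _] [s sE]] := retract_Er hr ret.
    by split; [exists i | exists s].
  rewrite /sum_relations /= /class_coef !big_cons big_nil /=.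
  have -> : `[< Er_equiv r (sval (fdsum N N)) (sval A) >] = `[< Er_equiv r (sval N) (sval A) >].
    by apply: asbool_equiv_eq; split; apply: Er_equiv_trans; case: iso.
  by case: ifP => _; rewrite ?addr0 // addrN addr0.
move=> /andP[z0 zs0]; have [bz fz] := zcomplex_findim z0.
have f' : bounded (zsum K zs) /\ findim_pages r (zsum K zs).
  split; first exact: zsum_bounded.
  apply: model_findim => //; first exact: zsum_bounded.
  by move=> b k; eexists; apply: zsum_value.
pose Z := fdz z; pose M : fdc := exist _ (zsum K zs) f'.
have ZE : sval Z = zcomplex K z by apply: fdzE.
apply: (@formal_equiv_trans _ [:: (c, fdsum Z M)]).
  by apply: formal_equiv_class; rewrite /= ZE; apply: Er_equiv_refl.
apply: (@formal_equiv_trans _ ([:: (c, Z)] ++ [:: (c, M)])).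
  exists [:: (- c, (Z, M))] => A.
  rewrite -[sum_relations _]/([:: (- c, Z)] ++ [:: (- c, M)] ++ [:: (- - c, fdsum Z M)]).
  by rewrite !class_coef_cat !class_coef1 opprK; do 3!case: ifP => _; lia.
exact: (formal_equiv_cat (formal_equiv_coef (x := [:: (c, Z)]) (fun _ => erefl)) (IHzs f' zs0)).
Qed.

Lemma groth_zformal X : exists s, all (fun t : int * zigzag => zvalid r t.2) s /\ X = groth_of (zformal s).
Proof.
suff h (x : formal K r) : exists s, all (fun t : int * zigzag => zvalid r t.2) s /\ formal_equiv x (zformal s).
  have [s [sv sE]] := h (groth_repr X); exists s; split=> //.
  by rewrite -(groth_reprK X); apply/groth_ofP.
elim: x => [|[c A] x [s [sv sE]]]; first by exists [::]; split=> //; apply: formal_equiv_coef.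
have [pv ret] := piecesP A; exists ([seq (c, z) | z <- pieces A] ++ s).
rewrite all_cat sv andbT all_map; split; first exact: pv.
rewrite -[_ :: x]/([:: (c, A)] ++ x) /zformal map_cat; apply: formal_equiv_cat => //.
have f' : bounded (zsum K (pieces A)) /\ findim_pages r (zsum K (pieces A)).
  split; first exact: zsum_bounded.
  apply: model_findim => //; first exact: zsum_bounded.
  by move=> b k; eexists; apply: zsum_value; apply: zvalid_pos.
apply: formal_equiv_trans (zsum_formal c f' (zvalid_pos pv)).
have [[i iE _] [t tE]] := retract_Er hr ret.
by apply: formal_equiv_class; [exists t | exists i].
Qed.

Lemma combination_by_class (T : eqType) (V : pzRingType) (u : seq (int * T)) (f : T -> V) :
  (forall z, \sum_(t <- u | t.2 == z) t.1 = 0) -> \sum_(t <- u) t.1%:~R * f t.2 = 0.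
Proof.
move: {2}(size u) (leqnn (size u)) => k; elim: k u => [|k IHk] u.
  by rewrite leqn0 => /nilP -> _; rewrite big_nil.
case: u => [|t0 u]; first by rewrite big_nil.
set v := t0 :: u => vk h; pose c (t : int * T) := t.2 == t0.2.
rewrite (bigID c) /=.
have -> : \sum_(t <- v | c t) t.1%:~R * f t.2 = 0.
  transitivity ((\sum_(t <- v | c t) t.1)%:~R * f t0.2).
    by rewrite raddf_sum mulr_suml; apply: eq_bigr => t /eqP ->.
  by rewrite [\sum_(t <- v | _) _](h t0.2) mul0r.
rewrite add0r -big_filter; apply: IHk.
  rewrite /v /= /c eqxx /=; apply: leq_trans (_ : size u <= k)%N; last exact: vk.
  by rewrite size_filter count_size.
move=> z; rewrite big_filter_cond; have [->|ne] := eqVneq z t0.2.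
  by rewrite big_pred0 // => t; rewrite /c; case: eqP.
by rewrite -[RHS](h z); apply: eq_bigl => t; rewrite /c andbC; case: eqP => [->|] //=; rewrite ne.
Qed.

Lemma sum_by_class (T : eqType) (u : seq (int * T)) (P : pred T) :
  (forall z, \sum_(t <- u | t.2 == z) t.1 = 0) -> \sum_(t <- u | P t.2) t.1 = 0.
Proof.
move=> /(combination_by_class (fun z => (P z)%:R : int)) h; rewrite -[RHS]h big_mkcond.
by apply: eq_bigr => t _; rewrite intz; case: ifP => _; rewrite ?mulr1 ?mulr0.
Qed.

(** Both classes are combinations of zigzags; equal invariants force equal total coefficients at
    each zigzag, and then equal formal sums. Ring identities are thereby reduced to identities in
    the field. *)
Lemma gvalue_inj X Y : (forall o, admissible r o -> gvalue o X = gvalue o Y) -> X = Y.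
Proof.
have [s [sv ->]] := groth_zformal X; have [t [tv ->]] := groth_zformal Y => h.
apply/groth_ofP; apply: formal_equiv_coef => A.
pose u := s ++ [seq (- p.1, p.2) | p <- t].
have uv : all (fun t : int * zigzag => zvalid r t.2) u by rewrite all_cat sv all_map.
have u0 z : \sum_(p <- u | p.2 == z) p.1 = 0.
  apply: (zvalue_indep uv) => // o ao; rewrite big_cat big_map /=.
  have := h o ao; rewrite !gvalue_of // !fvalue_zformal ?(zvalid_all sv) ?(zvalid_all tv) // => ->.
  rewrite -[RHS](subrr (\sum_(t0 <- t) t0.1%:~R * zvalue o t0.2)) -sumrN; congr (_ + _).
  by apply: eq_bigr => p _; rewrite mulrNz mulNr.
have := sum_by_class (fun z => `[< Er_equiv r (sval (fdz z)) (sval A) >]) u0.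
rewrite big_cat big_map /= sumrN => /eqP; rewrite subr_eq0 => /eqP e.
by rewrite /class_coef /zformal !big_map.
Qed.
End GrothendieckValues.

(** * The ring structure and the map from polynomials *)

Section GrothendieckRing.
Variables (K : fieldType) (r : option nat) (hr : r1infty r).

Implicit Types (X Y Z W : groth K r) (o : option (bool * nat)).

Local Notation element := (@zelement laurentXY (@malgC _ laurent) var).
Local Notation gval := (gvalue hr).

Lemma laurentXY_reducible (x : laurentXY) :
  reducible (@malgC _ laurent : {rmorphism laurent -> laurentXY}) var (ideal_generated XY_relation) x.
Proof.
have [hI hS] := ideal_generatedP XY_relation.
have hXY l m : (0 < l)%N -> (0 < m)%N -> ideal_generated XY_relation (var true l * var false m).
  by move=> l0 m0; apply: hS; exact: XY_relation_XY l0 m0.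
have hL v l : (0 < l)%N -> ideal_generated XY_relation
    (constXY laurentL * var v l - constXY (unit_of v 1) * var v l).
  by case: v => l0; apply: hS; [exact: XY_relation_LX l0 | exact: XY_relation_LY l0].
have hVV v l m : (0 < l)%N -> (l <= m)%N -> ideal_generated XY_relation
    (var v l * var v m - constXY (1 + monomial (pole v m)) * var v l).
  by case: v => l0 lm; apply: hS; [exact: XY_relation_XX l0 lm | exact: XY_relation_YY l0 lm].
apply: (malg_ind (P := fun x : laurentXY => reducible (@malgC _ laurent) var (ideal_generated XY_relation) x)) => [c|[v i]|y z|y z].
- exact: reducible_con.
- exact: (@reducible_single laurentXY _ var _ hI hL v i.+1).
- exact: reducibleD.
exact: reducibleM.
Qed.

Lemma rmorph_zcombination (P F : comNzRingType) (f : {rmorphism P -> F}) (s : seq (int * zigzag)) (e : zigzag -> P) :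
  f (\sum_(t <- s) t.1%:~R * e t.2) = \sum_(t <- s) t.1%:~R * f (e t.2).
Proof. by rewrite rmorph_sum; apply: eq_bigr => t _; rewrite rmorphM rmorph_int. Qed.

Lemma specialize_zcombination o s : all (fun t : int * zigzag => 0 < zlen t.2)%N s ->
  specialize o (zcombination (@malgC _ laurent) var s) = \sum_(t <- s) t.1%:~R * zvalue o t.2.
Proof.
move=> sv; apply: etrans (rmorph_zcombination (specialize o) s _) _.
elim: s sv => [|t s IHs] /=; first by rewrite !big_nil.
move=> /andP[t0 /IHs h]; rewrite big_cons [RHS]big_cons; congr (_ * _ + _); last exact: h.
exact: specialize_zelement.
Qed.

Lemma reducible_specialize o (x : laurentXY) s : ideal_generated XY_relation
    (x - zcombination (@malgC _ laurent) var s) -> all (fun t : int * zigzag => 0 < zlen t.2)%N s ->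
  specialize o x = \sum_(t <- s) t.1%:~R * zvalue o t.2.
Proof.
move=> /(specialize_ideal o) h sv; rewrite -(specialize_zcombination o sv).
by apply/eqP; rewrite -subr_eq0; apply/eqP; apply: etrans (esym (specializeB o _ _)) h.
Qed.

Lemma groth_of_laurent (x : laurentXY) : exists X, forall o, admissible r o -> gval o X = specialize o x.
Proof.
have [s [sv sI]] := laurentXY_reducible x; have sv' := zvalid_all sv.
exists (groth_of (zformal K hr s)) => o ao.
by rewrite (gvalue_of hr _ ao) (fvalue_zformal K hr ao sv') (reducible_specialize o sI sv').
Qed.

Lemma groth_element X : exists x : laurentXY, forall o, admissible r o -> gval o X = specialize o x.
Proof.
have [s [sv ->]] := groth_zformal hr X; have sv' := zvalid_all sv.
exists (zcombination (@malgC _ laurent) var s) => o ao.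
by rewrite (gvalue_of hr _ ao) (fvalue_zformal K hr ao sv') (specialize_zcombination o sv').
Qed.

(** The class whose invariants are the specializations of [x]. It exists by reduction to normal form
    and is unique by [gvalue_inj]. *)
Definition groth_map (x : laurentXY) : groth K r := projT1 (cid (groth_of_laurent x)).

Lemma groth_mapE o x : admissible r o -> gval o (groth_map x) = specialize o x.
Proof. by rewrite /groth_map; case: cid => X /= h; apply: h. Qed.

Lemma groth_mul_ex X Y : exists W, forall o, admissible r o -> gval o W = gval o X * gval o Y.
Proof.
have [x xE] := groth_element X; have [y yE] := groth_element Y.
exists (groth_map (x * y)) => o ao; rewrite (groth_mapE _ ao) (xE o ao) (yE o ao); exact: specializeM.
Qed.

(** The class whose invariants are the products. Existence follows since every class comes from a
    polynomial; compatibility with tensor products is then the multiplicativity of the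
    invariants. *)
Definition groth_mul X Y : groth K r := projT1 (cid (groth_mul_ex X Y)).

Lemma groth_mulE o X Y : admissible r o -> gval o (groth_mul X Y) = gval o X * gval o Y.
Proof. by rewrite /groth_mul; case: cid => W /= h; apply: h. Qed.

Lemma groth_tensor_mul : tensor_mul groth_mul.
Proof.
split=> [X Y Z|X Y Z|A B].
- by apply: (gvalue_inj (hr := hr)) => o ao; rewrite (gvalue_add hr _ _ ao) !(groth_mulE _ _ ao) (gvalue_add hr _ _ ao) mulrDl.
- by apply: (gvalue_inj (hr := hr)) => o ao; rewrite (gvalue_add hr _ _ ao) !(groth_mulE _ _ ao) (gvalue_add hr _ _ ao) mulrDr.
have [C tC vC] := tensor_jvalue hr A B; exists C => //.
by apply: (gvalue_inj (hr := hr)) => o ao; rewrite (groth_mulE _ _ ao) !(gvalue_class hr _ ao) (vC o ao).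
Qed.

Lemma groth_map_shape (x : laurentXY) z S : (0 < zlen z)%N -> x = element z -> S =i zsupport z ->
  shape_class S (groth_map x).
Proof.
move=> z0 xE SE; exists (fdzigzag K hr z0); first exact: has_shape_zcomplex.
apply: (gvalue_inj (hr := hr)) => o ao; rewrite (groth_mapE _ ao) (gvalue_class hr _ ao) (jvalue_zigzag K hr z0 ao) xE.
exact: specialize_zelement.
Qed.

Lemma element1 (a b : int) : element (a, b, false, 1%N) = constXY (laurent_monomial a b 0).
Proof. exact: (congr1 (fun d => constXY (laurent_monomial d b 0)) (addr0 a)). Qed.

Lemma groth_map_unit : shape_class [:: (0, 0)] (groth_map 1).
Proof.
apply: (@groth_map_shape _ (0, 0, false, 1%N) _ isT _ (fun _ => erefl)).
apply: etrans (esym (element1 0 0)); rewrite laurent_monomial0.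
exact: esym (rmorph1 (@malgC _ laurent : {rmorphism laurent -> laurentXY})).
Qed.

Lemma groth_map_U : shape_class [:: (1, 0)] (groth_map (constXY laurentU)).
Proof. by apply: (@groth_map_shape _ (1, 0, false, 1%N)) => //; rewrite /zelement /= addr0 oppr0. Qed.

Lemma groth_map_R : shape_class [:: (0, 1)] (groth_map (constXY laurentR)).
Proof. by apply: (@groth_map_shape _ (0, 1, false, 1%N)) => //; rewrite /zelement /= addr0 oppr0. Qed.

Lemma groth_map_L : shape_class shapeL (groth_map (constXY laurentL)).
Proof.
apply: (@groth_map_shape _ (- 1, 1, true, 3%N)) => //.
move=> x; rewrite -[zsupport _]/[:: (0, 1); (0, 0); (1, 0)] !inE.
by do 3!case: (x == _).
Qed.

Lemma shapeX_support l : shapeX l =i zsupport (0, 0, false, (2 * l)%N).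
Proof.
move=> [p q]; apply/flatten_mapP/zsupportP => [[j]|[j jl [-> ->]]].
  rewrite mem_iota !inE => jl /orP[]/eqP[-> ->]; [exists (2 * j)%N | exists (2 * j).+1];
    rewrite /zlen /zcol /zrow /zpar /=; lia.
exists (j./2); first by rewrite mem_iota; move: jl; rewrite /zlen /=; lia.
rewrite !inE /zcol /zrow /zpar /=; apply/orP.
by have [oj|ej] := boolP (odd j); [right | left]; apply/eqP; congr (_, _); lia.
Qed.

Lemma shapeY_support l : shapeY l =i zsupport (- l%:Z, l%:Z, true, (2 * l)%N).
Proof.
move=> [p q]; apply/flatten_mapP/zsupportP => [[j]|[j jl [-> ->]]].
  (* [shapeY] starts at its lower end and zigzags are numbered from the upper one, so [j]
     corresponds to [l - j.+1]. *)
  rewrite mem_iota !inE => jl /orP[]/eqP[-> ->]; [exists (2 * (l - j.+1)).+1 | exists (2 * (l - j.+1))%N];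
    rewrite /zlen /zcol /zrow /zpar /=; lia.
move: jl; rewrite /zlen /= => jl; exists (l - (j./2).+1)%N; first by rewrite mem_iota; lia.
rewrite !inE /zcol /zrow /zpar /=; apply/orP.
by have [oj|ej] := boolP (odd j); [left | right]; apply/eqP; congr (_, _); lia.
Qed.

Lemma const_monomial1 (y : laurentXY) : y = constXY (laurent_monomial 0 0 0) * y.
Proof. by rewrite laurent_monomial0 [constXY 1](rmorph1 (@malgC _ laurent : {rmorphism laurent -> laurentXY})) mul1r. Qed.

Lemma groth_map_X l : (0 < l)%N -> shape_class (shapeX l) (groth_map (varX l)).
Proof.
move=> l0; apply: (@groth_map_shape _ (0, 0, false, (2 * l)%N)); first by rewrite /zlen /=; lia.
  rewrite /zelement mul2n odd_double doubleK; exact: const_monomial1.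
exact: shapeX_support.
Qed.

Lemma groth_map_Y l : (0 < l)%N -> shape_class (shapeY l) (groth_map (varY l)).
Proof.
move=> l0; apply: (@groth_map_shape _ (- l%:Z, l%:Z, true, (2 * l)%N)); first by rewrite /zlen /=; lia.
  rewrite /zelement mul2n odd_double doubleK addNr subrr; exact: const_monomial1.
exact: shapeY_support.
Qed.

Lemma groth_map_add x y : groth_map (x + y) = groth_add (groth_map x) (groth_map y).
Proof.
apply: (gvalue_inj (hr := hr)) => o ao; rewrite (gvalue_add hr _ _ ao) !(groth_mapE _ ao).
exact: (rmorphD (specialize o)).
Qed.

Lemma groth_map_mul x y : groth_map (x * y) = groth_mul (groth_map x) (groth_map y).
Proof.
by apply: (gvalue_inj (hr := hr)) => o ao; rewrite (groth_mulE _ _ ao) !(groth_mapE _ ao); exact: specializeM.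
Qed.

Lemma groth_map_surjective X : exists x, groth_map x = X.
Proof.
have [x xE] := groth_element X; exists x; apply: (gvalue_inj (hr := hr)) => o ao.
by rewrite (groth_mapE _ ao) (xE o ao).
Qed.

Lemma groth_map_ideal x : ideal_generated XY_relation x -> groth_map x = groth_zero K r.
Proof.
move=> Ix; apply: (gvalue_inj (hr := hr)) => o ao; rewrite (groth_mapE _ ao) (gvalue_zero K hr ao).
exact: specialize_ideal.
Qed.
End GrothendieckRing.

(** * Kernel and generators for the first page *)

Section FirstPage.
Variable K : fieldType.

Variable hr : r1infty (Some 1%N).
Let adm o : admissible (Some 1%N) o. Proof. by rewrite /admissible orbT. Qed.

Local Notation gmap := (groth_map K hr).
Local Notation gmul := (groth_mul (K := K) hr).

(** Modulo the relations [x] is a combination of zigzags, and the invariants of the zero class make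
    the coefficients of that combination cancel zigzag by zigzag. *)
Lemma groth_map_kernel x : gmap x = groth_zero K (Some 1%N) -> ideal_generated XY_relation x.
Proof.
move=> x0; have [s [sv sI]] := laurentXY_reducible x; have sv' := zvalid_all sv.
have z0 o : \sum_(t <- s) t.1%:~R * zvalue o t.2 = 0.
  by rewrite -(reducible_specialize o sI sv') -(groth_mapE K hr x (adm o)) x0 (gvalue_zero K hr (adm o)).
have e0 : zcombination (@malgC _ laurent) var s = 0 :> laurentXY.
  by apply: combination_by_class; exact: (zvalue_indep sv (fun o _ => z0 o) hr).
by rewrite e0 subr0 in sI.
Qed.

Lemma zvalue_stable z k : (zlen z <= k)%N -> zvalue (Some (false, k)) z = zvalue (Some (false, k.+1)) z.
Proof.
case: z => [[[p q] b] n]; rewrite /zlen /= => nk.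
have E k' : zvalue (Some (false, k')) (p, q, b, n) =
    if odd n then mono fracU (zdegree (p, q, b, n))
    else if (b == false) && (k' < n./2)%N
         then mono fracU (zdegree (p, q, b, n)) * (1 + mono fracU (pole (~~ b) n./2)) else 0 by [].
have e1 : (k < n./2)%N = false by lia.
have e2 : (k.+1 < n./2)%N = false by lia.
apply: etrans (E k) (etrans _ (esym (E k.+1))); by rewrite e1 e2 !andbF.
Qed.

Lemma gvalue_stable (X : groth K (Some 1%N)) : exists m, forall k, (m <= k)%N ->
  gvalue hr (Some (false, k)) X = gvalue hr (Some (false, k.+1)) X.
Proof.
have [s [sv ->]] := groth_zformal hr X; have sv' := zvalid_all sv.
exists (\max_(t <- s) zlen t.2) => k mk; rewrite !(gvalue_of hr _ (adm _)) !(fvalue_zformal K hr (adm _) sv').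
apply: eq_big_seq => t ts; congr (_ * _); apply: zvalue_stable; apply: leq_trans mk.
by rewrite (big_rem t ts) /= leq_maxl.
Qed.

(* The classes on which the invariants of two consecutive pages agree form a
   subring, which contains any given finite set of classes if the pages are
   late enough, but never all the [X_l]. *)
Lemma not_finitely_generated (n : nat) (s : 'I_n -> groth K (Some 1%N)) : exists Z,
  ~ subring_generated gmul (gmap 1)
      (fun Y => (exists j, Y = s j) \/ (exists c, Y = gmap (constXY c))) Z.
Proof.
have [m mE] := choice (fun j => gvalue_stable (s j)).
pose k := \max_j m j; exists (gmap (varX k.+1)) => gen.
pose T (Y : groth K (Some 1%N)) := gvalue hr (Some (false, k)) Y = gvalue hr (Some (false, k.+1)) Y.
have Tconst c : T (gmap (constXY c)).
  rewrite /T !(groth_mapE K hr _ (adm _)); apply: etrans (specialize_const _ _) _; apply: etrans _ (esym (specialize_const _ _)).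
  by congr (laurent_eval _ c); apply: bool_irrelevance.
have TZ : T (gmap (varX k.+1)).
  elim: gen => [Y [[j ->]|[c ->]]||X Y _ hX _ hY|X _ hX|X Y _ hX _ hY].
  - by apply: mE; apply: (leq_bigmax j).
  - exact: Tconst.
  - by have := Tconst 1; rewrite [constXY 1](rmorph1 (@malgC _ laurent : {rmorphism laurent -> laurentXY})).
  - by rewrite /T !(gvalue_add hr _ _ (adm _)) hX hY.
  - by rewrite /T !(gvalue_opp hr _ (adm _)) hX.
  by rewrite /T !(groth_mulE hr _ _ (adm _)) hX hY.
move: TZ; rewrite /T !(groth_mapE K hr _ (adm _)).
move=> /(etrans (esym (specialize_var _ true k.+1))) /esym /(etrans (esym (specialize_var _ true k.+1))) /esym.
(* [X_(k+1)] is alive for the index [k] and dead for [k.+1]: its two values are [1 + U^(k+1) R^(-k)]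
   and [0]. *)
rewrite /ovalue /= leqnn ltnn => /eqP.
by apply/negP; exact: (mono_pole_neq0 true k.+1 fracU).
Qed.
End FirstPage.

Theorem theorem6 (K : fieldType) :
  (exists (mul : groth K None -> groth K None -> groth K None)
          (phi : laurent -> groth K None),
     [/\ tensor_mul mul, ring_hom_to_groth mul phi & bijective phi] /\
     [/\ shape_class [:: (1, 0)] (phi laurentU),
         shape_class [:: (0, 1)] (phi laurentR) &
         shape_class shapeL (phi laurentL)])
  /\
  (exists (mul : groth K (Some 1%N) -> groth K (Some 1%N) -> groth K (Some 1%N))
          (psi : laurentXY -> groth K (Some 1%N)),
     [/\ tensor_mul mul,
         ring_hom_to_groth mul psi,
         forall Z, exists x, psi x = Z &
         forall x, psi x = groth_zero K (Some 1%N) <->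
                   ideal_generated XY_relation x] /\
     [/\ shape_class [:: (1, 0)] (psi (constXY laurentU)),
         shape_class [:: (0, 1)] (psi (constXY laurentR)),
         shape_class shapeL (psi (constXY laurentL)),
         forall l : nat, (0 < l)%N -> shape_class (shapeX l) (psi (varX l)) &
         forall l : nat, (0 < l)%N -> shape_class (shapeY l) (psi (varY l))] /\
     (forall l l' : nat, (0 < l)%N -> (0 < l')%N ->
        mul (psi (varX l)) (psi (varY l')) = groth_zero K (Some 1%N)) /\
     (forall (n : nat) (s : 'I_n -> groth K (Some 1%N)), exists Z,
        ~ subring_generated mul (psi 1)
            (fun Y => (exists j, Y = s j) \/ (exists c, Y = psi (constXY c))) Z)).
Proof.
have hN : r1infty None by left.
have h1 : r1infty (Some 1%N) by right.
split.
  exists (groth_mul (K := K) hN), (fun x => groth_map K hN (constXY x)).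
  pose con : {rmorphism laurent -> laurentXY} := @malgC _ laurent.
  split; last by split; [exact: groth_map_U | exact: groth_map_R | exact: groth_map_L].
  split; first exact: groth_tensor_mul.
    split=> [x y|x y|].
    - by rewrite [constXY _](rmorphD con) groth_map_add.
    - by rewrite [constXY _](rmorphM con) groth_map_mul.
    by rewrite [constXY 1](rmorph1 con); exact: groth_map_unit.
  (* The only admissible invariant for [E_oo] returns the Laurent polynomial itself, which gives
     injectivity. *)
  have value x : gvalue hN None (groth_map K hN (constXY x)) = laurent_val x.
    rewrite (groth_mapE K hN _ (o := None) isT); apply: etrans (specialize_const _ _) _; rewrite -laurent_eval_val.
    by congr (laurent_eval _ x); apply: bool_irrelevance.
  have inj : injective (fun x => groth_map K hN (constXY x)).
    move=> x y /= e; apply: val_inj.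
    exact: etrans (esym (value x)) (etrans (congr1 (gvalue hN None) e) (value y)).
  (* All zigzags valid for [E_oo] are odd, hence have Laurent monomials as values, so every class
     has the invariant of a Laurent polynomial. *)
  have surj X : exists x, groth_map K hN (constXY x) = X.
    have [s [sv ->]] := groth_zformal hN X; have sv' := zvalid_all sv.
    exists (\sum_(t <- [seq (t.1, zdegree t.2) | t <- s]) t.1%:~R * laurent_monomial t.2.1.1 t.2.1.2 t.2.2).
    apply: (gvalue_inj (hr := hN)) => -[o|] // _; rewrite value laurent_val_sum (gvalue_of hN _ (o := None) isT) (fvalue_zformal K hN (o := None) isT sv').
    rewrite big_map; apply: eq_big_seq => t /(allP sv) /and3P[_ _ /=].
    by case: t => c [[[p q] b] n]; rewrite /zlen /zvalue /= => ->.
  exists (fun X => projT1 (cid (surj X))) => [x|X]; last by case: cid.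
  by apply: inj; case: cid.
exists (groth_mul (K := K) h1), (groth_map K h1); split; last split; last split.
- split; first exact: groth_tensor_mul.
  + by split=> [x y|x y|]; [exact: groth_map_add | exact: groth_map_mul | exact: groth_map_unit].
  + exact: groth_map_surjective.
  by move=> x; split; [exact: groth_map_kernel | exact: groth_map_ideal].
- split; [exact: groth_map_U | exact: groth_map_R | exact: groth_map_L | exact: groth_map_X | exact: groth_map_Y].
- move=> l l' l0 l0'; rewrite -groth_map_mul; apply: groth_map_ideal.
  by apply: (proj2 (ideal_generatedP XY_relation)); exact: XY_relation_XY.
by move=> n s; exact: not_finitely_generated.
Qed.
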